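(* Let $\vec p=(p_1,\dots,p_n)$ with $1<p_i<\infty$ for all $i$, and let $t,r$ satisfy either $1<\frac{n}{\sum_{i=1}^n1/p_i}<t<r<\infty$ or $1<\frac{n}{\sum_{i=1}^n1/p_i}\le t<r=\infty$. Let $\psi^\ell$, $\ell=1,\dots,2^n-1$, be a system of compactly supported wavelets of class $C^m$ with vanishing moments up to order $L$ (as specified in the context), with $L=n$ and $m=n+1$, and let $S$ be the associated square function $$Sf=\Big(\sum_{\ell=1}^{2^n-1}\sum_{(j,k)\in\mathbb Z^{n+1}}\big|\langle f,\psi_{j,k}^\ell\rangle\chi_{j,k}\big|^2\Big)^{1/2}.$$ Then for $f\in M_{\vec p}^{t,r}$, $$\|f\|_{M_{\vec p}^{t,r}}\approx\|Sf\|_{M_{\vec p}^{t,r}},$$ with implicit constants independent of $f$.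
   Context: $A\approx B$ means $A\le CB$ and $B\le CA$ for a constant $C>0$. Wavelets: for a function $h$ on $\mathbb R^n$ put $h_{j,k}=2^{jn/2}h(2^j\cdot-k)$, $j\in\mathbb Z$, $k\in\mathbb Z^n$. The functions $\psi^\ell$, $\ell=1,\dots,2^n-1$, are real-valued compactly supported $C^m$-functions with $\operatorname{supp}\psi^\ell=[0,2N-1]^n$ for some $N\in\mathbb N$ such that: (i) $\{\psi_{j,k}^\ell:j\in\mathbb Z,k\in\mathbb Z^n,\ell=1,\dots,2^n-1\}$ is an orthonormal basis of $L^2(\mathbb R^n)$; (ii) $\psi^\ell\in\mathcal P_L^\perp$, i.e. $(1+|\cdot|^2)^{L/2}\psi^\ell\in L^1$ and $\int_{\mathbb R^n}x^\alpha\psi^\ell(x)\,dx=0$ for all multi-indices $|\alpha|\le L$. Here $\langle f,\psi_{j,k}^\ell\rangle=\int_{\mathbb R^n}f\psi_{j,k}^\ell\,dx$ and $\chi_{j,k}=2^{jn/2}\chi_{Q_{j,k}}$ with $Q_{j,k}=\prod_{i=1}^n[2^{-j}k_i,2^{-j}(k_i+1))$; $\mathcal D$ is the family of all dyadic cubes $Q_{j,k}$. Mixed Lebesgue norm: for measurable $f$ on $\mathbb R^n$, $$\|f\|_{L^{\vec p}}=\Big(\int_{\mathbb R}\cdots\Big(\int_{\mathbb R}|f(x_1,\dots,x_n)|^{p_1}dx_1\Big)^{p_2/p_1}\cdots dx_n\Big)^{1/p_n}$$ (innermost integration in $x_1$). Mixed Bourgain-Morrey space $M_{\vec p}^{t,r}$: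 all measurable $f$ with $$\|f\|_{M_{\vec p}^{t,r}}=\Big(\sum_{Q\in\mathcal D}|Q|^{\frac rt-\frac rn\sum_{i=1}^n\frac1{p_i}}\|f\chi_Q\|_{L^{\vec p}}^r\Big)^{1/r}<\infty$$ (supremum over $Q\in\mathcal D$ if $r=\infty$). *)

(* Defs.v *)
From HB Require Import structures.
From mathcomp Require Import all_boot all_order all_algebra.
From mathcomp Require Import complex.
From mathcomp Require Import all_classical all_reals all_analysis.
From mathcomp Require Import measurable_realfun.

Set Implicit Arguments.
Unset Strict Implicit.
Unset Printing Implicit Defensive.

Import Order.TTheory GRing.Theory Num.Theory.
Import numFieldNormedType.Exports.
Import Normc.

Local Open Scope classical_set_scope.
Local Open Scope complex_scope.
Local Open Scope ring_scope.

(* R^n is 'rV[R]_n, with the product (= Borel) sigma-algebra: the one generated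
   by the coordinate functions, as the library does for n.-tuple. *)
Definition rV_display : measure_display -> measure_display.
Proof. exact. Qed.

Section measurable_rV.
Context (R : realType) (n : nat).

Let coors : 'I_n -> 'rV[R]_n -> R := fun i x => x ord0 i.

Let rV_set0 : g_sigma_preimage coors set0.
Proof. exact: sigma_algebra0. Qed.

Let rV_setC A : g_sigma_preimage coors A -> g_sigma_preimage coors (~` A).
Proof. exact: sigma_algebraC. Qed.

Let rV_bigcup (F : (set 'rV[R]_n)^nat) :
  (forall i, g_sigma_preimage coors (F i)) ->
  g_sigma_preimage coors (\bigcup_i (F i)).
Proof. exact: sigma_algebra_bigcup. Qed.

HB.instance Definition _ := @isMeasurable.Build (rV_display default_measure_display)
  'rV[R]_n (g_sigma_preimage coors) rV_set0 rV_setC rV_bigcup.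

End measurable_rV.

Section lebesgue_rV.
Context (R : realType).

Definition rV_cons n (x : R * 'rV[R]_n) : 'rV[R]_n.+1 :=
  row_mx (const_mx x.1 : 'rV_1) x.2.

Lemma measurable_rV_coord n (i : 'I_n) :
  measurable_fun [set: 'rV[R]_n] (fun x => x ord0 i).
Proof.
move=> _ Y mY; rewrite setTI; apply: sub_sigma_algebra => /=.
rewrite -bigcup_seq/=; exists i => /=; first by rewrite mem_index_enum.
by exists Y => //; rewrite setTI.
Qed.

Lemma measurable_fun_rV d (T : measurableType d) n (f : T -> 'rV[R]_n) :
  (forall i, measurable_fun [set: T] (fun t => f t ord0 i)) ->
  measurable_fun [set: T] f.
Proof.
move=> mf _ A; rewrite setTI.
pose G := [set A | d.-measurable (f @^-1` A)].
suff: g_sigma_preimage (fun i (x : 'rV[R]_n) => x ord0 i) `<=` G by exact.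
apply: smallest_sub.
  split; rewrite /G/=.
  - by rewrite preimage_set0.
  - by move=> B mB; rewrite setTD preimage_setC; exact: measurableC.
  - by move=> F mF; rewrite preimage_bigcup; exact: bigcupT_measurable.
rewrite -bigcup_seq/= => B [i _ [C mC <-]]; rewrite /G/= setTI.
by rewrite -[X in measurable X]setTI; exact: mf.
Qed.

Lemma measurable_rV_cons n : measurable_fun setT (@rV_cons n).
Proof.
apply: measurable_fun_rV => i; rewrite /rV_cons.
have [j ->|j ->] := @split_ordP 1 n i.
  rewrite (_ : (fun _ => _) = fst); first exact: measurable_fst.
  by apply/funext => x; rewrite (@row_mxEl R 1 1 n) mxE.
rewrite (_ : (fun _ => _) = (fun y : 'rV[R]_n => y ord0 j) \o snd).
  by apply: measurableT_comp; [exact: measurable_rV_coord|exact: measurable_snd].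
by apply/funext => x; rewrite /= (@row_mxEr R 1 1 n).
Qed.

Definition rV_uncons n (y : 'rV[R]_n.+1) : measurableTypeR R * 'rV[R]_n :=
  (lsubmx (y : 'rV_(1 + n)) ord0 ord0, rsubmx (y : 'rV_(1 + n))).

Lemma measurable_rV_uncons n : measurable_fun setT (@rV_uncons n).
Proof.
apply/measurable_fun_pairP; split.
  rewrite (_ : _ \o _ = fun y : 'rV[R]_n.+1 => y ord0 (@lshift 1 n ord0)).
    exact: measurable_rV_coord.
  by apply/funext => y; rewrite /= mxE.
apply: measurable_fun_rV => i.
rewrite (_ : (fun _ => _) = fun y : 'rV[R]_n.+1 => y ord0 (rshift 1 i)).
  exact: measurable_rV_coord.
by apply/funext => y; rewrite /= mxE.
Qed.

Lemma rV_consK n : cancel (@rV_cons n) (@rV_uncons n).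
Proof. by case=> x y; rewrite /rV_cons/rV_uncons row_mxKl row_mxKr mxE. Qed.

Section lebesgue_rV_cons.
Context (n : nat) (mu : {sigma_finite_measure set 'rV[R]_n -> \bar R}).

Definition lebesgue_rV_cons : set 'rV[R]_n.+1 -> \bar R :=
  pushforward (@lebesgue_measure R \x mu)%E (@rV_cons n).

Let measurable_preimage A : measurable A -> measurable (@rV_cons n @^-1` A).
Proof.
by move=> mA; rewrite -[X in measurable X]setTI; exact: measurable_rV_cons.
Qed.

Let lebesgue_rV_cons0 : lebesgue_rV_cons set0 = 0%E.
Proof. by rewrite /lebesgue_rV_cons /pushforward preimage_set0 measure0. Qed.

Let lebesgue_rV_cons_ge0 A : (0 <= lebesgue_rV_cons A)%E.
Proof. by rewrite /lebesgue_rV_cons /pushforward measure_ge0. Qed.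

Let lebesgue_rV_cons_sigma_additive : semi_sigma_additive lebesgue_rV_cons.
Proof.
move=> F mF tF mUF; rewrite /lebesgue_rV_cons /pushforward preimage_bigcup.
apply: measure_semi_sigma_additive.
- by move=> i; exact: measurable_preimage.
- apply/trivIsetP => /= i j _ _ ij; rewrite -preimage_setI.
  by move/trivIsetP : tF => /(_ _ _ _ _ ij) ->//; rewrite preimage_set0.
- by rewrite -preimage_bigcup; exact: measurable_preimage.
Qed.

HB.instance Definition _ := isMeasure.Build _ _ _ lebesgue_rV_cons
  lebesgue_rV_cons0 lebesgue_rV_cons_ge0 lebesgue_rV_cons_sigma_additive.

Let lebesgue_rV_cons_sigma_finite : sigma_finite setT lebesgue_rV_cons.
Proof.
have /sigma_finiteP[F [FT ndF Foo]] := sigma_finiteT (@lebesgue_measure R).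
have /sigma_finiteP[G [GT ndG Goo]] := sigma_finiteT mu.
exists (fun i => @rV_uncons n @^-1` (F i `*` G i)).
  rewrite -preimage_bigcup -(preimage_setT (@rV_uncons n)); congr (_ @^-1` _).
  rewrite -setXTT FT GT predeqE => -[x y]; split => /= [|[i _ [? ?]]].
    move=> [[i _ Fix] [j _ Gjy]]; exists (maxn i j) => //; split.
      by move: x Fix; exact/subsetPset/ndF/leq_maxl.
    by move: y Gjy; exact/subsetPset/ndG/leq_maxr.
  by split; exists i.
move=> i; have [mF Fi] := Foo i; have [mG Gi] := Goo i; split.
  by rewrite -[X in measurable X]setTI; apply: measurable_rV_uncons => //;
    exact: measurableX.
rewrite /lebesgue_rV_cons /pushforward -comp_preimage (_ : _ \o _ = id); last first.
  by apply/funext => x /=; rewrite rV_consK.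
by rewrite preimage_id product_measure1E// lte_mul_pinfty// ge0_fin_numE.
Qed.

HB.instance Definition _ := Measure_isSigmaFinite.Build _ _ _ lebesgue_rV_cons
  lebesgue_rV_cons_sigma_finite.

End lebesgue_rV_cons.

(* Lebesgue measure on R^n, as an iterated product of one-dimensional ones *)
Fixpoint lebesgue_rV n : {sigma_finite_measure set 'rV[R]_n -> \bar R} :=
  match n return {sigma_finite_measure set 'rV[R]_n -> \bar R} with
  | 0 => \d_(0 : 'rV[R]_0)
  | n.+1 => lebesgue_rV_cons (lebesgue_rV n)
  end.

End lebesgue_rV.

Section function_spaces.
Context (R : realType) (n : nat).
Local Notation mu := (lebesgue_rV R n).
Implicit Types (f : 'rV[R]_n -> R[i]) (g : 'rV[R]_n -> \bar R)
  (h : 'rV[R]_n -> R).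

Definition modulus f : 'rV[R]_n -> \bar R := fun x => (normc (f x))%:E.

(* "Measurable" is Lebesgue measurable: preimages of Borel sets belong to the
   completion of the Borel sigma-algebra of R^n. The integral of the library is
   defined on all functions, through the lower integrals of the positive and
   negative parts, and it is the Lebesgue integral for these functions too. *)
Definition lebesgue_measurable h : Prop :=
  forall B : set R, measurable B -> completed_algebra_gen mu (h @^-1` B).

Definition clebesgue_measurable f : Prop :=
  lebesgue_measurable (fun x => complex.Re (f x)) /\
  lebesgue_measurable (fun x => complex.Im (f x)).

(* <f, h> = \int f h for complex-valued f and real-valued h *)
Definition pairing f h : R[i] :=
  (\int[mu]_x (complex.Re (f x) * h x)) +i*
  (\int[mu]_x (complex.Im (f x) * h x)).

Definition in_L2 f : Prop :=
  clebesgue_measurable f /\ ('N[mu]_(2%:E)[modulus f] < +oo)%E.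

(* A family of real-valued functions is an orthonormal basis of the complex
   space L^2(R^n): it is orthonormal and its linear span is dense. *)
Definition orthonormal_basis_L2 (I : eqType) (e : I -> 'rV[R]_n -> R) : Prop :=
  [/\ forall i, in_L2 (fun x => (e i x)%:C),
      forall i j, pairing (fun x => (e i x)%:C) (e j) = (i == j)%:R &
      forall f, in_L2 f -> forall eps : R, 0 < eps ->
        exists (s : seq I) (c : I -> R[i]),
          ('N[mu]_(2%:E)[modulus (fun x =>
              (f x - \sum_(i <- s) c i * (e i x)%:C)%R)] < eps%:E)%E].

Fixpoint C_class (m : nat) h : Prop :=
  continuous h /\
  match m with
  | 0 => True
  | m.+1 => forall i : 'I_n, (forall x, derivable h x (delta_mx 0 i)) /\
                             C_class m ('D_(delta_mx 0 i) h)
  end.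

Definition dilate h (j : int) (k : 'rV[int]_n) : 'rV[R]_n -> R :=
  fun x => 2 `^ (j%:~R * n%:R / 2) * h (2 ^ j *: x - map_mx intr k).

Definition dyadic_cube (j : int) (k : 'rV[int]_n) : set 'rV[R]_n :=
  [set x | forall i, 2 ^ (- j) * (k ord0 i)%:~R <= x ord0 i <
                     2 ^ (- j) * (k ord0 i + 1)%:~R].

Definition dyadic_cubes : set (set 'rV[R]_n) :=
  [set Q | exists j k, Q = dyadic_cube j k].

Definition chi (j : int) (k : 'rV[int]_n) : 'rV[R]_n -> R :=
  fun x => 2 `^ (j%:~R * n%:R / 2) * \1_(dyadic_cube j k) x.

(* h \in P_L^\perp *)
Definition vanishing_moments (L : nat) h : Prop :=
  mu.-integrable setT
    (fun x => ((1 + \sum_i x ord0 i ^+ 2) `^ (L%:R / 2) * h x)%:E) /\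
  forall alpha : 'I_n -> nat, (\sum_i alpha i <= L)%N ->
    \int[mu]_x (\prod_i x ord0 i ^+ alpha i * h x) = 0.

Definition compact_wavelets (m L : nat)
    (psi : 'I_(2 ^ n - 1) -> 'rV[R]_n -> R) : Prop :=
  [/\ forall l, C_class m (psi l),
      exists N : nat, forall l, closure [set x | psi l x != 0] =
        [set x | forall i, 0 <= x ord0 i <= 2 * N%:R - 1],
      orthonormal_basis_L2 (fun i : 'I_(2 ^ n - 1) * (int * 'rV[int]_n) =>
        dilate (psi i.1) i.2.1 i.2.2) &
      forall l, vanishing_moments L (psi l)].

Definition square_function (psi : 'I_(2 ^ n - 1) -> 'rV[R]_n -> R) f :
    'rV[R]_n -> \bar R :=
  fun x => ((\sum_(l < 2 ^ n - 1)
    \esum_(jk in [set: int * 'rV[int]_n])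
      (normc (pairing f (dilate (psi l) jk.1 jk.2) *
              (chi jk.1 jk.2 x)%:C) ^+ 2)%:E) `^ 2^-1)%E.

End function_spaces.

(* The innermost integration is over the first coordinate. *)
Fixpoint mixed_norm (R : realType) n :
    ('I_n -> R) -> ('rV[R]_n -> \bar R) -> \bar R :=
  match n return ('I_n -> R) -> ('rV[R]_n -> \bar R) -> \bar R with
  | 0 => fun _ g => `|g 0%R|%E
  | n.+1 => fun p g => mixed_norm (fun i => p (lift ord0 i))
      (fun y => 'N[@lebesgue_measure R]_((p ord0)%:E)
                  [(fun x => g (rV_cons (x, y)))]%E)
  end.

Section bourgain_morrey.
Context (R : realType) (n : nat).
Implicit Types (p : 'I_n -> R) (t : R) (r : \bar R)
  (f : 'rV[R]_n -> R[i]) (g : 'rV[R]_n -> \bar R).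

Definition hmean p : R := n%:R / \sum_i (p i)^-1.

Definition volume (Q : set 'rV[R]_n) : R := fine (lebesgue_rV R n Q).

Definition mixed_norm_on p (Q : set 'rV[R]_n) g : \bar R :=
  mixed_norm p (fun x => g x * (\1_Q x)%:E)%E.

(* the value at r = -oo is a dummy *)
Definition bourgain_morrey_norm p t r g : \bar R :=
  match r with
  | r%:E => ((\esum_(Q in @dyadic_cubes R n)
      ((volume Q `^ (r / t - r / n%:R * \sum_i (p i)^-1))%:E *
       mixed_norm_on p Q g `^ r)) `^ r^-1)%E
  | +oo%E => ereal_sup
      [set ((volume Q `^ (t^-1 - n%:R^-1 * \sum_i (p i)^-1))%:E *
            mixed_norm_on p Q g)%E | Q in @dyadic_cubes R n]
  | -oo%E => 0%E
  end.

Definition bourgain_morrey p t r : set ('rV[R]_n -> R[i]) :=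
  [set f | clebesgue_measurable f /\
           (bourgain_morrey_norm p t r (modulus f) < +oo)%E].

End bourgain_morrey.

(* Main.v *)
Require Import Defs.
From mathcomp Require Import all_boot all_order all_algebra.
From mathcomp Require Import complex.
From mathcomp Require Import all_classical all_reals all_analysis.
From mathcomp Require Import measurable_realfun.
From mathcomp Require Import zify ring lra.

Set Implicit Arguments.
Unset Strict Implicit.
Unset Printing Implicit Defensive.

Import Order.TTheory GRing.Theory Num.Theory.
Import numFieldNormedType.Exports.

Local Open Scope classical_set_scope.
Local Open Scope ring_scope.

(* The supports of the wavelets are the cells 2^-j (k + [0, L)^n) with L = 2N - 1.
   Since L is odd, all of them together form a forest, the children of (j, k)
   being the (j + 1, 2k + L e) with e in {0, 1}^n. On a forest, Doob's inequality
   and Lerner's argument bound the maximal operator on L^p(w) for w in A_p; a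
   stopping-time argument bounds the square function by the maximal function in
   L^2(w) for w in A_2; and Rubio de Francia extrapolation, applied one
   coordinate at a time, gives ||S f|| <= C ||f|| for all mixed norms, hence also
   for the norms with the dual exponents.

   Fix a cube Q. The wavelets that meet Q and are not coarser than Q live near Q,
   and for them the mixed norm estimate applies to f (for S f), or, by duality
   and Parseval's inequality, to a test function (for f). At the level of the
   s-th ancestor of Q only L^n wavelets meet Q, and, measured in the weighted
   local norms of the Morrey space, their contribution is O(2^(-sn/t)). So each
   of the two families of local norms is bounded by geometrically weighted sums
   of the other one over the neighbours of the ancestors of Q, and such sums are
   bounded on l^r because a cube has 2^(sn) descendants s levels below and r > t. *)

(** A weight that is constant in x_1 and belongs to A_p in the other variables belongs to A_p with
    the same constant. Hence a weighted L^(p_1) bound becomes, by Tonelli, a weighted bound between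
    inner norms in one dimension less, and extrapolation changes the exponent before the next
    coordinate is removed. This is why the square function is bounded with weights although the
    theorem has none. Oddness of L means that every integer is 2k + L e for exactly one pair of an
    integer k and a bit e, so every cell has a parent; overlapping cells of one level then lie in
    different trees. The reverse inequality cannot start from a wavelet expansion, since f need not
    lie in L^2. Only the inequality between the integral of f g and the sum of the products of the
    coefficients is proved, for bounded g carried by a cube, by truncating f. Finiteness of the
    Morrey norm enters there: it makes the coefficients decay at coarse scales, uniformly in the
    truncation. The number q = 2^(-n/t) is the price of one generation in the Morrey weights; sums
    over ancestors are bounded on l^r when q^r 2^n < 1, that is, when r > t. *)

Section power_inequalities.
Context {R : realType}.
Implicit Types (p s : R).

(** Young's inequality for the exponents [p / (p - 1)] and [p], multiplied by [p]. It serves Doob's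
    theorem twice: pointwise on the function, and for the jumps of the running maximum. *)
Lemma young_powR p s (x : R) : 1 < p -> 0 <= s -> 0 <= x ->
  p * (s `^ (p - 1) * x) <= (p - 1) * s `^ p + x `^ p.
Proof.
move=> p1 s0 x0.
have p0 : 0 < p by rewrite (lt_trans _ p1).
have pB1 : 0 < p - 1 by rewrite subr_gt0.
have := @conjugate_powR R x (s `^ (p - 1)) p (p / (p - 1)) x0 (powR_ge0 _ _) p0.
rewrite -powRrM mulrCA divff ?gt_eqF// mulr1 => /(_ (divr_gt0 p0 pB1)).
rewrite invfM invrK => H.
have {}H := H ltac:(field; rewrite ?gt_eqF//; lra).
have -> : p * (s `^ (p - 1) * x) = p * (x * s `^ (p - 1)) by ring.
rewrite -(ler_pdivlMl _ _ p0).
rewrite (le_trans H)// le_eqVlt; apply/orP; left; apply/eqP.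
by field; rewrite ?gt_eqF//; lra.
Qed.

Lemma ge0_poweR_le (x y : \bar R) (r : R) : 0 < r -> (0 <= x)%E -> (0 <= y)%E ->
  (x `^ r <= y)%E = (x <= y `^ r^-1)%E.
Proof.
move=> r0 x0 y0; apply/idP/idP => h.
- have := @gt0_ler_poweR R r^-1 ltac:(by rewrite invr_ge0 ltW) (x `^ r)%E y.
  rewrite !in_itv/= !leey !poweR_ge0 y0 => /(_ isT isT h).
  by rewrite -poweRrM mulfV ?gt_eqF// poweRe1.
- have := @gt0_ler_poweR R r (ltW r0) x (y `^ r^-1)%E.
  rewrite !in_itv/= !leey !poweR_ge0 x0 => /(_ isT isT h).
  by rewrite -poweRrM mulVf ?gt_eqF// poweRe1.
Qed.

Lemma ge0_poweRK (x : \bar R) (r : R) : 0 < r -> (0 <= x)%E ->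
  ((x `^ r) `^ r^-1 = x)%E.
Proof. by move=> r0 x0; rewrite -poweRrM mulfV ?gt_eqF// poweRe1. Qed.

Lemma ge0_poweRVK (x : \bar R) (r : R) : 0 < r -> (0 <= x)%E ->
  ((x `^ r^-1) `^ r = x)%E.
Proof. by move=> r0 x0; rewrite -poweRrM mulVf ?gt_eqF// poweRe1. Qed.

Lemma ge0_ler_poweR (x y : \bar R) (r : R) : 0 <= r -> (0 <= x)%E ->
  (x <= y)%E -> (x `^ r <= y `^ r)%E.
Proof.
move=> r0 x0 xy; apply: (gt0_ler_poweR r0) => //; rewrite in_itv/= leey andbT//.
by rewrite (le_trans x0).
Qed.

(** One inequality is monotonicity of the power, the other monotonicity of the inverse power. A
    nonempty set of nonnegative numbers keeps the suprema away from -oo. *)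
Lemma poweR_ereal_sup (A : set (\bar R)) (r : R) : 0 < r -> A !=set0 ->
  (forall x, A x -> 0 <= x)%E ->
  (ereal_sup A `^ r = ereal_sup [set x `^ r | x in A])%E.
Proof.
move=> r0 [a Aa] A0; apply/eqP; rewrite eq_le; apply/andP; split; last first.
  apply: ge_ereal_sup => _ [x Ax <-].
  by apply: ge0_ler_poweR (ltW r0) (A0 _ Ax) _; exact: ereal_sup_ubound.
have s0 : (0 <= ereal_sup A)%E by rewrite (le_trans (A0 _ Aa))// ereal_sup_ubound.
have S0 : (0 <= ereal_sup [set x `^ r | x in A])%E.
  by rewrite (le_trans (poweR_ge0 a r))//; apply: ereal_sup_ubound; exists a.
rewrite ge0_poweR_le//.
apply: ge_ereal_sup => x Ax; rewrite -(ge0_poweR_le r0 (A0 _ Ax) S0).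
by apply: ereal_sup_ubound; exists x.
Qed.

End power_inequalities.

(** * Measurability and integrals of nonnegative functions *)

Section measurable_helpers.
Context d (T : measurableType d) (R : realType).

Lemma emeasurable_poweR D (f : T -> \bar R) (r : R) :
  measurable_fun D f -> measurable_fun D (fun x => f x `^ r)%E.
Proof. by move=> mf; exact: (measurableT_comp (measurable_poweR r)). Qed.

Lemma emeasurable_powR D (f : T -> R) (r : R) :
  measurable_fun D f -> measurable_fun D (fun x => f x `^ r).
Proof. by move=> mf; exact: (measurableT_comp (measurable_powR r)). Qed.

End measurable_helpers.

Section integral_helpers.
Context d (T : measurableType d) (R : realType) (mu : {measure set T -> \bar R}).
Local Open Scope ereal_scope.
Implicit Types (D : set T) (f g : T -> \bar R).

Lemma intZl D f (k : R) : measurable D -> measurable_fun setT f ->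
  (forall x, 0 <= f x) -> (0 <= k)%R ->
  \int[mu]_(x in D) (k%:E * f x) = k%:E * \int[mu]_(x in D) f x.
Proof.
by move=> mD mf f0 k0; rewrite ge0_integralZl//; exact: measurable_funTS.
Qed.

Lemma intD D f g : measurable D -> measurable_fun setT f ->
  measurable_fun setT g -> (forall x, 0 <= f x) -> (forall x, 0 <= g x) ->
  \int[mu]_(x in D) (f x + g x) =
  \int[mu]_(x in D) f x + \int[mu]_(x in D) g x.
Proof.
by move=> mD mf mg f0 g0; rewrite ge0_integralD//; exact: measurable_funTS.
Qed.

Lemma le_int D f g : measurable D -> measurable_fun setT f ->
  measurable_fun setT g -> (forall x, 0 <= f x) ->
  (forall x, D x -> f x <= g x) ->
  \int[mu]_(x in D) f x <= \int[mu]_(x in D) g x.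
Proof.
by move=> mD mf mg f0 fg; apply: ge0_le_integral => //; exact: measurable_funTS.
Qed.

Lemma int_indic D f : (\int[mu]_(x in D) f x = \int[mu]_x (f x * (\1_D x)%:E)).
Proof. by rewrite integral_mkcond epatch_indic. Qed.

End integral_helpers.

(* A forest of measurable cells: every cell is the disjoint union of its
   children, and finitely many cells always lie below finitely many roots that
   cover each point at most [N0] times. *)
Section forest.
Context d (T : measurableType d) (R : realType)
  (mu : {measure set T -> \bar R}) (V : countType) (E : finType)
  (cell : V -> set T) (ch : V -> E -> V) (N0 : nat).

(** The depth bound makes descent decidable and open to induction; infinite trees only appear as
    limits of trees cut at depth [D]. *)
Fixpoint desc D (v u : V) : bool :=
  (v == u) || (if D is D'.+1 then [exists e, desc D' (ch v e) u] else false).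

Record forest : Prop := Forest {
  forest_measurable : forall v, measurable (cell v) ;
  forest_gt0 : forall v, (0 < mu (cell v))%E ;
  forest_lty : forall v, (mu (cell v) < +oo)%E ;
  forest_children : forall v, cell v = \bigcup_e cell (ch v e) ;
  forest_disjoint : forall v, trivIset [set: E] (fun e => cell (ch v e)) ;
  forest_roots : forall s : seq V, exists (rs : seq V) (D : nat),
    (forall v, v \in s -> exists2 r, r \in rs & desc D r v) /\
    (forall x, \sum_(r <- rs) (\1_(cell r) x : R) <= N0%:R) ;
  forest_cover : forall x, exists v, cell v x }.

Context (F : forest).
Local Notation mcell := (forest_measurable F).

Lemma cell_child v e : cell (ch v e) `<=` cell v.
Proof. by rewrite (forest_children F v) => x ?; exists e. Qed.

Lemma desc_sub D v u : desc D v u -> cell u `<=` cell v.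
Proof.
elim: D v => [|D ih] v /=; first by rewrite orbF => /eqP ->.
case/orP => [/eqP -> //|/existsP[e /ih]] h.
exact: subset_trans h (cell_child (v := v) (e := e)).
Qed.

Lemma ge0_integral_children v (f : T -> \bar R) :
  measurable_fun (cell v) f -> (forall x, cell v x -> 0 <= f x)%E ->
  (\int[mu]_(x in cell v) f x = \sum_e \int[mu]_(x in cell (ch v e)) f x)%E.
Proof.
move=> mf f0.
have cE : cell v = \big[setU/set0]_e cell (ch v e).
  rewrite (forest_children F v) -bigcup_seq; apply: eq_bigcupl.
  by split=> // e _ /=; rewrite mem_index_enum.
rewrite [in LHS]cE ge0_integral_bigsetU//.
- by move=> e; exact: mcell.
- exact: index_enum_uniq.
- exact: (sub_trivIset (@subsetT _ _) (forest_disjoint F (v := v))).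
- by rewrite -cE.
- by rewrite -cE.
Qed.

(** A sum over the children weighted by their indicators picks out the child that contains the
    point. Functions on a tree are written in this form so that they are visibly measurable and no
    child has to be chosen. *)
Lemma child_val (f : E -> R) v e x : cell (ch v e) x ->
  \sum_e' \1_(cell (ch v e')) x * f e' = f e.
Proof.
move=> xe; rewrite (bigD1 e)//= big1 ?addr0 ?indicE ?mem_set ?mul1r//.
move=> e' e'e; rewrite indicE memNset ?mul0r// => xe'.
have /trivIsetP/(_ e' e I I e'e) := forest_disjoint F (v := v).
by move/seteqP => [/(_ x)] /= h _; apply: h.
Qed.

(** On the root cell this is the maximum of [a] along the path of cells that contain [x], cut at
    depth [D]. *)
Fixpoint tree_max (a : V -> R) D v (x : T) : R :=
  if D is D'.+1 then
    Num.max (a v) (\sum_e \1_(cell (ch v e)) x * tree_max a D' (ch v e) x)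
  else a v.

Lemma measurable_tree_max a D v : measurable_fun setT (tree_max a D v).
Proof.
elim: D v => [|D ih] v /=; first exact: measurable_cst.
apply: measurable_maxr; first exact: measurable_cst.
apply: measurable_sum => e; apply: measurable_funM => //.
by apply: measurable_indic; exact: mcell.
Qed.

Lemma tree_max_ge a D v x : a v <= tree_max a D v x.
Proof. by case: D => [|D] //=; rewrite le_max lexx. Qed.

Lemma tree_max_desc a D v u x : desc D v u -> cell u x -> a u <= tree_max a D v x.
Proof.
elim: D v => [|D ih] v /=; first by rewrite orbF => /eqP ->.
case/orP => [/eqP -> _|/existsP[e h] ux]; first by rewrite le_max lexx.
rewrite le_max (child_val (fun e => tree_max a D (ch v e) x) (e := e)) ?ih ?orbT//.
exact: desc_sub h _ ux.
Qed.

Lemma tree_max_child a D v e x m : cell (ch v e) x ->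
  Num.max m (tree_max a D.+1 v x) =
  Num.max (Num.max m (a v)) (tree_max a D (ch v e) x).
Proof.
move=> xe /=.
by rewrite (child_val (fun e => tree_max a D (ch v e) x) (e := e))// maxA.
Qed.

(* [p m^p B - p c m^(p-1) C] is Burkholder's function of Doob's inequality. *)
Lemma doob_tree (p : R) (w : T -> R) (B C G : V -> R) (a : V -> R) D v m m' :
  1 < p -> measurable_fun setT w -> (forall x, 0 <= w x) ->
  (forall v, \int[mu]_(x in cell v) (w x)%:E = (B v)%:E)%E ->
  (forall v, 0 <= B v) -> (forall v, 0 <= a v) ->
  (forall v, C v = a v * B v) ->
  (forall v, C v = \sum_e C (ch v e)) -> (forall v, G v = \sum_e G (ch v e)) ->
  let c := p / (p - 1) in
  (forall v s, 0 <= s ->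
     p * c * s `^ (p - 1) * C v <= (p - 1) * s `^ p * B v + c `^ p * G v) ->
  0 <= m -> m' = Num.max m (a v) ->
  (\int[mu]_(x in cell v) ((Num.max m (tree_max a D v x)) `^ p * w x)%:E <=
   (p * m' `^ p * B v + c `^ p * G v - p * c * m' `^ (p - 1) * C v)%:E)%E.
Proof.
move=> p1 mw w0 wB B0 a0 CaB Cch Gch c Y.
have p0 : 0 < p by lra.
have pB1 : 0 < p - 1 by lra.
(* The running maximum varies in the induction: a child inherits [m'], which already takes the
   average of its parent into account. *)
elim: D v m m' => [|D ih] v m m' m0 m'E.
  rewrite /=.
  under eq_integral do rewrite EFinM.
  have m'0 : 0 <= m' by rewrite m'E le_max m0.
  rewrite -m'E.
  rewrite ge0_integralZl//; [|exact: mcell|exact/measurable_EFinP/measurable_funTS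
    |by move=> x _; rewrite lee_fin|by rewrite lee_fin powR_ge0].
  rewrite wB -EFinM lee_fin.
  by have := Y v m' m'0; lra.
rewrite ge0_integral_children//; last 2 first.
- apply/measurable_EFinP/measurable_funTS/measurable_funM => //.
  apply: emeasurable_powR; apply: measurable_maxr => //.
  exact: (measurable_tree_max a D.+1 v).
- by move=> x _; rewrite lee_fin mulr_ge0// powR_ge0.
have m'0 : 0 <= m' by rewrite m'E le_max m0.
have Bch u : B u = \sum_e B (ch u e).
  apply: EFin_inj; rewrite -wB -sumEFin ge0_integral_children//.
  - by apply: eq_bigr => e _; rewrite wB.
  - exact/measurable_EFinP/measurable_funTS.
  - by move=> x _; rewrite lee_fin.
(* [B], [C] and [G] are additive over the children, so with [m'] frozen Burkholder's expression
   splits into one term per child. *)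
have -> : p * m' `^ p * B v + c `^ p * G v - p * c * m' `^ (p - 1) * C v =
  \sum_e (p * m' `^ p * B (ch v e) + c `^ p * G (ch v e) -
          p * c * m' `^ (p - 1) * C (ch v e)).
  by rewrite sumrB big_split /= -!mulr_sumr -Bch -Gch -Cch.
rewrite -sumEFin; apply: lee_sum => e _.
under eq_integral => x /[!inE] xe.
  rewrite (tree_max_child _ _ _ xe) -m'E; over.
apply: le_trans (ih (ch v e) m' _ m'0 erefl) _.
rewrite lee_fin.
set x := a (ch v e); set b := B (ch v e).
(* A child whose average [x] is at most [m'] leaves the running maximum unchanged. Otherwise the
   maximum jumps to [x], and the expression must not increase; as [C = a B] and p c - p = p / (p -
   1), this is Young's inequality [y] up to a positive factor. *)
case: (leP x m') => [//|m'x].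
have x0 : 0 <= x by exact: a0.
rewrite CaB -/x -/b.
have y : p * (m' `^ (p - 1) * x) <= (p - 1) * m' `^ p + x `^ p.
  exact: young_powR.
have xE : x `^ (p - 1) * x = x `^ p by rewrite mulrC mulr_powRB1.
have b0 : 0 <= b by exact: B0.
suff : b * (p * x `^ p + p * c * (m' `^ (p - 1) * x)) <=
       b * (p * m' `^ p + p * c * (x `^ (p - 1) * x)).
  by clearbody x b c; lra.
apply: ler_wpM2l => //; rewrite xE.
have -> : p * c = p * (1 + (p - 1)^-1).
  by congr (_ * _); rewrite /c; field; rewrite gt_eqF//; lra.
suff : (p - 1) * (p * x `^ p + p * (1 + (p - 1)^-1) * (m' `^ (p - 1) * x)) <=
  (p - 1) * (p * m' `^ p + p * (1 + (p - 1)^-1) * x `^ p).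
  by rewrite ler_pM2l.
have q1 : (p - 1) * (p - 1)^-1 = 1 by rewrite divff// gt_eqF.
have -> : (p - 1) * (p * x `^ p + p * (1 + (p - 1)^-1) * (m' `^ (p - 1) * x)) =
  (p - 1) * p * x `^ p + p * ((p - 1) + (p - 1) * (p - 1)^-1) * (m' `^ (p - 1) * x).
  by ring.
have -> : (p - 1) * (p * m' `^ p + p * (1 + (p - 1)^-1) * x `^ p) =
  (p - 1) * p * m' `^ p + p * ((p - 1) + (p - 1) * (p - 1)^-1) * x `^ p by ring.
rewrite q1.
have := ler_wpM2l (ltW p0) y.
set X := x `^ p; set M := m' `^ p; set Z := m' `^ (p - 1) * x.
move: X M Z => X M Z; nra.
Qed.

End forest.

(** * Doob's maximal inequality on a forest *)

Section countable_families.
Context d (T : measurableType d) (R : realType).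
Local Open Scope ereal_scope.

Lemma measurable_ereal_sup_count (V : countType) (h : V -> T -> \bar R) :
  (forall v, measurable_fun setT (h v)) ->
  measurable_fun setT (fun x => ereal_sup [set h v x | v in [set: V]]).
Proof.
move=> mh.
(* The value -oo at numbers that code no element does not affect the supremum. *)
pose k n x := if pickle_inv n is Some v then h v x else -oo.
have mk n : measurable_fun setT (k n).
  by rewrite /k; case: (pickle_inv n) => [v|]; [exact: mh|exact: measurable_cst].
rewrite (_ : (fun _ => _) = fun x => esups (k ^~ x) 0%N).
  exact: measurable_fun_esups.
apply/funext => x; rewrite /esups/=; apply/eqP; rewrite eq_le; apply/andP; split.
- apply: ge_ereal_sup => _ [v _ <-]; apply: ereal_sup_ubound.
  by exists (pickle v) => //=; rewrite /k pickleK_inv.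
- apply: ge_ereal_sup => _ [n _ <-]; rewrite /k; case: (pickle_inv n) => [v|].
    by apply: ereal_sup_ubound; exists v.
  by rewrite leNye.
Qed.

(** Sums over a countable type become series along the injection [pickle], with 0 at the numbers
    that code nothing; the exchange of series and integral then applies to them. *)
Definition count_term (I : countType) (a : I -> \bar R) (n : nat) : \bar R :=
  if pickle_inv n is Some i then a i else 0.

Lemma count_term_ge0 (I : countType) (a : I -> \bar R) n :
  (forall i, 0 <= a i) -> 0 <= count_term a n.
Proof. by rewrite /count_term => a0; case: pickle_inv. Qed.

Lemma esum_count_term (I : countType) (a : I -> \bar R) : (forall i, 0 <= a i) ->
  \esum_(i in [set: I]) a i = \sum_(n <oo) count_term a n.
Proof.
move=> a0; rewrite nneseries_esumT; last by move=> n; exact: count_term_ge0.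
transitivity (\esum_(k in range (@pickle I)) count_term a k).
  rewrite (@reindex_esum _ _ _ [set: I] _ pickle).
    by apply: eq_esum => i _; rewrite /count_term pickleK_inv.
  split => //.
rewrite esum_mkcond; apply: eq_esum => n _.
case: ifPn => //; rewrite notin_setE => nI; rewrite /count_term.
case E : (pickle_inv n) => [i|//]; exfalso; apply: nI; exists i => //.
by have := @pickle_invK I n; rewrite /ocancel /oapp E.
Qed.

Lemma measurable_count_term (I : countType) (f : I -> T -> \bar R) n :
  (forall i, measurable_fun setT (f i)) ->
  measurable_fun setT (fun x => count_term (f ^~ x) n).
Proof.
by move=> mf; rewrite /count_term; case: (pickle_inv n) => [i|].
Qed.

Lemma measurable_esum_count (I : countType) (f : I -> T -> \bar R) :
  (forall i x, 0 <= f i x) -> (forall i, measurable_fun setT (f i)) ->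
  measurable_fun setT (fun x => \esum_(i in [set: I]) f i x).
Proof.
move=> f0 mf; under eq_fun do rewrite esum_count_term//.
apply: ge0_emeasurable_sum => [n x _ _|n _]; first exact: count_term_ge0.
exact: measurable_count_term.
Qed.

Lemma ge0_integral_esum (mu : {measure set T -> \bar R}) (I : countType)
    (f : I -> T -> \bar R) D : measurable D ->
  (forall i x, 0 <= f i x) -> (forall i, measurable_fun setT (f i)) ->
  \int[mu]_(x in D) (\esum_(i in [set: I]) f i x) =
  \esum_(i in [set: I]) \int[mu]_(x in D) f i x.
Proof.
move=> mD f0 mf; under eq_integral do rewrite esum_count_term//.
rewrite integral_nneseries//; last 2 first.
- by move=> n; apply: measurable_funTS; exact: measurable_count_term.
- by move=> n x _; exact: count_term_ge0.
rewrite esum_count_term; last by move=> i; apply: integral_ge0 => x _.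
apply: eq_eseriesr => n _; rewrite /count_term.
by case: (pickle_inv n) => [i//|]; rewrite integral0.
Qed.

End countable_families.

Section maximal_function.
Context d (T : measurableType d) (R : realType)
  (mu : {measure set T -> \bar R}) (V : countType) (E : finType)
  (cell : V -> set T) (ch : V -> E -> V) (N0 : nat) (F : forest mu cell ch N0).
Local Notation mcell := (forest_measurable F).

(** The average of [g] with respect to the measure with density [w]; [cst 1] gives the plain
    average. In [wmax] a cell that misses the point contributes 0, which is harmless because [g] is
    nonnegative in all uses and every point lies in some cell. *)
Definition wavg (w : T -> R) (g : T -> \bar R) (v : V) : \bar R :=
  (((fine (\int[mu]_(x in cell v) (w x)%:E))^-1)%:E *
   \int[mu]_(x in cell v) (g x * (w x)%:E))%E.

Definition wmax (w : T -> R) (g : T -> \bar R) (x : T) : \bar R :=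
  ereal_sup [set (wavg w g v * (\1_(cell v) x)%:E)%E | v in [set: V]].

Record weight (w : T -> R) : Prop := Weight {
  weight_measurable : measurable_fun setT w ;
  weight_gt0 : forall x, 0 < w x ;
  weight_lty : forall v, (\int[mu]_(x in cell v) (w x)%:E < +oo)%E }.

Lemma weight_cst1 : weight (cst 1).
Proof.
split=> //= v; rewrite integral_cst//= ?mul1e//; last exact: mcell.
exact: (forest_lty F).
Qed.

(** A vanishing integral would force [w = 0] almost everywhere on a cell of positive measure,
    although [w] is positive at every point. *)
Lemma weight_int w v : weight w ->
  exists B : R, 0 < B /\ (\int[mu]_(x in cell v) (w x)%:E = B%:E)%E.
Proof.
case=> mw w0 wy.
have i0 : (0 <= \int[mu]_(x in cell v) (w x)%:E)%E.
  by apply: integral_ge0 => x _; rewrite lee_fin ltW.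
exists (fine (\int[mu]_(x in cell v) (w x)%:E)%E); split; last first.
  by rewrite fineK// ge0_fin_numE// wy.
rewrite fine_gt0// wy andbT lt_neqAle i0 andbT eq_sym; apply/eqP => i0'.
have mwE : measurable_fun (cell v) (fun x => (w x)%:E).
  exact/measurable_EFinP/measurable_funTS.
have /(ae_eq_integral_abs mu (mcell v) mwE)[N [mN N0' sN]] :
  (\int[mu]_(x in cell v) `|(w x)%:E| = 0)%E.
  by rewrite -[RHS]i0'; apply: eq_integral => x _; rewrite gee0_abs// lee_fin ltW.
have : (mu (cell v) <= mu N)%E.
  apply: le_measure; rewrite ?inE//; first exact: mcell.
  apply: subset_trans sN => x xv /= /(_ xv)[] wx0.
  by have := weight_gt0 (Weight mw w0 wy) x; rewrite wx0 ltxx.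
by rewrite N0' leNgt (forest_gt0 F).
Qed.

Section doob.
Context (w : T -> R) (W : weight w) (g : T -> \bar R) (p : R).
Hypotheses (p1 : 1 < p) (mg : measurable_fun setT g)
  (g0 : forall x, (0 <= g x)%E).

Let w0 x : 0 <= w x. Proof. exact/ltW/(weight_gt0 W). Qed.
Let w0e x : (0 <= (w x)%:E)%E. Proof. by rewrite lee_fin. Qed.
Let mw := weight_measurable W.

Let mgw D : measurable_fun D (fun x => g x * (w x)%:E)%E.
Proof. by apply/measurable_funTS/emeasurable_funM => //; exact/measurable_EFinP. Qed.

Let mgpw D : measurable_fun D (fun x => g x `^ p * (w x)%:E)%E.
Proof.
apply/measurable_funTS/emeasurable_funM; last exact/measurable_EFinP.
exact: emeasurable_poweR.
Qed.

Lemma wavg_ge0 v : (0 <= wavg w g v)%E.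
Proof.
rewrite /wavg mule_ge0//; last by apply: integral_ge0 => x _; exact: mule_ge0.
by rewrite lee_fin invr_ge0 fine_ge0// integral_ge0.
Qed.

Lemma wavg_mulE v :
  (\int[mu]_(x in cell v) (g x * (w x)%:E) =
   wavg w g v * \int[mu]_(x in cell v) (w x)%:E)%E.
Proof.
have [b [b0 bE]] := weight_int v W.
by rewrite /wavg bE/= muleC muleA -EFinM mulfV ?gt_eqF// mul1e.
Qed.

Lemma measurable_wmax : measurable_fun setT (wmax w g).
Proof.
apply: measurable_ereal_sup_count => v; apply: emeasurable_funM => //.
by apply/measurable_EFinP/measurable_indic; exact: mcell.
Qed.

Lemma wmax_ge v x : cell v x -> (wavg w g v <= wmax w g x)%E.
Proof.
move=> xv; apply: ereal_sup_ubound; exists v => //.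
by rewrite indicE mem_set// mule1.
Qed.

Lemma wmax_ge0 x : (0 <= wmax w g x)%E.
Proof.
have [v xv] := forest_cover F x.
by apply: le_trans (wmax_ge xv); exact: wavg_ge0.
Qed.

Let c := p / (p - 1).

Section finite.
Hypothesis gfin : (\int[mu]_x (g x `^ p * (w x)%:E) < +oo)%E.

Let Bv v := fine (\int[mu]_(x in cell v) (w x)%:E)%E.
Let Cv v := fine (\int[mu]_(x in cell v) (g x * (w x)%:E))%E.
Let Gv v := fine (\int[mu]_(x in cell v) (g x `^ p * (w x)%:E))%E.
Let av v := Cv v / Bv v.

Let BE v : (\int[mu]_(x in cell v) (w x)%:E)%E = (Bv v)%:E.
Proof. by have [b [b0 bE]] := weight_int v W; rewrite /Bv bE. Qed.

Let B0 v : 0 < Bv v.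
Proof. by have [b [b0 bE]] := weight_int v W; rewrite /Bv bE. Qed.

Let gp0 x : (0 <= g x `^ p * (w x)%:E)%E.
Proof. by rewrite mule_ge0 ?poweR_ge0. Qed.

Let GE v : (\int[mu]_(x in cell v) (g x `^ p * (w x)%:E))%E = (Gv v)%:E.
Proof.
rewrite /Gv fineK// ge0_fin_numE ?integral_ge0//.
apply: le_lt_trans gfin; apply: ge0_subset_integral => //.
exact: mcell.
Qed.

(** Young's inequality for [s] and [c * g x], integrated over the cell against [w]. This is the
    hypothesis that Burkholder's argument needs on each cell. *)
Let young s v : 0 <= s ->
  ((p * c * s `^ (p - 1))%:E * \int[mu]_(x in cell v) (g x * (w x)%:E) <=
  ((p - 1) * s `^ p * Bv v + c `^ p * Gv v)%:E)%E.
Proof.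
move=> s0.
have p10 : 0 < p - 1 by rewrite subr_gt0.
have pp : 0 < p by rewrite (lt_trans _ p1).
have c0 : 0 < c by rewrite divr_gt0.
have k0 : 0 <= (p - 1) * s `^ p by rewrite mulr_ge0 ?powR_ge0// ltW.
have l0 : 0 <= p * c * s `^ (p - 1) by rewrite mulr_ge0 ?powR_ge0// mulr_ge0// ltW.
rewrite EFinD (EFinM _ (Bv v)) (EFinM _ (Gv v)) -BE -GE.
have mE D : measurable_fun D (EFin \o w) by exact/measurable_EFinP/measurable_funTS.
have ke u : 0 <= u -> (0 <= u%:E)%E by rewrite lee_fin.
rewrite -!intZl ?powR_ge0//; try by [exact: mcell|exact: mE|exact: mgpw|exact: mgw|move=> x; exact: mule_ge0].
rewrite -intD//; [|exact: mcell|exact: measurable_funeM|exact: measurable_funeM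
  |by move=> x; rewrite mule_ge0// ke|by move=> x; rewrite mule_ge0// ke// powR_ge0].
apply: le_int; [exact: mcell|exact: measurable_funeM| |
  by move=> x; rewrite mule_ge0 ?ke// mule_ge0|].
  by apply: emeasurable_funD; exact: measurable_funeM.
move=> x _; have := g0 x; case: (g x) => [y| |//].
- rewrite lee_fin => y0; rewrite poweR_EFin -!EFinM -EFinD lee_fin.
  have := @young_powR R p s (c * y) p1 s0 (mulr_ge0 (ltW c0) y0).
  rewrite powRM ?(ltW c0)// => /(ler_wpM2r (w0 x)).
  set X := c `^ p; set Y := y `^ p; set Z := s `^ (p - 1); set Q := s `^ p.
  move: X Y Z Q (w x) => X Y Z Q u; lra.
- move=> _; rewrite poweRyr ?gt_eqF//.
  rewrite (gt0_mulye (x := (w x)%:E)) ?lte_fin ?(weight_gt0 W)//.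
  rewrite (gt0_muley (x := (c `^ p)%:E)) ?lte_fin ?powR_gt0//.
  by rewrite addey ?leey// -EFinM.
Qed.

(** Finiteness of the integral of [g] over a cell comes from [young] at [s = 1], whose right side is
    finite. *)
Let CE v : (\int[mu]_(x in cell v) (g x * (w x)%:E))%E = (Cv v)%:E.
Proof.
have p10 : 0 < p - 1 by rewrite subr_gt0.
have pp : 0 < p by rewrite (lt_trans _ p1).
have c0 : 0 < c by rewrite divr_gt0.
rewrite /Cv fineK// ge0_fin_numE; last by apply: integral_ge0 => x _; exact: mule_ge0.
have := @young 1 v ler01; rewrite powR1 mulr1 => h.
rewrite ltey; apply/eqP => hy; move: h; rewrite hy gt0_muley ?leye_eq// lte_fin.
by rewrite mulr_gt0// mulr_gt0.
Qed.

Let a0 v : 0 <= av v.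
Proof.
rewrite /av divr_ge0// ?(ltW (B0 v))// fine_ge0//.
by apply: integral_ge0 => x _; exact: mule_ge0.
Qed.

Let avE v : wavg w g v = (av v)%:E.
Proof. by rewrite /wavg CE BE /= -EFinM mulrC. Qed.

(** Burkholder's argument with the initial maximum 0. What remains besides the integral of g^p is p
    (1 - c) a^p B, which is nonpositive since [c >= 1]. *)
Let doob_cell D v : (\int[mu]_(x in cell v) ((tree_max cell ch av D v x) `^ p * w x)%:E
   <= (c `^ p)%:E * \int[mu]_(x in cell v) (g x `^ p * (w x)%:E))%E.
Proof.
have p10 : 0 < p - 1 by rewrite subr_gt0.
have pp : 0 < p by rewrite (lt_trans _ p1).
have CaB u : Cv u = av u * Bv u by rewrite /av divfK// gt_eqF.
have Cch u : Cv u = \sum_e Cv (ch u e).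
  apply: EFin_inj; rewrite -CE -sumEFin (ge0_integral_children F)//.
  - by apply: eq_bigr => e _; rewrite CE.
  - by move=> x _; exact: mule_ge0.
have Gch u : Gv u = \sum_e Gv (ch u e).
  apply: EFin_inj; rewrite -GE -sumEFin (ge0_integral_children F)//.
  by apply: eq_bigr => e _; rewrite GE.
have Y u s : 0 <= s ->
  p * c * s `^ (p - 1) * Cv u <= (p - 1) * s `^ p * Bv u + c `^ p * Gv u.
  by move=> s0; have := young u s0; rewrite CE -EFinM lee_fin.
have := @doob_tree _ _ _ _ _ _ _ _ _ F p w Bv Cv Gv av D v 0 (av v) p1 mw w0 BE
  (fun v => ltW (B0 v)) a0 CaB Cch Gch Y (lexx 0).
rewrite max_r// => /(_ erefl).
under eq_integral => x _.
  rewrite max_r; last by rewrite (le_trans (a0 v))// tree_max_ge.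
  over.
move=> /le_trans; apply.
rewrite GE -EFinM lee_fin CaB.
have -> : p * c * av v `^ (p - 1) * (av v * Bv v) = p * c * av v `^ p * Bv v.
  by rewrite -(mulr_powRB1 (a0 v) pp); ring.
have : 0 <= (c - 1) * p * (av v `^ p * Bv v).
  rewrite mulr_ge0//; last by rewrite mulr_ge0 ?powR_ge0// ltW.
  rewrite mulr_ge0// ?(ltW pp)// /c subr_ge0 ler_pdivlMr//; lra.
move: (av v `^ p) (Bv v) (Gv v) (c `^ p) => X Y' Z Q; lra.
Qed.

Let list_max (s : seq V) x := \big[Num.max/0]_(v <- s) (av v * \1_(cell v) x).

Let list_max_ge (s : seq V) v x : v \in s -> av v * \1_(cell v) x <= list_max s x.
Proof. rewrite /list_max; elim: s => // u s ih; rewrite inE big_cons le_max.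
by case/orP => [/eqP ->|/ih ->]; rewrite ?lexx ?orbT. Qed.

Let list_max_ge0 s x : 0 <= list_max s x.
Proof.
rewrite /list_max; elim: s => [|v s ih]; first by rewrite big_nil.
by rewrite big_cons le_max ih orbT.
Qed.

Let measurable_list_max s : measurable_fun setT (list_max s).
Proof.
rewrite /list_max; elim: s => [|v s ih].
  by under eq_fun do rewrite big_nil; exact: measurable_cst.
under eq_fun do rewrite big_cons; apply: measurable_maxr => //.
by apply: measurable_funM => //; apply: measurable_indic; exact: mcell.
Qed.

(** At each point the finite maximum is attained at a cell [v] or vanishes, and it is dominated by
    the tree maximum of a root above [v]. Summing over the roots costs their overlap [N0]. *)
Let doob_list s : (\int[mu]_x ((list_max s x) `^ p * w x)%:E
   <= (c `^ p * N0%:R)%:E * \int[mu]_x (g x `^ p * (w x)%:E))%E.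
Proof.
have pp : 0 < p by rewrite (lt_trans _ p1).
have [rs [D [rsD rsN]]] := forest_roots F s.
pose f r x : \bar R := ((tree_max cell ch av D r x `^ p * w x)%:E * (\1_(cell r) x)%:E)%E.
have mf r : measurable_fun setT (f r).
  apply: emeasurable_funM.
    apply/measurable_EFinP/measurable_funM => //; apply: emeasurable_powR.
    exact: measurable_tree_max F _ _ _.
  by apply/measurable_EFinP/measurable_indic; exact: mcell.
have f0 r x : (0 <= f r x)%E.
  by rewrite mule_ge0// lee_fin mulr_ge0 ?powR_ge0.
apply: (@le_trans _ _ (\int[mu]_x (\sum_(r <- rs) f r x))%E).
  apply: ge0_le_integral => //.
  - by move=> x _; rewrite lee_fin mulr_ge0 ?powR_ge0.
  - by apply/measurable_EFinP/measurable_funM => //; exact: emeasurable_powR.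
  - exact: emeasurable_sum.
  move=> x _.
  have [h0|[v vs h]] : list_max s x = 0 \/
      exists2 v, v \in s & list_max s x = av v * \1_(cell v) x.
    rewrite /list_max; elim: s {rsD} => [|v s ih]; first by left; rewrite big_nil.
    rewrite big_cons; have [le|le] := leP (av v * \1_(cell v) x)
      (\big[Num.max/0]_(j <- s) (av j * \1_(cell j) x)).
      case: ih => [|[u us ->]]; first by left.
      by right; exists u => //; rewrite inE us orbT.
    by right; exists v => //; rewrite inE eqxx.
  - by rewrite h0 powR0 ?gt_eqF// mul0r; apply: sume_ge0 => r _.
  - have [xv|xv] := pselect (cell v x); last first.
      by rewrite h indicE memNset// mulr0 powR0 ?gt_eqF// mul0r; apply: sume_ge0 => r _.
    have [r rrs vr] := rsD _ vs.
    rewrite (perm_big _ (perm_to_rem rrs))/= big_cons.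
    apply: (@le_trans _ _ (f r x)); last by rewrite leeDl// sume_ge0.
    have xr := desc_sub F vr xv.
    rewrite /f indicE mem_set// mule1 lee_fin ler_wpM2r//.
    apply: ge0_ler_powR; rewrite ?nnegrE ?(ltW pp)//.
      by rewrite (le_trans (a0 r))// tree_max_ge.
    by rewrite h indicE mem_set// mulr1; exact: (tree_max_desc F).
rewrite ge0_integral_sum//.
apply: (@le_trans _ _ (\sum_(r <- rs)
    (c `^ p)%:E * \int[mu]_(x in cell r) (g x `^ p * (w x)%:E)))%E.
  apply: lee_sum => r _; apply: le_trans (doob_cell D r).
  by rewrite (integral_mkcond (cell r)) epatch_indic.
rewrite -ge0_sume_distrr; last by move=> r _; exact: integral_ge0.
rewrite EFinM -muleA lee_wpmul2l//; first by rewrite lee_fin powR_ge0.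
rewrite -intZl//.
under eq_bigr do rewrite integral_mkcond epatch_indic/=.
rewrite -ge0_integral_sum//; last 2 first.
- move=> r; apply: emeasurable_funM => //.
  by apply/measurable_EFinP/measurable_indic; exact: mcell.
- by move=> r x _; rewrite mule_ge0.
apply: ge0_le_integral => //.
- by move=> x _; apply: sume_ge0 => r _; rewrite mule_ge0.
- apply: emeasurable_sum => r; apply: emeasurable_funM => //.
  by apply/measurable_EFinP/measurable_indic; exact: mcell.
- exact: measurable_funeM.
move=> x _; rewrite -ge0_sume_distrr//.
by rewrite muleC lee_wpmul2r// sumEFin lee_fin.
Qed.

Let sV n : seq V := pmap pickle_inv (iota 0 n).

Let sV_mem v n : (pickle v < n)%N -> v \in sV n.
Proof.
move=> vn; rewrite /sV mem_pmap; apply/mapP; exists (pickle v).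
  by rewrite mem_iota.
by rewrite pickleK_inv.
Qed.

Let sV_nd m n : (m <= n)%N -> {subset sV m <= sV n}.
Proof.
move=> mn v; rewrite /sV !mem_pmap => /mapP[k]; rewrite mem_iota/= => km kv.
by apply/mapP; exists k => //; rewrite mem_iota/= add0n (leq_trans km).
Qed.

Let list_max_nd x m n : (m <= n)%N -> list_max (sV m) x <= list_max (sV n) x.
Proof.
move=> mn; rewrite [leLHS]/list_max big_seq.
elim/big_ind: _ => // [y z yn zn|v vs]; first by rewrite ge_max yn zn.
exact/list_max_ge/(sV_nd mn).
Qed.

(** The maxima over initial segments [sV n] of an enumeration of the cells increase to [wmax], so
    monotone convergence passes from finite lists to all cells. *)
Lemma doob_wmax_fin : (\int[mu]_x (wmax w g x `^ p * (w x)%:E)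
   <= (c `^ p * N0%:R)%:E * \int[mu]_x (g x `^ p * (w x)%:E))%E.
Proof.
have pp : 0 < p by rewrite (lt_trans _ p1).
pose h n x : \bar R := ((list_max (sV n) x) `^ p * w x)%:E.
have mh n : measurable_fun setT (h n).
  by apply/measurable_EFinP/measurable_funM => //; exact: emeasurable_powR.
have h0 n x : (0 <= h n x)%E by rewrite lee_fin mulr_ge0 ?powR_ge0.
have ndh x : nondecreasing_seq (h ^~ x).
  move=> m n mn; rewrite lee_fin ler_wpM2r// ge0_ler_powR ?nnegrE ?(ltW pp)//.
  exact: list_max_nd.
apply: (@le_trans _ _ (\int[mu]_x limn (h ^~ x)))%E.
  apply: ge0_le_integral => //.
  - by move=> x _; rewrite mule_ge0// poweR_ge0.
  - apply: emeasurable_funM; last exact/measurable_EFinP.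
    exact/emeasurable_poweR/measurable_wmax.
  - apply: (emeasurable_fun_cvg h) => // x _.
    exact: ereal_nondecreasing_is_cvgn.
  move=> x _; rewrite (cvg_lim _ (ereal_nondecreasing_cvgn (ndh x)))//.
  have wx : (0 < w x) by exact: weight_gt0.
  rewrite muleC -lee_pdivlMl// poweR_ereal_sup//; last 2 first.
  - by have [v xv] := forest_cover F x; exists (wavg w g v * (\1_(cell v) x)%:E)%E, v.
  - by move=> _ [v _ <-]; rewrite mule_ge0 ?wavg_ge0// lee_fin.
  apply: ge_ereal_sup => _ [_ [v _ <-] <-].
  have -> : (wavg w g v * (\1_(cell v) x)%:E)%E = (av v * \1_(cell v) x)%:E.
    by rewrite avE EFinM.
  rewrite lee_pdivlMl// poweR_EFin -EFinM.
  apply: (@le_trans _ _ (h (pickle v).+1 x)); last first.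
    by apply: ereal_sup_ubound; exists (pickle v).+1.
  rewrite lee_fin mulrC ler_wpM2r// ge0_ler_powR ?nnegrE ?(ltW pp)//.
    by rewrite mulr_ge0// a0.
  exact/list_max_ge/sV_mem.
rewrite monotone_convergence//.
apply: lime_le; last by apply: nearW => n; exact: doob_list.
apply: ereal_nondecreasing_is_cvgn => m n mn.
by apply: ge0_le_integral => // x _; exact: ndh.
Qed.

End finite.

(** The factor [N0.+1] instead of [N0] keeps the constant positive, so that an infinite right side
    really is +oo and no finiteness is required. *)
Lemma doob_wmax : (\int[mu]_x (wmax w g x `^ p * (w x)%:E)
   <= (c `^ p * N0.+1%:R)%:E * \int[mu]_x (g x `^ p * (w x)%:E))%E.
Proof.
have [gfin|] := ltP (\int[mu]_x (g x `^ p * (w x)%:E))%E +oo%E.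
  apply: (le_trans (doob_wmax_fin gfin)); rewrite lee_wpmul2r//.
    by apply: integral_ge0 => x _; rewrite mule_ge0// poweR_ge0.
  by rewrite lee_fin ler_wpM2l ?powR_ge0// ler_nat.
rewrite leye_eq => /eqP ->; rewrite gt0_muley ?leey// lte_fin.
by rewrite mulr_gt0// powR_gt0// divr_gt0// ?subr_gt0// (lt_trans _ p1).
Qed.

End doob.

End maximal_function.

(** * Muckenhoupt weights *)

Section geometric_convexity.
Context {R : realType}.
Implicit Types (p q : R).

(** Convexity of the power at a + q x = (1 - q) (a / (1 - q)) + q x. *)
Lemma powR_convex2 p q (a x : R) : 1 <= p -> 0 < q < 1 -> 0 <= a -> 0 <= x ->
  (a + q * x) `^ p <= (1 - q) `^ (1 - p) * a `^ p + q * x `^ p.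
Proof.
move=> p1 /andP[q0 q1] a0 x0.
have q'0 : 0 < 1 - q by rewrite subr_gt0.
pose t := Itv01 (ltW q0) (ltW q1).
have := @convex_powR R p p1 t x (a / (1 - q)).
rewrite !inE /= !in_itv/= !andbT => /(_ x0 (divr_ge0 a0 (ltW q'0))).
rewrite !convRE /= /unstable.onem.
have -> : a + q * x = conv t (x : R^o) (a / (1 - q) : R^o) :> R.
  by rewrite [RHS]convRE /= /unstable.onem; field; rewrite gt_eqF.
move=> /le_trans; apply.
rewrite [leRHS]addrC lerD2l powRM ?invr_ge0 ?(ltW q'0)// powRD; last first.
  by rewrite (gt_eqF q'0) implybT.
rewrite powRr1 ?(ltW q'0)// -[(1 - q)^-1]powR_inv1 ?(ltW q'0)// -powRrM mulN1r.
by rewrite mulrCA mulrC -mulrA mulrC.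
Qed.

Local Open Scope ereal_scope.

Lemma poweR_convex2 p q (a x : \bar R) : (1 <= p)%R -> (0 < q < 1)%R ->
  0 <= a -> 0 <= x ->
  (a + q%:E * x) `^ p <= ((1 - q) `^ (1 - p))%:E * a `^ p + q%:E * x `^ p.
Proof.
move=> p1 /[dup] qq /andP[q0 q1].
have p0 : (p != 0)%R by rewrite gt_eqF// (lt_le_trans _ p1).
have c0 : (0 < (1 - q) `^ (1 - p))%R by rewrite powR_gt0// subr_gt0.
case: a => [a| |//]; last first.
  rewrite (_ : (+oo `^ p = +oo :> \bar R)) ?poweRyr// gt0_muley ?lte_fin//.
  move=> _ x0; rewrite [leRHS]addye ?leey//.
  by rewrite -ltNye (lt_le_trans ltNy0)// mule_ge0 ?poweR_ge0// lee_fin ltW.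
case: x => [x| |//]; last first.
  by rewrite poweRyr// gt0_muley ?lte_fin// !addey// ?leey// poweR_EFin -EFinM.
rewrite !lee_fin => a0 x0.
exact: powR_convex2.
Qed.

(** Jensen's inequality for the probability weights (1 - q) q^k. It is obtained by applying the
    two-term case along the Horner form b_0 + q (b_1 + q ...) of the partial sums. It serves the
    Rubio de Francia iteration and the sums over ancestors. *)
Lemma geometric_convexity p q (b : (\bar R)^nat) : (1 <= p)%R -> (0 < q < 1)%R ->
  (forall k, 0 <= b k) ->
  (\sum_(k <oo) (q ^+ k)%:E * b k) `^ p <=
  ((1 - q) `^ (1 - p))%:E * \sum_(k <oo) (q ^+ k)%:E * b k `^ p.
Proof.
move=> p1 /[dup] qq /andP[q0 q1] b0.
have p0 : (0 < p)%R by rewrite (lt_le_trans _ p1).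
have qk0 k : 0 <= (q ^+ k)%:E by rewrite lee_fin exprn_ge0// ltW.
have c0 : (0 <= (1 - q) `^ (1 - p))%R by rewrite powR_ge0.
have fin n : forall c : (\bar R)^nat, (forall k, 0 <= c k) ->
  (\sum_(0 <= k < n) (q ^+ k)%:E * c k) `^ p <=
  ((1 - q) `^ (1 - p))%:E * \sum_(0 <= k < n) (q ^+ k)%:E * c k `^ p.
  elim: n => [|n ih] c cc0.
    by rewrite !big_nil poweR0r ?gt_eqF// mule0.
  rewrite !big_nat_recl//= expr0 !mul1e.
  have rec (e : (\bar R)^nat) : (forall k, 0 <= e k) ->
      \sum_(0 <= i < n) (q ^+ i.+1)%:E * e i.+1 =
      q%:E * \sum_(0 <= i < n) (q ^+ i)%:E * e i.+1.
    move=> e0; rewrite ge0_sume_distrr; last by move=> i _; exact: mule_ge0.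
    by apply: eq_bigr => i _; rewrite exprS EFinM muleA.
  rewrite rec// (rec (fun k => c k `^ p)); last by move=> k; exact: poweR_ge0.
  have S0 (e : (\bar R)^nat) : (forall k, 0 <= e k) ->
    0 <= \sum_(0 <= i < n) (q ^+ i)%:E * e i.+1.
    by move=> e0; apply: sume_ge0 => i _; exact: mule_ge0.
  apply: (le_trans (poweR_convex2 p1 qq (cc0 0%N) (S0 _ cc0))).
  rewrite ge0_muleDr//; last 2 first.
  - exact: poweR_ge0.
  - by rewrite mule_ge0 ?lee_fin ?(ltW q0)// (S0 (fun k => c k `^ p))// => k; exact: poweR_ge0.
  rewrite leeD2l// muleCA lee_wpmul2l//; first by rewrite lee_fin ltW.
  by apply: (ih (fun k => c k.+1)).
have cR0 : 0 <= ((1 - q) `^ (1 - p))%:E * \sum_(k <oo) (q ^+ k)%:E * b k `^ p.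
  rewrite mule_ge0 ?lee_fin//; apply: nneseries_ge0 => k _ _.
  by rewrite mule_ge0// poweR_ge0.
rewrite ge0_poweR_le//; last first.
  by apply: nneseries_ge0 => k _ _; exact: mule_ge0.
apply: lime_le.
  by apply: is_cvg_nneseries => k _ _; exact: mule_ge0.
apply: nearW => n; rewrite -ge0_poweR_le//; last first.
  by apply: sume_ge0 => k _; exact: mule_ge0.
apply: (le_trans (fin n b b0)); rewrite lee_wpmul2l//.
by apply: nneseries_lim_ge => k _ _; rewrite mule_ge0// poweR_ge0.
Qed.

End geometric_convexity.

Section muckenhoupt.
Context d (T : measurableType d) (R : realType)
  (mu : {measure set T -> \bar R}) (V : countType) (E : finType)
  (cell : V -> set T) (ch : V -> E -> V) (N0 : nat) (F : forest mu cell ch N0).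
Local Notation mcell := (forest_measurable F).
Local Notation wmax := (wmax mu cell).
Local Notation wavg := (wavg mu cell).
Local Notation weight := (weight mu cell).
Local Notation cmax := (wmax (cst 1)).
Local Notation cavg := (wavg (cst 1)).

Definition vol (v : V) : R := fine (mu (cell v)).
Definition wint (w : T -> R) (v : V) : R :=
  fine (\int[mu]_(x in cell v) (w x)%:E)%E.
Definition dual_weight (p : R) (w : T -> R) (x : T) : R := w x `^ (- (p - 1)^-1).

(** The class A_p relative to the cells of the forest. That [dual_weight p w] is a weight too is a
    field, because both directions of the duality use its local integrability. *)
Record muckenhoupt (p K : R) (w : T -> R) : Prop := Muckenhoupt {
  Ap_ge0 : 0 <= K ;
  Ap_weight : weight w ;
  Ap_dual : weight (dual_weight p w) ;
  Ap_bound : forall v, wint w v / vol v *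
    (wint (dual_weight p w) v / vol v) `^ (p - 1) <= K }.

Lemma vol_gt0 v : 0 < vol v.
Proof. by rewrite /vol fine_gt0// (forest_gt0 F) (forest_lty F). Qed.

Lemma volE v : (mu (cell v) = (vol v)%:E).
Proof. by rewrite /vol fineK// ge0_fin_numE// (forest_lty F). Qed.

Lemma wint_gt0 w v : weight w -> 0 < wint w v.
Proof. by move=> W; have [b [b0 bE]] := weight_int F v W; rewrite /wint bE. Qed.

Lemma wintE w v : weight w -> (\int[mu]_(x in cell v) (w x)%:E = (wint w v)%:E)%E.
Proof. by move=> W; have [b [b0 bE]] := weight_int F v W; rewrite /wint bE. Qed.

Lemma cavgE g v : (cavg g v = (vol v)^-1%:E * \int[mu]_(x in cell v) g x)%E.
Proof.
rewrite /wavg (_ : (fun x => ((cst 1 x):R)%:E) = cst 1%E)// integral_cst ?mul1e; last exact: mcell.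
by congr (_ * _)%E; apply: eq_integral => x _; rewrite mule1.
Qed.

Lemma int_cavg g v : (\int[mu]_(x in cell v) g x = (vol v)%:E * cavg g v)%E.
Proof. by rewrite cavgE muleA -EFinM divff ?mul1e// gt_eqF// vol_gt0. Qed.

Lemma cavg_ge0 (g : T -> \bar R) v : (forall x, 0 <= g x)%E -> (0 <= cavg g v)%E.
Proof. by move=> g0; exact: (wavg_ge0 (weight_cst1 F)). Qed.

Lemma cmax_ge (g : T -> \bar R) v x : cell v x -> (cavg g v <= cmax g x)%E.
Proof. exact: wmax_ge. Qed.

Lemma cmax_ge0 (g : T -> \bar R) x : (forall x, 0 <= g x)%E -> (0 <= cmax g x)%E.
Proof. by move=> g0; exact: (wmax_ge0 F (weight_cst1 F)). Qed.

Lemma measurable_cmax g : measurable_fun setT (cmax g).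
Proof. exact: (measurable_wmax F). Qed.

Lemma dual_weightK (p : R) w : 1 < p -> (forall x, 0 < w x) ->
  dual_weight (p / (p - 1)) (dual_weight p w) = w.
Proof.
move=> p1 w0; have pB1 : 0 < p - 1 by rewrite subr_gt0.
apply/funext => x; rewrite /dual_weight -powRrM.
rewrite (_ : _ * _ = 1) ?powRr1 ?ltW//.
by field; rewrite gt_eqF//= gt_eqF//; lra.
Qed.

(** The power 1 / (p - 1) of the A_p condition exchanges the two averages. *)
Lemma muckenhoupt_dual p K w : 1 < p -> muckenhoupt p K w ->
  muckenhoupt (p / (p - 1)) (K `^ (p - 1)^-1) (dual_weight p w).
Proof.
move=> p1 [K0 W W' AK]; have pB1 : 0 < p - 1 by rewrite subr_gt0.
have aux (a b : R) : 0 <= a -> 0 <= b ->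
    (b * a `^ (p - 1)) `^ (p - 1)^-1 = a * b `^ (p - 1)^-1.
  by move=> a0 b0; rewrite powRM ?powR_ge0// -powRrM mulfV ?gt_eqF// powRr1// mulrC.
split => //; [exact: powR_ge0|rewrite dual_weightK//; exact: weight_gt0 W|].
move=> v; rewrite dual_weightK//; last exact: weight_gt0 W.
have -> : p / (p - 1) - 1 = (p - 1)^-1 by field; rewrite gt_eqF.
have r0 : 0 <= (p - 1)^-1 by rewrite invr_ge0 ltW.
have a0 : 0 <= wint (dual_weight p w) v / vol v.
  by rewrite divr_ge0 ?ltW ?vol_gt0 ?wint_gt0.
have b0 : 0 <= wint w v / vol v by rewrite divr_ge0 ?ltW ?vol_gt0 ?wint_gt0.
have := AK v; move/(@ge0_ler_powR _ _ r0); rewrite !nnegrE.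
have h0 : 0 <= wint w v / vol v * (wint (dual_weight p w) v / vol v) `^ (p - 1).
  by rewrite mulr_ge0 ?powR_ge0.
move=> /(_ h0 (le_trans h0 (AK v))).
by rewrite aux.
Qed.

(* Lerner's argument: on a cell, [<g>^(p-1)] is at most [K] times the [w]-average
   of [(M_s (g / s))^(p-1) / w], where [s] is the dual weight. *)
Lemma cmax_muckenhoupt p K w g : 1 < p -> muckenhoupt p K w ->
  measurable_fun setT g -> (forall x, 0 <= g x)%E ->
  let q := p / (p - 1) in
  is_true (\int[mu]_x (cmax g x `^ p * (w x)%:E) <=
   (K `^ q * (p `^ q * N0.+1%:R) * (q `^ p * N0.+1%:R))%:E *
   \int[mu]_x (g x `^ p * (w x)%:E))%E.
Proof.
move=> p1 [K0 W W' AK] mg g0 q; have pB1 : 0 < p - 1 by rewrite subr_gt0.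
have p0 : 0 < p by lra.
set s := dual_weight p w in W' AK.
have s0 y : 0 < s y := weight_gt0 W' y.
have w0 y : 0 < w y := weight_gt0 W y.
have mw := weight_measurable W; have ms := weight_measurable W'.
have q1 : 1 < q by rewrite ltr_pdivlMr//; lra.
have q0 : 0 < q by lra.
pose u y : \bar R := (g y * (s y `^ (-1))%:E)%E.
pose h y : \bar R := (wmax s u y `^ (p - 1) * (w y `^ (-1))%:E)%E.
have mu_ : measurable_fun setT u.
  by apply: emeasurable_funM => //; apply/measurable_EFinP/emeasurable_powR.
have u0 y : (0 <= u y)%E by rewrite mule_ge0// lee_fin powR_ge0.
have mMs := measurable_wmax F s u.
have mh : measurable_fun setT h.
  apply: emeasurable_funM; first exact: emeasurable_poweR.
  by apply/measurable_EFinP/emeasurable_powR.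
have h0 y : (0 <= h y)%E by rewrite mule_ge0 ?poweR_ge0// lee_fin powR_ge0.
have us y : (u y * (s y)%:E = g y)%E.
  rewrite /u -muleA -EFinM -{2}[s y]powRr1 ?(ltW (s0 y))// -powRD ?addNr.
    by rewrite powRr0 mule1.
  by rewrite (gt_eqF (s0 y)) implybT.
have hw y : (h y * (w y)%:E = wmax s u y `^ (p - 1))%E.
  rewrite /h -muleA -EFinM -{2}[w y]powRr1 ?(ltW (w0 y))// -powRD ?addNr.
    by rewrite powRr0 mule1.
  by rewrite (gt_eqF (w0 y)) implybT.
(* With [u = g / s], the plain average of [g] is the [s]-average of [u] times s(v) / |v|. The A_p
   condition turns the power p - 1 of the last factor into K |v| / w(v), and on the cell the
   [s]-average of [u] is at most [wmax s u]. *)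
have cell_le v : (cavg g v `^ (p - 1) <= K%:E * wavg w h v)%E.
  have A0 : (0 <= wavg s u v)%E by exact: (wavg_ge0 W').
  have -> : cavg g v = (wavg s u v * (wint s v / vol v)%:E)%E.
    rewrite cavgE; under eq_integral do rewrite -us.
    rewrite (wavg_mulE F W') wintE// muleC -muleA -EFinM; congr (_ * _)%E.
  rewrite poweRM//; last by rewrite lee_fin divr_ge0 ?ltW ?vol_gt0 ?wint_gt0.
  rewrite poweR_EFin.
  have AKv := AK v.
  have b0 := wint_gt0 v W; have m0 := vol_gt0 v.
  set A := wavg s u v in A0 *.
  rewrite /wavg -/(wint w v).
  under eq_integral do rewrite hw.
  have : ((vol v)%:E * A `^ (p - 1) <=
      \int[mu]_(x in cell v) wmax s u x `^ (p - 1))%E.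
    rewrite -volE muleC -integral_cst; last exact: mcell.
    apply: le_int => //; [exact: mcell|exact: emeasurable_poweR| |].
      by move=> ?; exact: poweR_ge0.
    move=> y yv /=; apply: ge0_ler_poweR => //; first exact: ltW.
    exact: wmax_ge.
  move: (poweR_ge0 A (p - 1)).
  set X := (A `^ (p - 1))%E; set I := (\int[mu]_(x in cell v) _)%E => X0 XI.
  apply: (@le_trans _ _ (X * (K * (vol v / wint w v))%:E))%E.
    rewrite lee_wpmul2l// lee_fin.
    move: AKv; set z := _ `^ (p - 1) => AKv.
    rewrite mulrA ler_pdivlMr// mulrC -ler_pdivrMr//.
    by rewrite mulrAC.
  have -> : (X * (K * (vol v / wint w v))%:E =
    K%:E * ((wint w v)^-1%:E * ((vol v)%:E * X)))%E.
    rewrite muleC EFinM -muleA; congr (_ * _)%E.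
    by rewrite (mulrC (vol v)) EFinM muleA.
  by rewrite !lee_wpmul2l// ?lee_fin ?invr_ge0 ?ltW.
have pt x : (cmax g x `^ p <= (K `^ q)%:E * wmax w h x `^ q)%E.
  have pq : p = (p - 1) * q by rewrite /q; field; rewrite gt_eqF.
  have MW0 := wmax_ge0 F W h0 x.
  rewrite {1}pq poweRrM -poweR_EFin -poweRM ?lee_fin//.
  apply: ge0_ler_poweR => //; [exact: ltW|exact: poweR_ge0|].
  rewrite poweR_ereal_sup//; last 2 first.
  - by have [v xv] := forest_cover F x; exists (cavg g v * (\1_(cell v) x)%:E)%E, v.
  - by move=> _ [v _ <-]; rewrite mule_ge0 ?cavg_ge0// lee_fin.
  apply: ge_ereal_sup => _ [_ [v _ <-] <-].
  have [xv|xv] := pselect (cell v x); last first.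
    by rewrite indicE memNset// mule0 poweR0r ?gt_eqF// mule_ge0.
  rewrite indicE mem_set// mule1; apply: le_trans (cell_le v) _.
  by rewrite lee_wpmul2l//; exact: wmax_ge.
have mMw := measurable_wmax F w h.
have mpw (f : T -> \bar R) (r : R) (z : T -> R) : measurable_fun setT f ->
    measurable_fun setT z -> measurable_fun setT (fun x => f x `^ r * (z x)%:E)%E.
  move=> mf mz; apply: emeasurable_funM; first exact: emeasurable_poweR.
  exact/measurable_EFinP.
have pw0 (f : T -> \bar R) (r : R) (z : T -> R) x : (forall y, 0 < z y) ->
    (0 <= f x `^ r * (z x)%:E)%E.
  by move=> z0; rewrite mule_ge0 ?poweR_ge0// lee_fin ltW.
apply: (@le_trans _ _ ((K `^ q)%:E * \int[mu]_x (wmax w h x `^ q * (w x)%:E))%E).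
  rewrite -intZl//; [|exact: mpw|by move=> x; exact: pw0|exact: powR_ge0].
  apply: le_int => //.
  - by apply: mpw; [exact: (measurable_wmax F)|exact: mw].
  - by apply: measurable_funeM; exact: mpw.
  - by move=> x; exact: pw0.
  by move=> x _; rewrite muleA lee_wpmul2r// lee_fin ltW.
have q'p : q / (q - 1) = p by rewrite /q; field; rewrite gt_eqF//= gt_eqF//; lra.
(* Doob's inequality is used for [w] with exponent [q] and for the dual weight with exponent [p].
   The two uses fit together because w^(1-q) = s and s^(1-p) = w. *)
have := doob_wmax F W q1 mh h0; rewrite q'p => D1.
have := doob_wmax F W' p1 mu_ u0; rewrite -/q => D2.
rewrite !EFinM -!muleA lee_wpmul2l ?lee_fin ?powR_ge0//.
apply: (le_trans D1); rewrite EFinM -muleA.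
do 2 (apply: lee_wpmul2l; first by rewrite lee_fin ?powR_ge0).
have -> : (\int[mu]_x (h x `^ q * (w x)%:E) =
           \int[mu]_x (wmax s u x `^ p * (s x)%:E))%E.
  apply: eq_integral => x _.
  rewrite /h poweRM ?poweR_ge0 ?lee_fin ?powR_ge0// -poweRrM.
  have -> : (p - 1) * q = p by rewrite /q; field; rewrite gt_eqF.
  rewrite -muleA poweR_EFin -EFinM -powRrM -{2}[w x]powRr1 ?(ltW (w0 x))//.
  rewrite -powRD; last by rewrite (gt_eqF (w0 x)) implybT.
  congr (_ * (_ `^ _)%:E)%E.
  by rewrite /q; field; rewrite gt_eqF.
apply: (le_trans D2); rewrite EFinM -muleA.
do 2 (apply: lee_wpmul2l; first by rewrite lee_fin ?powR_ge0).
rewrite le_eqVlt; apply/orP; left; apply/eqP; apply: eq_integral => x _.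
rewrite /u poweRM ?lee_fin ?powR_ge0// -muleA poweR_EFin -EFinM -powRrM.
rewrite -{2}[s x]powRr1 ?(ltW (s0 x))// -powRD; last by rewrite (gt_eqF (s0 x)) implybT.
congr (_ * _%:E)%E; rewrite /s /dual_weight -powRrM.
rewrite -[RHS]powRr1 ?(ltW (w0 x))//; congr (_ `^ _).
by field; rewrite gt_eqF.
Qed.

End muckenhoupt.

(** * Extrapolation *)

Section powR_monotone.
Context {R : realType}.
Implicit Types a b r : R.

Lemma powR_le r a b : 0 <= r -> 0 <= a -> a <= b -> a `^ r <= b `^ r.
Proof.
by move=> r0 a0 ab; apply: ge0_ler_powR; rewrite ?nnegrE// (le_trans a0).
Qed.

Lemma powRN_le r a b : 0 <= r -> 0 < a -> a <= b -> b `^ (- r) <= a `^ (- r).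
Proof.
move=> r0 a0 ab; rewrite !powRN lef_pV2 ?posrE ?powR_gt0//; last first.
  exact: lt_le_trans ab.
by apply: powR_le => //; exact: ltW.
Qed.

End powR_monotone.

Section extrapolation.
Context d (T : measurableType d) (R : realType)
  (mu : {measure set T -> \bar R}) (V : countType) (E : finType)
  (cell : V -> set T) (ch : V -> E -> V) (N0 : nat) (F : forest mu cell ch N0).
Local Notation mcell := (forest_measurable F).
Local Notation cmax := (wmax mu cell (cst 1)).
Local Notation cavg := (wavg mu cell (cst 1)).
Local Notation weight := (weight mu cell).
Local Notation vol := (vol mu cell).
Local Notation wint := (wint mu cell).
Local Notation muckenhoupt := (muckenhoupt mu cell).

(** The majorant is the sum of (2B)^(-k) M^k g over k, with M the maximal operator. Averaging shifts
    the series by one index, which is the A_1 condition with constant 2B, at every point of the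
    cell. The hypothesis says that M has norm at most B, so the k-th term has norm at most 2^(-k)
    times that of [g]. *)
Lemma rubio_de_francia p (B : R) (w : T -> R) (g : T -> \bar R) : 1 <= p -> 0 < B ->
  measurable_fun setT w -> (forall x, 0 < w x) ->
  (forall f, measurable_fun setT f -> (forall x, 0 <= f x)%E ->
     \int[mu]_x (cmax f x `^ p * (w x)%:E) <=
     (B `^ p)%:E * \int[mu]_x (f x `^ p * (w x)%:E))%E ->
  measurable_fun setT g -> (forall x, 0 <= g x)%E ->
  exists G : T -> \bar R, [/\ measurable_fun setT G, forall x, (g x <= G x)%E,
    forall v x, cell v x -> (cavg G v <= (2 * B)%:E * G x)%E &
    (\int[mu]_x (G x `^ p * (w x)%:E) <=
     (2 `^ p)%:E * \int[mu]_x (g x `^ p * (w x)%:E))%E].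
Proof.
move=> p1 B0 mw w0 MB mg g0.
have p0 : 0 < p by lra.
pose M k := iter k (fun f => cmax f) g.
have mM k : measurable_fun setT (M k).
  by case: k => [//|k]; exact: (measurable_wmax F).
have M0 k x : (0 <= M k x)%E.
  by elim: k x => [//|k ih] x; exact: (cmax_ge0 F).
have B20 : 0 < 2 * B by lra.
pose c k : R := (2 * B) ^- k.
have c0 k : 0 <= c k by rewrite invr_ge0 exprn_ge0// ltW.
have cM0 k x : (0 <= (c k)%:E * M k x)%E by rewrite mule_ge0// lee_fin.
have mcM k : measurable_fun setT (fun x => (c k)%:E * M k x)%E.
  exact: measurable_funeM.
pose G x : \bar R := (\sum_(k <oo) (c k)%:E * M k x)%E.
have mG : measurable_fun setT G by apply: ge0_emeasurable_sum.
have tail x : (\sum_(k <oo) (c k.+1)%:E * M k.+1 x <= G x)%E.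
  rewrite /G [leRHS]nneseries_recl//.
  have <- := @nneseries_addn _ (fun k => (c k)%:E * M k x)%E 1%N (cM0 ^~ x).
  by under [in leRHS]eq_eseriesr do rewrite addn1; rewrite leeDr.
exists G; split => //.
- move=> x; apply: le_trans (nneseries_lim_ge 1%N _) => //.
  by rewrite big_nat1 /c expr0 invr1 mul1e.
- move=> v x xv.
  have V0 := vol_gt0 F v.
  rewrite (cavgE F) integral_nneseries//; last 2 first.
  + exact: mcell.
  + by move=> k; exact: measurable_funTS.
  rewrite -nneseriesZl; last by move=> k _; exact: integral_ge0.
  apply: (@le_trans _ _ ((2 * B)%:E * \sum_(k <oo) (c k.+1)%:E * M k.+1 x)%E); last first.
    by rewrite lee_wpmul2l// lee_fin ltW.
  rewrite -nneseriesZl//; apply: lee_nneseries => k _.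
    by move=> _; rewrite mule_ge0 ?integral_ge0// lee_fin invr_ge0 ltW.
  rewrite intZl//; last exact: mcell.
  rewrite muleCA -(cavgE F).
  have : (cavg (M k) v <= M k.+1 x)%E by exact: cmax_ge.
  move: (cavg (M k) v) => z zle.
  rewrite [leRHS]muleA -[in leRHS]EFinM.
  have -> : 2 * B * c k.+1 = c k.
    rewrite /c exprS; field; rewrite expf_neq0 ?gt_eqF//.
  by rewrite lee_wpmul2l ?lee_fin.
have mpw (f : T -> \bar R) : measurable_fun setT f ->
    measurable_fun setT (fun x => f x `^ p * (w x)%:E)%E.
  move=> mf; apply: emeasurable_funM; first exact: emeasurable_poweR.
  exact/measurable_EFinP.
have pw0 (f : T -> \bar R) x : (0 <= f x `^ p * (w x)%:E)%E.
  by rewrite mule_ge0 ?poweR_ge0// lee_fin ltW.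
have MI k : (\int[mu]_x (M k x `^ p * (w x)%:E) <=
    ((B `^ p) ^+ k)%:E * \int[mu]_x (g x `^ p * (w x)%:E))%E.
  elim: k => [|k ih]; first by rewrite expr0 mul1e.
  apply: (le_trans (MB _ (mM k) (M0 k))).
  by rewrite exprS EFinM -muleA lee_wpmul2l// lee_fin powR_ge0.
(* The coefficient (2B)^(-k) is split: 2^(-k) serves as the weight in Jensen's inequality, and
   B^(-k) cancels the bound on the k-th iterate. *)
pose h : R := 2^-1.
have h01 : 0 < h < 1 by rewrite /h; apply/andP; split; lra.
have cE k : c k = h ^+ k * B ^- k by rewrite /c /h exprMn invfM exprVn.
have Bk0 k : 0 <= B ^- k by rewrite invr_ge0 exprn_ge0// ltW.
have GE x : G x = (\sum_(k <oo) (h ^+ k)%:E * ((B ^- k)%:E * M k x))%E.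
  by apply: eq_eseriesr => k _; rewrite cE EFinM muleA.
pose b k x := ((B ^- k)%:E * M k x)%E.
have b0 k x : (0 <= b k x)%E by rewrite mule_ge0// lee_fin.
have mb k : measurable_fun setT (b k) by exact: measurable_funeM.
have hk0 k : 0 <= h ^+ k by rewrite exprn_ge0//; case/andP: h01 => /ltW.
have hb0 k x : (0 <= (h ^+ k)%:E * (b k x `^ p * (w x)%:E))%E.
  by rewrite mule_ge0// lee_fin.
have hp : (1 - h) `^ (1 - p) = 2 `^ (p - 1).
  have -> : 1 - h = 2^-1 by rewrite /h; lra.
  by rewrite -powR_inv1// -powRrM; congr (_ `^ _); ring.
apply: (@le_trans _ _ (\int[mu]_x ((2 `^ (p - 1))%:E *
    \sum_(k <oo) (h ^+ k)%:E * (b k x `^ p * (w x)%:E)))%E).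
  apply: le_int => //; [exact: mpw| |].
    apply/measurable_funeM/ge0_emeasurable_sum => // k _.
    exact/measurable_funeM/mpw.
  move=> x _; rewrite GE.
  have := geometric_convexity p1 h01 (b0 ^~ x).
  rewrite hp => /(lee_wpmul2r (_ : (0 <= (w x)%:E)%E)).
  rewrite lee_fin ltW// => /(_ isT) /le_trans; apply.
  rewrite -muleA lee_wpmul2l ?lee_fin ?powR_ge0//.
  rewrite muleC -nneseriesZl; last by move=> k _; rewrite mule_ge0 ?lee_fin ?poweR_ge0.
  apply: lee_nneseries => k _.
    by move=> _; rewrite mule_ge0 ?mule_ge0 ?lee_fin ?poweR_ge0 ?(ltW (w0 x)).
  by rewrite muleCA [X in (_ * X <= _)%E]muleC.
rewrite intZl ?powR_ge0//; last 2 first.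
- by apply: ge0_emeasurable_sum => // k _; exact/measurable_funeM/mpw.
- by move=> x; apply: nneseries_ge0.
rewrite integral_nneseries//; last first.
  by move=> k; exact/measurable_funeM/mpw.
set I := (\int[mu]_x (g x `^ p * (w x)%:E))%E in MI *.
have I0 : (0 <= I)%E by exact: integral_ge0.
apply: (@le_trans _ _ ((2 `^ (p - 1))%:E * \sum_(k <oo) (2%:E * (1 / (2 ^ k.+1)%:R)%:E * I)))%E.
  rewrite lee_wpmul2l ?lee_fin ?powR_ge0//; apply: lee_nneseries => k _.
    by move=> _; exact: integral_ge0.
  rewrite intZl//; last exact: mpw.
  have -> : (2%:E * (1 / (2 ^ k.+1)%:R)%:E)%E = ((h ^+ k)%:E : \bar R).
    rewrite -EFinM /h natrX exprS exprVn; congr (_%:E).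
    by field; rewrite expf_neq0.
  rewrite lee_wpmul2l ?lee_fin//.
  have -> : (\int[mu]_x (b k x `^ p * (w x)%:E) =
    ((B ^- k) `^ p)%:E * \int[mu]_x (M k x `^ p * (w x)%:E))%E.
    rewrite -intZl//; [|exact: mpw|exact: powR_ge0].
    apply: eq_integral => x _.
    by rewrite /b poweRM ?lee_fin// poweR_EFin muleA.
  apply: (@le_trans _ _ (((B ^- k) `^ p)%:E * (((B `^ p) ^+ k)%:E * I))%E).
    by rewrite lee_wpmul2l// lee_fin powR_ge0.
  rewrite muleA -EFinM.
  have -> : (B ^- k) `^ p * (B `^ p) ^+ k = 1.
    rewrite -powR_invn ?ltW// -powR_mulrn ?powR_ge0// -!powRrM -powRD.
      by rewrite (_ : _ + _ = 0) ?powRr0//; ring.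
    by rewrite (gt_eqF B0) implybT.
  by rewrite mul1e.
have h20 (i : nat) : (0 <= (1 / (2 ^ i.+1)%:R)%:E :> \bar R)%E by rewrite lee_fin divr_ge0.
under eq_eseriesr do rewrite -muleA.
rewrite nneseriesZl; last by move=> i _; rewrite mule_ge0.
rewrite muleA -EFinM.
have -> : 2 `^ (p - 1) * 2 = 2 `^ p by rewrite mulrC mulr_powRB1.
rewrite lee_wpmul2l ?lee_fin ?powR_ge0//.
under eq_eseriesr do rewrite muleC.
move: I0; case: (I) => [r| |//]; last by move=> _; rewrite leey.
rewrite lee_fin => r0; rewrite nneseriesZl//.
rewrite -[leRHS]mule1 lee_wpmul2l ?lee_fin//.
exact: epsilon_trick0.
Qed.

(** A multiple of each cell's indicator, small against the integral of the weight over the cell and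
    against the index of the cell, is summed and the p-th root is taken; positivity holds since the
    cells cover. Such functions make others strictly positive and serve as integrable ceilings for
    truncation. *)
Lemma small_positive p (w : T -> R) (eta : R) : 0 < p -> weight w -> 0 < eta ->
  exists phi : T -> R, [/\ measurable_fun setT phi, forall x, 0 < phi x &
    (\int[mu]_x ((phi x)%:E `^ p * (w x)%:E) <= eta%:E)%E].
Proof.
move=> p0 W eta0.
have mw := weight_measurable W; have w0 := weight_gt0 W.
pose e v : R := eta / (2 ^ (pickle v).+1)%:R * (1 + wint w v)^-1.
have wi0 v : 0 < 1 + wint w v by rewrite ltr_wpDr// ltW// (wint_gt0 F).
have e0 v : 0 < e v by rewrite mulr_gt0 ?invr_gt0// divr_gt0.
pose f v x : \bar R := (e v * \1_(cell v) x)%:E.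
have f0 v x : (0 <= f v x)%E by rewrite lee_fin mulr_ge0// ltW.
have mf v : measurable_fun setT (f v).
  apply/measurable_EFinP/measurable_funM => //.
  by apply: measurable_indic; exact: mcell.
have sumle (a : V -> \bar R) : (forall v, 0 <= a v)%E ->
  (forall v, a v <= (eta / (2 ^ (pickle v).+1)%:R)%:E)%E ->
  (\esum_(v in [set: V]) a v <= eta%:E)%E.
  move=> a0 ae; rewrite esum_count_term//.
  apply: le_trans (epsilon_trick0 xpredT (ltW eta0)).
  apply: lee_nneseries => [n _ _|n _]; first exact: count_term_ge0.
  rewrite /count_term; case Ev : (pickle_inv n) => [v|].
    by have := @pickle_invK V n; rewrite Ev /= => <-.
  by rewrite lee_fin divr_ge0// ltW.
pose rho x := \esum_(v in [set: V]) f v x.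
have mrho : measurable_fun setT rho by exact: measurable_esum_count.
have rho_le x : (rho x <= eta%:E)%E.
  apply: sumle => // v; rewrite lee_fin /e -[leRHS]mulr1 -mulrA.
  apply: ler_wpM2l; first by rewrite divr_ge0// ltW.
  rewrite mulr_ile1 ?invr_ge0 ?(ltW (wi0 v))//.
  - by rewrite invf_le1// lerDl ltW// (wint_gt0 F).
have rho_gt0 x : (0 < rho x)%E.
  have [v xv] := forest_cover F x.
  apply: (@lt_le_trans _ _ (f v x)).
    by rewrite /f indicE mem_set// mulr1 lte_fin.
  have -> : f v x = \sum_(i \in [set v]) f i x by rewrite fsbig_set1.
  apply: esum_ge; exists [set v] => //.
have rhoE x : rho x = (fine (rho x))%:E.
  rewrite fineK// ge0_fin_numE ?ltW//.
  by rewrite (le_lt_trans (rho_le x))// ltry.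
exists (fun x => fine (rho x) `^ p^-1); split.
- apply: emeasurable_powR; exact: (measurableT_comp (fine_measurable measurableT)).
- by move=> x; rewrite powR_gt0// -lte_fin -rhoE.
under eq_integral => x _.
  rewrite -poweR_EFin -rhoE ge0_poweRVK ?(ltW (rho_gt0 x))// muleC.
  rewrite /rho esum_count_term// -nneseriesZl; last by move=> i _; exact: count_term_ge0.
  over.
have wct n x : (0 <= (w x)%:E * count_term (f ^~ x) n)%E.
  by rewrite mule_ge0 ?lee_fin ?(ltW (w0 x))// count_term_ge0.
rewrite integral_nneseries//; last first.
  move=> n; apply: emeasurable_funM; first exact/measurable_EFinP.
  exact: measurable_count_term.
rewrite [leLHS](_ : _ = \sum_(n <oo) count_term (fun v => (e v * wint w v)%:E) n)%E; last first.
  apply: eq_eseriesr => n _; rewrite /count_term.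
  case: (pickle_inv n) => [v|]; last first.
    by under eq_integral do rewrite mule0; rewrite integral0.
  rewrite EFinM -(wintE F v W) -intZl//; last 4 first.
  - exact: mcell.
  - exact/measurable_EFinP.
  - by move=> x; rewrite lee_fin ltW.
  - exact: ltW.
  rewrite [RHS]int_indic; apply: eq_integral => x _.
  by rewrite /f -!EFinM; congr (_%:E); ring.
rewrite -esum_count_term; last by move=> v; rewrite lee_fin mulr_ge0 ?ltW ?(wint_gt0 F).
apply: sumle => v; first by rewrite lee_fin mulr_ge0 ?ltW ?(wint_gt0 F).
rewrite lee_fin /e -mulrA -[leRHS]mulr1.
apply: ler_wpM2l; first by rewrite divr_ge0// ltW.
by rewrite mulrC ler_pdivrMr// mul1r lerDr.
Qed.

Lemma ae_le_int D (f g : T -> \bar R) (N : set T) : measurable D ->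
  measurable_fun setT f -> measurable_fun setT g ->
  (forall x, 0 <= f x)%E -> (forall x, 0 <= g x)%E ->
  measurable N -> mu N = 0%E -> (forall x, D x -> ~ N x -> f x <= g x)%E ->
  (\int[mu]_(x in D) f x <= \int[mu]_(x in D) g x)%E.
Proof.
move=> mD mf mg f0 g0 mN N0' fg.
apply: ae_ge0_le_integral => //; try exact: measurable_funTS.
exists N; split => // x /= h; apply: contrapT => Nx; apply: h => Dx; exact: fg.
Qed.

Lemma null_infty p (w : T -> R) (g : T -> \bar R) : 0 < p ->
  measurable_fun setT w -> (forall x, 0 < w x) -> measurable_fun setT g ->
  (forall x, 0 <= g x)%E ->
  (\int[mu]_x (g x `^ p * (w x)%:E) < +oo)%E ->
  measurable (g @^-1` [set +oo%E]) /\ mu (g @^-1` [set +oo%E]) = 0%E.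
Proof.
move=> p0 mw w0 mg g0 gy.
have mG : measurable (g @^-1` [set +oo%E]).
  by rewrite -[X in measurable X]setTI; exact: mg.
split => //.
have ig : mu.-integrable setT (fun x => g x `^ p * (w x)%:E)%E.
  apply/integrableP; split.
    apply: emeasurable_funM; first exact: emeasurable_poweR.
    exact/measurable_EFinP.
  under eq_integral do rewrite gee0_abs ?mule_ge0 ?poweR_ge0 ?lee_fin ?(ltW (w0 _))//.
  by [].
have [N [mN NN sN]] := integrable_ae measurableT ig.
apply: (subset_measure0 mG mN _ NN).
apply: subset_trans sN => x /= gx; rewrite gx poweRyr ?gt_eqF// => /(_ I).
by rewrite gt0_mulye// lte_fin.
Qed.

(* The product [h k^(1-p0)] of an A_1 weight and a power of another one. *)
Lemma muckenhoupt_factor p0 (c1 c2 : R) (H K : T -> \bar R) : 1 < p0 ->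
  0 < c1 -> 0 < c2 ->
  measurable_fun setT H -> measurable_fun setT K ->
  (forall x, 0 < H x)%E -> (forall x, 0 < K x)%E ->
  mu (H @^-1` [set +oo%E]) = 0%E -> mu (K @^-1` [set +oo%E]) = 0%E ->
  (forall v x, cell v x -> cavg H v <= c1%:E * H x)%E ->
  (forall v x, cell v x -> cavg K v <= c2%:E * K x)%E ->
  exists h k : T -> R, [/\ measurable_fun setT h, measurable_fun setT k,
    (forall x, 0 < h x) /\ (forall x, 0 < k x),
    (forall x, H x != +oo%E -> H x = (h x)%:E) /\
    (forall x, K x != +oo%E -> K x = (k x)%:E) &
    muckenhoupt p0 (c1 * c2 `^ (p0 - 1)) (fun x => h x * k x `^ (1 - p0))].
Proof.
move=> p01 c10 c20 mH mK H0 K0 Hy Ky MH MK.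
have pB1 : 0 < p0 - 1 by lra.
have npB1 : p0 - 1 != 0 by rewrite gt_eqF.
have npB1' : 1 - p0 != 0 by rewrite lt_eqF//; lra.
(* A finite positive version of the function: the value 1 replaces +oo, which happens on a null set
   only. *)
pose rl (G : T -> \bar R) x : R := if G x == +oo%E then 1 else fine (G x).
have mrl G : measurable_fun setT G -> measurable_fun setT (rl G).
  move=> mG; apply: measurable_fun_ifT => //.
    have mo : measurable (G @^-1` [set +oo%E]).
      by rewrite -[X in measurable X]setTI; exact: mG.
    apply: (measurable_fun_bool true).
    rewrite (_ : _ @^-1` _ = G @^-1` [set +oo%E]) ?setTI//.
    by apply/seteqP; split => x /= /eqP.
  exact: (measurableT_comp (fine_measurable measurableT)).
have rl0 G x : (forall x, 0 < G x)%E -> 0 < rl G x.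
  move=> G0; rewrite /rl; case: ifPn => // Gx.
  by rewrite fine_gt0// G0 ltey.
have rlE (G : T -> \bar R) x : (forall x, 0 < G x)%E -> G x != +oo%E -> G x = (rl G x)%:E.
  move=> G0 Gx; rewrite /rl (negbTE Gx) fineK// ge0_fin_numE ?ltey//.
  exact: ltW.
have mo (G : T -> \bar R) : measurable_fun setT G -> measurable (G @^-1` [set +oo%E]).
  by move=> mG; rewrite -[X in measurable X]setTI; exact: mG.
set h := rl H; set k := rl K.
have [mh mk] : measurable_fun setT h /\ measurable_fun setT k by split; exact: mrl.
have h0 x : 0 < h x by exact: rl0.
have k0 x : 0 < k x by exact: rl0.
have hE x : H x != +oo%E -> H x = (h x)%:E by exact: rlE.
have kE x : K x != +oo%E -> K x = (k x)%:E by exact: rlE.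
pose N := (H @^-1` [set +oo%E]) `|` (K @^-1` [set +oo%E]).
have mN : measurable N by apply: measurableU; exact: mo.
have muN : mu N = 0%E by apply: null_set_setU => //; exact: mo.
have NhE x : ~ N x -> H x = (h x)%:E /\ K x = (k x)%:E.
  move=> Nx; split; [apply: hE|apply: kE]; apply/eqP => e; apply: Nx; [left|right] => //.
have ex v : exists2 x, cell v x & ~ N x.
  apply: contrapT => ne; have : (mu (cell v) <= mu N)%E.
    apply: le_measure; rewrite ?inE//; first exact: mcell.
    by move=> x xv; apply: contrapT => Nx; apply: ne; exists x.
  by rewrite muN leNgt (forest_gt0 F).
(* The A_1 condition bounds the average [a] over the cell by [c * g x] at all points outside the
   null set. This lower bound on [g] lets a negative power of [g] be replaced by a constant on the
   cell. *)
have avg (G : T -> \bar R) (g : T -> R) (v : V) (c : R) : measurable_fun setT G -> (forall x, 0 < G x)%E ->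
    (forall x, 0 < g x) -> measurable_fun setT g -> 0 < c ->
    (forall x, ~ N x -> G x = (g x)%:E) ->
    (forall v x, cell v x -> cavg G v <= c%:E * G x)%E ->
    exists a, [/\ 0 < a, (forall x, cell v x -> ~ N x -> a <= c * g x) &
      (\int[mu]_(x in cell v) (g x)%:E <= (a * vol v)%:E)%E].
  move=> mG G0 g0 mg c0 Gg MG.
  have [y yv Ny] := ex v.
  have A0 : (0 <= cavg G v)%E by apply: (cavg_ge0 F) => x; exact: ltW.
  have Afin : (cavg G v < +oo)%E.
    by apply: le_lt_trans (MG _ _ yv) _; rewrite Gg// ltry.
  have AE : cavg G v = (fine (cavg G v))%:E by rewrite fineK// ge0_fin_numE.
  have gG : (\int[mu]_(x in cell v) (g x)%:E <= (fine (cavg G v) * vol v)%:E)%E.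
    rewrite mulrC EFinM -AE -(int_cavg F).
    apply: (@ae_le_int _ _ _ N) => //; first exact: mcell.
    - exact/measurable_EFinP.
    - by move=> x; rewrite lee_fin ltW.
    - by move=> x; exact: ltW.
    - by move=> x xv Nx; rewrite Gg.
  exists (fine (cavg G v)); split => //; last first.
    by move=> x xv Nx; rewrite -lee_fin -AE EFinM -Gg//; exact: MG.
  rewrite lt_neqAle fine_ge0// andbT eq_sym; apply/eqP => a0.
  move: gG; rewrite a0 mul0r => gG.
  have gI : (\int[mu]_(x in cell v) (g x)%:E = 0)%E.
    by apply/eqP; rewrite eq_le gG integral_ge0// => x _; rewrite lee_fin ltW.
  have mgE : measurable_fun (cell v) (fun x => (g x)%:E).
    exact/measurable_EFinP/measurable_funTS.
  have /(ae_eq_integral_abs mu (mcell v) mgE)[N' [mN' N0' sN']] :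
    (\int[mu]_(x in cell v) `|(g x)%:E| = 0)%E.
    by rewrite -[RHS]gI; apply: eq_integral => x _; rewrite gee0_abs// lee_fin ltW.
  have : (mu (cell v) <= mu N')%E.
    apply: le_measure; rewrite ?inE//; first exact: mcell.
    apply: subset_trans sN' => x xv /= /(_ xv)[] gx0.
    by have := g0 x; rewrite gx0 ltxx.
  by rewrite N0' leNgt (forest_gt0 F).
have avH v := avg H h v c1 mH H0 h0 mh c10 (fun x Nx => (NhE x Nx).1) MH.
have avK v := avg K k v c2 mK K0 k0 mk c20 (fun x Nx => (NhE x Nx).2) MK.
pose w0 x := h x * k x `^ (1 - p0).
have mw0 : measurable_fun setT w0.
  by apply: measurable_funM => //; exact: emeasurable_powR.
have w00 x : 0 < w0 x by rewrite mulr_gt0 ?powR_gt0.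
have b1 v : forall a b, 0 < b ->
   (\int[mu]_(x in cell v) (h x)%:E <= (a * vol v)%:E)%E ->
   (forall x, cell v x -> ~ N x -> b <= c2 * k x) ->
   (\int[mu]_(x in cell v) (w0 x)%:E <= ((b / c2) `^ (1 - p0) * (a * vol v))%:E)%E.
  move=> a b b0 ha bk.
  apply: (@le_trans _ _ (((b / c2) `^ (1 - p0))%:E * \int[mu]_(x in cell v) (h x)%:E))%E.
    rewrite -intZl ?powR_ge0//; [|exact: mcell|exact/measurable_EFinP|
      by move=> x; rewrite lee_fin ltW].
    apply: (@ae_le_int _ _ _ N) => //; first exact: mcell.
    - exact/measurable_EFinP.
    - exact/measurable_funeM/measurable_EFinP.
    - by move=> x; rewrite lee_fin ltW.
    - by move=> x; rewrite mule_ge0// lee_fin ?powR_ge0// ltW.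
    move=> x xv Nx; rewrite -EFinM lee_fin /w0 mulrC ler_wpM2r ?(ltW (h0 x))//.
    have bc : b / c2 <= k x by rewrite ler_pdivrMr// mulrC bk.
    have -> : 1 - p0 = - (p0 - 1) by ring.
    by apply: powRN_le bc; rewrite ?divr_gt0// ltW.
  by rewrite EFinM lee_wpmul2l// lee_fin powR_ge0.
have dE x : dual_weight p0 w0 x = h x `^ (- (p0 - 1)^-1) * k x.
  rewrite /dual_weight /w0 powRM ?powR_ge0 ?(ltW (h0 x))// -powRrM; congr (_ * _).
  by rewrite (_ : _ * _ = 1) ?powRr1 ?(ltW (k0 x))//; field.
have b2 v : forall a b, 0 < a ->
   (\int[mu]_(x in cell v) (k x)%:E <= (b * vol v)%:E)%E ->
   (forall x, cell v x -> ~ N x -> a <= c1 * h x) ->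
   (\int[mu]_(x in cell v) (dual_weight p0 w0 x)%:E <=
     ((a / c1) `^ (- (p0 - 1)^-1) * (b * vol v))%:E)%E.
  move=> a b a0 kb ah.
  under eq_integral do rewrite dE.
  apply: (@le_trans _ _ (((a / c1) `^ (- (p0 - 1)^-1))%:E * \int[mu]_(x in cell v) (k x)%:E))%E.
    rewrite -intZl ?powR_ge0//; [|exact: mcell|exact/measurable_EFinP|
      by move=> x; rewrite lee_fin ltW].
    apply: (@ae_le_int _ _ _ N) => //; first exact: mcell.
    - by apply/measurable_EFinP/measurable_funM => //; exact: emeasurable_powR.
    - exact/measurable_funeM/measurable_EFinP.
    - by move=> x; rewrite lee_fin mulr_ge0 ?powR_ge0 ?ltW.
    - by move=> x; rewrite mule_ge0// lee_fin ?powR_ge0// ltW.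
    move=> x xv Nx; rewrite -EFinM lee_fin ler_wpM2r ?(ltW (k0 x))//.
    have ac : a / c1 <= h x by rewrite ler_pdivrMr// mulrC ah.
    by apply: powRN_le ac; rewrite ?divr_gt0// invr_ge0 ltW.
  by rewrite EFinM lee_wpmul2l// lee_fin powR_ge0.
exists h, k; split => //; split.
- by rewrite mulr_ge0 ?powR_ge0// ltW.
- split => // v.
  have [a [a0 _ ha]] := avH v; have [b [b0 bk _]] := avK v.
  by apply: le_lt_trans (b1 v a b b0 ha bk) _; rewrite ltry.
- split => //.
  + exact: emeasurable_powR.
  + by move=> x; exact: powR_gt0 (w00 x).
  move=> v; have [a [a0 ah _]] := avH v; have [b [b0 _ kb]] := avK v.
  by apply: le_lt_trans (b2 v a b a0 kb ah) _; rewrite ltry.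
move=> v; have [a [a0 ah ha]] := avH v; have [b [b0 bk kb]] := avK v.
have V0 := vol_gt0 F v.
have B1 := b1 v a b b0 ha bk; have B2 := b2 v a b a0 kb ah.
have fle (x : \bar R) (y : R) : (0 <= x)%E -> (x <= y%:E)%E -> fine x <= y.
  by case: x => //= r _; rewrite lee_fin.
have i1 : wint w0 v / vol v <= (b / c2) `^ (1 - p0) * a.
  rewrite ler_pdivrMr// -mulrA; apply: fle => //.
  by apply: integral_ge0 => x _; rewrite lee_fin ltW.
have i2 : wint (dual_weight p0 w0) v / vol v <= (a / c1) `^ (- (p0 - 1)^-1) * b.
  rewrite ler_pdivrMr// -mulrA; apply: fle => //.
  by apply: integral_ge0 => x _; rewrite lee_fin; exact: powR_ge0.
have wi u : (forall x, 0 < u x) -> 0 <= wint u v / vol v.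
  move=> u0; rewrite divr_ge0 ?(ltW V0)// fine_ge0// integral_ge0// => x _.
  by rewrite lee_fin ltW.
(* The averages [a] and [b] cancel in this product and only c1 c2^(p0-1) survives. *)
apply: (@le_trans _ _ ((b / c2) `^ (1 - p0) * a *
   ((a / c1) `^ (- (p0 - 1)^-1) * b) `^ (p0 - 1))).
  apply: ler_pM => //; rewrite ?powR_ge0 ?wi//.
  apply: powR_le i2; first exact: ltW.
  by apply: wi => x; exact: powR_gt0 (w00 x).
rewrite powRM ?powR_ge0 ?(ltW b0)// -powRrM mulNr mulVf// powR_inv1 ?divr_ge0 ?(ltW a0) ?(ltW c10)//.
rewrite invf_div powRM ?invr_ge0 ?(ltW b0) ?(ltW c20)// -[c2^-1]powR_inv1 ?(ltW c20)// -powRrM.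
have -> : b `^ (1 - p0) = (b `^ (p0 - 1))^-1 by rewrite -powRN; congr (_ `^ _); ring.
have -> : -1 * (1 - p0) = p0 - 1 by ring.
have : b `^ (p0 - 1) != 0 by rewrite gt_eqF// powR_gt0.
move: (b `^ _) (c2 `^ _) => B C Bn0; rewrite le_eqVlt; apply/orP; left; apply/eqP.
by field; rewrite Bn0 gt_eqF.
Qed.

Lemma mct_sup (f : nat -> T -> \bar R) (g : T -> \bar R) (c : \bar R) :
  (forall n, measurable_fun setT (f n)) -> (forall n x, 0 <= f n x)%E ->
  (forall x, nondecreasing_seq (f ^~ x)) ->
  measurable_fun setT g -> (forall x, 0 <= g x)%E ->
  (forall x, g x <= ereal_sup (range (f ^~ x)))%E ->
  (forall n, \int[mu]_x f n x <= c)%E -> (\int[mu]_x g x <= c)%E.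
Proof.
move=> mf f0 ndf mg g0 gf fc.
apply: (@le_trans _ _ (\int[mu]_x limn (f ^~ x)))%E.
  apply: le_int => //.
    apply: (emeasurable_fun_cvg f) => // x _; exact: ereal_nondecreasing_is_cvgn.
  by move=> x _; rewrite (cvg_lim _ (ereal_nondecreasing_cvgn (ndf x))).
rewrite monotone_convergence//.
apply: lime_le; last exact: nearW.
apply: ereal_nondecreasing_is_cvgn => m n mn.
by apply: ge0_le_integral => // x _; exact: ndf.
Qed.

Definition nnpair (FF : (T -> \bar R) -> (T -> \bar R) -> Prop) : Prop :=
  forall f g, FF f g -> [/\ measurable_fun setT f, measurable_fun setT g,
    forall x, (0 <= f x)%E & forall x, (0 <= g x)%E].

(** The constant may depend on the A_p constant [K] but not on the weight or the pair. Extrapolation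
    relies on this, as it applies the bound to a weight built from the pair itself. *)
Definition weighted_bound (FF : (T -> \bar R) -> (T -> \bar R) -> Prop) (p : R) : Prop :=
  forall K : R, exists2 C : R, 0 < C & forall f g, FF f g ->
    forall w, muckenhoupt p K w ->
    (\int[mu]_x (f x `^ p * (w x)%:E) <=
     C%:E * \int[mu]_x (g x `^ p * (w x)%:E))%E.

(* Rubio de Francia extrapolation. With [A_1] majorants [k] of [g] and [h] of
   [f^(p-1) w] one has [int f h <= int k h + int f^p0 h k^(1-p0)], where
   [h k^(1-p0)] is an [A_p0] weight, and Young's inequality bounds [int k h]. *)
Theorem extrapolation p0 p FF : 1 < p0 -> 1 < p -> nnpair FF ->
  weighted_bound FF p0 -> weighted_bound FF p.
Proof.
move=> p01 p1 FF0 WB K.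
(* The term a / 2 is absorbed into the left side, which is legitimate because [a] will be a finite
   integral of a truncated function. *)
have final (a C Ig de : R) :
  a <= C / 2 * (Ig + de) + 2^-1 * (a + de) -> a <= C * Ig + (C + 1) * de by lra.
have p00 : 0 < p0 by lra.
have p0B1 : 0 < p0 - 1 by lra.
have p0' : 0 < p by lra.
have pB1 : 0 < p - 1 by lra.
pose q := p / (p - 1).
have q1 : 1 < q by rewrite ltr_pdivlMr//; lra.
have q0 : 0 < q by lra.
have pq1 : p^-1 + q^-1 = 1 by rewrite /q; field; rewrite !gt_eqF.
have q'p : q / (q - 1) = p by rewrite /q; field; rewrite gt_eqF//= gt_eqF//; lra.
pose K' := K `^ (p - 1)^-1.
have [C1 C10 C1E] : exists2 c, 0 <= c &
    K `^ q * (p `^ q * N0.+1%:R) * (q `^ p * N0.+1%:R) = c.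
  by eexists; last (exact: erefl); rewrite !mulr_ge0 ?powR_ge0.
have [C2 C20 C2E] : exists2 c, 0 <= c &
    K' `^ p * (q `^ p * N0.+1%:R) * (p `^ q * N0.+1%:R) = c.
  by eexists; last (exact: erefl); rewrite !mulr_ge0 ?powR_ge0.
have root (c r : R) : 0 < r -> 0 <= c -> exists2 b, 0 < b & b `^ r = c + 1.
  move=> r0 c0; exists ((c + 1) `^ r^-1); first by rewrite powR_gt0// ltr_wpDl.
  by rewrite -powRrM mulVf ?gt_eqF// powRr1// addr_ge0.
have [B1 B10 B1p] := root _ _ p0' C10.
have [B2 B20 B2q] := root _ _ q0 C20.
have B10' : 0 < 2 * B1 by rewrite mulr_gt0.
have B20' : 0 < 2 * B2 by rewrite mulr_gt0.
(* This is the A_p0 constant that [muckenhoupt_factor] produces from A_1 constants 2 B2 of the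
   numerator and 2 B1 of the denominator. *)
have [C0 C00 WB0] := WB ((2 * B2) * (2 * B1) `^ (p0 - 1)).
have [L L0 LE] : exists2 L, 0 < L & L = 1 + C0 by eexists; last (exact: erefl); rewrite addr_gt0.
(* The parameter of Young's inequality below: the part of the bound that contains [f] itself gets
   the factor 1/2. *)
have [la la0 laq] : exists2 la, 0 < la & L * (la `^ (- q) * 2 `^ q) = 2^-1.
  exists ((2 * L * 2 `^ q) `^ q^-1); first by rewrite powR_gt0// !mulr_gt0// powR_gt0.
  rewrite powRN -powRrM mulVf ?gt_eqF// powRr1 ?mulr_ge0 ?powR_ge0 ?(ltW L0)//.
  by field; rewrite !gt_eqF ?powR_gt0.
have [C C0' CE] : exists2 C, 0 < C & C = 2 * L * la `^ p * 2 `^ p.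
  by eexists; last (exact: erefl); rewrite !mulr_gt0// powR_gt0.
exists C => // f g fg w AK.
have [mf mg f0 g0] := FF0 _ _ fg.
have W := Ap_weight AK; have W' := Ap_dual AK.
have mw := weight_measurable W; have w0 := weight_gt0 W.
set s := dual_weight p w in W'.
have ms := weight_measurable W'; have s0 := weight_gt0 W'.
have [gy|] := ltP (\int[mu]_x (g x `^ p * (w x)%:E))%E +oo%E; last first.
  by rewrite leye_eq => /eqP ->; rewrite gt0_muley ?leey// lte_fin.
have mpw (u : T -> \bar R) (r : R) (z : T -> R) : measurable_fun setT u ->
    measurable_fun setT z -> measurable_fun setT (fun x => u x `^ r * (z x)%:E)%E.
  move=> mu' mz; apply: emeasurable_funM; first exact: emeasurable_poweR.
  exact/measurable_EFinP.
have pw0 (u : \bar R) (r : R) (z : R) : 0 < z -> (0 <= u `^ r * z%:E)%E.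
  by move=> z0; rewrite mule_ge0 ?poweR_ge0// lee_fin ltW.
have Ig0 : (0 <= \int[mu]_x (g x `^ p * (w x)%:E))%E.
  by apply: integral_ge0 => x _; apply: pw0.
pose Ig := fine (\int[mu]_x (g x `^ p * (w x)%:E))%E.
have IgE : (\int[mu]_x (g x `^ p * (w x)%:E) = Ig%:E)%E by rewrite fineK// ge0_fin_numE.
rewrite IgE -EFinM.
(* The truncations [fm m], the minimum of [f] and [m * phi], have finite weighted norm and increase
   to [f]. *)
have [phi [mphi phi0 phi1]] := small_positive p0' W ltr01.
pose fm (m : nat) x : R := fine (mine (f x) (m%:R * phi x)%:E).
have fmE m x : (fm m x)%:E = mine (f x) (m%:R * phi x)%:E.
  rewrite fineK// ge0_fin_numE.
    by rewrite gt_min ltry orbT.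
  by rewrite le_min f0 lee_fin mulr_ge0// ltW.
have fm0 m x : 0 <= fm m x.
  by rewrite -lee_fin fmE le_min f0 lee_fin mulr_ge0// ltW.
have mfm m : measurable_fun setT (fm m).
  apply: (measurableT_comp (fine_measurable measurableT)).
  apply: measurable_mine => //; apply/measurable_EFinP/measurable_funM => //.
have maxpw (u : T -> \bar R) (z : T -> R) (de : R) : measurable_fun setT u ->
   measurable_fun setT z -> (forall x, 0 <= u x)%E -> (forall x, 0 < z x) ->
   (\int[mu]_x ((z x)%:E `^ p * (w x)%:E) <= de%:E)%E ->
   (\int[mu]_x (maxe (u x) (z x)%:E `^ p * (w x)%:E) <=
    \int[mu]_x (u x `^ p * (w x)%:E) + de%:E)%E.
  move=> mu' mz u0 z0 zde.
  have mzE : measurable_fun setT (fun x => (z x)%:E) by exact/measurable_EFinP.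
  apply: le_trans (leeD2l _ zde).
  rewrite -intD//; [|exact: mpw|exact: (@mpw (fun x => (z x)%:E))|
    by move=> x; apply: pw0|by move=> x; apply: pw0].
  apply: le_int => //.
  - by apply: mpw => //; exact: measurable_maxe.
  - by apply: emeasurable_funD; [exact: mpw|exact: (@mpw (fun x => (z x)%:E))].
  - by move=> x; apply: pw0.
  move=> x _; case: (leP (u x) (z x)%:E) => _.
    by rewrite leeDr// pw0.
  by rewrite leeDl// pw0.
have main m (de : R) : 0 < de ->
    (\int[mu]_x ((fm m x)%:E `^ p * (w x)%:E) <= (C * Ig + (C + 1) * de)%:E)%E.
  move=> de0.
  have [psi [mpsi psi0 psi1]] := small_positive p0' W de0.
  have mfmE : measurable_fun setT (fun x => (fm m x)%:E) by exact/measurable_EFinP.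
  have mpsiE : measurable_fun setT (fun x => (psi x)%:E) by exact/measurable_EFinP.
  set I := (\int[mu]_x ((fm m x)%:E `^ p * (w x)%:E))%E.
  have I0 : (0 <= I)%E by apply: integral_ge0 => x _; apply: pw0.
  have Iy : (I < +oo)%E.
    apply: (@le_lt_trans _ _ ((m%:R `^ p)%:E *
        \int[mu]_x ((phi x)%:E `^ p * (w x)%:E)))%E; last first.
      apply: le_lt_trans (_ : ((m%:R `^ p)%:E * 1 < +oo)%E); last by rewrite mule1 ltry.
      by rewrite lee_wpmul2l// lee_fin powR_ge0.
    have mphiE : measurable_fun setT (fun x => (phi x)%:E) by exact/measurable_EFinP.
    rewrite -intZl ?powR_ge0//; [|exact: (@mpw (fun x => (phi x)%:E))|by move=> x; apply: pw0].
    apply: le_int => //.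
    - exact: (@mpw (fun x => (fm m x)%:E)).
    - by apply: measurable_funeM; exact: (@mpw (fun x => (phi x)%:E)).
    - by move=> x; apply: pw0.
    move=> x _; rewrite muleA lee_wpmul2r ?lee_fin ?(ltW (w0 x))//.
    rewrite -powRM ?(ltW (phi0 x))//.
    apply: powR_le => //; first exact: ltW.
    by rewrite -lee_fin fmE ge_min lexx orbT.
  pose a := fine I.
  have IE : I = a%:E by rewrite fineK// ge0_fin_numE.
  (* Raising both functions to the small positive [psi] makes the A_1 majorants strictly positive,
     as the factorisation demands; the error [de] tends to 0 at the end. *)
  pose g' x := maxe (g x) (psi x)%:E.
  pose f' x := maxe (fm m x)%:E (psi x)%:E.
  have mg' : measurable_fun setT g' by exact: measurable_maxe.
  have mf' : measurable_fun setT f' by exact: measurable_maxe.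
  have g'0 x : (0 < g' x)%E by rewrite lt_max lte_fin psi0 orbT.
  have f'0 x : (0 < f' x)%E by rewrite lt_max !lte_fin psi0 orbT.
  have g'le : (\int[mu]_x (g' x `^ p * (w x)%:E) <= (Ig + de)%:E)%E.
    by rewrite EFinD -IgE; exact: maxpw.
  have f'le : (\int[mu]_x (f' x `^ p * (w x)%:E) <= (a + de)%:E)%E.
    rewrite EFinD -IE; apply: maxpw => //.
    by move=> x; rewrite lee_fin.
  pose h' x := (f' x `^ (p - 1) * (w x)%:E)%E.
  have mh' : measurable_fun setT h' by exact: mpw.
  have h'0 x : (0 < h' x)%E by rewrite mule_gt0 ?lte_fin// poweR_gt0.
  have h'le : (\int[mu]_x (h' x `^ q * (s x)%:E) <= (a + de)%:E)%E.
    apply: le_trans f'le; rewrite le_eqVlt; apply/orP; left; apply/eqP.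
    apply: eq_integral => x _; rewrite /h' poweRM ?poweR_ge0 ?lee_fin ?(ltW (w0 x))//.
    rewrite -poweRrM (_ : (p - 1) * q = p); last by rewrite /q; field; rewrite gt_eqF.
    rewrite -muleA poweR_EFin -EFinM /s /dual_weight -powRD; last first.
      by rewrite (gt_eqF (w0 x)) implybT.
    rewrite (_ : q + _ = 1) ?powRr1 ?(ltW (w0 x))//.
    by rewrite /q; field; rewrite gt_eqF.
  have [KK [mKK gKK MKK IKK]] : exists G : T -> \bar R, [/\ measurable_fun setT G,
      forall x, (g' x <= G x)%E,
      forall v x, cell v x -> (cavg G v <= (2 * B1)%:E * G x)%E &
      (\int[mu]_x (G x `^ p * (w x)%:E) <=
       (2 `^ p)%:E * \int[mu]_x (g' x `^ p * (w x)%:E))%E].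
    apply: rubio_de_francia => //; [exact: ltW| |by move=> x; exact: ltW].
    move=> u mu' u0; apply: (le_trans (cmax_muckenhoupt F p1 AK mu' u0)).
    rewrite lee_wpmul2r ?integral_ge0//; first by move=> x _; apply: pw0.
    by rewrite lee_fin B1p -/q C1E lerDl.
  have [HH [mHH hHH MHH IHH]] : exists G : T -> \bar R, [/\ measurable_fun setT G,
      forall x, (h' x <= G x)%E,
      forall v x, cell v x -> (cavg G v <= (2 * B2)%:E * G x)%E &
      (\int[mu]_x (G x `^ q * (s x)%:E) <=
       (2 `^ q)%:E * \int[mu]_x (h' x `^ q * (s x)%:E))%E].
    apply: rubio_de_francia => //; [exact: ltW| |by move=> x; exact: ltW].
    move=> u mu' u0.
    have := cmax_muckenhoupt F q1 (muckenhoupt_dual F p1 AK) mu' u0.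
    rewrite -/q q'p => /le_trans; apply.
    rewrite lee_wpmul2r ?integral_ge0//; first by move=> x _; apply: pw0.
    by rewrite lee_fin B2q -/K' C2E lerDl.
  have KK0 x : (0 < KK x)%E by apply: lt_le_trans (gKK x).
  have HH0 x : (0 < HH x)%E by apply: lt_le_trans (hHH x).
  have KKy : (\int[mu]_x (KK x `^ p * (w x)%:E) <= (2 `^ p * (Ig + de))%:E)%E.
    by apply: (le_trans IKK); rewrite EFinM lee_wpmul2l ?lee_fin ?powR_ge0.
  have HHy : (\int[mu]_x (HH x `^ q * (s x)%:E) <= (2 `^ q * (a + de))%:E)%E.
    by apply: (le_trans IHH); rewrite EFinM lee_wpmul2l ?lee_fin ?powR_ge0.
  have [mKy nKy] := null_infty p0' mw w0 mKK (fun x => ltW (KK0 x)) (le_lt_trans KKy (ltry _)).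
  have [mHy nHy] := null_infty q0 ms s0 mHH (fun x => ltW (HH0 x)) (le_lt_trans HHy (ltry _)).
  have [h [k [mh mk [h0 k0] [hE kE] AW]]] :=
    muckenhoupt_factor p01 B20' B10' mHH mKK HH0 KK0 nHy nKy MHH MKK.
  set w0' := (fun x => _) in AW.
  have mw0' : measurable_fun setT w0' by exact: weight_measurable (Ap_weight AW).
  have w0'0 x : 0 < w0' x by exact: weight_gt0 (Ap_weight AW) x.
  have := WB0 _ _ fg _ AW => fgW.
  pose N := (HH @^-1` [set +oo%E]) `|` (KK @^-1` [set +oo%E]).
  have mN : measurable N by apply: measurableU.
  have muN : mu N = 0%E by apply: null_set_setU.
  have NhE x : ~ N x -> HH x = (h x)%:E /\ KK x = (k x)%:E.
    move=> Nx; split; [apply: hE|apply: kE]; apply/eqP => e; apply: Nx; [left|right] => //.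
  pose X := (\int[mu]_x (k x * h x)%:E)%E.
  have mkh : measurable_fun setT (fun x => (k x * h x)%:E).
    exact/measurable_EFinP/measurable_funM.
  have kh0 x : (0 <= (k x * h x)%:E)%E by rewrite lee_fin mulr_ge0// ltW.
  have X0 : (0 <= X)%E by exact: integral_ge0.
  (* Since fm^(p-1) w is at most h, the integral of fm^p w is at most that of fm h. Where fm <= k
     this is below k h; elsewhere fm = fm^p0 fm^(1-p0) is at most fm^p0 k^(1-p0). *)
  have step1 : (I <= X + \int[mu]_x (f x `^ p0 * (w0' x)%:E))%E.
    rewrite -intD//; [|exact: mpw|by move=> x; apply: pw0].
    apply: (@ae_le_int _ _ _ N) => //.
    - exact: (@mpw (fun x => (fm m x)%:E)).
    - by apply: emeasurable_funD => //; exact: mpw.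
    - by move=> x; apply: pw0.
    - by move=> x; rewrite adde_ge0// pw0.
    move=> x _ /NhE[HhE KkE].
    have hh := hHH x; rewrite HhE in hh.
    have ff : (fm m x `^ (p - 1) * w x <= h x).
      rewrite -lee_fin; apply: le_trans hh; rewrite EFinM /h'.
      rewrite lee_wpmul2r ?lee_fin ?(ltW (w0 x))// -poweR_EFin.
      apply: ge0_ler_poweR; rewrite ?lee_fin ?(ltW pB1)//.
      by rewrite le_max lexx.
    apply: (@le_trans _ _ ((k x * h x)%:E + (fm m x)%:E `^ p0 * (w0' x)%:E)%E); last first.
      rewrite leeD2l// lee_wpmul2r ?lee_fin ?(ltW (w0'0 x))//.
      apply: ge0_ler_poweR; rewrite ?lee_fin ?(ltW p00)//.
      by rewrite fmE ge_min lexx.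
    rewrite !poweR_EFin -!EFinM -EFinD lee_fin.
    apply: (@le_trans _ _ (fm m x * h x)).
      rewrite -(mulr_powRB1 (fm0 m x) p0') -mulrA.
      by rewrite ler_wpM2l.
    have -> : k x * h x + fm m x `^ p0 * w0' x =
       (k x + fm m x `^ p0 * k x `^ (1 - p0)) * h x by rewrite /w0'; ring.
    rewrite ler_wpM2r ?(ltW (h0 x))//.
    have [fk|kf] := leP (fm m x) (k x).
      by rewrite ler_wpDr// mulr_ge0 ?powR_ge0.
    rewrite ler_wpDl ?(ltW (k0 x))//.
    have fgt0 : 0 < fm m x by apply: lt_trans (k0 x) kf.
    have {1}-> : fm m x = fm m x `^ p0 * fm m x `^ (1 - p0).
      rewrite -powRD; first by rewrite (_ : p0 + _ = 1) ?powRr1//; ring.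
      by rewrite (gt_eqF fgt0) implybT.
    rewrite ler_wpM2l ?powR_ge0//.
    have -> : 1 - p0 = - (p0 - 1) by ring.
    by apply: powRN_le; rewrite ?ltW.
  have step2 : (\int[mu]_x (g x `^ p0 * (w0' x)%:E) <= X)%E.
    apply: (@ae_le_int _ _ _ N) => //.
    - exact: mpw.
    - by move=> x; apply: pw0.
    move=> x _ /NhE[HhE KkE].
    apply: (@le_trans _ _ ((k x)%:E `^ p0 * (w0' x)%:E)%E).
      rewrite lee_wpmul2r ?lee_fin ?(ltW (w0'0 x))//.
      apply: ge0_ler_poweR => //; first exact: ltW.
      by rewrite -KkE; apply: le_trans (gKK x); rewrite le_max lexx.
    rewrite poweR_EFin -EFinM lee_fin /w0' mulrCA mulrC -powRD.
      by rewrite (_ : p0 + _ = 1) ?powRr1 ?(ltW (k0 x))//; ring.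
    by rewrite (gt_eqF (k0 x)) implybT.
  (* Young's inequality for [la * k] and [h / w / la], multiplied by [w]; the factors 1/p and 1/q
     are discarded. The dual weight appears as w^(1-q). *)
  have step3 : (X <= (la `^ p * (2 `^ p * (Ig + de)) + la `^ (- q) * (2 `^ q * (a + de)))%:E)%E.
    rewrite EFinD [(la `^ p * _)%:E]EFinM [(la `^ (- q) * _)%:E]EFinM.
    apply: (@le_trans _ _ ((la `^ p)%:E * \int[mu]_x (KK x `^ p * (w x)%:E) +
      (la `^ (- q))%:E * \int[mu]_x (HH x `^ q * (s x)%:E))%E); last first.
      by apply: leeD; rewrite lee_wpmul2l ?lee_fin ?powR_ge0.
    have l1 x : (0 <= (la `^ p)%:E * (KK x `^ p * (w x)%:E))%E.
      by rewrite mule_ge0 ?lee_fin ?powR_ge0 ?pw0.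
    have l2 x : (0 <= (la `^ (-q))%:E * (HH x `^ q * (s x)%:E))%E.
      by rewrite mule_ge0 ?lee_fin ?powR_ge0 ?pw0.
    rewrite -!intZl ?powR_ge0//; [|exact: mpw|by move=> x; apply: pw0
      |exact: mpw|by move=> x; apply: pw0].
    rewrite -intD//; [|exact/measurable_funeM/mpw|exact/measurable_funeM/mpw].
    apply: (@ae_le_int _ _ _ N) => //.
    - by apply: emeasurable_funD; exact/measurable_funeM/mpw.
    - by move=> x; rewrite adde_ge0.
    move=> x _ /NhE[-> ->]; rewrite !poweR_EFin -!EFinM -EFinD lee_fin.
    have kx := k0 x; have hx := h0 x; have wx := w0 x.
    have := @conjugate_powR R (la * k x) (h x / w x / la) p q.
    have y1 : 0 <= la * k x by rewrite mulr_ge0 ?(ltW la0) ?(ltW kx).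
    have y2 : 0 <= h x / w x / la.
      by rewrite !mulr_ge0 ?invr_ge0 ?(ltW la0) ?(ltW wx) ?(ltW hx).
    move=> /(_ y1 y2 p0' q0 pq1).
    have -> : la * k x * (h x / w x / la) = k x * h x / w x.
      by field; rewrite !gt_eqF.
    move=> y.
    have {}y : k x * h x / w x <= (la * k x) `^ p + (h x / w x / la) `^ q.
      apply: (le_trans y); apply: lerD; rewrite ler_pdivrMr//;
        by rewrite ler_peMr ?powR_ge0// ltW.
    rewrite ler_pdivrMr// in y; apply: (le_trans y).
    have iN (z : R) : 0 < z -> z^-1 `^ q = z `^ (- q).
      by move=> z0; rewrite -[z^-1]powR_inv1 ?(ltW z0)// -powRrM mulN1r.
    have e1 : (la * k x) `^ p = la `^ p * k x `^ p.
      by rewrite powRM ?(ltW la0) ?(ltW kx).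
    have e2 : (h x / w x / la) `^ q = h x `^ q * w x `^ (- q) * la `^ (- q).
      rewrite powRM; [|by rewrite mulr_ge0 ?invr_ge0 ?(ltW wx) ?(ltW hx)
        |by rewrite invr_ge0 (ltW la0)].
      by rewrite powRM ?(ltW hx) ?invr_ge0 ?(ltW wx)// !iN.
    have -> : s x = w x `^ (- q) * w x.
      rewrite -{2}[w x]powRr1 ?(ltW wx)// -powRD; last by rewrite (gt_eqF wx) implybT.
      by rewrite /s /dual_weight; congr (_ `^ _); rewrite /q; field; rewrite gt_eqF.
    rewrite e1 e2.
    by rewrite le_eqVlt; apply/orP; left; apply/eqP; ring.
  have Xy : (X < +oo)%E by rewrite (le_lt_trans step3)// ltry.
  have XE : X = (fine X)%:E by rewrite fineK// ge0_fin_numE.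
  have aX : a <= L * fine X.
    rewrite -lee_fin -IE; apply: (le_trans step1).
    rewrite LE mulrDl mul1r EFinD EFinM -XE leeD2l//.
    by apply: (le_trans fgW); rewrite lee_wpmul2l// lee_fin ltW.
  rewrite IE lee_fin.
  rewrite XE lee_fin in step3.
  have := ler_wpM2l (ltW L0) step3 => {}step3.
  have := le_trans aX step3; rewrite mulrDr.
  have -> : L * (la `^ (- q) * (2 `^ q * (a + de))) =
    (L * (la `^ (- q) * 2 `^ q)) * (a + de) by ring.
  have -> : L * (la `^ p * (2 `^ p * (Ig + de))) = C / 2 * (Ig + de).
    by rewrite CE; field.
  by rewrite laq; exact: final.
(* The truncation is removed by monotone convergence, and [de] is chosen so that the error (C + 1)
   de is any prescribed number. *)
apply: (@mct_sup (fun m x => (fm m x)%:E `^ p * (w x)%:E)%E) => //.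
- by move=> n; apply: (@mpw (fun x => (fm n x)%:E)) => //; exact/measurable_EFinP.
- by move=> n x; apply: pw0.
- move=> x m n mn; rewrite lee_wpmul2r ?lee_fin ?(ltW (w0 x))//.
  apply: powR_le => //; first exact: ltW.
  rewrite -lee_fin !fmE le_min [X in X && _]ge_min lexx /=.
  by rewrite ge_min lee_fin ler_wpM2r ?(ltW (phi0 x)) ?ler_nat ?orbT.
- exact: mpw.
- by move=> x; apply: pw0.
- move=> x; rewrite muleC -lee_pdivlMl//.
  have fsup : f x = ereal_sup (range (fun m => (fm m x)%:E)).
    apply/eqP; rewrite eq_le; apply/andP; split; last first.
      by apply: ge_ereal_sup => _ [m _ <-]; rewrite fmE ge_min lexx.
    have := f0 x; case E1 : (f x) => [r| |//] r0.
      apply: ereal_sup_ubound; exists (Num.bound `|r / phi x|) => //.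
      rewrite fmE E1; apply/min_idPl; rewrite lee_fin -ler_pdivrMr//.
      by rewrite (le_trans (ler_norm _))// ltW// archi_boundP.
    rewrite leye_eq; apply/eqP/eq_infty => r.
    apply: ereal_sup_ge; exists ((fm (Num.bound `|r / phi x|) x)%:E); first by exists (Num.bound `|r / phi x|).
    rewrite fmE E1 min_r ?leey// lee_fin -ler_pdivrMr//.
    by rewrite (le_trans (ler_norm _))// ltW// archi_boundP.
  rewrite fsup poweR_ereal_sup//; last 2 first.
  - by exists (fm 0 x)%:E, 0%N.
  - by move=> _ [m _ <-]; rewrite lee_fin.
  apply: ge_ereal_sup => _ [_ [m _ <-] <-].
  rewrite lee_pdivlMl//; apply: ereal_sup_ubound; exists m => //.
  by rewrite muleC.
- move=> n; apply/lee_addgt0Pr => e e0.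
  have := main n (e / (C + 1)) ltac:(by rewrite divr_gt0// addr_gt0).
  by rewrite [(C + 1) * _]mulrC divfK ?EFinD// gt_eqF// addr_gt0.
Qed.

End extrapolation.

(** * Dyadic cells *)

Section boxes.
Context {R : realType}.

Definition box n (a b : 'I_n -> R) : set 'rV[R]_n :=
  [set x | forall i, a i <= x ord0 i < b i].

Lemma measurable_box n (a b : 'I_n -> R) : measurable (box a b).
Proof.
rewrite (_ : box a b = \bigcap_(i in [set: 'I_n]) [set x | a i <= x ord0 i < b i]).
  apply: fin_bigcap_measurable => // i _.
  rewrite [X in measurable X](_ : _ = (fun x : 'rV[R]_n => x ord0 i) @^-1` `[a i, b i[%classic).
    by rewrite -[X in measurable X]setTI; exact: measurable_rV_coord.
  by apply/seteqP; split => x /=; rewrite in_itv.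
by apply/seteqP; split => x /= h i; [move=> _|]; exact: h.
Qed.

Lemma rV_cons0 n (x : R) (y : 'rV[R]_n) : rV_cons (x, y) ord0 ord0 = x.
Proof.
have -> : (ord0 : 'I_n.+1) = @lshift 1 n ord0 by apply/val_inj.
by rewrite /rV_cons (@row_mxEl R 1 1 n) mxE.
Qed.

Lemma rV_consS n (x : R) (y : 'rV[R]_n) i : rV_cons (x, y) ord0 (lift ord0 i) = y ord0 i.
Proof.
have -> : (lift ord0 i : 'I_n.+1) = @rshift 1 n i by apply/val_inj.
by rewrite /rV_cons (@row_mxEr R 1 1 n).
Qed.

Lemma ord_cases n (P : 'I_n.+1 -> Prop) :
  P ord0 -> (forall i, P (lift ord0 i)) -> forall i, P i.
Proof. by move=> P0 PS i; case: (unliftP ord0 i) => [j ->|->]. Qed.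

Lemma rV_cons_box n (a b : 'I_n.+1 -> R) (x : R) (y : 'rV[R]_n) :
  box a b (rV_cons (x, y)) <->
  a ord0 <= x < b ord0 /\ box (fun i => a (lift ord0 i)) (fun i => b (lift ord0 i)) y.
Proof.
split=> [h|[h0 hS]].
  by split=> [|i]; [have := h ord0; rewrite rV_cons0|have := h (lift ord0 i); rewrite rV_consS].
by apply: ord_cases => [|i]; rewrite ?rV_cons0 ?rV_consS//; exact: hS.
Qed.

Local Open Scope ereal_scope.

Lemma measurable_cons_pair n (F : 'rV[R]_n.+1 -> \bar R) : measurable_fun setT F ->
  measurable_fun setT (fun xy : measurableTypeR R * 'rV[R]_n => F (rV_cons xy)).
Proof. by move=> mF; apply: measurableT_comp mF _; exact: measurable_rV_cons. Qed.

Lemma measurable_cons n (F : 'rV[R]_n.+1 -> \bar R) y : measurable_fun setT F ->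
  measurable_fun setT (fun x : measurableTypeR R => F (rV_cons (x, y))).
Proof.
move=> mF; apply: (measurableT_comp (measurable_cons_pair mF)).
exact: measurable_pair2.
Qed.

Lemma lebesgue_rV_tonelli n (F : 'rV[R]_n.+1 -> \bar R) : measurable_fun setT F ->
  (forall z, 0 <= F z) ->
  \int[lebesgue_rV R n.+1]_z F z =
  \int[lebesgue_rV R n]_y \int[@lebesgue_measure R]_x F (rV_cons (x, y)).
Proof.
move=> mF F0.
transitivity (\int[(@lebesgue_measure R \x lebesgue_rV R n)]_z (F \o @rV_cons R n) z).
  pose phi : measurableTypeR R * 'rV[R]_n -> 'rV[R]_n.+1 := @rV_cons R n.
  have mphi : measurable_fun setT phi by exact: measurable_rV_cons.
  have F0' : {in [set: 'rV[R]_n.+1], forall y, 0 <= F y} by move=> z _; exact: F0.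
  have := ge0_integral_pushforward mphi (@lebesgue_measure R \x lebesgue_rV R n)%E
    measurableT mF F0'.
  rewrite preimage_setT => <-; exact: eq_measure_integral.
rewrite fubini_tonelli1//; [|exact: measurable_cons_pair|by move=> ?; exact: F0].
rewrite fubini_tonelli//; [exact: measurable_cons_pair|by move=> ?; exact: F0].
Qed.

Lemma measurable_tonelli n (F : 'rV[R]_n.+1 -> \bar R) : measurable_fun setT F ->
  (forall z, 0 <= F z) ->
  measurable_fun setT (fun y => \int[@lebesgue_measure R]_x F (rV_cons (x, y))).
Proof.
move=> mF F0; exact: (@measurable_fun_fubini_tonelli_G _ _ _ _ R (@lebesgue_measure R)
  (fun xy : measurableTypeR R * 'rV[R]_n => F (rV_cons xy)) (measurable_cons_pair mF)
  (fun _ => F0 _)).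
Qed.

Lemma lebesgue_rV_box n (a b : 'I_n -> R) : (forall i, a i <= b i)%R ->
  lebesgue_rV R n (box a b) = (\prod_(i < n) (b i - a i))%:E.
Proof.
elim: n a b => [|n ih] a b ab.
  by rewrite big_ord0 /= diracE mem_set// => -[].
rewrite -[LHS]mul1e -[LHS]integral_cst//; last exact: measurable_box.
rewrite int_indic lebesgue_rV_tonelli; last 2 first.
- by apply: measurable_funeM; apply/measurable_EFinP/measurable_indic; exact: measurable_box.
- by move=> z; rewrite mul1e lee_fin.
rewrite big_ord_recl EFinM -(ih _ _ (fun i => ab (lift ord0 i))) -integral_cst; last exact: measurable_box.
rewrite [RHS]int_indic; apply: eq_integral => y _.
transitivity (\int[@lebesgue_measure R]_x ((\1_(box (fun i => a (lift ord0 i)) (fun i => b (lift ord0 i))) y)%:E * (\1_`[a ord0, b ord0[%classic x)%:E)).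
  apply: eq_integral => x _; rewrite mul1e -EFinM; congr (_%:E).
  rewrite !indicE; have [|] := pselect (box a b (rV_cons (x, y))) => h.
    have [h1 h2] := (rV_cons_box a b x y).1 h.
    by rewrite !mem_set ?mulr1//= in_itv.
  rewrite memNset//; have [h2|h2] := pselect (box (fun i => a (lift ord0 i)) (fun i => b (lift ord0 i)) y).
    rewrite (_ : (x \in `[a ord0, b ord0[%classic) = false) ?mulr0//.
    apply/negP; rewrite inE/= in_itv/= => h1.
    by apply: h; apply/rV_cons_box.
  by rewrite memNset// mul0r.
rewrite intZl//; last exact/measurable_EFinP/measurable_indic.
have mE : @lebesgue_measure R `[a ord0, b ord0[%classic = (b ord0 - a ord0)%:E.
  rewrite lebesgue_measure_itv/= lte_fin.
  by case: ltP => // ba; congr (_%:E); have := ab ord0; lra.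
by rewrite [LHS]muleC; congr (_ * _); rewrite integral_indic// setIT.
Qed.

End boxes.

Section cells.
Context {R : realType}.
Variables (L : nat).

(** Side 1 gives the dyadic cubes, side 2N - 1 the cells that carry the wavelets, with the same
    indices. *)
Definition lcell n (v : int * 'rV[int]_n) : set 'rV[R]_n :=
  box (fun i => 2 ^ (- v.1) * (v.2 ord0 i)%:~R) (fun i => 2 ^ (- v.1) * (v.2 ord0 i + L%:Z)%:~R).

Definition lchild n (v : int * 'rV[int]_n) (e : {ffun 'I_n -> bool}) : int * 'rV[int]_n :=
  (v.1 + 1, \row_i (v.2 ord0 i *+ 2 + L%:Z * (e i : nat)%:Z)).

(** The parity of each coordinate of the index tells which half of its parent the cell is:
    subtracting the odd number L makes an odd coordinate even. *)
Definition lparent n (v : int * 'rV[int]_n) : int * 'rV[int]_n :=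
  (v.1 - 1, \row_i ((v.2 ord0 i - (if (v.2 ord0 i %% 2)%Z == 1 then L%:Z else 0)) %/ 2)%Z).

Definition lancestor n m (v : int * 'rV[int]_n) := iter m (@lparent n) v.

Hypothesis oddL : odd L.

Let L_gt0 : (0 < L)%N. Proof. by case: (L) oddL. Qed.

Lemma exp2z_gt0 (j : int) : 0 < (2 : R) ^ j. Proof. by rewrite exprz_gt0. Qed.

Lemma lcell_side n (v : int * 'rV[int]_n) (i : 'I_n) :
  2 ^ (- v.1) * (v.2 ord0 i + L%:Z)%:~R - 2 ^ (- v.1) * (v.2 ord0 i)%:~R = 2 ^ (- v.1) * L%:R :> R.
Proof. by rewrite -mulrBr -intrB addrAC subrr add0r. Qed.

Lemma lebesgue_lcell n (v : int * 'rV[int]_n) :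
  lebesgue_rV R n (lcell v) = ((2 ^ (- v.1) * L%:R) ^+ n)%:E.
Proof.
rewrite lebesgue_rV_box => [|i]; last first.
  by rewrite -subr_ge0 lcell_side mulr_ge0// ltW// exp2z_gt0.
by under eq_bigr do rewrite lcell_side; rewrite prodr_const card_ord.
Qed.

Lemma lcell_le n (v : int * 'rV[int]_n) (x : 'rV[R]_n) (i : 'I_n) : lcell v x ->
  (v.2 ord0 i)%:~R <= 2 ^ v.1 * x ord0 i < (v.2 ord0 i + L%:Z)%:~R.
Proof.
move=> /(_ i); rewrite -invr_expz mulrC ler_pdivrMr ?exp2z_gt0// mulrC => /andP[-> /=].
by rewrite -[X in _ < X]mulrC ltr_pdivlMr ?exp2z_gt0// mulrC.
Qed.

Lemma lcellP n (v : int * 'rV[int]_n) (x : 'rV[R]_n) :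
  (forall i : 'I_n, (v.2 ord0 i)%:~R <= 2 ^ v.1 * x ord0 i < (v.2 ord0 i + L%:Z)%:~R) -> lcell v x.
Proof.
move=> h i /=; move: (h i) => /andP[h1 h2]; rewrite -invr_expz; apply/andP; split.
  by rewrite mulrC ler_pdivrMr ?exp2z_gt0// mulrC.
by rewrite mulrC ltr_pdivlMr ?exp2z_gt0// mulrC.
Qed.

(** In each coordinate, [2k, 2k + 2L) is cut at 2k + L; the bit [e i] records the side. *)
Lemma lcell_children n (v : int * 'rV[int]_n) : lcell v = \bigcup_e lcell (lchild v e).
Proof.
have e1 : (2 : R) ^ (v.1 + 1) = 2 * 2 ^ v.1 by rewrite expfzDr// expr1z mulrC.
apply/seteqP; split => x.
  move=> xv; exists [ffun i => ((v.2 ord0 i *+ 2 + L%:Z)%:~R <= 2 * (2 ^ v.1 * x ord0 i))] => //.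
  apply: lcellP => i; rewrite /lchild/= mxE ffunE e1 -mulrA.
  have := lcell_le i xv; set y := 2 ^ v.1 * _; set k := v.2 ord0 i.
  rewrite !intrD => /andP[h1 h2].
  case: (leP (k%:~R + k%:~R + L%:Z%:~R) (2 * y)) => h.
    by rewrite mulr1; apply/andP; split => //; lra.
  by rewrite mulr0 mulr0z !addr0; apply/andP; split; lra.
move=> [e _ /lcell_le xe]; apply: lcellP => i.
have := xe i; rewrite /lchild/= mxE e1 -mulrA.
set y := 2 ^ v.1 * _; set k := v.2 ord0 i.
have L0 : 0 <= L%:Z%:~R :> R by rewrite ler0z.
by case: (e i); rewrite /= ?mulr1 ?mulr0 ?addr0 !intrD; move: L0;
  set l := (L%:~R : R); set z := (k%:~R : R) => L0 /andP[h1 h2]; apply/andP; split; lra.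
Qed.

Lemma lcell_disjoint n (v : int * 'rV[int]_n) :
  trivIset [set: {ffun 'I_n -> bool}] (fun e => lcell (lchild v e)).
Proof.
apply/trivIsetP => e e' _ _ /eqP ee'; apply/seteqP; split => // x [/lcell_le xe /lcell_le xe'].
apply: ee'; apply/ffunP => i; have := xe i; have := xe' i.
rewrite /lchild/= !mxE; move: (2 ^ _ * _) => y; move: (v.2 ord0 i) => k.
have L0 : 0 < L%:Z%:~R :> R by rewrite ltr0z.
case: (e i); case: (e' i) => //=; rewrite ?mulr1 ?mulr0 ?addr0 !intrD;
  move: L0; set l := (L%:~R : R); set z := (k%:~R : R) => L0 /andP[h1 h2] /andP[h3 h4]; lra.
Qed.

Lemma lparentK n (v : int * 'rV[int]_n) : exists e, lchild (lparent v) e = v.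
Proof.
case: v => j k; exists [ffun i => (k ord0 i %% 2)%Z == 1].
rewrite /lchild /lparent/=; congr (_, _); first by rewrite subrK.
apply/rowP => i; rewrite !mxE ffunE; move: (k ord0 i) => {}k.
by case: eqP => /= h; move: oddL h; lia.
Qed.

Lemma lancestor_level n m (v : int * 'rV[int]_n) : (lancestor m v).1 = v.1 - m%:Z.
Proof.
elim: m => [|m ih]; first by rewrite subr0.
by rewrite /lancestor iterS /= -/(lancestor m v) ih; lia.
Qed.

Lemma desc_mono n m m' (v u : int * 'rV[int]_n) : (m <= m')%N ->
  desc (@lchild n) m v u -> desc (@lchild n) m' v u.
Proof.
elim: m m' v => [|m ih] [|m'] v //=; first by move=> _; rewrite orbF => ->.
move=> mm' /orP[->//|/existsP[e h]]; apply/orP; right; apply/existsP; exists e.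
exact: ih h.
Qed.

Lemma desc_lancestor n m (v : int * 'rV[int]_n) : desc (@lchild n) m (lancestor m v) v.
Proof.
elim: m v => [|m ih] v /=; first by rewrite orbF.
apply/orP; right; apply/existsP.
have [e he] := lparentK (lancestor m v).
by exists e; rewrite he; exact: ih.
Qed.

(** At a fixed level the cells around [x] have indices floor(2^j x_i) - e_i with 0 <= e_i < L in
    each coordinate. *)
Lemma lcell_overlap n (j : int) (rs : seq (int * 'rV[int]_n)) (x : 'rV[R]_n) : uniq rs ->
  (forall v, v \in rs -> v.1 = j) ->
  \sum_(r <- rs) (\1_(lcell r) x : R) <= (L ^ n)%:R.
Proof.
move=> urs rsj.
have -> : \sum_(r <- rs) (\1_(lcell r) x : R) =
    (size [seq r <- rs | x \in lcell r])%:R.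
  rewrite size_filter -sum1_count natr_sum [RHS]big_mkcond/=.
  by apply: eq_bigr => r _; rewrite indicE; case: (x \in lcell r).
rewrite ler_nat.
pose f (e : {ffun 'I_n -> 'I_L}) : int * 'rV[int]_n :=
  (j, \row_i (Num.floor (2 ^ j * x ord0 i) - (e i : nat)%:Z)).
have <- : size [seq f e | e <- enum {ffun 'I_n -> 'I_L}] = (L ^ n)%N.
  by rewrite size_map -cardE card_ffun !card_ord.
apply: uniq_leq_size; first exact: filter_uniq.
move=> r; rewrite mem_filter => /andP[/set_mem/lcell_le xr /[dup] rrs /rsj rj].
have H i : 0 <= Num.floor (2 ^ j * x ord0 i) - r.2 ord0 i < L%:Z.
  have := xr i; rewrite rj => /andP[h1 h2].
  have f1 := floor_le_tmp (2 ^ j * x ord0 i).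
  have f2 := floorD1_gt (2 ^ j * x ord0 i).
  set fl := Num.floor _ in f1 f2 *.
  have : (r.2 ord0 i < fl + 1)%R by rewrite -(ltr_int R) (le_lt_trans h1).
  have : (fl < r.2 ord0 i + L%:Z)%R by rewrite -(ltr_int R) (le_lt_trans f1).
  by lia.
have Hlt i : (`|Num.floor (2 ^ j * x ord0 i) - r.2 ord0 i|%N < L)%N.
  by have := H i; lia.
apply/mapP; exists [ffun i => Ordinal (Hlt i)]; first by rewrite mem_enum.
rewrite /f; case: r rj H Hlt {xr rrs} => j' k /= -> H Hlt; congr (_, _).
apply/rowP => i; rewrite mxE ffunE/= gez0_abs ?subKr//.
by case/andP: (H i).
Qed.

(** Given finitely many cells with levels of modulus at most D, the roots are their ancestors at
    level -D. Being on one level they overlap at most L^n times, and depth D + D reaches all the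
    given cells. *)
Lemma forest_rV n : forest (lebesgue_rV R n) (@lcell n) (@lchild n) (L ^ n).
Proof.
split.
- by move=> v; exact: measurable_box.
- by move=> v; rewrite [X in (_ < X)%E](lebesgue_lcell v) lte_fin exprn_gt0// mulr_gt0 ?exp2z_gt0// ltr0n.
- by move=> v; rewrite [X in (X < _)%E](lebesgue_lcell v) ltry.
- exact: lcell_children.
- exact: lcell_disjoint.
- move=> s; pose D := \max_(v <- s) `|v.1|%N.
  pose m (v : int * 'rV[int]_n) := absz (v.1 + D%:Z).
  have leD v : v \in s -> (absz v.1 <= D)%N.
    by move=> vs; exact: (@leq_bigmax_seq _ s xpredT (fun v => absz v.1)).
  have mD v : v \in s -> (m v)%:Z = v.1 + D%:Z.
    by move=> /leD; rewrite /m; move: (v.1 : int) (D) => z e; lia.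
  exists (undup [seq lancestor (m v) v | v <- s]), (D + D)%N; split.
  + move=> v vs; exists (lancestor (m v) v); first by rewrite mem_undup; apply/mapP; exists v.
    apply: desc_mono (desc_lancestor (m v) v).
    by have := mD v vs; have := leD v vs; move: (m v) (v.1 : int) (D) => y z e; lia.
  + move=> x; apply: (@lcell_overlap n (- D%:Z)); first exact: undup_uniq.
    move=> v; rewrite mem_undup => /mapP[u us ->].
    by rewrite lancestor_level mD// opprD addrA subrr add0r.
- move=> x; exists (0, \row_i Num.floor (x ord0 i)); apply: lcellP => i /=.
  rewrite mxE expr0z mul1r floor_le_tmp/=.
  apply: lt_le_trans (floorD1_gt _) _; rewrite ler_int lerD2l; move: L_gt0; lia.
Qed.

End cells.

(** * Extrapolation to mixed norms *)

Section mixed_extrapolation.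
Context {R : realType}.
Variables (L : nat).
Hypothesis oddL : odd L.
Local Notation lam := (@lebesgue_measure R).
Local Notation rmuck n := (muckenhoupt (lebesgue_rV R n) (@lcell R L n)).
Local Notation rbound n := (@weighted_bound _ _ R (lebesgue_rV R n) _ (@lcell R L n)).
Local Open Scope ereal_scope.

Definition inner_norm n (p : R) (F : 'rV[R]_n.+1 -> \bar R) (y : 'rV[R]_n) : \bar R :=
  'N[lam]_(p%:E)[(fun x => F (rV_cons (x, y)))].

Lemma inner_norm_ge0 n (p : R) (F : 'rV[R]_n.+1 -> \bar R) y : 0 <= inner_norm p F y.
Proof. exact: Lnorm_ge0. Qed.

Lemma inner_normE n (p : R) (F : 'rV[R]_n.+1 -> \bar R) y : (0 < p)%R ->
  (forall z, 0 <= F z) ->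
  inner_norm p F y = (\int[lam]_x (F (rV_cons (x, y)) `^ p)) `^ p^-1.
Proof.
move=> p0 F0; rewrite /inner_norm unlock; congr (_ `^ _).
by apply: eq_integral => x _; rewrite gee0_abs.
Qed.

Lemma inner_norm_pow n (p : R) (F : 'rV[R]_n.+1 -> \bar R) y : (0 < p)%R ->
  (forall z, 0 <= F z) ->
  inner_norm p F y `^ p = \int[lam]_x (F (rV_cons (x, y)) `^ p).
Proof.
move=> p0 F0; rewrite inner_normE// ge0_poweRVK//.
by apply: integral_ge0 => x _; exact: poweR_ge0.
Qed.

Lemma measurable_inner_norm n (p : R) (F : 'rV[R]_n.+1 -> \bar R) : (0 < p)%R ->
  measurable_fun setT F -> (forall z, 0 <= F z) ->
  measurable_fun setT (inner_norm p F).
Proof.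
move=> p0 mF F0; rewrite (_ : inner_norm p F =
    fun y => (\int[lam]_x (F (rV_cons (x, y)) `^ p)) `^ p^-1); last first.
  by apply/funext => y; exact: inner_normE.
apply: emeasurable_poweR.
apply: (measurable_tonelli (F := fun z => F z `^ p)); first exact: emeasurable_poweR.
by move=> z; exact: poweR_ge0.
Qed.

Lemma mixed_normS n (p : 'I_n.+1 -> R) (F : 'rV[R]_n.+1 -> \bar R) :
  mixed_norm p F = mixed_norm (fun i => p (lift ord0 i)) (inner_norm (p ord0) F).
Proof. by []. Qed.

(** The weight extended to be constant in the first coordinate, the variable of the innermost
    norm. *)
Definition lift_fun n (w : 'rV[R]_n -> R) (z : 'rV[R]_n.+1) : R := w (rV_uncons z).2.

Lemma lift_fun_cons n (w : 'rV[R]_n -> R) x y : lift_fun w (rV_cons (x, y)) = w y.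
Proof. by rewrite /lift_fun rV_consK. Qed.

Lemma measurable_lift_fun n (w : 'rV[R]_n -> R) : measurable_fun setT w ->
  measurable_fun setT (lift_fun w).
Proof.
move=> mw; apply: (measurableT_comp mw).
exact: (measurableT_comp measurable_snd (@measurable_rV_uncons R n)).
Qed.

Let vtail n (v : int * 'rV[int]_n.+1) : int * 'rV[int]_n :=
  (v.1, \row_i v.2 ord0 (lift ord0 i)).

Let side (v : int) : R := (2 ^ (- v) * L%:R)%R.

Let side_gt0 v : (0 < side v)%R.
Proof.
by rewrite mulr_gt0 ?exp2z_gt0// ltr0n; case: (L) oddL.
Qed.

Lemma int_lift_fun n (w : 'rV[R]_n -> R) v : measurable_fun setT w -> (forall x, (0 <= w x)%R) ->
  \int[lebesgue_rV R n.+1]_(z in lcell L v) (lift_fun w z)%:E =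
  (side v.1)%:E * \int[lebesgue_rV R n]_(y in lcell L (vtail v)) (w y)%:E.
Proof.
move=> mw w0.
have mwE : measurable_fun setT (fun y : 'rV[R]_n => (w y)%:E) by exact/measurable_EFinP.
have mc k (u : int * 'rV[int]_k) : measurable (@lcell R L k u) by exact: measurable_box.
rewrite int_indic lebesgue_rV_tonelli; last 2 first.
- apply: emeasurable_funM; first by apply/measurable_EFinP; exact: measurable_lift_fun.
  by apply/measurable_EFinP; apply: measurable_indic; exact: mc.
- by move=> z; rewrite mule_ge0// lee_fin// w0.
rewrite -intZl ?(ltW (side_gt0 _))//; last exact: mc.
rewrite [RHS]int_indic.
apply: eq_integral => y _.
pose a : R := (2 ^ (- v.1) * (v.2 ord0 ord0)%:~R)%R.
pose b : R := (2 ^ (- v.1) * (v.2 ord0 ord0 + L%:Z)%:~R)%R.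
transitivity (\int[lam]_x (((w y)%:E * (\1_(lcell L (vtail v)) y)%:E) * (\1_`[a, b[%classic x)%:E)).
  apply: eq_integral => x _; rewrite lift_fun_cons -!EFinM -mulrA; congr (_ * _)%:E.
  rewrite !indicE; have tE : lcell L (vtail v) y <->
    box (fun i : 'I_n => 2 ^ (- v.1) * (v.2 ord0 (lift ord0 i))%:~R)%R
      (fun i : 'I_n => 2 ^ (- v.1) * (v.2 ord0 (lift ord0 i) + L%:Z)%:~R)%R y.
    by split => h i; have := h i; rewrite /= ?mxE.
  have cE := rV_cons_box (fun i => 2 ^ (- v.1) * (v.2 ord0 i)%:~R)%R
    (fun i => 2 ^ (- v.1) * (v.2 ord0 i + L%:Z)%:~R)%R x y.
  have [h|h] := pselect (lcell L v (rV_cons (x, y))).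
    have [h1 h2] := cE.1 h.
    by rewrite !mem_set ?mulr1//= ?in_itv//=; exact/tE.
  rewrite memNset//; have [h2|h2] := pselect (lcell L (vtail v) y); last first.
    by rewrite memNset// mul0r.
  rewrite (_ : (x \in `[a, b[%classic) = false) ?mulr0//.
  apply/negP; rewrite inE/= in_itv/= => h1.
  by apply: h; apply/cE; split => //; exact/tE.
have mE : lam `[a, b[%classic = (side v.1)%:E.
  rewrite lebesgue_measure_itv/= lte_fin -subr_gt0 -[X in (_ < X)%R]opprB.
  have -> : (a - b = - side v.1)%R.
    by rewrite -[LHS]opprB /a /b (lcell_side L v ord0).
  by rewrite opprK side_gt0; congr (_%:E); rewrite /a /b (lcell_side L v ord0).
rewrite ge0_integralZl//; last 2 first.
- by apply/measurable_EFinP; apply: measurable_indic.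
- by rewrite mule_ge0// lee_fin.
by rewrite muleC -muleA; congr (_ * _); rewrite integral_indic// setIT.
Qed.

Lemma vol_lift n v : vol (lebesgue_rV R n.+1) (@lcell R L n.+1) v =
  (side v.1 * vol (lebesgue_rV R n) (@lcell R L n) (vtail v))%R.
Proof.
by rewrite /vol [X in fine X = _](lebesgue_lcell L v)
  [X in (_ * fine X)%R](lebesgue_lcell L (vtail v)) /= exprS.
Qed.

Lemma weight_lift n (w : 'rV[R]_n -> R) :
  weight (lebesgue_rV R n) (@lcell R L n) w ->
  weight (lebesgue_rV R n.+1) (@lcell R L n.+1) (lift_fun w).
Proof.
move=> W; have w0 := weight_gt0 W; have mw := weight_measurable W; split.
- exact: measurable_lift_fun.
- by move=> z; exact: w0.
- move=> v; rewrite int_lift_fun//; last by move=> x; exact: ltW.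
  have [c [_ ->]] := weight_int (@forest_rV R L oddL n) (vtail v) W.
  by rewrite -EFinM ltry.
Qed.

(** The side length in the first coordinate is a factor of both the integral and the volume, so it
    cancels from every average. *)
Lemma muckenhoupt_lift n p K (w : 'rV[R]_n -> R) :
  rmuck n p K w -> rmuck n.+1 p K (lift_fun w).
Proof.
case=> K0 W W' AK.
have dE : dual_weight p (lift_fun w) = lift_fun (dual_weight p w) by [].
split => //; [exact: weight_lift|by rewrite dE; exact: weight_lift|].
move=> v; have := AK (vtail v); rewrite dE.
have wE (u : 'rV[R]_n -> R) : weight (lebesgue_rV R n) (@lcell R L n) u ->
    (wint (lebesgue_rV R n.+1) (@lcell R L n.+1) (lift_fun u) v /
    vol (lebesgue_rV R n.+1) (@lcell R L n.+1) v =
    wint (lebesgue_rV R n) (@lcell R L n) u (vtail v) /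
    vol (lebesgue_rV R n) (@lcell R L n) (vtail v))%R.
  move=> U; rewrite /wint int_lift_fun//; [|exact: weight_measurable U|
    by move=> x; exact/ltW/(weight_gt0 U)].
  have [c [_ ->]] := weight_int (@forest_rV R L oddL n) (vtail v) U.
  have V0 := vol_gt0 (@forest_rV R L oddL n) (vtail v).
  rewrite vol_lift -EFinM /=.
  by rewrite -mulf_div divff ?mul1r// gt_eqF.
by rewrite !wE.
Qed.

(** Induction on the dimension. Extrapolation moves the exponent to [p ord0]; restricted to weights
    constant in the first coordinate, the bound becomes, by Tonelli, a weighted bound between inner
    norms with exponent [p ord0]. These pairs of inner norms are the family for the next step. In
    dimension 0 the measure is a point mass and the weight 1 has A_p constant 1. *)
Theorem mixed_extrapolation n (p0 : R) (p : 'I_n -> R) FF :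
  (1 < p0)%R -> (forall i, (1 < p i)%R) -> nnpair FF -> rbound n FF p0 ->
  exists2 C : R, (0 < C)%R & forall f g, FF f g ->
    mixed_norm p f <= C%:E * mixed_norm p g.
Proof.
elim: n p0 p FF => [|n ih] p0 p FF p01 p1 FF0 WB.
  have p00 : (0 < p0)%R by rewrite (lt_trans _ p01).
  have F0 := @forest_rV R L oddL 0.
  have W1 := weight_cst1 F0.
  have dE : dual_weight p0 (cst 1%R : 'rV[R]_0 -> R) = cst 1%R.
    by apply/funext => x; rewrite /dual_weight powR1.
  have A1 : rmuck 0 p0 1 (cst 1%R).
    split => //; first by rewrite dE.
    move=> v; rewrite dE.
    have -> : wint (lebesgue_rV R 0) (@lcell R L 0) (cst 1%R) v =
        vol (lebesgue_rV R 0) (@lcell R L 0) v.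
      rewrite /wint /vol; congr fine.
      rewrite (_ : (fun x => (cst 1%R x)%:E) = cst 1)// integral_cst ?mul1e//.
      exact: measurable_box.
    have V0 := vol_gt0 F0 v.
    by rewrite divff ?powR1 ?mulr1// gt_eqF.
  have [C C0 CP] := WB 1%R; exists (C `^ p0^-1)%R; first by rewrite powR_gt0.
  move=> f g fg; have [mf mg f0 g0] := FF0 _ _ fg.
  have := CP f g fg _ A1.
  have dir (h : 'rV[R]_0 -> \bar R) : measurable_fun setT h ->
      \int[lebesgue_rV R 0]_x (h x `^ p0 * (cst 1%R x)%:E) = h 0%R `^ p0.
    move=> mh; under eq_integral do rewrite mule1.
    by rewrite integral_dirac//; [rewrite diracE mem_set// mul1e|exact: emeasurable_poweR].
  rewrite !dir//= ge0_poweR_le//; last by rewrite mule_ge0 ?poweR_ge0// lee_fin ltW.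
  rewrite !gee0_abs// => /le_trans; apply.
  by rewrite poweRM ?poweR_ge0 ?lee_fin ?(ltW C0)// ge0_poweRK.
have q1 := p1 ord0; have q0 : (0 < p ord0)%R by rewrite (lt_trans _ q1).
have WB' := extrapolation (@forest_rV R L oddL n.+1) p01 q1 FF0 WB.
pose FF' (f' g' : 'rV[R]_n -> \bar R) := exists f g, [/\ FF f g,
  f' = inner_norm (p ord0) f & g' = inner_norm (p ord0) g].
have FF'0 : nnpair FF'.
  move=> _ _ [f [g [fg -> ->]]]; have [mf mg f0 g0] := FF0 _ _ fg.
  by split; [exact: measurable_inner_norm|exact: measurable_inner_norm|
    move=> x; exact: inner_norm_ge0|move=> x; exact: inner_norm_ge0].
have WB'' : rbound n FF' (p ord0).
  move=> K; have [C C0 CP] := WB' K; exists C => // _ _ [f [g [fg -> ->]]] w AK.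
  have [mf mg f0 g0] := FF0 _ _ fg.
  have W := Ap_weight AK.
  have lE (h : 'rV[R]_n.+1 -> \bar R) : measurable_fun setT h -> (forall z, 0 <= h z) ->
      \int[lebesgue_rV R n]_y (inner_norm (p ord0) h y `^ p ord0 * (w y)%:E) =
      \int[lebesgue_rV R n.+1]_z (h z `^ p ord0 * (lift_fun w z)%:E).
    move=> mh h0; rewrite lebesgue_rV_tonelli; last 2 first.
    - apply: emeasurable_funM; first exact: emeasurable_poweR.
      by apply/measurable_EFinP; apply: measurable_lift_fun; exact: weight_measurable W.
    - move=> z; rewrite mule_ge0 ?poweR_ge0// lee_fin.
      exact/ltW/(weight_gt0 W).
    apply: eq_integral => y _; rewrite inner_norm_pow// muleC -intZl//.
    - by apply: eq_integral => x _; rewrite lift_fun_cons muleC.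
    - by apply: emeasurable_poweR; exact: measurable_cons.
    - by move=> x; exact: poweR_ge0.
    - exact/ltW/(weight_gt0 W).
  rewrite !lE//; apply: CP => //; exact: muckenhoupt_lift.
have [C C0 CP] := ih (p ord0) (fun i => p (lift ord0 i)) FF' q1 (fun i => p1 _) FF'0 WB''.
by exists C => // f g fg; rewrite !mixed_normS; apply: CP; exists f, g.
Qed.

End mixed_extrapolation.

(** * Integrals of real-valued functions *)

Section real_integrals.
Context d (T : measurableType d) (R : realType) (mu : {measure set T -> \bar R}).
Local Notation J f := (\int[mu]_x f x)%R.
Local Notation ii f := (mu.-integrable [set: T] (EFin \o f)).
Implicit Types f g phi : T -> R.

Lemma integrableDR f g : ii f -> ii g -> ii (fun x => f x + g x).
Proof. exact: integrableD. Qed.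

Lemma integrableBR f g : ii f -> ii g -> ii (fun x => f x - g x).
Proof. exact: integrableB. Qed.

Lemma integrableZR (k : R) f : ii f -> ii (fun x => k * f x).
Proof. exact: integrableZl. Qed.

Lemma integrable_measR f : ii f -> measurable_fun setT f.
Proof. by move=> /integrableP[/measurable_EFinP]. Qed.

Lemma integrable0R : ii (cst 0).
Proof. exact: integrable0. Qed.

Lemma integrable_sumR (I : Type) (s : seq I) (F : I -> T -> R) :
  (forall i, ii (F i)) -> ii (fun x => \sum_(i <- s) F i x).
Proof.
move=> iF; elim: s => [|i s ih].
  by under eq_fun do rewrite big_nil; exact: integrable0R.
by under eq_fun do rewrite big_cons; exact: integrableDR.
Qed.

Lemma Rintegral_sumR (I : Type) (s : seq I) (F : I -> T -> R) :
  (forall i, ii (F i)) -> J (fun x => \sum_(i <- s) F i x) = \sum_(i <- s) J (F i).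
Proof.
move=> iF; elim: s => [|i s ih].
  under eq_fun do rewrite big_nil; rewrite big_nil.
  by rewrite Rintegral_cst//= mul0r.
rewrite big_cons -ih; under eq_fun do rewrite big_cons.
by rewrite RintegralD//; exact: integrable_sumR.
Qed.

Lemma integrable_leR f g : measurable_fun setT f -> (forall x, `|f x| <= g x) ->
  ii g -> ii f.
Proof.
move=> mf fg ig; apply: (le_integrable _ _ _ ig) => //; first exact/measurable_EFinP.
by move=> x _ /=; rewrite lee_fin (le_trans (fg x))// ler_norm.
Qed.

Lemma integrable_normR f : ii f -> ii (fun x => `|f x|).
Proof. exact: integrable_norm. Qed.

Lemma integrable_mulR f phi B : ii f -> measurable_fun setT phi ->
  (forall x, `|phi x| <= B) -> ii (fun x => f x * phi x).
Proof.
move=> jf mphi phiB; apply: (@integrable_leR _ (fun x => B * `|f x|)).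
- by apply: measurable_funM => //; exact: integrable_measR.
- by move=> x; rewrite normrM mulrC ler_wpM2r.
- exact/integrableZR/integrable_normR.
Qed.

Lemma Rintegral_leR f g : ii f -> ii g -> (forall x, f x <= g x) -> J f <= J g.
Proof. by move=> jf jg fg; apply: le_Rintegral. Qed.

Lemma EFin_Rintegral f : ii f -> (J f)%:E = (\int[mu]_x (f x)%:E)%E.
Proof. by move=> jf; rewrite /Rintegral fineK//; exact: integrable_fin_num. Qed.

Lemma integrable_indicR A : measurable A -> (mu A < +oo)%E -> ii (\1_A : T -> R).
Proof.
move=> mA Ay; apply/integrableP; split; first by apply/measurable_EFinP; exact: measurable_indic.
under eq_integral => x _ do rewrite gee0_abs ?lee_fin//=.
by rewrite integral_indic// setIT.
Qed.

Lemma Rintegral_indicR A : measurable A -> J (\1_A : T -> R) = fine (mu A).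
Proof. by move=> mA; rewrite /Rintegral integral_indic// setIT. Qed.

Lemma sum_sqr_le (I : Type) (s : seq I) (a : I -> R) : (forall i, 0 <= a i) ->
  \sum_(i <- s) a i ^+ 2 <= (\sum_(i <- s) a i) ^+ 2.
Proof.
move=> a0; elim: s => [|i s ih]; first by rewrite !big_nil expr0n.
rewrite !big_cons sqrrD -addrA lerD2l (le_trans ih)// lerDr.
by rewrite mulrn_wge0// mulr_ge0// sumr_ge0.
Qed.

End real_integrals.

(** * Wavelet frames on a forest *)

Section wavelet_frame.
Context d (T : measurableType d) (R : realType)
  (mu : {measure set T -> \bar R}) (V : countType) (E : finType)
  (cell : V -> set T) (ch : V -> E -> V) (lev : V -> int)
  (Lam : finType) (h : Lam -> V -> T -> R) (K0 K1 : R).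
Local Notation J f := (\int[mu]_x f x)%R.
Local Notation ii f := (mu.-integrable [set: T] (EFin \o f)).
Local Notation vol := (vol mu cell).

Definition wcoef (g : T -> R) l v : R := J (fun x => g x * h l v x).

(** All that the stopping-time argument uses: L^2 normalised size, support in the cell, a Lipschitz
    bound at the scale of the cell ([wf_osc], used on finer cells), Bessel's inequality on bounded
    functions carried by a cell, and comparable volumes of parent and child. *)
Record wavelet_frame : Prop := WaveletFrame {
  wf_K0 : 0 <= K0 ;
  wf_K1 : 0 <= K1 ;
  wf_lev : forall v e, lev (ch v e) = lev v + 1 ;
  wf_vol : forall v e, vol v <= K1 * vol (ch v e) ;
  wf_measurable : forall l v, measurable_fun setT (h l v) ;
  wf_supp : forall l v x, ~ cell v x -> h l v x = 0 ;
  wf_bound : forall l v x, `|h l v x| <= K0 / Num.sqrt (vol v) ;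
  wf_osc : forall l v u x y, cell u x -> cell u y ->
    `|h l v x - h l v y| <= K0 / Num.sqrt (vol v) * 2 ^ (lev v - lev u) ;
  wf_bessel : forall (f : T -> R) B v (s : seq V), uniq s ->
    measurable_fun setT f -> (forall x, `|f x| <= B) ->
    (forall x, ~ cell v x -> f x = 0) ->
    \sum_(w <- s) \sum_l wcoef f l w ^+ 2 <= J (fun x => f x ^+ 2) }.

(** A child that satisfies [st] is pruned with everything below it, while the root is always kept.
    [xpred0] gives the full tree. *)
Fixpoint tree (st : pred V) D v : seq V :=
  v :: (if D is D'.+1 then
    flatten [seq tree st D' u | u <- [seq ch v e | e <- enum E] & ~~ st u] else [::]).

Lemma sum_treeS (st : pred V) D v (G : V -> R) :
  \sum_(w <- tree st D.+1 v) G w =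
  G v + \sum_e (if st (ch v e) then 0 else \sum_(w <- tree st D (ch v e)) G w).
Proof.
rewrite /= big_cons; congr (_ + _).
rewrite big_flatten big_map big_filter big_map big_enum_cond/=.
by rewrite big_mkcond/=; apply: eq_bigr => e _; case: (st _).
Qed.

Lemma desc_tree D v u : desc ch D v u -> u \in tree xpred0 D v.
Proof.
elim: D v => [|D ih] v /=; first by rewrite orbF inE eq_sym.
case/orP => [/eqP ->|/existsP[e /ih ue]]; first by rewrite mem_head.
rewrite inE; apply/orP; right; apply/flattenP; exists (tree xpred0 D (ch v e)) => //.
by apply/mapP; exists (ch v e) => //; rewrite filter_predT map_f// mem_enum.
Qed.

Variables (N0 : nat) (F : forest mu cell ch N0) (H : wavelet_frame).
Local Notation mcell := (forest_measurable F).

Let K0_ge0 := wf_K0 H.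
Let K1_ge0 := wf_K1 H.

Let v0 v : 0 < vol v. Proof. exact: (vol_gt0 F). Qed.

Let in_cell v x : cell v x -> \1_(cell v) x = 1 :> R.
Proof. by move=> vx; rewrite indicE mem_set. Qed.

Let out_cell v x : ~ cell v x -> \1_(cell v) x = 0 :> R.
Proof. by move=> vx; rewrite indicE memNset. Qed.

Lemma child_exists v x : cell v x -> exists e, cell (ch v e) x.
Proof. by rewrite (forest_children F) => -[e _ ?]; exists e. Qed.

Lemma child_out (f : E -> R) v x : ~ cell v x -> \sum_e \1_(cell (ch v e)) x * f e = 0.
Proof.
move=> vx; rewrite big1// => e _; rewrite out_cell ?mul0r// => ux.
by apply: vx; exact: (cell_child F ux).
Qed.

Lemma sum_child (f : R) v x : \sum_e \1_(cell (ch v e)) x * f = \1_(cell v) x * f.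
Proof.
have [vx|vx] := pselect (cell v x); last by rewrite child_out// out_cell// mul0r.
by have [e ux] := child_exists vx; rewrite (child_val F _ ux) in_cell// mul1r.
Qed.

Lemma tree_sub st D v w : w \in tree st D v -> cell w `<=` cell v.
Proof.
elim: D v => [|D ih] v /=; first by rewrite inE => /eqP ->.
rewrite inE => /orP[/eqP -> //|/flattenP[s /mapP[u]]].
rewrite mem_filter => /andP[_ /mapP[e _ ->]] -> /ih wu.
exact: subset_trans wu (cell_child F (v := v) (e := e)).
Qed.

Lemma tree_lev st D v w : w \in tree st D v -> lev v <= lev w.
Proof.
elim: D v => [|D ih] v /=; first by rewrite inE => /eqP ->.
rewrite inE => /orP[/eqP -> //|/flattenP[s /mapP[u]]].
rewrite mem_filter => /andP[_ /mapP[e _ ->]] -> /ih.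
by rewrite (wf_lev H) => /(le_trans _); apply; rewrite lerDl.
Qed.

Let cell_ex v : exists x, cell v x.
Proof.
have [//|n] := pselect (exists x, cell v x).
have := forest_gt0 F v; rewrite (_ : cell v = set0) ?measure0 ?ltxx//.
by apply/seteqP; split => // x vx; apply: n; exists x.
Qed.

Lemma child_inj v : injective (ch v).
Proof.
move=> e e' ee'; apply/eqP/negPn/negP => /eqP ne.
have [x xe] := cell_ex (ch v e).
have /trivIsetP/(_ e e' I I) := forest_disjoint F (v := v).
move=> /(_ (introN eqP ne)); rewrite -ee' setIid => c0.
by move: xe; rewrite c0.
Qed.

Lemma uniq_tree st D v : uniq (tree st D v).
Proof.
elim: D v => [//|D ih] v; rewrite /= -/(tree st).
apply/andP; split.
  apply/negP => /flattenP[s /mapP[u]].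
  rewrite mem_filter => /andP[_ /mapP[e _ ->]] -> /tree_lev.
  by rewrite (wf_lev H) gerDl.
set us := [seq u <- _ | _].
have uu : uniq us.
  by rewrite filter_uniq// map_inj_uniq ?enum_uniq//; exact: child_inj.
have uch u : u \in us -> exists e, u = ch v e.
  by rewrite mem_filter => /andP[_ /mapP[e _ ->]]; exists e.
elim: us uu uch => [//|u us ihu] /= /andP[unus uus] uch.
rewrite cat_uniq ih ihu//=; last by move=> w wus; apply: uch; rewrite inE wus orbT.
rewrite andbT; apply/hasPn => w /flattenP[s /mapP[u' u'us ->]] wu'.
apply/negP => /= wu.
have [e ue] := uch u (mem_head _ _).
have [e' ue'] : exists e, u' = ch v e by apply: uch; rewrite inE u'us orbT.
have ne : e' != e.
  by apply/eqP => ee'; move: unus; rewrite ue -ee' -ue' u'us.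
have [x wx] := cell_ex w.
have /trivIsetP/(_ e' e I I ne) := forest_disjoint F (v := v).
rewrite -ue -ue' => /seteqP[/(_ x) + _]; apply.
by split; [exact: tree_sub wu' _ wx|exact: tree_sub wu _ wx].
Qed.

Lemma int_tree (s : seq V) (q : V -> R) :
  ii (fun x => \sum_(w <- s) q w * \1_(cell w) x) /\
  J (fun x => \sum_(w <- s) q w * \1_(cell w) x) = \sum_(w <- s) q w * vol w.
Proof.
have iI w : ii (\1_(cell w) : T -> R).
  by apply: integrable_indicR; [exact: mcell|exact: forest_lty F w].
split; first by apply: integrable_sumR => w; exact: integrableZR.
rewrite Rintegral_sumR => [|w]; last exact: integrableZR.
apply: eq_bigr => w _; rewrite RintegralZl// Rintegral_indicR//; exact: mcell.
Qed.

Section local.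
Variable g : T -> R.
Hypothesis gloc : forall v, ii (fun x => g x * \1_(cell v) x).
Hypothesis mg : measurable_fun setT g.

Definition iabs v : R := J (fun x => `|g x| * \1_(cell v) x).
Definition avgabs v : R := iabs v / vol v.
Definition mean v : R := J (fun x => g x * \1_(cell v) x) / vol v.

Let iI v : ii (\1_(cell v) : T -> R).
Proof. by apply: integrable_indicR; [exact: mcell|exact: forest_lty F v]. Qed.

Lemma integrable_iabs v : ii (fun x => `|g x| * \1_(cell v) x).
Proof.
rewrite (_ : (fun _ => _) = (fun x => `|g x * \1_(cell v) x|)); first exact: integrable_normR.
by apply/funext => x; rewrite normrM [X in _ = _ * X]ger0_norm.
Qed.

Lemma iabs_ge0 v : 0 <= iabs v.
Proof. by apply: Rintegral_ge0 => x _; rewrite mulr_ge0. Qed.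

Lemma avgabs_ge0 v : 0 <= avgabs v.
Proof. by rewrite divr_ge0 ?iabs_ge0// ltW. Qed.

Lemma avgabsE v : avgabs v * vol v = iabs v.
Proof. by rewrite divfK// gt_eqF. Qed.

Lemma iabs_child v : \sum_e iabs (ch v e) = iabs v.
Proof.
rewrite -Rintegral_sumR => [|e]; last exact: integrable_iabs.
by congr Rintegral; apply/funext => x; under eq_bigr do rewrite mulrC; rewrite sum_child mulrC.
Qed.

Lemma normr_mean v : `|mean v| <= avgabs v.
Proof.
rewrite /mean normrM [X in _ * X]gtr0_norm ?invr_gt0// ler_wpM2r ?invr_ge0 ?(ltW (v0 _))//.
rewrite (le_trans (le_normr_Rintegral _ (gloc v)))//.
apply: Rintegral_leR; [exact/integrable_normR|exact: integrable_iabs|].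
by move=> x; rewrite normrM [X in _ * X]ger0_norm.
Qed.

Lemma mean_int v : `|mean v| * vol v <= iabs v.
Proof. by rewrite -avgabsE ler_wpM2r ?(ltW (v0 _))// normr_mean. Qed.

Lemma avgabs_child v e : avgabs (ch v e) <= K1 * avgabs v.
Proof.
have Ic : iabs (ch v e) <= iabs v.
  by rewrite -(iabs_child v) (bigD1 e)//= lerDl sumr_ge0// => e' _; exact: iabs_ge0.
rewrite /avgabs ler_pdivrMr// (le_trans Ic)//.
have := ler_wpM2l (divr_ge0 (iabs_ge0 v) (ltW (v0 v))) (wf_vol H v e).
rewrite divfK ?gt_eqF// => /le_trans; apply.
by rewrite mulrCA mulrA.
Qed.

Section stopping.
Variable lam : R.
Let stop u := lam < avgabs u.

(** The good part of the Calderon-Zygmund decomposition at height [lam]: means over the maximal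
    cells with average above [lam], and means over the cells at depth [D.+1] where no such cell was
    met. *)
Fixpoint good D v x : R :=
  \sum_e \1_(cell (ch v e)) x *
    (if D is D'.+1 then
       if stop (ch v e) then mean (ch v e) else good D' (ch v e) x
     else mean (ch v e)).

Let goodE D v e x : cell (ch v e) x -> good D v x =
  if D is D'.+1 then if stop (ch v e) then mean (ch v e) else good D' (ch v e) x
  else mean (ch v e).
Proof. by move=> ux; case: D => [|D] /=; rewrite (child_val F _ ux). Qed.

Let good_out D v x : ~ cell v x -> good D v x = 0.
Proof. by move=> vx; case: D => [|D] /=; rewrite child_out. Qed.

Lemma integrable_good D v : ii (good D v).
Proof.
elim: D v => [|D ih] v /=; apply: integrable_sumR => e.
  by under eq_fun do rewrite mulrC; exact: integrableZR.
case: (stop _); first by under eq_fun do rewrite mulrC; exact: integrableZR.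
under eq_fun do rewrite mulrC; apply: (@integrable_mulR _ _ _ _ _ _ 1) => //.
  by apply: measurable_indic; exact: mcell.
by move=> x; rewrite indicE; case: (_ \in _); rewrite ?normr1 ?normr0.
Qed.

(** A stopped cell is the child of a cell with average at most [lam], so its own average is at most
    [K1 * lam]. *)
Lemma good_le D v x : avgabs v <= lam -> `|good D v x| <= K1 * lam.
Proof.
move=> vl; have l0 : 0 <= lam by rewrite (le_trans (avgabs_ge0 v)).
have me e w : avgabs w <= lam -> `|mean (ch w e)| <= K1 * lam.
  move=> wl; rewrite (le_trans (normr_mean _))// (le_trans (avgabs_child _ _))//.
  by rewrite ler_wpM2l.
elim: D v vl => [|D ih] v vl; have [vx|vx] := pselect (cell v x);
  try by rewrite good_out// normr0 mulr_ge0.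
- by have [e ux] := child_exists vx; rewrite (goodE _ ux) me.
- have [e ux] := child_exists vx; rewrite (goodE _ ux).
  by case: ifPn => st; [exact: me|apply: ih; rewrite leNgt].
Qed.

Lemma int_good D v : J (fun x => `|good D v x|) <= iabs v.
Proof.
have mI e w : J (fun x => \1_(cell (ch w e)) x * `|mean (ch w e)|) <= iabs (ch w e).
  rewrite RintegralZr//; rewrite Rintegral_indicR; last exact: mcell.
  by rewrite mulrC; exact: mean_int.
have im e w : ii (fun x => \1_(cell (ch w e)) x * `|mean (ch w e)|).
  by under eq_fun do rewrite mulrC; exact: integrableZR.
elim: D v => [|D ih] v.
  rewrite (_ : (fun _ => _) = (fun x => \sum_e \1_(cell (ch v e)) x * `|mean (ch v e)|)).
    by rewrite Rintegral_sumR// -(iabs_child v) ler_sum.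
  apply/funext => x; have [vx|vx] := pselect (cell v x); last by rewrite good_out// normr0 child_out.
  by have [e ux] := child_exists vx; rewrite (goodE _ ux) (child_val F _ ux).
have ig e : ii (fun x => \1_(cell (ch v e)) x * `|good D (ch v e) x|).
  under eq_fun do rewrite mulrC; apply: (@integrable_mulR _ _ _ _ _ _ 1) => //.
  - exact/integrable_normR/integrable_good.
  - by apply: measurable_indic; exact: mcell.
  - by move=> x; rewrite indicE; case: (_ \in _); rewrite ?normr1 ?normr0.
rewrite (_ : (fun _ => _) = (fun x => \sum_e \1_(cell (ch v e)) x *
    (if stop (ch v e) then `|mean (ch v e)| else `|good D (ch v e) x|))); last first.
  apply/funext => x; have [vx|vx] := pselect (cell v x); last by rewrite good_out// normr0 child_out.
  by have [e ux] := child_exists vx; rewrite (goodE _ ux) (child_val F _ ux); case: ifP.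
rewrite Rintegral_sumR => [|e]; last by case: (stop _).
rewrite -(iabs_child v) ler_sum// => e _; case: (stop _) => //.
apply: le_trans (ih (ch v e)); apply: Rintegral_leR => //.
  exact/integrable_normR/integrable_good.
by move=> x; rewrite -[leRHS]mul1r ler_wpM2r// indicE; case: (_ \in _).
Qed.

Definition bad D v x : R := g x * \1_(cell v) x - good D v x.

Let bad_out D v x : ~ cell v x -> bad D v x = 0.
Proof. by move=> vx; rewrite /bad out_cell// good_out// mulr0 subrr. Qed.

Let badE D v e x : cell (ch v e) x -> bad D v x =
  if D is D'.+1 then if stop (ch v e) then g x - mean (ch v e) else bad D' (ch v e) x
  else g x - mean (ch v e).
Proof.
move=> ux; have vx := cell_child F ux.
by rewrite /bad (goodE _ ux) in_cell// mulr1; case: D => // D; case: ifP => // _; rewrite in_cell// mulr1.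
Qed.

Lemma integrable_bad D v : ii (bad D v).
Proof. by apply: integrableBR => //; exact: integrable_good. Qed.

(** A sum over the stopped and terminal cells [u] below [v]: 2^(-lev u) is the scale of [u], and
    [2 * iabs u] bounds the L^1 norm of the bad part on [u]. *)
Fixpoint bad_osc D v : R :=
  \sum_e (if D is D'.+1 then
    if stop (ch v e) then 2 ^ (- lev (ch v e)) * (2 * iabs (ch v e)) else bad_osc D' (ch v e)
    else 2 ^ (- lev (ch v e)) * (2 * iabs (ch v e))).

(** On each stopped or terminal cell the bad part has mean zero, so a value of [phi] in that cell
    may be subtracted; the oscillation bound then applies. *)
Lemma bad_pairing (phi : T -> R) B Kh D v : measurable_fun setT phi ->
  (forall x, `|phi x| <= B) -> 0 <= Kh ->
  (forall u x y, cell u x -> cell u y -> `|phi x - phi y| <= Kh * 2 ^ (- lev u)) ->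
  `|J (fun x => bad D v x * phi x)| <= Kh * bad_osc D v.
Proof.
move=> mphi phiB Kh0 osc.
have ig u : ii (fun x => (g x - mean u) * \1_(cell u) x).
  by under eq_fun do rewrite mulrBl; apply: integrableBR => //; exact: integrableZR.
have ip f : ii f -> ii (fun x => f x * phi x).
  by move=> jf; apply: (integrable_mulR jf mphi phiB).
have stopped u : `|J (fun x => (g x - mean u) * \1_(cell u) x * phi x)| <=
    Kh * (2 ^ (- lev u) * (2 * iabs u)).
  have [x0 ux0] := cell_ex u.
  have z0 : J (fun x => (g x - mean u) * \1_(cell u) x) = 0.
    under eq_Rintegral do rewrite mulrBl.
    rewrite RintegralB//; last exact: integrableZR.
    rewrite RintegralZl// Rintegral_indicR//; last exact: mcell.
    by rewrite -/(vol u) /mean divfK ?subrr// gt_eqF.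
  have -> : J (fun x => (g x - mean u) * \1_(cell u) x * phi x) =
      J (fun x => (g x - mean u) * \1_(cell u) x * (phi x - phi x0)).
    under [RHS]eq_Rintegral do rewrite mulrBr.
    rewrite RintegralB//; [|exact: ip|by under eq_fun do rewrite mulrC; exact: integrableZR].
    by rewrite RintegralZr// z0 mul0r subr0.
  have ip' : ii (fun x => (g x - mean u) * \1_(cell u) x * (phi x - phi x0)).
    under eq_fun do rewrite mulrBr; apply: integrableBR; first exact: ip.
    by under eq_fun do rewrite mulrC; exact: integrableZR.
  have iR : ii (fun x => Kh * 2 ^ (- lev u) * (`|g x| * \1_(cell u) x + `|mean u| * \1_(cell u) x)).
    by apply/integrableZR/integrableDR; [exact: integrable_iabs|exact: integrableZR].
  rewrite (le_trans (le_normr_Rintegral _ ip'))//.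
  apply: (@le_trans _ _ (J (fun x => Kh * 2 ^ (- lev u) * (`|g x| * \1_(cell u) x + `|mean u| * \1_(cell u) x)))).
    apply: Rintegral_leR => //; first exact: integrable_normR.
    move=> x; have [ux|ux] := pselect (cell u x); last by rewrite out_cell// !mulr0 mul0r normr0 addr0 mulr0.
    rewrite in_cell// !mulr1 normrM mulrC ler_pM// ?osc//.
    by rewrite (le_trans (ler_normB _ _)).
  rewrite RintegralZl//; last by apply: integrableDR; [exact: integrable_iabs|exact: integrableZR].
  rewrite RintegralD//; [|exact: integrable_iabs|exact: integrableZR].
  rewrite RintegralZl// Rintegral_indicR; last exact: mcell.
  rewrite mulrA ler_wpM2l// ?mulr_ge0// ?(ltW (exprz_gt0 _ _))//.
  by rewrite mulr_natl mulr2n lerD2l mean_int.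
elim: D v => [|D ih] v; rewrite /bad_osc -/bad_osc.
  rewrite (_ : (fun _ => _) = (fun x => \sum_e ((g x - mean (ch v e)) * \1_(cell (ch v e)) x * phi x))); last first.
    apply/funext => x; under eq_bigr do rewrite mulrAC mulrC.
    have [vx|vx] := pselect (cell v x); last by rewrite bad_out// mul0r child_out.
    by have [e ux] := child_exists vx; rewrite (child_val F _ ux) (badE _ ux).
  rewrite Rintegral_sumR => [|e]; last exact: ip.
  by rewrite (le_trans (ler_norm_sum _ _ _))// mulr_sumr ler_sum.
pose f e x := if stop (ch v e) then (g x - mean (ch v e)) * \1_(cell (ch v e)) x else bad D (ch v e) x.
have jf e : ii (f e) by rewrite /f; case: (stop _) => //; exact: integrable_bad.
rewrite (_ : (fun _ => _) = (fun x => \sum_e (f e x * phi x))); last first.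
  apply/funext => x; rewrite -mulr_suml; congr (_ * _).
  rewrite (_ : \sum_e f e x = \sum_e \1_(cell (ch v e)) x * f e x); last first.
    apply: eq_bigr => e _; have [ux|ux] := pselect (cell (ch v e) x).
      by rewrite in_cell// mul1r.
    by rewrite /f out_cell// mul0r mulr0; case: ifP => // _; rewrite bad_out.
  have [vx|vx] := pselect (cell v x); last by rewrite bad_out// child_out.
  have [e ux] := child_exists vx; rewrite (child_val F _ ux) (badE _ ux) /f.
  by rewrite in_cell// mulr1.
rewrite Rintegral_sumR => [|e]; last exact: ip.
rewrite (le_trans (ler_norm_sum _ _ _))// mulr_sumr ler_sum// => e _.
by rewrite /f; case: (stop _).
Qed.

(** The sum of 2^(lev w) [bad_osc] over the unpruned cells [w], with the depth that remains below
    each of them. *)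
Fixpoint bad_total D v : R :=
  2 ^ lev v * bad_osc D v +
  (if D is D'.+1 then \sum_e (if stop (ch v e) then 0 else bad_total D' (ch v e)) else 0).

(** A stopped cell is counted once for each cell above it, with a factor that halves with the level
    gap. The extra summand on the left makes the induction close: twice 2^(lev v) is 2^(lev u) for a
    child [u], exactly the extra summand of the child. *)
Lemma bad_total_le D v : bad_total D v + 2 ^ lev v * bad_osc D v <= 4 * iabs v.
Proof.
have e2 v' e : 2 ^ lev v' * 2 ^ (- lev (ch v' e)) = 2^-1 :> R.
  by rewrite -expfzDr// (wf_lev H) opprD addNKr -[RHS]exprN1.
elim: D v => [|D ih] v.
  rewrite /= addr0 -mulrDr -big_split/= -(iabs_child v) !mulr_sumr ler_sum// => e _.
  by have := iabs_ge0 (ch v e); rewrite mulrDr !mulrA e2; lra.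
rewrite /bad_total -/bad_total addrAC -mulrDr [bad_osc _ _]/= -big_split/= mulr_sumr -big_split/=.
rewrite -(iabs_child v) mulr_sumr ler_sum// => e _; case: (stop _).
  by have := iabs_ge0 (ch v e); rewrite addr0 mulrDr !mulrA e2; lra.
apply: le_trans (ih (ch v e)); rewrite addrC lerD2l.
by rewrite (wf_lev H) expfzDr// expr1z; lra.
Qed.

Lemma bad_osc_ge0 D v : 0 <= bad_osc D v.
Proof.
elim: D v => [|D ih] v /=; apply: sumr_ge0 => e _; try case: (stop _) => //;
  by rewrite !mulr_ge0 ?iabs_ge0// ltW// exprz_gt0.
Qed.

Lemma wcoef_eq (f f' : T -> R) l w : (forall x, cell w x -> f x = f' x) ->
  wcoef f l w = wcoef f' l w.
Proof.
move=> ff'; congr Rintegral; apply/funext => x.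
by have [/ff' -> //|wx] := pselect (cell w x); rewrite (wf_supp H)// !mulr0.
Qed.

(** Inside an unpruned cell the bad part of the whole tree is that of the subtree, so [bad_pairing]
    with the wavelet as [phi] bounds each coefficient by 2^(lev w) [bad_osc] up to normalisation. *)
Lemma sum_coef_bad D v :
  \sum_(w <- tree stop D v) \sum_l Num.sqrt (vol w) * `|wcoef (bad D v) l w| <=
  #|Lam|%:R * K0 * bad_total D v.
Proof.
have head D' u : \sum_l Num.sqrt (vol u) * `|wcoef (bad D' u) l u| <=
    #|Lam|%:R * K0 * (2 ^ lev u * bad_osc D' u).
  have s0 : 0 < Num.sqrt (vol u) by rewrite sqrtr_gt0.
  rewrite (le_trans (_ : _ <= \sum_(l : Lam) K0 * (2 ^ lev u * bad_osc D' u)))//; last first.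
    by rewrite sumr_const -[leRHS]mulrA mulr_natl; exact: lexx.
  apply: ler_sum => l _.
  have := @bad_pairing (h l u) (K0 / Num.sqrt (vol u)) (K0 / Num.sqrt (vol u) * 2 ^ lev u) D' u
    (wf_measurable H l u) (wf_bound H l u).
  have Kh0 : 0 <= K0 / Num.sqrt (vol u) * 2 ^ lev u.
    by rewrite mulr_ge0 ?divr_ge0 ?sqrtr_ge0// ltW// exprz_gt0.
  move=> /(_ Kh0).
  move=> hh; rewrite mulrC -ler_pdivlMr//; apply: le_trans (hh _) _.
    move=> u' x y ux uy; apply: le_trans (wf_osc H l u ux uy) _.
    by rewrite expfzDr// mulrA.
  by rewrite le_eqVlt; apply/orP; left; apply/eqP; field; rewrite gt_eqF.
elim: D v => [|D ih] v; first by rewrite /= big_seq1 addr0 head.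
rewrite sum_treeS /bad_total -/bad_total mulrDr lerD ?head// mulr_sumr ler_sum// => e _.
case: ifPn => st; first by rewrite mulr0.
apply: le_trans (ih (ch v e)); rewrite big_seq [leRHS]big_seq ler_sum// => w ww.
rewrite ler_sum// => l _; rewrite (@wcoef_eq _ (bad D (ch v e)))// => x wx.
by rewrite (badE _ (tree_sub ww wx)) (negbTE st).
Qed.

Fixpoint stopped D v x : R :=
  \sum_e \1_(cell (ch v e)) x *
    (if D is D'.+1 then if stop (ch v e) then 1 else stopped D' (ch v e) x else 0).

Let stopped_ge0 D v x : 0 <= stopped D v x.
Proof.
elim: D v => [|D ih] v /=; apply: sumr_ge0 => e _; rewrite mulr_ge0//.
by case: (stop _).
Qed.

(** Unless the path of cells through [x] meets a stopped cell, nothing on this path was pruned. *)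
Lemma stopped_cases (q : V -> R) D v x : cell v x -> 1 <= stopped D v x \/
  \sum_(w <- tree xpred0 D v) q w * \1_(cell w) x =
  \sum_(w <- tree stop D v) q w * \1_(cell w) x.
Proof.
elim: D v => [|D ih] v vx; first by right; rewrite !big_seq1.
have [e ux] := child_exists vx.
have tE st : \sum_(w <- tree st D.+1 v) q w * \1_(cell w) x =
    q v + (if st (ch v e) then 0 else \sum_(w <- tree st D (ch v e)) q w * \1_(cell w) x).
  rewrite sum_treeS in_cell// mulr1; congr (_ + _).
  rewrite -(child_val F (fun e => if st (ch v e) then 0 else
    \sum_(w <- tree st D (ch v e)) q w * \1_(cell w) x) ux).
  apply: eq_bigr => e' _; have [ux'|ux'] := pselect (cell (ch v e') x).
    by rewrite in_cell// mul1r.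
  rewrite out_cell// mul0r; case: ifP => // _; rewrite big_seq big1// => w ww.
  by rewrite out_cell ?mulr0// => wx; apply/ux'/(tree_sub ww).
rewrite !tE /= (child_val F _ ux); case: ifP => st; first by left.
by case: (ih _ ux) => [->|->]; [left|right].
Qed.

(** A stopped cell [u] has [lam * vol u < iabs u], and the stopped cells are disjoint and lie in
    [v]. *)
Lemma int_stopped D v : ii (stopped D v) /\ lam * J (stopped D v) <= iabs v.
Proof.
elim: D v => [|D ih] v.
  split; first by apply: integrable_sumR => e; under eq_fun do rewrite mulr0; exact: integrable0R.
  rewrite (_ : stopped 0 v = cst 0); last by apply/funext => x /=; rewrite big1// => e _; rewrite mulr0.
  by rewrite Rintegral_cst//= mul0r mulr0 iabs_ge0.
have jst e : ii (fun x => \1_(cell (ch v e)) x * (if stop (ch v e) then 1 else stopped D (ch v e) x)).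
  under eq_fun do rewrite mulrC.
  case: (stop _); first exact: integrableZR.
  apply: (@integrable_mulR _ _ _ _ _ _ 1) => //; first by have [] := ih (ch v e).
    by apply: measurable_indic; exact: mcell.
  by move=> x; rewrite indicE; case: (_ \in _); rewrite ?normr1 ?normr0.
split; first exact: integrable_sumR.
rewrite [stopped _ _]/= Rintegral_sumR// -(iabs_child v) mulr_sumr ler_sum// => e _.
move: (jst e); case st: (stop (ch v e)) => js.
  rewrite RintegralZr// mulr1 Rintegral_indicR//; last exact: mcell.
  by rewrite -avgabsE ler_wpM2r ?(ltW (v0 _))// ltW.
have [i1 i2] := ih (ch v e).
have [l0|l0] := leP 0 lam; last first.
  apply: (@le_trans _ _ 0); last exact: iabs_ge0.
  by rewrite nmulr_rle0// Rintegral_ge0// => x _; rewrite mulr_ge0.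
apply: le_trans i2; rewrite ler_wpM2l//; apply: Rintegral_leR => // x.
by rewrite -[leRHS]mul1r ler_wpM2r// indicE; case: (_ \in _).
Qed.

(** Bessel's inequality, and then one of the two factors of the square is bounded by [K1 * lam] and
    the other is integrated. *)
Lemma sum_coef_good D v : avgabs v <= lam ->
  \sum_(w <- tree stop D v) \sum_l wcoef (good D v) l w ^+ 2 <= K1 * lam * iabs v.
Proof.
move=> vl; have ig := integrable_good D v.
have l0 : 0 <= K1 * lam by rewrite mulr_ge0// (le_trans (avgabs_ge0 v)).
have gB x := good_le D x vl.
apply: le_trans (wf_bessel H _ _ gB _) _ => //.
- exact: uniq_tree.
- exact: integrable_measR ig.
- by move=> x; exact: good_out.
apply: (@le_trans _ _ (J (fun x => K1 * lam * `|good D v x|))); last first.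
  by rewrite RintegralZl ?ler_wpM2l ?int_good//; exact: integrable_normR.
have le2 x : good D v x ^+ 2 <= K1 * lam * `|good D v x|.
  by rewrite -real_normK ?num_real// expr2 ler_wpM2r.
apply: Rintegral_leR => //; last exact/integrableZR/integrable_normR.
apply: (integrable_leR _ _ (integrableZR (K1 * lam) (integrable_normR ig))) => [|x].
  by apply: measurable_funX; exact: integrable_measR ig.
by rewrite ger0_norm ?sqr_ge0.
Qed.

End stopping.

Lemma normr_wcoef l v : `|wcoef g l v| <= K0 / Num.sqrt (vol v) * iabs v.
Proof.
have -> : wcoef g l v = wcoef (fun x => g x * \1_(cell v) x) l v.
  by apply: wcoef_eq => x vx; rewrite in_cell// mulr1.
have ip := integrable_mulR (gloc v) (wf_measurable H l v) (wf_bound H l v).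
rewrite (le_trans (le_normr_Rintegral _ ip))// -RintegralZl//; last exact: integrable_iabs.
apply: Rintegral_leR; [exact: integrable_normR|exact/integrableZR/integrable_iabs|].
move=> x; rewrite !normrM mulrC [`|\1__ _|]ger0_norm//.
by rewrite ler_wpM2r ?mulr_ge0 ?wf_bound.
Qed.

(** The contribution of the cell to the square of the square function: dividing by the volume stands
    for the square of the L^2 normalised indicator. *)
Definition wsq w : R := (\sum_l wcoef g l w ^+ 2) / vol w.

Lemma wsq_ge0 w : 0 <= wsq w.
Proof. by rewrite divr_ge0 ?(ltW (v0 w))// sumr_ge0// => l _; exact: sqr_ge0. Qed.

Lemma wsq_le w : wsq w <= #|Lam|%:R * K0 ^+ 2 * avgabs w ^+ 2.
Proof.
rewrite /wsq ler_pdivrMr//.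
apply: (@le_trans _ _ (\sum_(l : Lam) (K0 / Num.sqrt (vol w) * iabs w) ^+ 2)).
  apply: ler_sum => l _; rewrite -real_normK ?num_real// lerXn2r ?nnegrE ?normr_wcoef//.
  by rewrite mulr_ge0 ?iabs_ge0// divr_ge0.
rewrite sumr_const -[leLHS]mulr_natl /avgabs !exprMn exprVn sqr_sqrtr ?(ltW (v0 w))//.
by rewrite le_eqVlt; apply/orP; left; apply/eqP; field; rewrite gt_eqF.
Qed.

Definition wtree D v x : R := \sum_(w <- tree xpred0 D v) wsq w * \1_(cell w) x.

(** The square of a sum is at most twice the sum of squares; for the bad part the l^2 norms over the
    wavelets and over the cells are moreover replaced by l^1 norms, which is what [sum_coef_bad]
    controls. *)
Lemma stopping_square lam st D v x : st = (fun u => lam < avgabs u) ->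
  \sum_(w <- tree st D v) wsq w * \1_(cell w) x <=
  2 * (\sum_(w <- tree st D v) (\sum_l wcoef (good lam D v) l w ^+ 2) / vol w * \1_(cell w) x) +
  2 * (\sum_(w <- tree st D v) (\sum_l `|wcoef (bad lam D v) l w|) / Num.sqrt (vol w) * \1_(cell w) x) ^+ 2.
Proof.
move=> stE; pose y w := (\sum_l `|wcoef (bad lam D v) l w|) / Num.sqrt (vol w).
have y0 w : 0 <= y w by rewrite divr_ge0// sumr_ge0.
have ip f l w : ii f -> ii (fun x => f x * h l w x).
  by move=> jf; apply: integrable_mulR jf (wf_measurable H l w) (wf_bound H l w).
have cE l w : w \in tree st D v ->
    wcoef g l w = wcoef (good lam D v) l w + wcoef (bad lam D v) l w.
  move=> ww; rewrite -RintegralD//; last 2 first.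
  - exact/ip/integrable_good.
  - exact/ip/integrable_bad.
  transitivity (wcoef (fun x => g x * \1_(cell v) x) l w).
    by apply: wcoef_eq => z wz; rewrite in_cell ?mulr1//; exact: tree_sub ww _ wz.
  by congr Rintegral; apply/funext => z; rewrite -mulrDl /bad addrC subrK.
apply: (@le_trans _ _ (2 * (\sum_(w <- tree st D v) (\sum_l wcoef (good lam D v) l w ^+ 2) / vol w * \1_(cell w) x) +
   2 * (\sum_(w <- tree st D v) (y w * \1_(cell w) x) ^+ 2))); last first.
  by rewrite lerD2l ler_pM2l// sum_sqr_le// => w; rewrite mulr_ge0.
rewrite !mulr_sumr -big_split/= big_seq [leRHS]big_seq ler_sum// => w ww.
have [wx|wx] := pselect (cell w x); last by rewrite out_cell// !mulr0 expr0n/= mulr0 addr0.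
rewrite in_cell// !mulr1 /y exprMn exprVn sqr_sqrtr ?(ltW (v0 w))// !mulrA -mulrDl.
rewrite ler_wpM2r ?invr_ge0 ?(ltW (v0 w))//.
apply: (@le_trans _ _ (\sum_l (2 * wcoef (good lam D v) l w ^+ 2 + 2 * `|wcoef (bad lam D v) l w| ^+ 2))).
  apply: ler_sum => l _; rewrite cE// real_normK ?num_real//.
  have := sqr_ge0 (wcoef (good lam D v) l w - wcoef (bad lam D v) l w).
  by rewrite sqrrB sqrrD; lra.
by rewrite big_split/= -!mulr_sumr lerD2l -mulrA -expr2 ler_pM2l// sum_sqr_le.
Qed.

(** The term with 256 makes the good part and the term with 64 the bad part each contribute at most
    one eighth in [weak_type]; the summand 1 ensures that the constant is at most its square. *)
Definition weak_const : R := 1 + 256 * K1 + 64 * (#|Lam|%:R * K0).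

(** Calderon-Zygmund decomposition at height 8 [al]. The stopped set has at most one eighth of the
    volume by the choice of height, and Chebyshev's inequality gives one eighth each for the good
    part (in L^2) and the bad part (in L^1). *)
Lemma weak_type D v (al : R) : 0 < al -> avgabs v <= al ->
  (mu [set x | cell v x /\ ((weak_const * al) ^+ 2 < wtree D v x)%R] <= (vol v / 2)%:E)%E.
Proof.
move=> al0 val; pose lam := 8 * al; pose st u := lam < avgabs u.
have L0 : 0 <= #|Lam|%:R * K0 :> R by rewrite mulr_ge0.
have k10 : 0 <= K1 by [].
have vlam : avgabs v <= lam by rewrite /lam; lra.
have lam0 : 0 < lam by rewrite /lam; lra.
have [A A0 AE] : exists2 a, 1 <= a & weak_const = a.
  by exists weak_const => //; rewrite /weak_const -addrA lerDl; apply: addr_ge0; apply: mulr_ge0 => //; exact: ler0n.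
have AK : 256 * K1 <= A.
  by rewrite -AE /weak_const -addrA addrCA lerDl; apply: addr_ge0; [exact: ler01|apply: mulr_ge0 => //; exact: ler0n].
have AL : 64 * (#|Lam|%:R * K0) <= A by rewrite -AE /weak_const lerDr; apply: addr_ge0; [exact: ler01|apply: mulr_ge0 => //; exact: ler0n].
rewrite AE.
pose qg w := (\sum_l wcoef (good lam D v) l w ^+ 2) / vol w.
pose yb w := (\sum_l `|wcoef (bad lam D v) l w|) / Num.sqrt (vol w).
pose tg x := \sum_(w <- tree st D v) qg w * \1_(cell w) x.
pose Y x := \sum_(w <- tree st D v) yb w * \1_(cell w) x.
have [itg Jtg] := int_tree (tree st D v) qg.
have [iY JY] := int_tree (tree st D v) yb.
have [iom Jom] := int_stopped lam D v.
have Jtg' : J tg <= K1 * lam * iabs v.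
  rewrite /tg Jtg; apply: le_trans (sum_coef_good D vlam).
  by rewrite le_eqVlt; apply/orP; left; apply/eqP/eq_bigr => w _; rewrite /qg divfK// gt_eqF.
have JY' : J Y <= #|Lam|%:R * K0 * (4 * iabs v).
  rewrite /Y JY; apply: le_trans (_ : _ <= #|Lam|%:R * K0 * bad_total lam D v) _.
    apply: le_trans (sum_coef_bad lam D v).
    rewrite le_eqVlt; apply/orP; left; apply/eqP/eq_bigr => w _.
    rewrite -mulr_sumr /yb -[X in _ * X = _](sqr_sqrtr (ltW (v0 w))).
    by field; rewrite gt_eqF// sqrtr_gt0.
  rewrite ler_wpM2l//; apply: le_trans (bad_total_le lam D v).
  by rewrite lerDl mulr_ge0 ?bad_osc_ge0// ltW// exprz_gt0.
have tg0 x : 0 <= tg x.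
  apply: sumr_ge0 => w _; rewrite mulr_ge0// divr_ge0 ?(ltW (v0 w))//.
  by apply: sumr_ge0 => l _; exact: sqr_ge0.
have Y0 x : 0 <= Y x by apply: sumr_ge0 => w _; rewrite mulr_ge0// divr_ge0// sumr_ge0.
have om0 x : 0 <= stopped lam D v x.
  move: (D) (v); elim=> [|D' ih] v' /=; apply: sumr_ge0 => e _; rewrite mulr_ge0//.
  by case: ifP.
have [iw _] := int_tree (tree xpred0 D v) wsq.
set B := [set x | _]; have mB : measurable B.
  rewrite (_ : B = cell v `&` (wtree D v @^-1` `](A * al) ^+ 2, +oo[)); last first.
    by apply/seteqP; split => x; rewrite /B/= in_itv/= andbT.
  apply: measurableI; first exact: mcell.
  by rewrite -[X in measurable X]setTI; apply: (integrable_measR iw).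
have Bfin : (mu B < +oo)%E.
  apply: le_lt_trans (forest_lty F v); apply: le_measure; rewrite ?inE//; first exact: mcell.
  by move=> x [].
rewrite -(fineK (x := mu B)) ?ge0_fin_numE// lee_fin -Rintegral_indicR//.
pose th := (A * al) ^+ 2.
have th0 : 0 < th by rewrite exprn_gt0// mulr_gt0//; lra.
have Aal0 : 0 < A * al by rewrite mulr_gt0//; lra.
have c1 : 0 <= 4 / th by rewrite divr_ge0// ltW.
have c2 : 0 <= 2 / (A * al) by rewrite divr_ge0// ltW.
(* At an exceptional point one of three things happens: the point is stopped, or the good sum is at
   least th / 4, or the bad sum is at least half the square root of th. The integrand is at least 1
   in each case. *)
apply: (@le_trans _ _ (J (fun x => stopped lam D v x + 4 / th * tg x + 2 / (A * al) * Y x))).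
  apply: Rintegral_leR; first exact: integrable_indicR.
    by apply: integrableDR; [apply: integrableDR => //|]; exact: integrableZR.
  move=> x; have pos : 0 <= 4 / th * tg x + 2 / (A * al) * Y x.
    by rewrite addr_ge0// mulr_ge0.
  rewrite indicE; case: (boolP (x \in B)) => [|_]; last by rewrite -addrA addr_ge0.
  rewrite inE => -[vx Bx]; rewrite -addrA -[(true : nat)%:R]/(1 : R).
  have [om1|tE] := stopped_cases lam wsq D vx; first by rewrite -[leLHS]addr0 lerD.
  rewrite (le_trans _ (_ : 4 / th * tg x + 2 / (A * al) * Y x <= _)) ?lerDr//.
  have := @stopping_square lam st D v x erefl; rewrite -tE => /(lt_le_trans Bx).
  rewrite -/(tg x) -/(Y x) -/th => hh.
  have [ht|ht] := leP (th / 4) (tg x).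
    apply: (@le_trans _ _ (4 / th * tg x)); last by rewrite lerDl mulr_ge0.
    by rewrite mulrAC ler_pdivlMr//; lra.
  have hY : (A * al / 2) ^+ 2 <= Y x ^+ 2 by rewrite expr_div_n -/th; lra.
  rewrite ler_pXn2r ?nnegrE ?divr_ge0 ?(ltW Aal0)// in hY.
  apply: (@le_trans _ _ (2 / (A * al) * Y x)); last by rewrite lerDr mulr_ge0.
  by rewrite mulrAC ler_pdivlMr//; lra.
rewrite !RintegralD//; [|exact: integrableZR|by apply: integrableDR => //; exact: integrableZR|exact: integrableZR].
rewrite !RintegralZl//.
have Iv : iabs v <= al * vol v by rewrite -avgabsE ler_wpM2r ?(ltW (v0 v)).
have b1 : J (stopped lam D v) <= vol v / 8.
  rewrite -(ler_pM2l lam0) (le_trans Jom)// (le_trans Iv)// /lam.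
  by rewrite le_eqVlt; apply/orP; left; apply/eqP; field.
have b2 : 4 / th * J tg <= vol v / 8.
  rewrite mulrAC ler_pdivrMr// (le_trans (_ : _ <= 4 * (K1 * lam * (al * vol v))))//.
    by rewrite ler_pM2l// (le_trans Jtg')// ler_wpM2l// mulr_ge0// ltW.
  have -> : 4 * (K1 * lam * (al * vol v)) = 256 * K1 * (vol v / 8 * al ^+ 2) by rewrite /lam; field.
  have -> : vol v / 8 * th = A * A * (vol v / 8 * al ^+ 2) by rewrite /th; ring.
  have p0 : 0 <= vol v / 8 * al ^+ 2.
    by apply: mulr_ge0; [rewrite divr_ge0 ?(ltW (v0 v))|exact: sqr_ge0].
  rewrite ler_wpM2r//.
  by rewrite (le_trans AK)// ler_peMl//; lra.
have b3 : 2 / (A * al) * J Y <= vol v / 8.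
  rewrite mulrAC ler_pdivrMr// (le_trans (_ : _ <= 2 * (#|Lam|%:R * K0 * (4 * (al * vol v)))))//.
    by rewrite ler_pM2l// (le_trans JY')// ler_wpM2l// ler_pM2l.
  have -> : 2 * (#|Lam|%:R * K0 * (4 * (al * vol v))) = 64 * (#|Lam|%:R * K0) * (vol v / 8 * al) by field.
  have -> : vol v / 8 * (A * al) = A * (vol v / 8 * al) by ring.
  by rewrite ler_wpM2r// mulr_ge0 ?(ltW al0)// divr_ge0 ?(ltW (v0 v)).
by have := v0 v; move: b1 b2 b3; set j1 := J _; set j2 := _ * J _; set j3 := _ * J _; lra.
Qed.

End local.
End wavelet_frame.

(** * The weighted L^2 bound for the square function *)

Section esum_helpers.
Context {R : realType}.
Local Open Scope ereal_scope.

Lemma esum_le_seq (I : choiceType) (a : I -> \bar R) (B : \bar R) :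
  (forall s : seq I, uniq s -> \sum_(i <- s) a i <= B) ->
  \esum_(i in [set: I]) a i <= B.
Proof.
move=> aB; apply: ge_ereal_sup => _ [X [finX _] <-].
by rewrite fsbig_finite//=; apply: aB; exact: finmap.fset_uniq.
Qed.

Lemma esumZl (I : countType) (a : I -> \bar R) (c : R) : (0 <= c)%R ->
  (forall i, 0 <= a i) ->
  \esum_(i in [set: I]) (c%:E * a i) = c%:E * \esum_(i in [set: I]) a i.
Proof.
move=> c0 a0; rewrite !esum_count_term// => [|i]; last by rewrite mule_ge0.
rewrite -nneseriesZl//; last by move=> n _; exact: count_term_ge0.
by apply: eq_eseriesr => n _; rewrite /count_term; case: pickle_inv => //; rewrite mule0.
Qed.

End esum_helpers.

Section weighted_wavelets.
Context d (T : measurableType d) (R : realType)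
  (mu : {measure set T -> \bar R}) (V : countType) (E : finType)
  (cell : V -> set T) (ch : V -> E -> V) (lev : V -> int)
  (Lam : finType) (h : Lam -> V -> T -> R) (K0 K1 : R).
Variables (N0 : nat) (F : forest mu cell ch N0) (H : wavelet_frame mu cell ch lev h K0 K1).
Local Notation mcell := (forest_measurable F).
Local Notation ii f := (mu.-integrable [set: T] (EFin \o f)).
Local Notation volu := (vol mu cell).
Local Notation wtree := (wtree mu cell ch h).
Local Notation wsq := (wsq mu cell h).
Local Notation wc := (weak_const Lam K0 K1).
Local Open Scope ereal_scope.

Definition wsquare (g : T -> R) (x : T) : \bar R :=
  \esum_(w in [set: V]) (wsq g w * \1_(cell w) x)%:E.

Let wsqt_ge0 g w x : (0 <= (wsq g w * \1_(cell w) x)%R%:E).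
Proof. by rewrite lee_fin mulr_ge0// (wsq_ge0 h F). Qed.

Let mwsqt g w : measurable_fun setT (fun x => (wsq g w * \1_(cell w) x)%:E).
Proof.
apply/measurable_EFinP; apply: measurable_funM => //.
by apply: measurable_indic; exact: mcell.
Qed.

Lemma measurable_wsquare g : measurable_fun setT (wsquare g).
Proof. by apply: measurable_esum_count. Qed.

Lemma wsquare_ge0 g x : 0 <= wsquare g x.
Proof. exact: esum_ge0. Qed.

Section one_weight.
Variables (g : T -> R) (K : R) (W : T -> R).
Hypotheses (mg : measurable_fun setT g) (AK : muckenhoupt mu cell 2 K W).
Hypothesis gloc : forall v, ii (fun x => (g x * \1_(cell v) x)%R).

Let mW := weight_measurable (Ap_weight AK).
Let W0 x : (0 < W x)%R := weight_gt0 (Ap_weight AK) x.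
Let mWE : measurable_fun setT (fun x => (W x)%:E).
Proof. exact/measurable_EFinP. Qed.

Let M x := wmax mu cell (cst 1%R) (fun x => `|g x|%:E) x `^ 2.
Let mM : measurable_fun setT M.
Proof. by apply: emeasurable_poweR; exact: measurable_cmax F _. Qed.

Let MW x := M x * (W x)%:E.
Let mMW : measurable_fun setT MW. Proof. exact: emeasurable_funM. Qed.
Let MW0 x : 0 <= MW x.
Proof. by rewrite mule_ge0 ?poweR_ge0// lee_fin ltW. Qed.

Let wt D v x := (wtree g D v x * W x)%:E.

Let wtree_ge0 D v x : (0 <= wtree g D v x)%R.
Proof. by apply: sumr_ge0 => w _; rewrite mulr_ge0// (wsq_ge0 h F). Qed.

Let mwtree D v : measurable_fun setT (wtree g D v).
Proof.
have [iw _] := int_tree F (tree ch xpred0 D v) (wsq g).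
exact: integrable_measR iw.
Qed.

Let wtreeS D v e x : cell (ch v e) x ->
  wtree g D.+1 v x = (wsq g v + wtree g D (ch v e) x)%R.
Proof.
move=> ux; have vx : cell v x := cell_child F ux.
rewrite /wtree sum_treeS indicE mem_set// mulr1; congr (_ + _)%R.
rewrite -(child_val F (fun e => \sum_(w <- tree ch xpred0 D (ch v e)) wsq g w * \1_(cell w) x)%R ux).
apply: eq_bigr => e' _; have [ux'|ux'] := pselect (cell (ch v e') x).
  by rewrite indicE mem_set// mul1r.
rewrite [\1_(cell (ch v e')) x]indicE memNset// mul0r big_seq big1// => w ww.
by rewrite indicE memNset ?mulr0// => wx; apply/ux'/(tree_sub F ww).
Qed.

Let wtree0 v x : cell v x -> wtree g 0 v x = wsq g v.
Proof. by move=> vx; rewrite /wtree big_seq1 indicE mem_set// mulr1. Qed.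

Let wtree_root D v x : cell v x -> (wsq g v <= wtree g D v x)%R.
Proof.
move=> vx; case: D => [|D]; first by rewrite wtree0.
by have [e ux] := child_exists F vx; rewrite (wtreeS D ux) lerDl.
Qed.

Let wtree_out D v x : ~ cell v x -> wtree g D v x = 0%R.
Proof.
move=> vx; rewrite /wtree big_seq big1// => w ww.
by rewrite indicE memNset ?mulr0// => wx; apply/vx/(tree_sub F ww).
Qed.

Let intW v : \int[mu]_(x in cell v) (W x)%:E = (wint mu cell W v)%:E.
Proof. exact: (wintE F v (Ap_weight AK)). Qed.

Let mbw D v (c : R) : measurable_fun setT (fun x => ((c + wtree g D v x) * W x)%:E).
Proof. by apply/measurable_EFinP/measurable_funM => //; exact: measurable_funD. Qed.

Let bw_ge0 D v (c : R) x : (0 <= c)%R -> 0 <= ((c + wtree g D v x) * W x)%:E.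
Proof. by move=> c0; rewrite lee_fin mulr_ge0 ?addr_ge0// ltW. Qed.

Let int_cW v (c : R) : (0 <= c)%R ->
  \int[mu]_(x in cell v) (c * W x)%:E = (c * wint mu cell W v)%:E.
Proof.
move=> c0; under eq_integral do rewrite EFinM.
rewrite intZl// ?intW//; first exact: mcell.
by move=> x; rewrite lee_fin ltW.
Qed.

(** The threshold is passed at [v] itself, hence on the whole cell: [b] is paid by [th] and the tree
    below by its own estimate. *)
Let level_big C0 th D v b : (0 <= C0)%R -> (0 <= b)%R -> (b <= th)%R ->
  (th < b + wsq g v)%R ->
  \int[mu]_(x in cell v) wt D v x <= C0%:E * \int[mu]_(x in cell v) MW x ->
  \int[mu]_(x in cell v) ((b + wtree g D v x) * W x)%:E <=
  (th * wint mu cell W v)%:E +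
  C0%:E * \int[mu]_(x in cell v `&` [set x | (th < b + wtree g D v x)%R]) MW x.
Proof.
move=> C00 b0 bth big hD; rewrite (_ : cell v `&` _ = cell v); last first.
  apply/seteqP; split => [x []//|x vx]; split => //=.
  by rewrite (lt_le_trans big)// lerD2l wtree_root.
under eq_integral do rewrite mulrDl EFinD.
rewrite intD//; last 5 first.
- exact: mcell.
- by apply/measurable_EFinP/measurable_funM.
- by apply/measurable_EFinP/measurable_funM.
- by move=> x; rewrite lee_fin mulr_ge0// ltW.
- by move=> x; rewrite lee_fin mulr_ge0// ltW.
rewrite leeD// int_cW// lee_fin ler_wpM2r// ltW// (wint_gt0 F)//.
exact: Ap_weight AK.
Qed.

(** The partial sum [b] of the square function is followed down the tree. On the maximal cells where
    it passes [th], the estimate already known for shallower trees is used; elsewhere the sum stays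
    below [th]. The disjunction exempts the root, whose tree has no known estimate yet but whose own
    term lies below the threshold. *)
Let level_est C0 th D v b : (0 <= C0)%R -> (0 <= b)%R -> (b <= th)%R ->
  (forall D', (D' < D)%N -> forall u,
     \int[mu]_(x in cell u) wt D' u x <= C0%:E * \int[mu]_(x in cell u) MW x) ->
  (b + wsq g v <= th)%R \/
     \int[mu]_(x in cell v) wt D v x <= C0%:E * \int[mu]_(x in cell v) MW x ->
  \int[mu]_(x in cell v) ((b + wtree g D v x) * W x)%:E <=
  (th * wint mu cell W v)%:E +
  C0%:E * \int[mu]_(x in cell v `&` [set x | (th < b + wtree g D v x)%R]) MW x.
Proof.
move=> C00; elim: D v b => [|D ih] v b b0 bth P hv.
  have [small|big] := leP (b + wsq g v)%R th; last first.
    by apply: level_big => //; case: hv => // hv; move: big; rewrite ltNge hv.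
  apply: (@le_trans _ _ (th * wint mu cell W v)%:E); last first.
    by rewrite leeDl// mule_ge0 ?lee_fin// integral_ge0.
  rewrite -int_cW//; last by rewrite (le_trans b0).
  apply: le_int => //; first exact: mcell.
  - by apply/measurable_EFinP/measurable_funM.
  - by move=> x; exact: bw_ge0.
  - by move=> x vx; rewrite lee_fin ler_wpM2r ?(ltW (W0 x))// wtree0.
have [small|big] := leP (b + wsq g v)%R th; last first.
  by apply: level_big => //; case: hv => // hv; move: big; rewrite ltNge hv.
have q0 : (0 <= b + wsq g v)%R by rewrite addr_ge0// (wsq_ge0 h F).
have chE (e : E) (x : T) : cell (ch v e) x ->
    (b + wtree g D.+1 v x = (b + wsq g v) + wtree g D (ch v e) x)%R.
  by move=> ux; rewrite (wtreeS _ ux) addrA.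
rewrite (ge0_integral_children F) //; last 2 first.
- exact: measurable_funTS.
- by move=> x _; exact: bw_ge0.
have -> : \int[mu]_(x in cell v `&` [set x | (th < b + wtree g D.+1 v x)%R]) MW x =
    \sum_e \int[mu]_(x in cell (ch v e) `&`
      [set x | (th < (b + wsq g v) + wtree g D (ch v e) x)%R]) MW x.
  rewrite setIC integral_mkcondl (ge0_integral_children F) //; last 2 first.
  - apply: measurable_funTS; apply/(measurable_restrictT _ _).1.
    + rewrite [X in measurable X](_ : _ = (fun x => b + wtree g D.+1 v x)%R @^-1` `]th, +oo[).
        rewrite -[X in measurable X]setTI.
        by apply: measurable_funD => //; exact: mwtree.
      by apply/seteqP; split => x; rewrite /= in_itv/= andbT.
    + exact: measurable_funTS.
  - by move=> x _; rewrite /patch; case: ifP.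
  apply: eq_bigr => e _; rewrite [in RHS]setIC [RHS]integral_mkcondl.
  apply: eq_integral => x; rewrite inE => ux; rewrite /patch.
  by congr (if _ then _ else _); apply/idP/idP; rewrite !inE/= (chE _ _ ux).
apply: (@le_trans _ _ (\sum_e ((th * wint mu cell W (ch v e))%:E +
  C0%:E * \int[mu]_(x in cell (ch v e) `&`
      [set x | (th < (b + wsq g v) + wtree g D (ch v e) x)%R]) MW x))).
  apply: lee_sum => e _; apply: le_trans (ih (ch v e) (b + wsq g v)%R _ _ _ _) => //.
  - apply: le_int; first exact: mcell.
    + exact: mbw.
    + exact: mbw.
    + by move=> x; exact: bw_ge0.
    + by move=> x ux; rewrite (chE _ _ ux).
  - by move=> D' D'D; apply: P; rewrite ltnW.
  - by right; apply: P.
rewrite big_split/= leeD//; last first.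
  by rewrite ge0_sume_distrr// => e _; exact: integral_ge0.
rewrite -int_cW ?(le_trans b0)// (ge0_integral_children F) //; last 2 first.
- by apply/measurable_EFinP; apply: measurable_funTS; exact: measurable_funM.
- by move=> x _; rewrite lee_fin; exact: mulr_ge0 (le_trans b0 bth) (ltW (W0 x)).
by apply: lee_sum => e _; rewrite int_cW// (le_trans b0).
Qed.

Let iabs_mono u v : cell u `<=` cell v -> (iabs mu cell g u <= iabs mu cell g v)%R.
Proof.
move=> uv; apply: Rintegral_leR; [exact: integrable_iabs|exact: integrable_iabs|].
move=> x; rewrite ler_wpM2l// !indicE ler_nat.
have [ux|ux] := pselect (cell u x); first by rewrite !mem_set//; exact: uv.
by rewrite memNset.
Qed.

Let avg_M v x : cell v x -> (avgabs mu cell g v ^+ 2)%:E <= M x.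
Proof.
move=> vx; apply: (@le_trans _ _ ((avgabs mu cell g v)%:E `^ 2)).
  by rewrite poweR_EFin powR_mulrn// (avgabs_ge0 F g).
rewrite ge0_ler_poweR//.
  by rewrite lee_fin (avgabs_ge0 F g).
have h1 : wavg mu cell (cst 1%R) (fun y => `|g y|%:E) v <= wmax mu cell (cst 1%R) (fun y => `|g y|%:E) x.
  exact: wmax_ge.
apply: le_trans h1.
rewrite (cavgE F) /avgabs mulrC EFinM /iabs EFin_Rintegral; last exact: integrable_iabs.
by rewrite [X in _ <= _ * X]int_indic; under eq_integral do rewrite EFinM.
Qed.

(** An A_2 weight gives a fixed share of its mass to a set of half the volume. The Cauchy-Schwarz
    inequality between the weight and its inverse is replaced by 1 <= s W + 1 / (4 s W) with s the
    average of the inverse weight. *)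
Let big_part v (B : set T) : measurable B -> B `<=` cell v ->
  mu B <= (volu v / 2)%:E ->
  (wint mu cell W v)%:E <= (4 * K)%:E * \int[mu]_(x in cell v `\` B) (W x)%:E.
Proof.
move=> mB Bv muB.
have v0 := vol_gt0 F v.
have mv : measurable (cell v) := mcell v.
have mU : measurable (cell v `\` B) by exact: measurableD.
have Wd := Ap_dual AK.
have dE x : dual_weight 2 W x = (W x)^-1%R.
  by rewrite /dual_weight (_ : 2 - 1 = 1 :> R)%R ?invr1 ?powR_inv1 ?(ltW (W0 x))//; lra.
have s0 := wint_gt0 F v Wd.
set sg := wint mu cell (dual_weight 2 W) v in s0 *.
have w0 := wint_gt0 F v (Ap_weight AK).
have AB : (wint mu cell W v * sg <= K * volu v ^+ 2)%R.
  have := Ap_bound AK v; rewrite (_ : 2 - 1 = 1 :> R)%R; last by lra.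
  rewrite powRr1 ?divr_ge0 ?(ltW s0) ?(ltW v0)// -/sg mulf_div -expr2.
  by rewrite ler_pdivrMr ?exprn_gt0.
have Uy : (\int[mu]_(x in cell v `\` B) (W x)%:E < +oo).
  apply: le_lt_trans (weight_lty (Ap_weight AK) v).
  apply: ge0_subset_integral => //; first by apply: measurable_funTS.
  by move=> x _; rewrite lee_fin ltW.
have U0 : (0 <= \int[mu]_(x in cell v `\` B) (W x)%:E).
  by apply: integral_ge0 => x _; rewrite lee_fin ltW.
have [u u0 uE] : exists2 u, (0 <= u)%R & \int[mu]_(x in cell v `\` B) (W x)%:E = u%:E.
  by exists (fine (\int[mu]_(x in cell v `\` B) (W x)%:E)); [exact: fine_ge0|rewrite fineK// ge0_fin_numE].
rewrite uE -EFinM lee_fin.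
pose s := (sg / volu v)%R.
have ss0 : (0 < s)%R by rewrite divr_gt0.
have mdual : measurable_fun setT (fun x => (dual_weight 2 W x)%:E).
  by apply/measurable_EFinP; exact: weight_measurable Wd.
have muU : (volu v / 2 <= s * u + s^-1 * sg / 4)%R.
  rewrite -lee_fin; apply: (@le_trans _ _ (mu (cell v `\` B))).
    have -> : mu (cell v `\` B) = mu (cell v) - mu B.
      by rewrite measureD ?(setIidr Bv)//; exact: forest_lty F v.
    rewrite (volE F); apply: (@le_trans _ _ ((volu v)%:E - (volu v / 2)%:E)).
      by rewrite -EFinB lee_fin; lra.
    by rewrite leeB.
  rewrite -[leLHS]mul1e -integral_cst//.
  apply: (@le_trans _ _ (\int[mu]_(x in cell v `\` B) (s%:E * (W x)%:E + (s^-1 / 4)%:E * (dual_weight 2 W x)%:E))).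
    apply: le_int => //.
      by apply: emeasurable_funD; exact: measurable_funeM.
    move=> x _; rewrite dE -!EFinM -EFinD lee_fin /=.
    have := sqr_ge0 (2 * s * W x - 1)%R.
    have wx := W0 x; move=> hh.
    rewrite -subr_ge0 (_ : (_ - _ = (2 * s * W x - 1) ^+ 2 / (4 * s * W x))%R).
      apply: divr_ge0 => //; apply: mulr_ge0; last exact: ltW.
      by apply: mulr_ge0; [exact: ler0n|exact: ltW].
    by field; rewrite !gt_eqF.
  rewrite intD//; last 4 first.
  - exact: measurable_funeM.
  - exact: measurable_funeM.
  - by move=> x; rewrite mule_ge0 ?lee_fin ?(ltW (W0 x)) ?(ltW ss0).
  - by move=> x; rewrite mule_ge0 ?lee_fin ?powR_ge0 ?divr_ge0 ?invr_ge0 ?(ltW ss0).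
  rewrite !intZl// ?(ltW ss0)// ?divr_ge0 ?invr_ge0 ?(ltW ss0)//; last 2 first.
  - by move=> x; rewrite lee_fin powR_ge0.
  - by move=> x; rewrite lee_fin ltW.
  rewrite uE (_ : (s^-1 * sg / 4 = s^-1 / 4 * sg)%R); last by ring.
  rewrite EFinD leeD// (EFinM (s^-1 / 4)) lee_wpmul2l//; first by rewrite lee_fin divr_ge0 ?invr_ge0 ?(ltW ss0).
  rewrite -(wintE F v Wd); apply: ge0_subset_integral => //; first exact: measurable_funTS.
  by move=> x _; rewrite lee_fin powR_ge0.
have e1 : (s^-1 * sg / 4 = volu v / 4)%R by rewrite /s; field; rewrite !gt_eqF.
have e2 : (volu v / 4 <= sg * u / volu v)%R.
  by move: muU; rewrite e1 /s mulrAC; lra.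
have e3 : (volu v ^+ 2 <= 4 * (sg * u))%R.
  by move: e2; rewrite ler_pdivlMr// mulrAC -expr2; lra.
rewrite -(ler_pM2r s0) (le_trans AB)//.
rewrite (le_trans (ler_wpM2l (Ap_ge0 AK) e3))//.
by rewrite le_eqVlt; apply/orP; left; apply/eqP; ring.
Qed.

Let wc0 : (1 <= wc)%R.
Proof.
rewrite /weak_const -addrA lerDl; apply: addr_ge0; apply: mulr_ge0; rewrite ?ler0n//.
  exact: wf_K1 H.
by rewrite mulr_ge0 ?ler0n//; exact: wf_K0 H.
Qed.

Let wsq_wc v : (wsq g v <= (wc * avgabs mu cell g v) ^+ 2)%R.
Proof.
apply: (le_trans (wsq_le F H gloc v)).
rewrite [X in (_ <= X)%R]exprMn ler_wpM2r ?sqr_ge0//.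
have k0 := wf_K0 H; have k1 := wf_K1 H.
apply: (@le_trans _ _ ((#|Lam|%:R * K0) ^+ 2)%R).
  rewrite exprMn ler_wpM2r ?sqr_ge0// -natrX ler_nat.
  by rewrite -mulnn; case: #|Lam| => // m; rewrite leq_pmulr.
have L0 : (0 <= #|Lam|%:R * K0)%R by rewrite mulr_ge0 ?ler0n.
rewrite lerXn2r ?nnegrE ?(le_trans ler01 wc0)//.
rewrite /weak_const; apply: (@le_trans _ _ (64 * (#|Lam|%:R * K0))%R).
  by rewrite ler_peMl// ler1n.
by rewrite lerDr; apply: addr_ge0; [exact: ler01|apply: mulr_ge0; rewrite ?ler0n].
Qed.

Let C0 : R := 4 * K * wc ^+ 2.

Let C00 : (0 <= C0)%R.
Proof. exact: mulr_ge0 (mulr_ge0 (ler0n _ 4) (Ap_ge0 AK)) (sqr_ge0 _). Qed.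

(** At the threshold (wc a)^2, with [a] the average over the root, the set B above it has at most
    half the volume. So th W(v) is at most 4 K th times the weight of the complement of B, and there
    a <= M makes this [C0] times the integral of M^2 W. The terms on B and off B add up with the
    same constant [C0], so strong induction on the depth loses nothing. *)
Lemma tree_est D v : \int[mu]_(x in cell v) wt D v x <= C0%:E * \int[mu]_(x in cell v) MW x.
Proof.
elim/ltn_ind: D v => D ih v.
have a0 := avgabs_ge0 F g v.
set a := avgabs mu cell g v in a0 *.
(* A vanishing average of |g| leaves no coefficient below [v]; this case is apart because
   [weak_type] needs a positive level. *)
have [a_eq0|a_gt0] := leP a 0%R.
  have wz x : wtree g D v x = 0%R.
    rewrite /wtree big_seq big1// => w ww.
    suff -> : wsq g w = 0%R by rewrite mul0r.
    apply/eqP; rewrite eq_le (wsq_ge0 h F) andbT (le_trans (wsq_wc w))//.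
    suff -> : avgabs mu cell g w = 0%R by rewrite mulr0 expr0n.
    apply/eqP; rewrite eq_le (avgabs_ge0 F g) andbT /avgabs pmulr_lle0 ?invr_gt0 ?(vol_gt0 F)//.
    rewrite (le_trans (iabs_mono (tree_sub F ww)))//.
    by rewrite -(avgabsE F g v) -/a mulr_le0_ge0// ltW// (vol_gt0 F).
  rewrite integral0_eq; first by rewrite mule_ge0 ?lee_fin// integral_ge0.
  by move=> x _; rewrite /wt wz mul0r.
pose th := ((wc * a) ^+ 2)%R.
have th0 : (0 <= th)%R by exact: sqr_ge0.
pose B := cell v `&` [set x | (th < 0 + wtree g D v x)%R].
have mB : measurable B.
  apply: measurableI; first exact: mcell.
  rewrite [X in measurable X](_ : _ = wtree g D v @^-1` `]th, +oo[).
    by rewrite -[X in measurable X]setTI; exact: mwtree.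
  by apply/seteqP; split => x; rewrite /= in_itv/= andbT add0r.
have muB : mu B <= (volu v / 2)%:E.
  apply: le_trans (weak_type F H gloc D a_gt0 (lexx _)).
  rewrite /B (_ : _ `&` _ = [set x | cell v x /\ (th < wtree g D v x)%R])//.
  by apply/seteqP; split => x [? /=]; rewrite ?add0r; split => //=; rewrite add0r.
have est := @level_est C0 th D v 0%R C00 (lexx _) th0 ih.
have := est (or_introl _); rewrite add0r => /(_ (wsq_wc v)).
under eq_integral do rewrite add0r; move=> /le_trans; apply.
rewrite -/B -(setDKU (B := cell v) (A := B)); last by move=> x [].
have mD : measurable (cell v `\` B) by apply: measurableD => //; exact: mcell.
rewrite ge0_integral_setU//; last 2 first.
- exact: measurable_funTS.
- by apply/disj_setPS => x [[]].
rewrite [leRHS]muleDr ?ge0_adde_def ?inE ?integral_ge0//.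
have thK : (0 <= th * (4 * K))%R.
  by apply: mulr_ge0 => //; apply: mulr_ge0; [exact: ler0n|exact: Ap_ge0 AK].
rewrite leeD2r// (EFinM th).
apply: (@le_trans _ _ (th%:E * ((4 * K)%:E * \int[mu]_(x in cell v `\` B) (W x)%:E))).
  by rewrite lee_wpmul2l ?lee_fin// big_part// => x [].
rewrite muleA -EFinM -intZl//; last by move=> x; rewrite lee_fin ltW.
rewrite -intZl//.
apply: le_int => //.
- exact: measurable_funeM.
- exact: measurable_funeM.
- by move=> x; apply: mule_ge0; rewrite lee_fin ?(ltW (W0 x)) ?thK.
move=> x [vx _]; rewrite muleA lee_wpmul2r ?lee_fin ?(ltW (W0 x))//.
apply: (@le_trans _ _ (C0%:E * (a ^+ 2)%:E)).
  by rewrite -EFinM lee_fin /th /C0 le_eqVlt; apply/orP; left; apply/eqP; ring.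
by rewrite lee_wpmul2l ?lee_fin// avg_M.
Qed.

(** Finitely many cells lie in trees of finite depth below roots that overlap at most [N0] times;
    [tree_est] is summed over these roots. *)
Lemma wsquare_weighted :
  \int[mu]_x (wsquare g x * (W x)%:E) <= (C0 * N0%:R)%:E * \int[mu]_x MW x.
Proof.
have tE x : wsquare g x * (W x)%:E = \esum_(w in [set: V]) (wsq g w * \1_(cell w) x * W x)%:E.
  by rewrite muleC -esumZl ?(ltW (W0 x))//; apply: eq_esum => w _; rewrite -EFinM mulrC.
under eq_integral do rewrite tE.
have t0 w x : 0 <= (wsq g w * \1_(cell w) x * W x)%:E.
  by rewrite lee_fin mulr_ge0 ?(ltW (W0 x))// mulr_ge0// (wsq_ge0 h F).
have mt w : measurable_fun setT (fun x => (wsq g w * \1_(cell w) x * W x)%:E).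
  apply/measurable_EFinP; apply: measurable_funM => //; apply: measurable_funM => //.
  by apply: measurable_indic; exact: mcell.
rewrite ge0_integral_esum//; apply: esum_le_seq => s us.
rewrite -ge0_integral_sum//.
have [rs [D [rsD rsN]]] := forest_roots F s.
pose f r x := wt D r x * (\1_(cell r) x)%:E.
have mf r : measurable_fun setT (f r).
  apply: emeasurable_funM; first by apply/measurable_EFinP/measurable_funM.
  by apply/measurable_EFinP; apply: measurable_indic; exact: mcell.
have wt0 r x : 0 <= wt D r x by rewrite lee_fin mulr_ge0// ltW.
have f0 r x : 0 <= f r x by rewrite mule_ge0.
apply: (@le_trans _ _ (\int[mu]_x (\sum_(r <- rs) f r x))).
  apply: le_int => //.
  - exact: emeasurable_sum.
  - exact: emeasurable_sum.
  - by move=> x; apply: sume_ge0.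
  move=> x _; rewrite sumEFin.
  pose all_nodes := flatten [seq tree ch xpred0 D r | r <- rs].
  have fE r : f r x = (wtree g D r x * W x)%:E.
    rewrite /f /wt -EFinM; have [rx|rx] := pselect (cell r x).
      by rewrite indicE mem_set// mulr1.
    by rewrite wtree_out// !mul0r.
  under [X in _ <= X]eq_bigr do rewrite fE; rewrite sumEFin lee_fin -!mulr_suml ler_wpM2r ?(ltW (W0 x))//.
  have -> : (\sum_(r <- rs) wtree g D r x = \sum_(w <- all_nodes) wsq g w * \1_(cell w) x)%R.
    by rewrite big_flatten big_map.
  have s_sub : {subset s <= all_nodes}.
    move=> w ws; have [r rrs rw] := rsD _ ws; apply/flattenP.
    by exists (tree ch xpred0 D r); [exact: map_f|exact: desc_tree].
  have nn w : (0 <= wsq g w * \1_(cell w) x)%R by rewrite mulr_ge0// (wsq_ge0 h F).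
  elim: s {rsD} us all_nodes s_sub => [_ l _|w s ihs /= /andP[wns us] l sl].
    by rewrite big_nil sumr_ge0.
  have wl : w \in l by apply: sl; exact: mem_head.
  rewrite big_cons (perm_big _ (perm_to_rem wl))/= big_cons lerD2l ihs// => u us'.
  have : u \in l by apply: sl; rewrite inE us' orbT.
  rewrite (perm_mem (perm_to_rem wl)) inE => /orP[/eqP uw|//].
  by move: wns; rewrite -uw us'.
rewrite ge0_integral_sum//.
apply: (@le_trans _ _ (\sum_(r <- rs) C0%:E * \int[mu]_(x in cell r) MW x)).
  by apply: lee_sum => r _; rewrite /f -int_indic; exact: tree_est.
rewrite -ge0_sume_distrr; last by move=> r _; exact: integral_ge0.
rewrite (EFinM C0) -muleA lee_wpmul2l ?lee_fin//.
rewrite -intZl//.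
under eq_bigr do rewrite int_indic.
rewrite -ge0_integral_sum//; last 2 first.
- move=> r; apply: emeasurable_funM => //.
  by apply/measurable_EFinP; apply: measurable_indic; exact: mcell.
- by move=> r x _; rewrite mule_ge0// lee_fin.
apply: le_int => //.
- apply: emeasurable_sum => r; apply: emeasurable_funM => //.
  by apply/measurable_EFinP; apply: measurable_indic; exact: mcell.
- exact: measurable_funeM.
- by move=> x; apply: sume_ge0 => r _; rewrite mule_ge0// lee_fin.
move=> x _; rewrite -ge0_sume_distrr//.
by rewrite muleC lee_wpmul2r// sumEFin lee_fin.
Qed.

End one_weight.
End weighted_wavelets.

(** * Compactly supported wavelets *)

Section calculus_rV.
Context {R : realType}.

Lemma bounded_support n (f : 'rV[R]_n -> R) (a b : R) : continuous f ->
  (forall x, f x != 0 -> forall i, a <= x ord0 i <= b) ->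
  exists2 B, 0 <= B & forall x, `|f x| <= B.
Proof.
move=> cf supp.
pose A := [set x : 'rV[R]_n | forall i, `[a, b]%classic (x ord0 i)].
have cA : compact A by apply: (@rV_compact R n (fun=> `[a, b]%classic)) => i; exact: segment_compact.
have cfA : compact (f @` A).
  by apply: continuous_compact cA; exact: continuous_subspaceT.
have [M [Mr MB]] := compact_bounded cfA.
exists (`|M| + 1) => [|x]; first by rewrite addr_ge0.
have [->|fx] := eqVneq (f x) 0; first by rewrite normr0 addr_ge0.
apply: (MB (`|M| + 1)); first by rewrite (le_lt_trans (ler_norm M))// ltrDl.
by exists x => // i; rewrite /= in_itv/=; exact: supp.
Qed.

Lemma closure_support n (f : 'rV[R]_n -> R) x : ~ closure [set y | f y != 0] x ->
  \near x, f x = 0.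
Proof.
move=> ncl; apply: contrapT => nn; apply: ncl => U nU.
apply: contrapT => nU'; apply: nn; apply: filterS nU => y Uy.
by apply/eqP/negPn/negP => fy; apply: nU'; exists y.
Qed.

Lemma derive_support n (f : 'rV[R]_n -> R) v x :
  ~ closure [set y | f y != 0] x -> 'D_v f x = 0.
Proof.
move=> /closure_support fx0.
have -> : 'D_v f x = 'D_v (cst 0 : 'rV[R]_n -> R) x by exact: near_eq_derive.
exact: derive_cst.
Qed.

Lemma line_derive n (f : 'rV[R]_n -> R) (x v : 'rV[R]_n) (t : R) :
  derivable f (x + t *: v) v ->
  is_derive t 1 (fun s : R => f (x + s *: v)) ('D_v f (x + t *: v)).
Proof.
move=> df.
have qE : (fun h : R => h^-1 *: (((fun s : R => f (x + s *: v)) \o shift t) (h *: (1 : R)) - f (x + t *: v))) =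
    (fun h : R => h^-1 *: ((f \o shift (x + t *: v)) (h *: v) - f (x + t *: v))).
  apply/funext => h; congr (_ *: (f _ - _)).
  by rewrite /= scalerDl /GRing.scale/= mulr1 addrCA.
by split; rewrite /derivable /derive qE.
Qed.

Lemma lipschitz_coord n (f : 'rV[R]_n -> R) (v x : 'rV[R]_n) (B t : R) :
  (forall y, derivable f y v) -> (forall y, `|'D_v f y| <= B) ->
  `|f (x + t *: v) - f x| <= B * `|t|.
Proof.
move=> df dB; pose g (s : R) := f (x + s *: v).
have dg (s : R) : is_derive s 1 g ('D_v f (x + s *: v)) by exact: line_derive.
have cg : continuous g.
  by move=> s; apply: differentiable_continuous; apply/derivable1_diffP; have [] := dg s.
have key (a b : R) : a < b -> `|g b - g a| <= B * (b - a).
  move=> ab; have [|c _ ->] := MVT ab (fun s _ => dg s).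
    exact: continuous_subspaceT.
  by rewrite normrM [X in _ * X]gtr0_norm ?subr_gt0// ler_wpM2r// subr_ge0 ltW.
have g0 : g 0 = f x by rewrite /g scale0r addr0.
rewrite -/(g t) -g0; have [t0|t0|->] := ltgtP t 0.
- by rewrite distrC (ltr0_norm t0); have := key _ _ t0; rewrite sub0r.
- by rewrite (gtr0_norm t0); have := key _ _ t0; rewrite subr0.
- by rewrite subrr normr0 mulr0.
Qed.

(** The coordinates of one point are replaced by those of the other one at a time, with the mean
    value theorem on each segment. *)
Lemma lipschitz_rV n (f : 'rV[R]_n -> R) (B : R) : 0 <= B ->
  (forall i x, derivable f x (delta_mx 0 i)) ->
  (forall i x, `|'D_(delta_mx 0 i) f x| <= B) ->
  forall x y, `|f x - f y| <= B * \sum_i `|x ord0 i - y ord0 i|.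
Proof.
move=> B0 df dB x y.
have key (s : seq 'I_n) (x' : 'rV[R]_n) : (forall i, i \notin s -> x' ord0 i = y ord0 i) ->
    `|f x' - f y| <= B * \sum_(i <- s) `|x' ord0 i - y ord0 i|.
  elim: s x' => [|i s ih] x' xy.
    rewrite big_nil mulr0 (_ : x' = y) ?subrr ?normr0//.
    by apply/rowP => i; exact: xy.
  pose z := x' + (y ord0 i - x' ord0 i) *: delta_mx 0 i.
  have zi : z ord0 i = y ord0 i by rewrite !mxE !eqxx mulr1 addrC subrK.
  have zj j : j != i -> z ord0 j = x' ord0 j.
    by move=> ji; rewrite !mxE (negbTE ji) mulr0 addr0.
  have zs j : j \notin s -> z ord0 j = y ord0 j.
    move=> js; have [->//|ji] := eqVneq j i.
    by rewrite zj// xy// inE negb_or ji.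
  rewrite big_cons mulrDr (le_trans (ler_distD (f z) _ _))// lerD//.
    by rewrite distrC [`|x' _ _ - _|]distrC; exact: lipschitz_coord.
  apply: le_trans (ih z zs) _; rewrite ler_wpM2l// ler_sum// => j _.
  by have [->|ji] := eqVneq j i; [rewrite zi subrr normr0|rewrite zj].
by apply: le_trans (key (index_enum 'I_n) x _) _ => // i; rewrite mem_index_enum.
Qed.

(** The sigma-algebra is generated by the coordinates, so a continuous function is exhibited as the
    limit of functions constant on dyadic cubes, with the values at the lower corners. *)
Lemma measurable_continuous_rV n (f : 'rV[R]_n -> R) : continuous f ->
  measurable_fun setT f.
Proof.
move=> cf.
pose pt m (k : 'rV[int]_n) : 'rV[R]_n := \row_i (2 ^ (- m%:Z) * (k ord0 i)%:~R).
pose fl (m : nat) (x : 'rV[R]_n) : 'rV[int]_n := \row_i Num.floor (2 ^ m%:Z * x ord0 i).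
have e0 (m : nat) : 0 < 2 ^ (- m%:Z) :> R by exact: exp2z_gt0.
have e1 (m : nat) : 2 ^ m%:Z * 2 ^ (- m%:Z) = 1 :> R by rewrite -expfzDr// subrr.
apply: (@measurable_fun_cvg _ _ _ _ (fun m x => f (pt m (fl m x)))); last first.
  move=> x _; apply: (@cvg_comp _ _ _ (fun m => pt m (fl m x)) f _ (nbhs x)); last exact: cf.
  apply/cvg_ballP => e e_gt0; near=> m.
  have em : 2 ^ (- m%:Z) < e.
    near: m; have := @cvg_expr R 2^-1; rewrite ger0_norm ?invr_ge0// invf_lt1 ?ltr1n//.
    move=> /(_ isT) /cvgrPdist_lt /(_ _ e_gt0); apply: filterS => m.
    by rewrite sub0r normrN ger0_norm ?exprn_ge0 ?invr_ge0// exprVn -invr_expz -exprnP.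
  split => // i j; rewrite (ord1 i) /ball/= !mxE.
  set y := x ord0 j; have /andP[h1 h2] := floor_itv (2 ^ m%:Z * y).
  have yE : y = 2 ^ (- m%:Z) * (2 ^ m%:Z * y) by rewrite mulrCA mulrA e1 mul1r.
  rewrite {1}yE -mulrBr normrM gtr0_norm// (le_lt_trans _ em)//.
  rewrite -[leRHS]mulr1 ler_wpM2l ?(ltW (e0 m))//.
  by rewrite ger0_norm ?subr_ge0//; move: h2; rewrite intrD; lra.
move=> m _ Y mY; rewrite setTI.
rewrite (_ : _ @^-1` Y = \bigcup_j (if pickle_inv j is Some k
  then if f (pt m k) \in Y then lcell 1 (m%:Z, k) else set0 else set0)).
  apply: bigcupT_measurable => j; case: pickle_inv => [k|//].
  by case: ifP => // _; exact: measurable_box.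
apply/seteqP; split => x /=.
  move=> Yx; exists (pickle (fl m x)) => //=; rewrite pickleK_inv mem_set//.
  by apply: lcellP => i; rewrite mxE; exact: floor_itv.
move=> [j _]; case: pickle_inv => [k|//]; case: ifPn => // /[!inE] Yk xk.
rewrite (_ : fl m x = k)//; apply/rowP => i; rewrite mxE.
by apply/eqP; rewrite floor_eq; exact: lcell_le xk.
Unshelve. all: by end_near. Qed.

End calculus_rV.

(** * Orthonormal expansions and the frame of wavelets *)

Section orthonormal_expansion.
Context d (T : measurableType d) (R : realType) (mu : {measure set T -> \bar R}).
Local Notation J f := (\int[mu]_x f x)%R.
Local Notation ii f := (mu.-integrable [set: T] (EFin \o f)).
Variables (I : eqType) (e : I -> T -> R).
Hypothesis ie : forall i j, ii (fun x => e i x * e j x).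
Hypothesis oe : forall i j, J (fun x => e i x * e j x) = (i == j)%:R.

(** Completing the square in the coefficients. It yields Bessel's inequality, and it shows that the
    orthogonal projection is the best approximation. *)
Lemma orthonormal_expansion (f : T -> R) (t : seq I) (c : I -> R) : uniq t ->
  ii (fun x => f x ^+ 2) -> (forall i, ii (fun x => f x * e i x)) ->
  J (fun x => (f x - \sum_(i <- t) c i * e i x) ^+ 2) =
  J (fun x => f x ^+ 2) - \sum_(i <- t) J (fun x => f x * e i x) ^+ 2 +
  \sum_(i <- t) (c i - J (fun x => f x * e i x)) ^+ 2.
Proof.
move=> ut if2 ife.
have i1 i : ii (fun x => c i * (f x * e i x)) by exact: integrableZR.
have i2 i j : ii (fun x => c i * c j * (e i x * e j x)) by exact: integrableZR.
have is1 : ii (fun x => \sum_(i <- t) c i * (f x * e i x)) by exact: integrable_sumR.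
have is2 i : ii (fun x => \sum_(j <- t) c i * c j * (e i x * e j x)) by exact: integrable_sumR.
have -> : (fun x => (f x - \sum_(i <- t) c i * e i x) ^+ 2) =
    (fun x => (f x ^+ 2 - 2 * \sum_(i <- t) c i * (f x * e i x)) +
       \sum_(i <- t) \sum_(j <- t) c i * c j * (e i x * e j x)).
  apply/funext => x; rewrite sqrrB -mulr_natl; congr (_ - 2 * _ + _).
    by rewrite mulr_sumr; apply: eq_bigr => i _; ring.
  rewrite expr2 mulr_suml; apply: eq_bigr => i _; rewrite mulr_sumr.
  by apply: eq_bigr => j _; ring.
rewrite RintegralD//; last 2 first.
- by apply: integrableBR => //; exact: integrableZR.
- exact: integrable_sumR.
rewrite RintegralB//; last exact: integrableZR.
rewrite RintegralZl// !Rintegral_sumR// -!addrA; congr (_ + _).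
rewrite mulr_sumr -!sumrN -!big_split/= big_seq [RHS]big_seq.
apply: eq_bigr => i it; rewrite Rintegral_sumR//.
rewrite (bigD1_seq i)//= big1_seq => [|j /andP[ji _]]; last first.
  by rewrite RintegralZl// oe eq_sym (negbTE ji) mulr0.
rewrite !RintegralZl// oe eqxx -[(true : nat)%:R]/(1 : R).
by ring.
Qed.

Lemma bessel (f : T -> R) (t : seq I) : uniq t ->
  ii (fun x => f x ^+ 2) -> (forall i, ii (fun x => f x * e i x)) ->
  \sum_(i <- t) J (fun x => f x * e i x) ^+ 2 <= J (fun x => f x ^+ 2).
Proof.
move=> ut if2 ife.
have := @orthonormal_expansion f t (fun i => J (fun x => f x * e i x)) ut if2 ife.
rewrite [X in _ + X]big1 => [|i _]; last by rewrite subrr expr0n.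
by rewrite addr0 => hE; rewrite -subr_ge0 -hE; apply: Rintegral_ge0 => x _; exact: sqr_ge0.
Qed.

End orthonormal_expansion.

Section compact_wavelet.
Context {R : realType}.

Lemma C_class1 n m (h : 'rV[R]_n -> R) : C_class m.+1 h ->
  [/\ continuous h, forall i x, derivable h x (delta_mx 0 i) &
      forall i, continuous ('D_(delta_mx 0 i) h)].
Proof.
move=> [ch dh]; split => // i; first by have [] := dh i.
by have [_] := dh i; case: m {dh} => [|m] [].
Qed.

(** A nonzero value on the far face would persist, by continuity, at points beyond the box.
    Half-open boxes are needed for the children of a cell to be disjoint. *)
Lemma support_half_open n (h : 'rV[R]_n -> R) (b : R) x : continuous h ->
  (forall x, h x != 0 -> forall i, 0 <= x ord0 i <= b) ->
  h x != 0 -> forall i, 0 <= x ord0 i < b.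
Proof.
move=> ch supp hx i; have /andP[-> /=] := supp x hx i.
rewrite le_eqVlt => /orP[/eqP xb|//].
have /cvgrPdist_lt/(_ `|h x|) := ch x; rewrite normr_gt0 => /(_ hx)/nbhs_ballP[e /= e0 he'].
have he y : ball x e y -> h y != 0.
  by move=> /he' /=; apply: contraTneq => ->; rewrite subr0 ltxx.
have y0 : (0 : R) < e / 2 by rewrite divr_gt0.
pose y := x + (e / 2) *: delta_mx 0 i.
have /he/supp/(_ i)/andP[_] : ball x e y.
  split => // a j; rewrite (ord1 a) /ball/= !mxE opprD addrA subrr sub0r normrN.
  rewrite normrM (gtr0_norm y0); case: (j == i); rewrite /= ?normr1 ?normr0 ?mulr1 ?mulr0//.
  by rewrite ltr_pdivrMr// ltr_pMr// ltr1n.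
by rewrite !mxE !eqxx/= mulr1 xb gerDl leNgt y0.
Qed.

Lemma dilateE n (h : 'rV[R]_n -> R) (j : int) (k : 'rV[int]_n) x :
  dilate h j k x = 2 `^ (j%:~R * n%:R / 2) * h (\row_i (2 ^ j * x ord0 i - (k ord0 i)%:~R)).
Proof.
by rewrite /dilate; congr (_ * h _); apply/rowP => i; rewrite !mxE.
Qed.

Lemma measurable_dilate n (h : 'rV[R]_n -> R) (j : int) (k : 'rV[int]_n) :
  measurable_fun setT h -> measurable_fun setT (dilate h j k).
Proof.
move=> mh; rewrite (_ : dilate h j k =
  (fun x => 2 `^ (j%:~R * n%:R / 2) * h (\row_i (2 ^ j * x ord0 i - (k ord0 i)%:~R)))); last first.
  by apply/funext => x; exact: dilateE.
apply: measurable_funM => //; apply: (measurableT_comp mh).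
apply: measurable_fun_rV => i.
rewrite (_ : (fun _ => _) = fun x : 'rV[R]_n => 2 ^ j * x ord0 i - (k ord0 i)%:~R); last first.
  by apply/funext => x; rewrite mxE.
by apply: measurable_funB => //; apply: measurable_funM => //; exact: measurable_rV_coord.
Qed.

Lemma sqrt_vol_lcell n (L : nat) (v : int * 'rV[int]_n) : (0 < L)%N ->
  2 `^ (v.1%:~R * n%:R / 2) * Num.sqrt (vol (lebesgue_rV R n) (@lcell R L n) v) =
  Num.sqrt (L%:R ^+ n).
Proof.
move=> L0; have e0 : 0 < 2 ^ (- v.1) :> R by exact: exp2z_gt0.
have -> : vol (lebesgue_rV R n) (@lcell R L n) v = (2 ^ (- v.1) * L%:R) ^+ n.
  by rewrite /vol [X in fine X](lebesgue_lcell L v).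
have sE : 2 `^ (v.1%:~R * n%:R / 2) = Num.sqrt ((2 `^ (v.1%:~R * n%:R / 2)) ^+ 2) :> R.
  by rewrite sqrtr_sqr ger0_norm ?powR_ge0.
rewrite sE -sqrtrM ?sqr_ge0//.
congr Num.sqrt; rewrite exprMn mulrA.
have -> : (2 `^ (v.1%:~R * n%:R / 2)) ^+ 2 = (2 ^ v.1) ^+ n :> R.
  rewrite -powR_mulrn ?powR_ge0// -powRrM divfK ?pnatr_eq0// powRrM powR_mulrn ?powR_ge0//.
  by rewrite powR_intmul.
by rewrite -exprMn -expfzDr// subrr expr1n mul1r.
Qed.

Lemma vol_lcell n (L : nat) (v : int * 'rV[int]_n) :
  vol (lebesgue_rV R n) (@lcell R L n) v = (2 ^ (- v.1) * L%:R) ^+ n.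
Proof. by rewrite /vol [X in fine X](lebesgue_lcell L v). Qed.

Lemma C_class1_bound n m (h : 'rV[R]_n -> R) (b : R) : C_class m.+1 h ->
  closure [set x | h x != 0] = [set x | forall i, 0 <= x ord0 i <= b] ->
  exists2 B, 0 <= B & (forall x, `|h x| <= B) /\
    forall i x, `|'D_(delta_mx 0 i) h x| <= B.
Proof.
move=> /C_class1[ch dh cdh] clh.
have supp x : h x != 0 -> forall i, 0 <= x ord0 i <= b.
  by move=> hx; have : closure [set x | h x != 0] x by [exact: subset_closure]; rewrite clh.
have [B0 B00 hB0] := bounded_support ch supp.
have /choice[Bd BdP] : forall i, exists B, 0 <= B /\ forall x, `|'D_(delta_mx 0 i) h x| <= B.
  move=> i; have [|B B0' hB] := @bounded_support _ _ _ 0 b (cdh i); last by exists B.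
  move=> x dx; have : closure [set y | h y != 0] x; last by rewrite clh.
  by apply: contrapT => /derive_support dz; move: dx; rewrite dz eqxx.
have Bs0 : 0 <= \sum_i Bd i by apply: sumr_ge0 => i _; have [] := BdP i.
exists (B0 + \sum_i Bd i); first by rewrite addr_ge0.
split=> [x|i x]; first by rewrite (le_trans (hB0 x))// lerDl.
rewrite (le_trans (proj2 (BdP i) x))// (bigD1 i)//= addrCA lerDl addr_ge0//.
by apply: sumr_ge0 => j _; have [] := BdP j.
Qed.

Lemma integrable_compact n (f : 'rV[R]_n -> R) (A : set 'rV[R]_n) (B : R) :
  measurable A -> (lebesgue_rV R n A < +oo)%E -> measurable_fun setT f ->
  (forall x, ~ A x -> f x = 0) -> (forall x, `|f x| <= B) ->
  (lebesgue_rV R n).-integrable setT (EFin \o f).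
Proof.
move=> mA Ay mf fA fB.
apply: (@integrable_leR _ _ _ _ _ (fun x => B * \1_A x)) => // [x|].
  have [Ax|Ax] := pselect (A x); first by rewrite indicE mem_set// mulr1.
  by rewrite fA// normr0 indicE memNset// mulr0.
by apply: integrableZR; exact: integrable_indicR.
Qed.

Section frame.
Context (n : nat) (n_gt0 : (0 < n)%N) (psi : 'I_(2 ^ n - 1) -> 'rV[R]_n -> R).
Hypothesis psiP : compact_wavelets n.+1 n psi.
Local Notation mu := (lebesgue_rV R n).
Local Notation J f := (\int[mu]_x f x)%R.
Local Notation ii f := (mu.-integrable [set: 'rV[R]_n] (EFin \o f)).

Definition wavelet (l : 'I_(2 ^ n - 1)) (v : int * 'rV[int]_n) : 'rV[R]_n -> R :=
  dilate (psi l) v.1 v.2.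

Lemma wavelet_orthonormal (i j : 'I_(2 ^ n - 1) * (int * 'rV[int]_n)) :
  J (fun x => wavelet i.1 i.2 x * wavelet j.1 j.2 x) = (i == j)%:R.
Proof.
have [_ _ [_ oE _] _] := psiP; have := oE i j => /(congr1 (@complex.Re R)).
by case: (i == j).
Qed.

Lemma wavelet_supportP : exists L : nat, [/\ odd L,
  forall l x, psi l x != 0 -> forall i, 0 <= x ord0 i < L%:R,
  exists2 B, 0 <= B & (forall l x, `|psi l x| <= B) /\
    forall l i x, `|'D_(delta_mx 0 i) (psi l) x| <= B &
  forall l, measurable_fun setT (psi l)].
Proof.
have [Cpsi [N suppN] _ _] := psiP.
have cpsi l : continuous (psi l) by have [] := C_class1 (Cpsi l).
have supp l x : psi l x != 0 -> forall i, 0 <= x ord0 i <= 2 * N%:R - 1.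
  by move=> hx; have : closure [set x | psi l x != 0] x by [exact: subset_closure]; rewrite suppN.
(* For N = 0 the box would be empty in a positive dimension and the wavelet would vanish, against
   its norm 1. *)
have N0 : (0 < N)%N.
  rewrite lt0n; apply/negP => /eqP N0.
  have l : 'I_(2 ^ n - 1).
    by apply: (@Ordinal _ 0); rewrite subn_gt0 -{1}(expn0 2) ltn_exp2l.
  have := wavelet_orthonormal (l, (0, 0)) (l, (0, 0)); rewrite eqxx /=.
  rewrite (_ : (fun _ => _) = cst 0) ?Rintegral_cst//= ?mul0r => [/esym/eqP|].
    by rewrite oner_eq0.
  apply/funext => x; rewrite /wavelet dilateE/=.
  set y := \row_ _ _; have [->|/supp/(_ (Ordinal n_gt0))] := eqVneq (psi l y) 0; first by rewrite mulr0 mul0r.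
  by rewrite N0; lra.
have LE : 2 * N%:R - 1 = ((2 * N).-1)%:R :> R.
  by rewrite -subn1 natrB ?muln_gt0// natrM.
exists (2 * N).-1; split.
- have -> : (2 * N).-1 = (2 * N.-1).+1 by lia.
  by rewrite /= oddM.
- by move=> l x hx i; apply: (support_half_open (cpsi l) _ hx) => z hz; rewrite -LE; exact: (supp l z hz).
- have /choice[Bf BfP] : forall l, exists B, [/\ 0 <= B, forall x, `|psi l x| <= B &
      forall i x, `|'D_(delta_mx 0 i) (psi l) x| <= B].
    by move=> l; have [B B0 [? ?]] := C_class1_bound (Cpsi l) (suppN l); exists B.
  have le l : Bf l <= \sum_l Bf l.
    by rewrite (bigD1 l)//= lerDl sumr_ge0// => j _; have [] := BfP j.
  exists (\sum_l Bf l); first by apply: sumr_ge0 => l _; have [] := BfP l.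
  by split=> l; have [_ h1 h2] := BfP l => *; rewrite (le_trans _ (le l)).
- by move=> l; exact: measurable_continuous_rV.
Qed.

(** The constant [M] = B (1 + n L) serves size and oscillation at once: two points of a cell [u]
    differ by at most L 2^(-lev u) in each of the n coordinates, and B bounds the first derivatives.
    A child has 2^-n times the volume of its parent. *)
Theorem wavelet_frame_rV : exists L K0, odd L /\
  wavelet_frame mu (@lcell R L n) (@lchild L n) fst wavelet K0 (2 ^+ n).
Proof.
have [L [oddL supp [B B0 [psiB dpsiB]] mpsi]] := wavelet_supportP.
have [Cpsi _ _ _] := psiP.
have L0 : (0 < L)%N by case: (L) oddL.
have sL : 0 < Num.sqrt (L%:R ^+ n) :> R by rewrite sqrtr_gt0 exprn_gt0// ltr0n.
have [M M0 ME] : exists2 M, 0 <= M & B * (1 + n%:R * L%:R) = M.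
  by eexists; last (exact: erefl); rewrite mulr_ge0// addr_ge0// mulr_ge0.
exists L, (M * Num.sqrt (L%:R ^+ n)); split => //.
have F := @forest_rV R L oddL n.
have v0 v : 0 < vol mu (@lcell R L n) v by exact: (vol_gt0 F).
have sE v : M * Num.sqrt (L%:R ^+ n) / Num.sqrt (vol mu (@lcell R L n) v) = M * 2 `^ (v.1%:~R * n%:R / 2).
  by rewrite -(sqrt_vol_lcell v L0) mulrA mulfK// gt_eqF// sqrtr_gt0.
have mw l v : measurable_fun setT (wavelet l v) by exact: measurable_dilate.
have wsupp l v x : ~ lcell L v x -> wavelet l v x = 0.
  move=> vx; rewrite /wavelet dilateE; set y := \row_ _ _.
  have [->|/supp hy] := eqVneq (psi l y) 0; first by rewrite mulr0.
  exfalso; apply: vx; apply: lcellP => i; have := hy i; rewrite mxE.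
  by rewrite subr_ge0 ltrBlDl intrD => /andP[-> ->].
have wbound l v x : `|wavelet l v x| <= B * 2 `^ (v.1%:~R * n%:R / 2).
  by rewrite /wavelet dilateE normrM ger0_norm ?powR_ge0// mulrC ler_wpM2r ?powR_ge0.
have BM : B <= M by rewrite -ME ler_peMr// lerDl mulr_ge0.
have iw i j : ii (fun x => wavelet (fst i) (snd i) x * wavelet (fst j) (snd j) x).
  apply: (@integrable_compact _ _ (lcell L i.2) ((B * 2 `^ (i.2.1%:~R * n%:R / 2)) * (B * 2 `^ (j.2.1%:~R * n%:R / 2)))).
  - exact: measurable_box.
  - exact: forest_lty F _.
  - exact: measurable_funM.
  - by move=> x ix; rewrite wsupp// mul0r.
  - by move=> x; rewrite normrM ler_pM.
split.
- by rewrite mulr_ge0// ltW.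
- by rewrite exprn_ge0.
- by [].
- move=> v e; rewrite !vol_lcell -exprMn lerXn2r ?nnegrE ?mulr_ge0 ?ler0n ?(ltW (exp2z_gt0 _))//.
  rewrite /lchild/= opprD expfzDr// exprN1 le_eqVlt; apply/orP; left; apply/eqP.
  by field.
- exact: mw.
- exact: wsupp.
- move=> l v x; rewrite sE (le_trans (wbound l v x))// ler_wpM2r ?powR_ge0//.
- move=> l v u x y ux uy; rewrite sE /wavelet !dilateE -mulrBr normrM ger0_norm ?powR_ge0//.
  rewrite [leRHS]mulrAC [leRHS]mulrC ler_wpM2l ?powR_ge0//.
  have [_ dpsi _] := C_class1 (Cpsi l).
  rewrite (le_trans (lipschitz_rV B0 dpsi (dpsiB l) _ _))//.
  rewrite -ME -mulrA ler_wpM2l//.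
  rewrite (le_trans (_ : _ <= \sum_(i < n) (L%:R * 2 ^ (v.1 - u.1))))//.
    apply: ler_sum => i _; rewrite !mxE opprB addrA subrK -mulrBr normrM gtr0_norm ?exp2z_gt0//.
    rewrite expfzDr// mulrCA ler_wpM2l ?(ltW (exp2z_gt0 _))//.
    have := lcell_side L u i => /(_ R).
    have /andP[] := ux i; have /andP[] := uy i; move=> h1 h2 h3 h4 h5.
    by rewrite ler_norml; lra.
  have q0 : 0 < 2 ^ (v.1 - u.1) :> R by exact: exp2z_gt0.
  rewrite sumr_const card_ord -mulr_natl.
  by rewrite -subr_ge0 (_ : _ - _ = 2 ^ (v.1 - u.1)); [exact: ltW|ring].
- move=> f Bf v s us mf fB fv.
  pose t := [seq (l, w) | w <- s, l <- enum 'I_(2 ^ n - 1)].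
  have ut : uniq t.
    by apply: allpairs_uniq => //; [exact: enum_uniq|move=> [? ?] [? ?] _ _ [-> ->]].
  have if1 (g : 'rV[R]_n -> R) Bg : measurable_fun setT g -> (forall x, `|g x| <= Bg) ->
      ii (fun x => f x * g x).
    move=> mg gB; apply: (@integrable_compact _ _ (lcell L v) (Bf * Bg)).
    - exact: measurable_box.
    - exact: forest_lty F _.
    - exact: measurable_funM.
    - by move=> x vx; rewrite fv// mul0r.
    - by move=> x; rewrite normrM ler_pM.
  have := @bessel _ _ _ mu _ (fun i => wavelet i.1 i.2) iw wavelet_orthonormal f t ut (if1 _ _ mf fB).
  move=> /(_ (fun i => if1 _ _ (mw i.1 i.2) (wbound i.1 i.2))).
  rewrite /t big_allpairs_dep; apply: le_trans; apply: ler_sum => w _.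
  by rewrite big_enum.
Qed.

End frame.
End compact_wavelet.

(** * Bounds for the square function in mixed norms *)

Section cellular_square_function.
Context d (T : measurableType d) (R : realType)
  (mu : {measure set T -> \bar R}) (V : countType) (E : finType)
  (cell : V -> set T) (ch : V -> E -> V) (lev : V -> int)
  (Lam : finType) (h : Lam -> V -> T -> R) (K0 K1 : R).
Variables (N0 : nat) (F : forest mu cell ch N0) (H : wavelet_frame mu cell ch lev h K0 K1).
Local Open Scope ereal_scope.

Definition square_pair (f g : T -> \bar R) : Prop :=
  exists G : T -> R, [/\ measurable_fun setT G,
    f = (fun x => wsquare mu cell h G x `^ 2^-1) & g = (fun x => `|G x|%:E)].

(** The weighted L^2 bound by the maximal function, followed by the weighted bound for the maximal
    function itself. This is the starting point of the extrapolation. *)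
Theorem square_weighted_bound : weighted_bound mu cell square_pair 2.
Proof.
move=> K.
have p2 : (1 < 2 :> R)%R by rewrite ltr1n.
set Cm := (K `^ (2 / (2 - 1)) * (2 `^ (2 / (2 - 1)) * N0.+1%:R) * ((2 / (2 - 1)) `^ 2 * N0.+1%:R))%R.
set C0 := (4 * K * weak_const Lam K0 K1 ^+ 2 * N0%:R)%R.
(* The constant must be positive before any weight is given, while [K >= 0] is only known from a
   weight; hence the absolute values. *)
exists (`|C0| * `|Cm| + 1)%R.
  by apply: ltr_wpDl => //; apply: mulr_ge0; exact: normr_ge0.
move=> f g [G [mG -> ->]] W AK.
have mW := weight_measurable (Ap_weight AK).
have W0 x : (0 < W x)%R := weight_gt0 (Ap_weight AK) x.
have mg : measurable_fun setT (fun x => `|G x|%:E).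
  by apply/measurable_EFinP; exact: measurableT_comp.
have g0 x : 0 <= `|G x|%:E by rewrite lee_fin.
have mgW : measurable_fun setT (fun x => `|G x|%:E `^ 2 * (W x)%:E).
  by apply: emeasurable_funM; [exact: emeasurable_poweR|exact/measurable_EFinP].
have gW0 x : 0 <= `|G x|%:E `^ 2 * (W x)%:E by rewrite mule_ge0 ?poweR_ge0// lee_fin ltW.
have I0 : 0 <= \int[mu]_x (`|G x|%:E `^ 2 * (W x)%:E) by exact: integral_ge0.
have Cp : (0 < `|C0| * `|Cm| + 1)%R.
  by apply: ltr_wpDl => //; apply: mulr_ge0; exact: normr_ge0.
under eq_integral do rewrite ge0_poweRVK// ?(wsquare_ge0 h F)//.
have [Ify|] := ltP (\int[mu]_x (`|G x|%:E `^ 2 * (W x)%:E)) +oo; last first.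
  rewrite leye_eq => /eqP ->; rewrite gt0_muley ?lte_fin// leey.
  by [].
(* Local integrability of [G] follows from |G| <= |G|^2 W + 1 / W, whose right side is integrable on
   the cell. *)
have gloc v : mu.-integrable setT (EFin \o (fun x => G x * \1_(cell v) x)%R).
  have mv := forest_measurable F v.
  apply/integrableP; split.
    by apply/measurable_EFinP; apply: measurable_funM => //; exact: measurable_indic.
  pose D x := (dual_weight 2 W x)%:E.
  have mD : measurable_fun setT D.
    by apply/measurable_EFinP; exact: weight_measurable (Ap_dual AK).
  have D0 x : 0 <= D x by rewrite lee_fin powR_ge0.
  apply: (@le_lt_trans _ _ (\int[mu]_(x in cell v) (`|G x|%:E `^ 2 * (W x)%:E + D x))).
    rewrite [leRHS]int_indic; apply: le_int => //.
    - by apply: measurableT_comp => //; apply/measurable_EFinP; apply: measurable_funM => //; exact: measurable_indic.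
    - apply: emeasurable_funM; first exact: emeasurable_funD.
      by apply/measurable_EFinP; exact: measurable_indic.
    - move=> x _ /=; rewrite normrM [`|\1__ _|%R]ger0_norm// EFinM lee_wpmul2r// ?lee_fin//.
      rewrite /D /dual_weight (_ : 2 - 1 = 1 :> R)%R; last by lra.
      rewrite invr1 powR_inv1 ?(ltW (W0 x))// powR_mulrn//.
      have w0 := W0 x; set a := `|G x|%R; rewrite -subr_ge0.
      have -> : (a ^+ 2 * W x + (W x)^-1 - a = ((2 * a * W x - 1) ^+ 2 + 3) / (4 * W x))%R.
        by field; rewrite gt_eqF.
      by rewrite divr_ge0 ?addr_ge0 ?sqr_ge0// mulr_ge0// ltW.
  rewrite intD// lte_add_pinfty//; last exact: weight_lty (Ap_dual AK) v.
  by apply: le_lt_trans Ify; apply: ge0_subset_integral.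
have main := wsquare_weighted F H AK gloc.
apply: (le_trans main).
have := cmax_muckenhoupt F p2 AK mg g0.
rewrite /= -/Cm => hM.
have K00 := Ap_ge0 AK.
have C00 : (0 <= C0)%R.
  rewrite /C0; apply: mulr_ge0; last exact: ler0n.
  by apply: mulr_ge0; [apply: mulr_ge0 => //; exact: ler0n|exact: sqr_ge0].
rewrite -/C0.
apply: (@le_trans _ _ (C0%:E * (Cm%:E * \int[mu]_x (`|G x|%:E `^ 2 * (W x)%:E)))).
  by rewrite lee_wpmul2l// lee_fin.
rewrite muleA -EFinM lee_wpmul2r// lee_fin.
rewrite (ger0_norm C00); apply: (@le_trans _ _ (C0 * `|Cm|)%R).
  by rewrite ler_wpM2l// ler_norm.
by rewrite lerDl.
Qed.

End cellular_square_function.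

Section mixed_square_function.
Context {R : realType} (n : nat) (n_gt0 : (0 < n)%N)
  (psi : 'I_(2 ^ n - 1) -> 'rV[R]_n -> R).
Hypothesis psiP : compact_wavelets n.+1 n psi.
Local Notation mu := (lebesgue_rV R n).

(* [(S g)^2] for a real-valued [g] *)
Definition rsquare (g : 'rV[R]_n -> R) (x : 'rV[R]_n) : \bar R :=
  (\esum_(w in [set: int * 'rV[int]_n])
    (wsq mu (@lcell R 1 n) (wavelet psi) g w * \1_(lcell 1 w) x)%:E)%E.

Lemma rsquare_ge0 g x : (0 <= rsquare g x)%E.
Proof.
apply: esum_ge0 => w _; rewrite lee_fin mulr_ge0//.
exact: (wsq_ge0 _ (@forest_rV R 1 isT n)).
Qed.

Lemma measurable_rsquare g : measurable_fun setT (rsquare g).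
Proof. exact: (measurable_wsquare _ (@forest_rV R 1 isT n)). Qed.

(** The square function is built on dyadic cubes, the frame on the larger cells with the same
    indices. The ratio [L ^ n] of the volumes bounds the former by the latter, and extrapolation
    starts from the exponent 2. *)
Theorem mixed_square_bound (p : 'I_n -> R) : (forall i, 1 < p i) ->
  exists2 C : R, 0 < C & forall g : 'rV[R]_n -> R, measurable_fun setT g ->
    (mixed_norm p (fun x => rsquare g x `^ 2^-1) <= C%:E * mixed_norm p (fun x => `|g x|%:E))%E.
Proof.
move=> p1; have [L [K0 [oddL H]]] := wavelet_frame_rV n_gt0 psiP.
have F := @forest_rV R L oddL n.
have L0 : (0 < L)%N by case: (L) oddL.
pose LL : R := L%:R ^+ n.
have LL1 : 1 <= LL by rewrite exprn_ege1// ler1n.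
pose FF (f g : 'rV[R]_n -> \bar R) := exists G : 'rV[R]_n -> R, [/\ measurable_fun setT G,
    f = (fun x => rsquare G x `^ 2^-1)%E & g = (fun x => `|G x|%:E)].
have FF0 : nnpair FF.
  move=> f g [G [mG -> ->]]; split.
  - by apply: emeasurable_poweR; exact: measurable_rsquare.
  - by apply/measurable_EFinP; exact: measurableT_comp.
  - by move=> x; exact: poweR_ge0.
  - by move=> x; rewrite lee_fin.
have le_wsquare G x : (rsquare G x <= LL%:E * wsquare mu (@lcell R L n) (wavelet psi) G x)%E.
  rewrite /wsquare -esumZl ?(le_trans ler01)//; last first.
    by move=> w; rewrite lee_fin mulr_ge0// (wsq_ge0 _ F).
  apply: le_esum => w _; rewrite -EFinM lee_fin /wsq.
  set c := \sum_l _; have c0 : 0 <= c by apply: sumr_ge0 => l _; exact: sqr_ge0.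
  have q0 : 0 < 2 ^ (- w.1) :> R by exact: exp2z_gt0.
  rewrite !vol_lcell mulr1 exprMn -/LL invfM.
  have -> : LL * (c * ((2 ^ (- w.1)) ^- n * LL^-1) * \1_(lcell L w) x) = c * (2 ^ (- w.1)) ^- n * \1_(lcell L w) x.
    have qn0 : (2 ^ (- w.1)) ^+ n != 0 :> R by rewrite gt_eqF// exprn_gt0.
    have LLn0 : LL != 0 by rewrite gt_eqF// (lt_le_trans ltr01).
    by move: qn0 LLn0; move: (_ ^+ n) (LL) => q l qn0 ln0; field; rewrite ?qn0 ?ln0.
  rewrite ler_wpM2l//; first by rewrite mulr_ge0// invr_ge0 exprn_ge0// ltW.
  rewrite !indicE ler_nat; have [wx|wx] := pselect (lcell 1 w x); last by rewrite memNset.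
  rewrite !mem_set//; apply: lcellP => i; have /andP[-> h2] := lcell_le i wx.
  rewrite (lt_le_trans h2)// ler_int; lia.
have WB : weighted_bound mu (@lcell R L n) FF 2.
  move=> K; have [C C0 CP] := square_weighted_bound F H K.
  exists (LL * C); first by rewrite mulr_gt0// (lt_le_trans ltr01).
  move=> f g [G [mG -> ->]] W AK.
  have W0 x : 0 < W x := weight_gt0 (Ap_weight AK) x.
  have mW : measurable_fun setT (fun x => (W x)%:E).
    by apply/measurable_EFinP; exact: weight_measurable (Ap_weight AK).
  have := CP _ _ (ex_intro _ G (And3 mG erefl erefl)) W AK.
  under eq_integral do rewrite ge0_poweRVK// ?(wsquare_ge0 _ F)//.
  under [X in _ -> (X <= _)%E]eq_integral do rewrite ge0_poweRVK// ?rsquare_ge0//.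
  move=> hC; rewrite EFinM -muleA.
  apply: (@le_trans _ _ (LL%:E * \int[mu]_x (wsquare mu (@lcell R L n) (wavelet psi) G x * (W x)%:E))%E); last first.
    by rewrite lee_wpmul2l// lee_fin (le_trans ler01).
  have mw : measurable_fun setT (fun x => wsquare mu (@lcell R L n) (wavelet psi) G x * (W x)%:E)%E.
    by apply: emeasurable_funM => //; exact: (measurable_wsquare _ F).
  rewrite -intZl ?(le_trans ler01)//; last first.
    by move=> x; rewrite mule_ge0 ?(wsquare_ge0 _ F)// lee_fin ltW.
  apply: le_int => //.
  - by apply: emeasurable_funM => //; exact: measurable_rsquare.
  - exact: measurable_funeM.
  - by move=> x; rewrite mule_ge0 ?rsquare_ge0// lee_fin ltW.
  - by move=> x _; rewrite muleA lee_wpmul2r// lee_fin ltW.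
have p2 : 1 < 2 :> R by rewrite ltr1n.
have [C C0 CP] := mixed_extrapolation oddL p2 p1 FF0 WB.
by exists C => // g mg; apply: CP; exists g.
Qed.

End mixed_square_function.

(** * Mixed norms *)

Section vanishing_sequences.
Context {R : realType}.
Implicit Type u : (\bar R)^nat.
Local Open Scope ereal_scope.

(** Convergence to 0 of nonnegative sequences that may begin with infinite values, in a form that
    passes easily through powers and nested norms. *)
Definition vanishing u := forall e : R, (0 < e)%R ->
  exists N, forall m, (N <= m)%N -> u m <= e%:E.

Lemma vanishing_cvg u : (forall m, 0 <= u m) -> vanishing u -> u @ \oo --> 0.
Proof.
move=> u0 vu; have [N uN] := vu 1%R ltr01.
have uf m : (N <= m)%N -> u m = (fine (u m))%:E.
  by move=> Nm; rewrite fineK// ge0_fin_numE// (le_lt_trans (uN _ Nm))// ltry.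
apply/fine_cvgP; split; first by exists N => // m /= Nm; rewrite (uf _ Nm).
apply/cvgrPdist_le => e e0; have [N' uN'] := vu e e0; exists (maxn N N') => // m /=.
rewrite geq_max => /andP[Nm Nm']; rewrite sub0r normrN ger0_norm ?fine_ge0//.
by rewrite -lee_fin -uf// uN'.
Qed.

Lemma cvg_vanishing u : (forall m, 0 <= u m) -> u @ \oo --> 0 -> vanishing u.
Proof.
move=> u0 /fine_cvgP[[N1 _ uf] /cvgrPdist_le cu] e e0; have [N2 _ uN] := cu e e0.
exists (maxn N1 N2) => m; rewrite geq_max => /andP[m1 m2].
have := uN _ m2; rewrite /= sub0r normrN ger0_norm ?fine_ge0// -lee_fin fineK//.
exact: uf.
Qed.

Lemma vanishing_poweR u (r : R) : (0 < r)%R -> (forall m, 0 <= u m) -> vanishing u ->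
  vanishing (fun m => u m `^ r).
Proof.
move=> r0 u0 vu e e0; have [|N uN] := vu (e `^ r^-1)%R; first by rewrite powR_gt0.
exists N => m Nm; rewrite ge0_poweR_le ?lee_fin ?(ltW e0)//.
by rewrite poweR_EFin; exact: uN.
Qed.

End vanishing_sequences.

Section ereal_hoelder.
Context d (T : measurableType d) (R : realType) (mu : {measure set T -> \bar R}).
Implicit Types f g : T -> \bar R.
Local Open Scope ereal_scope.

Lemma poweR_quasi_add (r : R) (x y : \bar R) : (0 < r)%R -> 0 <= x -> 0 <= y ->
  (x + y) `^ r <= (2 `^ r)%:E * (x `^ r + y `^ r).
Proof.
move=> r0; wlog xy : x y / x <= y.
  move=> h x0 y0; have [xy|/ltW yx] := leP x y; first exact: h.
  by rewrite addeC [X in _ * X]addeC; exact: h.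
move=> x0 y0; apply: (@le_trans _ _ ((2%:E * y) `^ r)).
  rewrite ge0_ler_poweR ?(ltW r0) ?adde_ge0//.
  by rewrite (_ : 2%:E * y = y + y) ?leeD2r// -mule2n mule_natl.
rewrite poweRM ?lee_fin// poweR_EFin lee_wpmul2l ?lee_fin ?powR_ge0//.
by rewrite leeDr// poweR_ge0.
Qed.

Lemma ae_zero_integral f (N : set T) : measurable_fun setT f -> (forall x, 0 <= f x) ->
  measurable N -> mu N = 0 -> (forall x, ~ N x -> f x = 0) -> \int[mu]_x f x = 0.
Proof.
move=> mf f0 mN N0 fN; apply/eqP; rewrite eq_le integral_ge0 ?andbT//.
apply: le_trans (ae_le_int (g := cst 0) measurableT mf _ f0 _ mN N0 _) _ => //.
  by move=> x _ /fN ->.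
by rewrite integral0.
Qed.

Lemma zero_ae f (p : R) : (0 < p)%R -> measurable_fun setT f -> (forall x, 0 <= f x) ->
  \int[mu]_x (f x `^ p) = 0 ->
  measurable [set x | f x != 0] /\ mu [set x | f x != 0] = 0.
Proof.
move=> p0 mf f0 fp0; have mS : measurable [set x | f x != 0].
  rewrite (_ : [set x | _] = ~` (f @^-1` [set 0])).
    by apply: measurableC; rewrite -[X in measurable X]setTI; exact: mf.
  by apply/seteqP; split => x /= /eqP.
split => //.
have mfp : measurable_fun setT (fun x => f x `^ p) by exact: emeasurable_poweR.
have [+ _] := ae_eq_integral_abs mu measurableT mfp.
have -> : \int[mu]_x `|f x `^ p| = 0.
  by rewrite -fp0; apply: eq_integral => x _; rewrite gee0_abs// poweR_ge0.
move=> /(_ erefl)[N [mN N0 sN]]; apply/eqP; rewrite -measure_le0.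
apply: (@le_trans _ _ (mu N)); last by rewrite N0.
apply: le_measure; rewrite ?inE//.
apply: subset_trans sN => x /= fx h; have := h I => /poweR_eq0_eq0 fx0.
by move: fx; rewrite fx0// eqxx.
Qed.

(** Young's inequality normalised by the two norms. A vanishing norm makes the product vanish almost
    everywhere, and an infinite one makes the right side infinite. *)
Lemma ehoelder f g (p q : R) : (0 < p)%R -> (0 < q)%R -> (p^-1 + q^-1 = 1)%R ->
  measurable_fun setT f -> measurable_fun setT g ->
  (forall x, 0 <= f x) -> (forall x, 0 <= g x) ->
  \int[mu]_x (f x * g x) <=
  (\int[mu]_x (f x `^ p)) `^ p^-1 * (\int[mu]_x (g x `^ q)) `^ q^-1.
Proof.
move=> p0 q0 pq mf mg f0 g0.
have mfg : measurable_fun setT (fun x => f x * g x) by exact: emeasurable_funM.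
have mfp : measurable_fun setT (fun x => f x `^ p) by exact: emeasurable_poweR.
have mgq : measurable_fun setT (fun x => g x `^ q) by exact: emeasurable_poweR.
have fg0 x : 0 <= f x * g x by exact: mule_ge0.
have A0 : 0 <= \int[mu]_x (f x `^ p) by apply: integral_ge0 => x _; exact: poweR_ge0.
have B0 : 0 <= \int[mu]_x (g x `^ q) by apply: integral_ge0 => x _; exact: poweR_ge0.
have [Az|Az] := eqVneq (\int[mu]_x (f x `^ p)) 0.
  have [mS S0] := zero_ae p0 mf f0 Az.
  rewrite (ae_zero_integral mfg fg0 mS S0) ?mule_ge0 ?poweR_ge0// => x /= /negP/negPn/eqP ->.
  by rewrite mul0e.
have [Bz|Bz] := eqVneq (\int[mu]_x (g x `^ q)) 0.
  have [mS S0] := zero_ae q0 mg g0 Bz.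
  rewrite (ae_zero_integral mfg fg0 mS S0) ?mule_ge0 ?poweR_ge0// => x /= /negP/negPn/eqP ->.
  by rewrite mule0.
have Ap : 0 < \int[mu]_x (f x `^ p) by rewrite lt0e Az.
have Bp : 0 < \int[mu]_x (g x `^ q) by rewrite lt0e Bz.
have [Ay|] := ltP (\int[mu]_x (f x `^ p)) +oo; last first.
  rewrite leye_eq => /eqP ->; rewrite poweRyr ?invr_eq0 ?gt_eqF// gt0_mulye ?leey//.
  by rewrite poweR_gt0.
have [By|] := ltP (\int[mu]_x (g x `^ q)) +oo; last first.
  rewrite leye_eq => /eqP ->; rewrite [X in _ <= _ * X]poweRyr ?invr_eq0 ?gt_eqF// gt0_muley ?leey//.
  by rewrite poweR_gt0.
have [A' A'0 AE] : exists2 a, (0 < a)%R & \int[mu]_x (f x `^ p) = (a `^ p)%:E.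
  exists (fine (\int[mu]_x (f x `^ p)) `^ p^-1)%R; first by rewrite powR_gt0// fine_gt0// Ap.
  rewrite -powRrM mulVf ?gt_eqF// powRr1 ?fine_ge0// fineK//.
  by rewrite ge0_fin_numE.
have [B' B'0 BE] : exists2 b, (0 < b)%R & \int[mu]_x (g x `^ q) = (b `^ q)%:E.
  exists (fine (\int[mu]_x (g x `^ q)) `^ q^-1)%R; first by rewrite powR_gt0// fine_gt0// Bp.
  rewrite -powRrM mulVf ?gt_eqF// powRr1 ?fine_ge0// fineK//.
  by rewrite ge0_fin_numE.
rewrite AE BE !poweR_EFin -!powRrM !mulfV ?gt_eqF// !powRr1 ?(ltW A'0) ?(ltW B'0)//.
pose al := (A' * B' * (p^-1 / A' `^ p))%R; pose be := (A' * B' * (q^-1 / B' `^ q))%R.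
have al0 : (0 < al)%R by rewrite !mulr_gt0 ?invr_gt0 ?powR_gt0.
have be0 : (0 < be)%R by rewrite !mulr_gt0 ?invr_gt0 ?powR_gt0.
have young x : f x * g x <= al%:E * f x `^ p + be%:E * g x `^ q.
  have := f0 x; have := g0 x; case: (f x) => [a| |//]; last first.
    by rewrite poweRyr ?gt_eqF// gt0_muley ?lte_fin// addye ?leey// -ltNye (lt_le_trans ltNy0)// mule_ge0 ?poweR_ge0// lee_fin ltW.
  case: (g x) => [b| |//]; last first.
    by rewrite (poweRyr (r := q)) ?gt_eqF// [be%:E * _]gt0_muley ?lte_fin// addey ?leey// poweR_EFin -EFinM.
  move=> b0' a0'; have b0 : (0 <= b)%R by []; have a0 : (0 <= a)%R by [].
  rewrite !poweR_EFin -!EFinM -EFinD lee_fin.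
  have dv (z c r : R) : (0 <= z)%R -> (0 < c)%R -> ((z / c) `^ r = z `^ r / c `^ r)%R.
    move=> z0 c0; rewrite powRM ?invr_ge0 ?(ltW c0)//; congr (_ * _)%R.
    by rewrite -[in LHS](powR_inv1 (ltW c0)) -powRrM mulN1r powRN.
  have := @conjugate_powR R (a / A')%R (b / B')%R p q.
  rewrite !divr_ge0 ?(ltW A'0) ?(ltW B'0)// => /(_ isT isT p0 q0 pq).
  rewrite !dv// => hY.
  have e : (a * b = A' * B' * (a * A'^-1 * (b * B'^-1)))%R by field; rewrite !gt_eqF.
  rewrite e (le_trans (ler_wpM2l _ hY)) ?mulr_ge0 ?(ltW A'0) ?(ltW B'0)//.
  by rewrite le_eqVlt; apply/orP; left; apply/eqP; rewrite /al /be; ring.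
apply: (@le_trans _ _ (\int[mu]_x (al%:E * f x `^ p + be%:E * g x `^ q))).
  apply: le_int => //; apply: emeasurable_funD; exact: measurable_funeM.
rewrite intD//; last 4 first.
- exact: measurable_funeM.
- exact: measurable_funeM.
- by move=> x; rewrite mule_ge0 ?poweR_ge0// lee_fin ltW.
- by move=> x; rewrite mule_ge0 ?poweR_ge0// lee_fin ltW.
rewrite !intZl ?(ltW al0) ?(ltW be0)//; last 2 first.
- by move=> x; exact: poweR_ge0.
- by move=> x; exact: poweR_ge0.
rewrite AE BE -!EFinM -EFinD lee_fin.
have a0 : (A' `^ p != 0)%R by rewrite gt_eqF// powR_gt0.
have b0 : (B' `^ q != 0)%R by rewrite gt_eqF// powR_gt0.
have -> : (al * A' `^ p + be * B' `^ q = A' * B' * (p^-1 + q^-1))%R.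
  rewrite /al /be; move: (A' `^ p)%R (B' `^ q)%R a0 b0 => u w u0 w0.
  by field; rewrite u0 w0 !gt_eqF.
by rewrite pq mulr1.
Qed.

Lemma dominated_vanishing (u : nat -> T -> \bar R) (G : T -> \bar R) (p : R) : (0 < p)%R ->
  (forall m, measurable_fun setT (u m)) -> measurable_fun setT G ->
  (forall m x, 0 <= u m x) -> (forall x, 0 <= G x) ->
  (forall m x, u m x <= G x) -> (forall x, G x < +oo -> vanishing (u ^~ x)) ->
  \int[mu]_x (G x `^ p) < +oo ->
  vanishing (fun m => \int[mu]_x (u m x `^ p)).
Proof.
move=> p0 mu_ mG u0 G0 uG vu Gy.
have mGp : measurable_fun setT (fun x => G x `^ p) by exact: emeasurable_poweR.
have iG : mu.-integrable setT (fun x => G x `^ p).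
  apply/integrableP; split => //.
  by under eq_integral do rewrite gee0_abs ?poweR_ge0//.
apply: cvg_vanishing; first by move=> m; apply: integral_ge0 => x _; exact: poweR_ge0.
rewrite -(integral0 mu setT).
have [|||||_ _ h//] := @dominated_convergence _ _ _ mu setT measurableT (fun m x => u m x `^ p) (cst 0)
  (fun x => G x `^ p).
- by move=> m; exact: emeasurable_poweR.
- exact: measurable_cst.
- have := integrable_ae measurableT iG; apply: filterS => x /= h _.
  apply: vanishing_cvg => [m|]; first exact: poweR_ge0.
  apply: vanishing_poweR => //; apply: vu.
  have := h I; rewrite ge0_fin_numE ?poweR_ge0//; case: (G x) => [a| |]//=; rewrite ?ltry//.
  by rewrite gt_eqF.
- exact: iG.
- apply/aeW => x m _ /=. by rewrite gee0_abs ?poweR_ge0// ge0_ler_poweR ?(ltW p0).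
Qed.

End ereal_hoelder.

Section mixed_norms.
Context {R : realType}.
Local Notation lam := (@lebesgue_measure R).
Local Open Scope ereal_scope.

Lemma inner_norm_le n (p : R) (F G : 'rV[R]_n.+1 -> \bar R) y : (0 < p)%R ->
  measurable_fun setT F -> measurable_fun setT G ->
  (forall z, 0 <= F z) -> (forall z, F z <= G z) -> inner_norm p F y <= inner_norm p G y.
Proof.
move=> p0 mF mG F0 FG; have G0 z : 0 <= G z := le_trans (F0 z) (FG z).
rewrite !inner_normE// ge0_ler_poweR ?invr_ge0 ?(ltW p0)//.
  by apply: integral_ge0 => x _; exact: poweR_ge0.
apply: le_int => //.
- by apply: emeasurable_poweR; exact: measurable_cons.
- by apply: emeasurable_poweR; exact: measurable_cons.
- by move=> x; exact: poweR_ge0.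
- by move=> x _; rewrite ge0_ler_poweR ?(ltW p0).
Qed.

Lemma inner_norm_scale n (p c : R) (F : 'rV[R]_n.+1 -> \bar R) y : (0 < p)%R -> (0 <= c)%R ->
  measurable_fun setT F -> (forall z, 0 <= F z) ->
  inner_norm p (fun z => c%:E * F z) y = c%:E * inner_norm p F y.
Proof.
move=> p0 c0 mF F0; rewrite !inner_normE//; last by move=> z; rewrite mule_ge0// lee_fin.
under eq_integral do rewrite poweRM ?lee_fin//.
rewrite intZl ?powR_ge0//; last 2 first.
- by apply: emeasurable_poweR; exact: measurable_cons.
- by move=> x; exact: poweR_ge0.
rewrite poweRM ?lee_fin ?powR_ge0//; last by apply: integral_ge0 => x _; exact: poweR_ge0.
by rewrite poweR_EFin -powRrM mulfV ?gt_eqF// powRr1.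
Qed.

(** The constant bounds 2 * 2^(1/p). A quasi-triangle inequality suffices throughout, because it is
    only ever applied to a bounded number of terms. *)
Lemma inner_norm_add n (p : R) (F G : 'rV[R]_n.+1 -> \bar R) y : (1 <= p)%R ->
  measurable_fun setT F -> measurable_fun setT G ->
  (forall z, 0 <= F z) -> (forall z, 0 <= G z) ->
  inner_norm p (fun z => F z + G z) y <= 4%:E * (inner_norm p F y + inner_norm p G y).
Proof.
move=> p1 mF mG F0 G0; have p0 : (0 < p)%R by rewrite (lt_le_trans _ p1).
have FG0 z : 0 <= F z + G z by exact: adde_ge0.
have mFp : measurable_fun setT (fun x : measurableTypeR R => F (rV_cons (x, y)) `^ p).
  by apply: emeasurable_poweR; exact: measurable_cons.
have mGp : measurable_fun setT (fun x : measurableTypeR R => G (rV_cons (x, y)) `^ p).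
  by apply: emeasurable_poweR; exact: measurable_cons.
have mFGp : measurable_fun setT (fun x : measurableTypeR R => (F (rV_cons (x, y)) + G (rV_cons (x, y))) `^ p).
  by apply: emeasurable_poweR; apply: emeasurable_funD; exact: measurable_cons.
have IF0 : 0 <= \int[lam]_x F (rV_cons (x, y)) `^ p by apply: integral_ge0 => x _; exact: poweR_ge0.
have IG0 : 0 <= \int[lam]_x G (rV_cons (x, y)) `^ p by apply: integral_ge0 => x _; exact: poweR_ge0.
rewrite !inner_normE//.
apply: (@le_trans _ _ (((2 `^ p)%:E * (\int[lam]_x F (rV_cons (x, y)) `^ p +
    \int[lam]_x G (rV_cons (x, y)) `^ p)) `^ p^-1)).
  rewrite ge0_ler_poweR ?invr_ge0 ?(ltW p0)//.
    by apply: integral_ge0 => x _; exact: poweR_ge0.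
  rewrite -intD//; last 2 first.
  - by move=> x; exact: poweR_ge0.
  - by move=> x; exact: poweR_ge0.
  rewrite -intZl ?powR_ge0//; last 2 first.
  - exact: emeasurable_funD.
  - by move=> x; rewrite adde_ge0 ?poweR_ge0.
  apply: le_int => //.
  - by apply: measurable_funeM; exact: emeasurable_funD.
  - by move=> x; exact: poweR_ge0.
  - by move=> x _; exact: poweR_quasi_add.
have twop : 0 <= (2 `^ p)%:E by rewrite lee_fin powR_ge0.
have IFG0 := adde_ge0 IF0 IG0.
rewrite poweRM//.
rewrite poweR_EFin -powRrM mulfV ?gt_eqF// powRr1//.
apply: (@le_trans _ _ (2%:E * ((2 `^ p^-1)%:E * ((\int[lam]_x F (rV_cons (x, y)) `^ p) `^ p^-1 +
    (\int[lam]_x G (rV_cons (x, y)) `^ p) `^ p^-1)))).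
  by rewrite lee_wpmul2l// poweR_quasi_add// invr_gt0.
rewrite muleA -EFinM lee_wpmul2r ?adde_ge0 ?poweR_ge0// lee_fin.
have : (2 `^ p^-1 <= 2 `^ 1 :> R)%R.
  by rewrite ler_powR ?ler1n// invf_le1.
by rewrite powRr1//; lra.
Qed.

Lemma mixed_norm_ge0 n (p : 'I_n -> R) (F : 'rV[R]_n -> \bar R) : 0 <= mixed_norm p F.
Proof. by elim: n p F => [|n ih] p F /=; [exact: abse_ge0|exact: ih]. Qed.

Lemma mixed_norm_le n (p : 'I_n -> R) (F G : 'rV[R]_n -> \bar R) : (forall i, 0 < p i)%R ->
  measurable_fun setT F -> measurable_fun setT G ->
  (forall z, 0 <= F z) -> (forall z, F z <= G z) -> mixed_norm p F <= mixed_norm p G.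
Proof.
elim: n p F G => [|n ih] p F G p0 mF mG F0 FG.
  by rewrite /= !gee0_abs// (le_trans (F0 _) (FG _)).
have G0 z : 0 <= G z := le_trans (F0 z) (FG z).
rewrite !mixed_normS; apply: ih => //.
- exact: measurable_inner_norm.
- exact: measurable_inner_norm.
- by move=> y; exact: inner_norm_ge0.
- by move=> y; exact: inner_norm_le.
Qed.

Lemma mixed_norm_scale n (p : 'I_n -> R) (c : R) (F : 'rV[R]_n -> \bar R) :
  (forall i, 0 < p i)%R -> (0 <= c)%R -> measurable_fun setT F -> (forall z, 0 <= F z) ->
  mixed_norm p (fun z => c%:E * F z) = c%:E * mixed_norm p F.
Proof.
elim: n p F => [|n ih] p F p0 c0 mF F0.
  by rewrite /= !gee0_abs// mule_ge0.
rewrite !mixed_normS (_ : inner_norm _ _ = fun y => c%:E * inner_norm (p ord0) F y); last first.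
  by apply/funext => y; exact: inner_norm_scale.
by rewrite ih//; [exact: measurable_inner_norm|move=> y; exact: inner_norm_ge0].
Qed.

Lemma mixed_norm_add n (p : 'I_n -> R) : (forall i, 1 <= p i)%R ->
  exists2 c : R, (1 <= c)%R & forall F G : 'rV[R]_n -> \bar R,
  measurable_fun setT F -> measurable_fun setT G ->
  (forall z, 0 <= F z) -> (forall z, 0 <= G z) ->
  mixed_norm p (fun z => F z + G z) <= c%:E * (mixed_norm p F + mixed_norm p G).
Proof.
elim: n p => [|n ih] p p1.
  by exists 1%R => // F G mF mG F0 G0; rewrite /= !gee0_abs ?adde_ge0// mul1e.
have p0 i : (0 < p i)%R by rewrite (lt_le_trans _ (p1 i)).
have [c c1 cP] := ih (fun i => p (lift ord0 i)) (fun i => p1 _).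
have c0 : (0 <= c)%R by rewrite (le_trans _ c1).
exists (4 * c)%R; first by lra.
move=> F G mF mG F0 G0; have p00 := p0 ord0; rewrite !mixed_normS.
have mf := measurable_inner_norm p00 mF F0; have mg := measurable_inner_norm p00 mG G0.
have f0 y := inner_norm_ge0 (p ord0) F y; have g0 y := inner_norm_ge0 (p ord0) G y.
rewrite (EFinM 4 c) -muleA.
apply: le_trans (_ : _ <= 4%:E * mixed_norm (fun i => p (lift ord0 i))
  (fun y => inner_norm (p ord0) F y + inner_norm (p ord0) G y)) _; last first.
  by rewrite lee_wpmul2l//; exact: cP.
rewrite -mixed_norm_scale//; [|exact: emeasurable_funD|by move=> y; exact: adde_ge0].
apply: mixed_norm_le => //.
- by apply: measurable_inner_norm => //; [exact: emeasurable_funD|move=> z; exact: adde_ge0].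
- by apply: measurable_funeM; exact: emeasurable_funD.
- by move=> y; exact: inner_norm_ge0.
- by move=> y; exact: inner_norm_add.
Qed.

Lemma mixed_norm_sum n (p : 'I_n -> R) (I : finType) : (forall i, 1 <= p i)%R ->
  exists2 c : R, (0 < c)%R & forall F : I -> 'rV[R]_n -> \bar R,
  (forall i, measurable_fun setT (F i)) -> (forall i z, 0 <= F i z) ->
  mixed_norm p (fun z => \sum_i F i z) <= c%:E * \sum_i mixed_norm p (F i).
Proof.
move=> p1; have [c c1 cP] := mixed_norm_add p1.
have p0 i : (0 < p i)%R by rewrite (lt_le_trans _ (p1 i)).
have c0 : (0 < c)%R by rewrite (lt_le_trans _ c1).
exists (c ^+ (size (index_enum I)).+1)%R; first by rewrite exprn_gt0.
move=> F mF F0; elim: (index_enum I) => [|i s ih].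
  under eq_fun do rewrite big_nil; rewrite big_nil mule0.
  rewrite (_ : (fun _ => 0) = fun z => 0%:E * cst 0 z); last by apply/funext => z; rewrite mul0e.
  by rewrite mixed_norm_scale// mul0e.
under eq_fun do rewrite big_cons; rewrite big_cons.
apply: le_trans (cP _ _ (mF i) _ (F0 i) _) _.
- exact: emeasurable_sum.
- by move=> z; exact: sume_ge0.
have S0 : 0 <= \sum_(j <- s) mixed_norm p (F j) by apply: sume_ge0 => j _; exact: mixed_norm_ge0.
rewrite (exprS c (size s).+1) (EFinM c) -muleA lee_wpmul2l ?lee_fin ?(ltW c0)//.
rewrite muleDr ?ge0_adde_def ?inE ?mixed_norm_ge0//.
apply: leeD.
  rewrite -[leLHS]mul1e lee_wpmul2r ?mixed_norm_ge0// lee_fin.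
  exact: exprn_ege1.
by apply: le_trans ih _; rewrite lee_wpmul2r.
Qed.

Lemma box_cons n (a b : 'I_n.+1 -> R) x y :
  \1_(box a b) (rV_cons (x, y)) = (\1_`[a ord0, b ord0[ x *
   \1_(box (fun i => a (lift ord0 i)) (fun i => b (lift ord0 i))) y)%R :> R.
Proof.
have cE := rV_cons_box a b x y; rewrite !indicE.
have [h|h] := pselect (box a b (rV_cons (x, y))).
  have [h1 h2] := cE.1 h.
  have x1 : x \in `[a ord0, b ord0[%classic by rewrite inE/= in_itv.
  by rewrite x1 (mem_set h) (mem_set h2) mulr1.
rewrite memNset//; have [h1|h1] := pselect (a ord0 <= x < b ord0)%R; last first.
  by rewrite (_ : (x \in _) = false) ?mul0r//; apply/negP; rewrite inE /= in_itv.
rewrite [(y \in _)]memNset ?mulr0// => h2; apply: h; apply/cE; split => //.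
Qed.

Lemma mixed_norm_box n (p : 'I_n -> R) (a b : 'I_n -> R) : (forall i, 0 < p i)%R ->
  (forall i, a i <= b i)%R ->
  mixed_norm p (fun z => (\1_(box a b) z)%:E) = (\prod_i (b i - a i) `^ (p i)^-1)%:E.
Proof.
elim: n p a b => [|n ih] p a b p0 ab.
  by rewrite big_ord0 /= indicE mem_set ?normr1//= => -[].
have mb : measurable (box (fun i => a (lift ord0 i)) (fun i => b (lift ord0 i))) by exact: measurable_box.
rewrite mixed_normS (_ : inner_norm _ _ = fun y => ((b ord0 - a ord0) `^ (p ord0)^-1)%:E *
    (\1_(box (fun i => a (lift ord0 i)) (fun i => b (lift ord0 i))) y)%:E); last first.
  apply/funext => y; rewrite inner_normE//.
  have pw (c : bool) : ((c%:R : R) `^ p ord0 = c%:R)%R.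
    by case: c; rewrite ?powR1// powR0// gt_eqF.
  under eq_integral => x _ do rewrite poweR_EFin box_cons powRM// !indicE !pw mulrC EFinM -!indicE.
  rewrite intZl//; last by apply/measurable_EFinP; exact: measurable_indic.
  have -> : \int[lam]_x (\1_`[a ord0, b ord0[ x)%:E = lam `[a ord0, b ord0[%classic.
    by rewrite integral_indic// setIT.
  rewrite lebesgue_measure_itv/= lte_fin.
  have [lt|ge] := ltP (a ord0) (b ord0).
    rewrite -EFinB -EFinM poweR_EFin powRM ?subr_ge0// EFinM muleC; congr (_ * _).
    by rewrite indicE; case: (_ \in _); rewrite ?powR1// powR0// invr_eq0 gt_eqF.
  have -> : a ord0 = b ord0 by apply/eqP; rewrite eq_le ge ab.
  by rewrite subrr powR0 ?invr_eq0 ?gt_eqF// mul0e mule0 poweR_EFin powR0// invr_eq0 gt_eqF.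
rewrite mixed_norm_scale ?powR_ge0//; last by apply/measurable_EFinP; exact: measurable_indic.
by rewrite ih// big_ord_recl EFinM.
Qed.

(** Tonelli, Hoelder in the first coordinate, and induction on the inner norms. *)
Lemma mixed_hoelder n (p q : 'I_n -> R) (F G : 'rV[R]_n -> \bar R) :
  (forall i, 0 < p i)%R -> (forall i, 0 < q i)%R -> (forall i, (p i)^-1 + (q i)^-1 = 1)%R ->
  measurable_fun setT F -> measurable_fun setT G ->
  (forall z, 0 <= F z) -> (forall z, 0 <= G z) ->
  \int[lebesgue_rV R n]_z (F z * G z) <= mixed_norm p F * mixed_norm q G.
Proof.
elim: n p q F G => [|n ih] p q F G p0 q0 pq mF mG F0 G0.
  rewrite /= !gee0_abs// integral_dirac//; last exact: emeasurable_funM.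
  by rewrite diracE mem_set// mul1e.
rewrite lebesgue_rV_tonelli; [|exact: emeasurable_funM|by move=> z; exact: mule_ge0].
rewrite !mixed_normS; apply: le_trans (ih _ _ (inner_norm (p ord0) F) (inner_norm (q ord0) G) _ _ _ _ _ _ _) => //.
- apply: le_int => //.
  + by apply: (measurable_tonelli (F := fun z => F z * G z)); [exact: emeasurable_funM|move=> z; exact: mule_ge0].
  + by apply: emeasurable_funM; exact: measurable_inner_norm.
  + by move=> y; apply: integral_ge0 => x _; exact: mule_ge0.
  + by move=> y _; rewrite !inner_normE//; apply: ehoelder => //; exact: measurable_cons.
- exact: measurable_inner_norm.
- exact: measurable_inner_norm.
- by move=> y; exact: inner_norm_ge0.
- by move=> y; exact: inner_norm_ge0.
Qed.

(** Dominated convergence in one coordinate after another. Convergence is demanded only where the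
    dominating function is finite, since its inner norm may be infinite on some slices. *)
Lemma mixed_dominated n (p : 'I_n -> R) (u : nat -> 'rV[R]_n -> \bar R) (G : 'rV[R]_n -> \bar R) :
  (forall i, 0 < p i)%R -> (forall m, measurable_fun setT (u m)) -> measurable_fun setT G ->
  (forall m x, 0 <= u m x) -> (forall x, 0 <= G x) ->
  (forall m x, u m x <= G x) -> (forall x, G x < +oo -> vanishing (u ^~ x)) ->
  mixed_norm p G < +oo -> vanishing (fun m => mixed_norm p (u m)).
Proof.
elim: n p u G => [|n ih] p u G p0 mu_ mG u0 G0 uG vu.
  rewrite /= gee0_abs// => /vu h e e0; have [N hN] := h e e0; exists N => m Nm.
  by rewrite gee0_abs// hN.
rewrite mixed_normS => Gy.
apply: (ih _ (fun m => inner_norm (p ord0) (u m)) _ _ _ _ _ _ _ _ Gy) => //.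
- by move=> m; exact: measurable_inner_norm.
- exact: measurable_inner_norm.
- by move=> m y; exact: inner_norm_ge0.
- by move=> y; exact: inner_norm_ge0.
- by move=> m y; exact: inner_norm_le.
move=> y; rewrite inner_normE// => Gy1.
have I0 : 0 <= \int[lam]_x (G (rV_cons (x, y)) `^ p ord0).
  by apply: integral_ge0 => x _; exact: poweR_ge0.
have Gy2 : \int[lam]_x (G (rV_cons (x, y)) `^ p ord0) < +oo.
  rewrite ltNge leye_eq; apply/negP => /eqP Iy; move: Gy1.
  by rewrite Iy poweRyr// invr_eq0 gt_eqF.
rewrite (_ : (fun m => _) = fun m => (\int[lam]_x (u m (rV_cons (x, y)) `^ p ord0)) `^ (p ord0)^-1); last first.
  by apply/funext => m; rewrite inner_normE.
apply: vanishing_poweR; first by rewrite invr_gt0.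
  by move=> m; apply: integral_ge0 => x _; exact: poweR_ge0.
apply: (@dominated_vanishing _ _ _ lam (fun m x => u m (rV_cons (x, y))) (fun x => G (rV_cons (x, y)))) => //.
- by move=> m; exact: measurable_cons.
- exact: measurable_cons.
- by move=> x; exact: vu.
Qed.

(** The extremal function is built recursively: on each slice it is f^(p_1 - 1) divided by the same
    power of the inner norm of [f], times the extremal function of that inner norm. Boundedness and
    support in a box keep every inner norm finite. *)
Lemma mixed_norm_dual n (p q : 'I_n -> R) (a b : 'I_n -> R) (f : 'rV[R]_n -> R) (B : R) :
  (forall i, 1 < p i)%R -> (forall i, 0 < q i)%R -> (forall i, (p i)^-1 + (q i)^-1 = 1)%R ->
  measurable_fun setT f -> (forall x, 0 <= f x <= B)%R -> (forall x, ~ box a b x -> f x = 0%R) ->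
  exists h : 'rV[R]_n -> R, [/\ measurable_fun setT h, forall x, (0 <= h x)%R,
    \int[lebesgue_rV R n]_x (f x * h x)%:E = mixed_norm p (fun x => (f x)%:E) &
    mixed_norm q (fun x => (h x)%:E) <= 1].
Proof.
elim: n p q a b f B => [|n ih] p q a b f B p1 q0 pq mf fB fbox.
  exists (cst 1%R); split => //; last by rewrite /= normr1.
  rewrite /= integral_dirac//; last by apply/measurable_EFinP; exact: measurable_funM.
  by rewrite diracE mem_set// mul1e mulr1 ger0_norm//; have /andP[] := fB 0%R.
have p10 := p1 ord0; have p00 : (0 < p ord0)%R by lra.
have f0 x : (0 <= f x)%R by have /andP[] := fB x.
have fE0 z : 0 <= (f z)%:E by rewrite lee_fin.
have mfE : measurable_fun setT (fun z => (f z)%:E) by exact/measurable_EFinP.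
pose F y := inner_norm (p ord0) (fun z => (f z)%:E) y.
have B0 : (0 <= B)%R by have /andP[/le_trans + /[dup] h] := fB 0%R; exact.
pose B1 := (B * `|b ord0 - a ord0| `^ (p ord0)^-1)%R.
have FB y : F y <= B1%:E.
  rewrite /F inner_normE// ge0_poweR_le ?invr_gt0 ?invrK//; last 2 first.
  - by apply: integral_ge0 => x _; exact: poweR_ge0.
  - by rewrite lee_fin mulr_ge0 ?powR_ge0.
  rewrite poweR_EFin powRM ?powR_ge0// -powRrM mulVf ?gt_eqF// powRr1// EFinM.
  apply: (@le_trans _ _ (\int[lam]_x ((B `^ p ord0)%:E * (\1_`[a ord0, b ord0[ x)%:E))).
    apply: le_int => //.
    - by apply: emeasurable_poweR; exact: (measurable_cons y mfE).
    - by apply: measurable_funeM; apply/measurable_EFinP; exact: measurable_indic.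
    - by move=> x; exact: poweR_ge0.
    move=> x _; rewrite poweR_EFin -EFinM lee_fin.
    have [h|h] := pselect (box a b (rV_cons (x, y))); last first.
      by rewrite fbox// powR0 ?gt_eqF// mulr_ge0 ?powR_ge0.
    have [h1 _] := (rV_cons_box a b x y).1 h.
    rewrite indicE mem_set ?mulr1/= ?in_itv// powR_le ?(ltW p00)//.
    by have /andP[] := fB (rV_cons (x, y)).
  rewrite intZl ?powR_ge0//; last by apply/measurable_EFinP; exact: measurable_indic.
  apply: lee_wpmul2l; first by rewrite lee_fin powR_ge0.
  have -> : \int[lam]_x (\1_`[a ord0, b ord0[ x)%:E = lam `[a ord0, b ord0[%classic.
    by rewrite integral_indic// setIT.
  rewrite lebesgue_measure_itv/=.
  by case: ifP => _; rewrite lee_fin ?ler_norm.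
have F0 y : 0 <= F y by exact: inner_norm_ge0.
pose f1 y := fine (F y).
have f1E y : (f1 y)%:E = F y.
  by rewrite /f1 fineK// ge0_fin_numE// (le_lt_trans (FB y))// ltry.
have f10 y : (0 <= f1 y)%R by rewrite -lee_fin f1E.
have mF : measurable_fun setT F by exact: measurable_inner_norm.
have mf1 : measurable_fun setT f1 by apply/measurable_EFinP; rewrite (_ : EFin \o f1 = F)//; apply/funext => y; exact: f1E.
have [||||h1 [mh1 h10 h1f h1n]] := ih (fun i => p (lift ord0 i)) (fun i => q (lift ord0 i))
  (fun i => a (lift ord0 i)) (fun i => b (lift ord0 i)) f1 B1 (fun i => p1 _) (fun i => q0 _).
- by move=> i; exact: pq.
- exact: mf1.
- by move=> y; rewrite f10 -lee_fin f1E FB.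
- move=> y yb; rewrite /f1 /F inner_normE// integral0_eq ?poweR_EFin ?powR0 ?invr_eq0 ?gt_eqF//.
  move=> x _; rewrite fbox ?poweR_EFin ?powR0 ?gt_eqF// => /rV_cons_box[_].
  exact: yb.
pose r := (p ord0 - 1)%R; have r0 : (0 < r)%R by rewrite subr_gt0.
(* A negative power of 0 is 0 here, so the slices where the inner norm vanishes get the value 0, as
   they should. *)
pose k y := (h1 y * f1 y `^ (- r))%R.
have mk : measurable_fun setT k by apply: measurable_funM => //; exact: emeasurable_powR.
have k0 y : (0 <= k y)%R by rewrite mulr_ge0 ?powR_ge0.
pose h z := (f z `^ r * lift_fun k z)%R.
have mh : measurable_fun setT h.
  by apply: measurable_funM; [exact: emeasurable_powR|exact: measurable_lift_fun].
have h0 z : (0 <= h z)%R by rewrite mulr_ge0 ?powR_ge0// /lift_fun.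
have q0' := q0 ord0.
have rq : (r * q ord0 = p ord0)%R.
  have : (q ord0 = p ord0 / r)%R.
    rewrite -[LHS]invrK -[X in (X^-1 = _)%R](addKr (p ord0)^-1 (q ord0)^-1)%R pq /r.
    by field; rewrite !gt_eqF//= ?gt_eqF//; lra.
  by move=> ->; rewrite mulrC divfK// gt_eqF.
have f1p y : \int[lam]_x ((f (rV_cons (x, y)) `^ p ord0)%:E) = (f1 y `^ p ord0)%:E.
  rewrite -poweR_EFin f1E /F inner_norm_pow//.
exists h; split => //.
- rewrite lebesgue_rV_tonelli; last 2 first.
  + by apply/measurable_EFinP; exact: measurable_funM.
  + by move=> z; rewrite lee_fin mulr_ge0.
  rewrite mixed_normS (_ : inner_norm _ _ = fun y => (f1 y)%:E); last by apply/funext => y; rewrite f1E.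
  rewrite -h1f; apply: eq_integral => y _.
  transitivity (\int[lam]_x ((k y)%:E * (f (rV_cons (x, y)) `^ p ord0)%:E)).
    apply: eq_integral => x _; rewrite /h lift_fun_cons -EFinM; congr (_%:E).
    rewrite mulrA mulrC; congr (_ * _)%R; rewrite -{1}[f _]powRr1// -powRD ?subrKC//.
    by rewrite gt_eqF.
  rewrite intZl ?k0//; last 2 first.
  + by apply/measurable_EFinP; apply: emeasurable_powR; apply/measurable_EFinP; exact: (measurable_cons y mfE).
  + by move=> x; rewrite lee_fin powR_ge0.
  rewrite f1p -EFinM; congr (_%:E); rewrite /k -mulrA mulrC; congr (_ * _)%R.
  have [->|fy] := eqVneq (f1 y) 0%R; first by rewrite powR0 ?oppr_eq0 ?gt_eqF// mul0r.
  by rewrite -powRD ?fy ?implybT// /r opprB subrK powRr1.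
- apply: le_trans h1n; rewrite mixed_normS.
  have mhE : measurable_fun setT (fun x => (h x)%:E) by exact/measurable_EFinP.
  have hE0 z : 0 <= (h z)%:E by rewrite lee_fin.
  apply: mixed_norm_le => //.
  + exact: measurable_inner_norm.
  + exact/measurable_EFinP.
  + by move=> y; exact: inner_norm_ge0.
  move=> y; rewrite inner_normE//.
  have -> : \int[lam]_x (h (rV_cons (x, y)))%:E `^ q ord0 = (k y `^ q ord0 * f1 y `^ p ord0)%:E.
    transitivity (\int[lam]_x ((k y `^ q ord0)%:E * (f (rV_cons (x, y)) `^ p ord0)%:E)).
      apply: eq_integral => x _; rewrite /h lift_fun_cons poweR_EFin -EFinM; congr (_%:E).
      by rewrite powRM ?powR_ge0// -powRrM rq mulrC.
    rewrite intZl ?powR_ge0//; last 2 first.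
    + by apply/measurable_EFinP; apply: emeasurable_powR; apply/measurable_EFinP; exact: (measurable_cons y mfE).
    + by move=> x; rewrite lee_fin powR_ge0.
    by rewrite f1p EFinM.
  rewrite poweR_EFin lee_fin powRM ?powR_ge0// -!powRrM mulfV ?gt_eqF// powRr1// /k.
  have [->|fy] := eqVneq (f1 y) 0%R.
    by rewrite powR0 ?oppr_eq0 ?gt_eqF// mulr0 mul0r.
  rewrite -mulrA -powRD ?fy ?implybT// (_ : (- r + p ord0 / q ord0 = 0)%R) ?powRr0 ?mulr1//.
  by rewrite -rq mulfK ?addNr// gt_eqF.
Qed.

End mixed_norms.

(** * Sums over ancestors *)

Section dyadic_combinatorics.
Context {R : realType} (n L : nat).
Hypothesis oddL : odd L.
Local Notation V := (int * 'rV[int]_n)%type.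
Local Notation cube := (@lcell R 1 n).
Local Notation big := (@lcell R L n).
Local Notation M := {ffun 'I_n -> 'I_L}.

Let L_gt0 : (0 < L)%N. Proof. by case: (L) oddL. Qed.

Definition anc (s : nat) (v : V) : V := lancestor 1 s v.

(** Two offsets in one map: [(m0, m)] runs through the cubes that cover an enlarged cell, and
    [(m, m0)] through the indices of the enlarged cells that cover a cube. *)
Definition shift (tau : M * M) (u : V) : V :=
  (u.1, \row_i (u.2 ord0 i + (tau.2 i : nat)%:Z - (tau.1 i : nat)%:Z)).

Definition m0 : M := [ffun=> Ordinal L_gt0].

Lemma anc_level s v : (anc s v).1 = v.1 - s%:Z.
Proof. exact: lancestor_level. Qed.

Lemma cube_anc s v : cube v `<=` cube (anc s v).
Proof.
exact: (desc_sub (@forest_rV R 1 isT n) (@desc_lancestor 1 isT n s v)).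
Qed.

Lemma cube_uniq u w x : cube u x -> cube w x -> u.1 = w.1 -> u = w.
Proof.
move=> ux wx e; rewrite [u]surjective_pairing [w]surjective_pairing e; congr (_, _).
apply/rowP => i; have := lcell_le i ux; have := lcell_le i wx; rewrite e.
by move=> /floor_def <- /floor_def <-.
Qed.

Lemma cube_exists (j : int) (x : 'rV[R]_n) : cube (j, \row_i Num.floor (2 ^ j * x ord0 i)) x.
Proof. by apply: lcellP => i /=; rewrite mxE; exact: floor_itv. Qed.

(** If a dyadic cube lies in another, so do their enlargements: at the finer scale the enlargement
    adds K - 1 units to the smaller cube and 2^d (K - 1) to the larger one. *)
Lemma cube_nest (K : nat) v w x : (0 < K)%N -> v.1 <= w.1 -> cube w x -> cube v x ->
  @lcell R K n w `<=` @lcell R K n v.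
Proof.
move=> K0 vw wx vx y wy; apply: lcellP => i.
have [d dE] : exists d : nat, w.1 = v.1 + d%:Z by exists `|w.1 - v.1|%N; lia.
have e0 : 0 < (2 : R) ^+ d by rewrite exprn_gt0.
have e1 z : 2 ^ w.1 * z = 2 ^+ d * (2 ^ v.1 * z) :> R by rewrite dE expfzDr// -exprnP; ring.
have := lcell_le i wx; have := lcell_le i vx; have := lcell_le i wy; rewrite !e1.
set X := 2 ^ v.1 * x ord0 i; set Y := 2 ^ v.1 * y ord0 i.
set k' := w.2 ord0 i; set k := v.2 ord0 i => /andP[w1 w2] /andP[v1 v2] /andP[x1 x2].
have a1 : 2 ^+ d * k <= k' :> int.
  rewrite -ltzD1 -(ltr_int R) (le_lt_trans _ x2)// rmorphM/= rmorphXn/=.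
  by rewrite ler_pM2l.
have a2 : k' + 1 <= 2 ^+ d * (k + 1) :> int.
  rewrite -[k' + 1]addrC lez1D -(ltr_int R) (le_lt_trans x1)// rmorphM/= rmorphXn/=.
  by rewrite ltr_pM2l.
apply/andP; split.
  rewrite -(ler_pM2l e0) (le_trans _ w1)// -[leLHS]/(_ * _).
  by move: a1; rewrite -(ler_int R) rmorphM/= rmorphXn.
rewrite -(ltr_pM2l e0) (lt_le_trans w2)//.
suff : k' + K%:Z <= 2 ^+ d * (k + K%:Z) by rewrite -(ler_int R) [in X in _ -> X]intrD rmorphM/= rmorphXn/= intrD.
have d1 : 1 <= 2 ^+ d :> int by rewrite exprn_ege1.
have -> : 2 ^+ d * (k + K%:Z) = 2 ^+ d * (k + 1) + 2 ^+ d * (K%:Z - 1) by ring.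
have -> : k' + K%:Z = (k' + 1) + (K%:Z - 1) by ring.
apply: lerD => //; rewrite ler_peMl// subr_ge0; lia.
Qed.

Lemma shift_of (v : V) x : big v x -> exists m : M, cube (shift (m0, m) v) x.
Proof.
move=> vx; have fi i : (absz (Num.floor (2 ^ v.1 * x ord0 i) - v.2 ord0 i) < L)%N /\
    v.2 ord0 i <= Num.floor (2 ^ v.1 * x ord0 i).
  have /andP[h1 h2] := lcell_le i vx; move: h1 h2.
  rewrite -floor_ge_int -floor_lt_int; set z := Num.floor _; set k := v.2 ord0 i => h1 h2.
  by split => //; lia.
exists [ffun i => Ordinal (proj1 (fi i))]; apply: lcellP => i.
rewrite /shift/= mxE !ffunE/= subr0.
have [_ h] := fi i; move: h; set z := Num.floor _; set k := v.2 ord0 i => h.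
have -> : k + (absz (z - k))%:Z = z by lia.
exact: floor_itv.
Qed.

Lemma shiftK (m : M) (u w : V) : u = shift (m0, m) w -> w = shift (m, m0) u.
Proof.
move=> ->; case: w => j k; rewrite /shift/=; congr (_, _).
by apply/rowP => i; rewrite !mxE !ffunE/= addr0 subr0 addrK.
Qed.

(** Consequently, at the level of an ancestor, at most L^n enlarged cells meet the given cube. *)
Lemma far_shift v w x (s : nat) : big w x -> cube v x -> v.1 - s%:Z = w.1 ->
  exists m, w = shift (m, m0) (anc s v).
Proof.
move=> wx vx vw; have [m mx] := shift_of wx; exists m; apply: shiftK.
by apply: (cube_uniq (cube_anc s vx) mx); rewrite anc_level.
Qed.

(** The cube at the level of [z] that contains the lower corner of [w] has an enlargement containing
    [big w], hence [x]; so [z] is one of the cubes covering that enlargement. *)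
Lemma near_shift z w x : big w x -> cube z x -> z.1 <= w.1 ->
  exists m, cube w `<=` cube (shift (m, m0) z) /\ big w `<=` big (shift (m, m0) z).
Proof.
move=> wx zx zw.
pose y : 'rV[R]_n := \row_i (2 ^ (- w.1) * (w.2 ord0 i)%:~R).
have wy : cube w y.
  apply: lcellP => i; rewrite mxE mulrA -expfzDr// subrr mul1r lexx /=.
  by rewrite intrD ltrDl.
pose u : V := (z.1, \row_i Num.floor (2 ^ z.1 * y ord0 i)).
have uy : cube u y by exact: cube_exists.
have ux : big u x by exact: (@cube_nest L u w y L_gt0 zw wy uy x wx).
have [m mx] := shift_of ux.
have uE : z = shift (m0, m) u by apply: (cube_uniq zx mx).
exists m; rewrite -(shiftK uE); split.
  exact: (@cube_nest 1 u w y isT zw wy uy).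
exact: (@cube_nest L u w y L_gt0 zw wy uy).
Qed.

End dyadic_combinatorics.

Section esum_splitting.
Context {R : realType}.
Local Open Scope ereal_scope.

Lemma sum_subset_le (I : eqType) (s l : seq I) (a : I -> \bar R) : (forall i, 0 <= a i) ->
  uniq s -> {subset s <= l} -> \sum_(i <- s) a i <= \sum_(i <- l) a i.
Proof.
move=> a0; elim: s l => [l _ _|i s ih l /= /andP[wns us] sl].
  by rewrite big_nil sume_ge0.
have wl : i \in l by apply: sl; exact: mem_head.
rewrite big_cons (perm_big _ (perm_to_rem wl))/= big_cons leeD2l// ih// => u us'.
have : u \in l by apply: sl; rewrite inE us' orbT.
rewrite (perm_mem (perm_to_rem wl)) inE => /orP[/eqP uw|//].
by move: wns; rewrite -uw us'.
Qed.

Lemma seq_le_esum (I : choiceType) (s : seq I) (a : I -> \bar R) : (forall i, 0 <= a i) ->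
  uniq s -> \sum_(i <- s) a i <= \esum_(i in [set: I]) a i.
Proof.
move=> a0 us; apply: esum_ge; exists [set` s] => //.
by rewrite fsbig_seq.
Qed.

(** Terms not coarser than the [S]-th ancestor stay together. A coarser cell that meets [v] is on
    the level of exactly one ancestor further up, where [far_shift] lists the candidates; the shift
    [S + s.+1] starts strictly above the [S]-th. *)
Lemma esum_split (n L : nat) (oddL : odd L) (S : nat) (v : int * 'rV[int]_n)
    (A : int * 'rV[int]_n -> \bar R) : (forall w, 0 <= A w) ->
  (forall w, A w != 0 -> exists x, @lcell R L n w x /\ @lcell R 1 n v x) ->
  \esum_(w in [set: int * 'rV[int]_n]) A w <=
  \esum_(w in [set: int * 'rV[int]_n]) (if ((anc S v).1 <= w.1)%R then A w else 0) +
  \sum_(s <oo) \sum_(m : {ffun 'I_n -> 'I_L}) A (shift (m, m0 n oddL) (anc (S + s.+1) v)).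
Proof.
move=> A0 Asupp; apply: esum_le_seq => s us.
rewrite (bigID (fun w => (anc S v).1 <= w.1)%R)/=; apply: leeD.
  by rewrite big_mkcond/=; apply: seq_le_esum => // w; case: ifP.
pose D := (\max_(w <- s) `|v.1 - w.1|)%N.
pose l := [seq shift (m, m0 n oddL) (anc (S + k.+1) v) | k <- iota 0 D, m <- enum {ffun 'I_n -> 'I_L}].
apply: (@le_trans _ _ (\sum_(w <- l) A w)).
  rewrite -big_filter (bigID (fun w => A w == 0))/= big1 ?add0e => [|w /eqP//].
  rewrite -big_filter; apply: sum_subset_le => //; first by rewrite !filter_uniq.
  move=> w; rewrite mem_filter => /andP[Aw]; rewrite mem_filter -ltNge => /andP[wlt ws].
  have [x [wx vx]] := Asupp w Aw.
  have wD : (`|v.1 - w.1| <= D)%N by exact: (@leq_bigmax_seq _ s xpredT (fun w => `|v.1 - w.1|%N)).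
  move: wlt; rewrite anc_level => wlt.
  pose k := (`|v.1 - w.1| - S.+1)%N.
  have kS : ((v.1 - (S + k.+1)%:Z) = w.1)%R by rewrite /k; move: (v.1) (w.1) wlt => a b; lia.
  have [m wE] := far_shift oddL wx vx kS.
  apply/allpairsP; exists (k, m) => /=; split => //; last by rewrite mem_enum.
  rewrite mem_iota/= add0n; move: wD wlt; rewrite /k; move: (v.1) (w.1) (D) => a b c; lia.
rewrite big_allpairs_dep /=.
under eq_bigr do rewrite big_enum/=.
rewrite -[X in \sum_(i <- X) _](_ : index_iota 0 D = _); last by rewrite /index_iota subn0.
apply: (@le_trans _ _ (\sum_(0 <= k < D) \sum_(m : {ffun 'I_n -> 'I_L}) A (shift (m, m0 n oddL) (anc (S + k.+1) v)))).
  by rewrite le_eqVlt; apply/orP; left; apply/eqP; apply: eq_bigr => k _; apply: eq_bigl => m; rewrite inE.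
by apply: nneseries_lim_ge => k _ _; apply: sume_ge0.
Qed.

End esum_splitting.

Section sequence_norms.
Context {R : realType} (n L : nat).
Local Notation V := (int * 'rV[int]_n)%type.
Local Notation M := {ffun 'I_n -> 'I_L}.
Local Open Scope ereal_scope.

Lemma geometric_sum_le (q : R) (X : \bar R) : (0 <= q < 1)%R -> 0 <= X ->
  \sum_(s <oo) (q ^+ s)%:E * X <= ((1 - q)^-1)%:E * X.
Proof.
move=> /andP[q0 q1] X0; apply: lime_le.
  by apply: is_cvg_nneseries => s _ _; rewrite mule_ge0// lee_fin exprn_ge0.
apply: nearW => N; rewrite -ge0_sume_distrl => [|s _]; last by rewrite lee_fin exprn_ge0.
rewrite lee_wpmul2r// sumEFin lee_fin.
have q1' : (0 < 1 - q)%R by rewrite subr_gt0.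
rewrite -[leRHS]mul1r ler_pdivlMr// big_mkord mulrC -subr_ge0.
have -> : (1 - (1 - q) * \sum_(i < N) q ^+ i = q ^+ N)%R.
  have := subrX1 q N; set X1 := (\sum_(i < N) _)%R => hX.
  by rewrite -[(q ^+ N)%R](subrK 1%R) hX; ring.
exact: exprn_ge0.
Qed.

Lemma sum_cst (I : finType) (A : \bar R) : \sum_(i : I) A = #|I|%:R%:E * A.
Proof. by rewrite sumr_const mule_natl. Qed.

Lemma sum_poweR_le (I : finType) (r : R) (x : I -> \bar R) : (0 < r)%R ->
  (forall i, 0 <= x i) ->
  (\sum_i x i) `^ r <= (#|I|%:R `^ r)%:E * \sum_i x i `^ r.
Proof.
move=> r0 x0; have [i0|I0] := pickP (fun _ : I => true); last first.
  by rewrite !big_pred0// poweR0r ?mule0// gt_eqF.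
move=> _; pose m := [arg max_(i > i0) x i]%O.
have xm i : x i <= x m.
  by rewrite /m; case: arg_maxP => // j _; apply.
apply: (@le_trans _ _ ((#|I|%:R%:E * x m) `^ r)).
  apply: ge0_ler_poweR; first exact: ltW.
    exact: sume_ge0.
  rewrite (@le_trans _ _ (\sum_(i : I) x m))//; first exact: lee_sum.
  by rewrite sum_cst.
rewrite poweRM// ?lee_fin// poweR_EFin lee_wpmul2l// ?lee_fin ?powR_ge0//.
by rewrite (bigD1 m)//= leeDl// sume_ge0// => i _; exact: poweR_ge0.
Qed.

Lemma esum_inj_le (f : V -> V) (P : pred V) (F : V -> \bar R) (s : seq V) : (forall v, 0 <= F v) ->
  uniq s -> {in P &, injective f} ->
  \sum_(v <- s | P v) F (f v) <= \esum_(v in [set: V]) F v.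
Proof.
move=> F0 us fI; rewrite -big_filter -(big_map f xpredT F).
apply: seq_le_esum => //; rewrite map_inj_in_uniq ?filter_uniq// => u v.
by rewrite !mem_filter => /andP[pu _] /andP[pv _]; exact: fI.
Qed.

(** Taking parents is injective on the cubes that are the [e]-th child of their parent, and there
    are 2^n values of [e]. *)
Lemma esum_lparent (F : V -> \bar R) : (forall v, 0 <= F v) ->
  \esum_(v in [set: V]) F (lparent 1 v) <= (2 ^+ n)%:E * \esum_(v in [set: V]) F v.
Proof.
move=> F0; apply: esum_le_seq => s us.
pose P (e : {ffun 'I_n -> bool}) v := lchild 1 (lparent 1 v) e == v :> V.
apply: (@le_trans _ _ (\sum_e \sum_(v <- s | P e v) F (lparent 1 v))).
  under [leRHS]eq_bigr do rewrite big_mkcond/=.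
  rewrite exchange_big/=; apply: lee_sum => v _.
  have [e eE] := @lparentK 1 isT n v; rewrite (bigD1 e)//= /P eE eqxx leeDl//.
  by apply: sume_ge0 => e' _; case: ifP.
rewrite (@le_trans _ _ (\sum_(e : {ffun 'I_n -> bool}) \esum_(v in [set: V]) F v))//.
  apply: lee_sum => e _; apply: esum_inj_le => // u v /eqP eu /eqP ev uv.
  by rewrite -eu -ev uv.
rewrite sum_cst card_ffun card_bool card_ord.
by rewrite natrX.
Qed.

Lemma esum_anc (F : V -> \bar R) (s : nat) : (forall v, 0 <= F v) ->
  \esum_(v in [set: V]) F (anc s v) <= ((2 ^+ n) ^+ s)%:E * \esum_(v in [set: V]) F v.
Proof.
elim: s F => [|s ih] F F0; first by rewrite expr0 mul1e.
have -> : \esum_(v in [set: V]) F (anc s.+1 v) = \esum_(v in [set: V]) F (lparent 1 (anc s v)).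
  by [].
rewrite (le_trans (ih (F \o @lparent 1 n) _))//= exprSr (EFinM _ (2 ^+ n)) -muleA.
by rewrite lee_wpmul2l ?lee_fin ?exprn_ge0//; exact: esum_lparent.
Qed.

Lemma shift_inj (tau : M * M) : injective (@shift n L tau).
Proof.
move=> [a k] [b l]; rewrite /shift/= => -[-> e]; congr (_, _).
apply/rowP => i; move/rowP/(_ i): e; rewrite !mxE => e.
by apply: (addIr (tau.2 i : nat)%:Z); apply: (addIr (- (tau.1 i : nat)%:Z)%R).
Qed.

Definition seq_norm (r : \bar R) (a : V -> \bar R) : \bar R :=
  match r with
  | r%:E => (\esum_(v in [set: V]) a v `^ r) `^ r^-1
  | +oo => ereal_sup [set a v | v in [set: V]]
  | -oo => 0
  end.

(** All pairs of offsets occur, so that a single expression dominates the cubes covering an enlarged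
    cell, the enlarged cells meeting a cube, and the composition of both. *)
Definition ancestral_sum (q : R) (a : V -> \bar R) (v : V) : \bar R :=
  \sum_(s <oo) (q ^+ s)%:E * \sum_(tau : M * M) a (shift tau (anc s v)).

Lemma ancestral_sum_ge0 q a v : (0 <= q)%R -> (forall v, 0 <= a v) -> 0 <= ancestral_sum q a v.
Proof.
move=> q0 a0; apply: nneseries_ge0 => s _ _; rewrite mule_ge0// ?lee_fin ?exprn_ge0//.
exact: sume_ge0.
Qed.

Lemma ancestral_sum_sup (q : R) : (0 <= q < 1)%R ->
  exists2 C : R, (0 < C)%R & forall a, (forall v, 0 <= a v) ->
    forall v, ancestral_sum q a v <= C%:E * seq_norm +oo a.
Proof.
move=> q01; have /andP[q0 q1] := q01; have q1' : (0 < 1 - q)%R by rewrite subr_gt0.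
exists ((1 - q)^-1 * (#|{: M * M}|%:R + 1))%R => [|a a0 v].
  by rewrite mulr_gt0// ?invr_gt0// ltr_wpDl.
set A := seq_norm +oo a.
have aA u : a u <= A by apply: ereal_sup_ubound; exists u.
have A0 : 0 <= A by exact: le_trans (a0 v) (aA v).
apply: (@le_trans _ _ (\sum_(s <oo) (q ^+ s)%:E * ((#|{: M * M}|%:R + 1)%:E * A))).
  apply: lee_nneseries => [s _ _|s _].
    by rewrite mule_ge0// ?lee_fin ?exprn_ge0//; exact: sume_ge0.
  rewrite lee_wpmul2l ?lee_fin ?exprn_ge0//.
  rewrite (@le_trans _ _ (\sum_(tau : M * M) A))//; first exact: lee_sum.
  by rewrite sum_cst lee_wpmul2r// lee_fin lerDl.
rewrite (EFinM (1 - q)^-1) -muleA; apply: geometric_sum_le => //.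
by rewrite mule_ge0// lee_fin addr_ge0.
Qed.

(** The contribution of the s-th ancestors to the sum of r-th powers is multiplied by at most
    2^(ns), the number of descendants, so the sum over s converges when q^r 2^n < 1, with some room
    to spare for Jensen's inequality. *)
Lemma ancestral_sum_power (q r : R) : odd L -> (0 < q < 1)%R -> (1 < r)%R -> (q `^ r * 2 ^+ n < 1)%R -> 
  exists2 C : R, (0 < C)%R & forall a, (forall v, 0 <= a v) ->
    \esum_(v in [set: V]) ancestral_sum q a v `^ r <= C%:E * \esum_(v in [set: V]) a v `^ r.
Proof.
move=> oddL /andP[q0 q1] r1; set rho := (q `^ r * 2 ^+ n)%R => rho1.
have r0 : (0 < r)%R by exact: lt_trans r1.
have rho0 : (0 < rho)%R by rewrite mulr_gt0// ?powR_gt0// exprn_gt0.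
have r10 : (0 < r - 1)%R by rewrite subr_gt0.
have lt1 (e : R) : (0 < e)%R -> (rho `^ e < 1)%R.
  move=> e0; have := @gt0_ltr_powR _ _ e0 rho 1%R; rewrite !nnegrE powR1; apply => //.
  exact: ltW.
(* Half of the room is spent: q^s = th^s (q / th)^s, Jensen's inequality uses the weights th^s, and
   this choice of th leaves rho^(1/2) as the ratio of the remaining geometric series. *)
have [th th01 thE] : exists2 th, (0 < th < 1)%R & (th * (q / th) `^ r * 2 ^+ n = rho `^ 2^-1)%R.
  exists (rho `^ (2 * (r - 1))^-1)%R; first by rewrite powR_gt0//= lt1// invr_gt0 mulr_gt0.
  set th := (_ `^ _)%R; have th0 : (0 < th)%R by exact: powR_gt0.
  have -> : ((q / th) `^ r = q `^ r * th `^ (-1 * r))%R.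
    by rewrite powRM ?invr_ge0 ?(ltW q0) ?(ltW th0)// (powRrM th (-1)) powR_inv1// ltW.
  have -> : (th * (q `^ r * th `^ (-1 * r)) * 2 ^+ n = rho * (th `^ 1 * th `^ (-1 * r)))%R.
    by rewrite powRr1 ?(ltW th0)// /rho; ring.
  rewrite -powRD ?(gt_eqF th0) ?implybT// /th -powRrM.
  rewrite -{1}[rho]powRr1 ?(ltW rho0)// -powRD ?(gt_eqF rho0) ?implybT//; congr (_ `^ _)%R.
  by field; rewrite gt_eqF.
have /andP[th0 th1] := th01.
have [c c0 cE] : exists2 c : R, (0 < c)%R & ((1 - th) `^ (1 - r) = c)%R.
  by eexists; last exact: erefl; rewrite powR_gt0// subr_gt0.
pose N : R := #|{: M * M}|%:R.
have N0 : (0 <= N)%R by [].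
have Nr0 : (0 <= N `^ r)%R by exact: powR_ge0.
have lt12 : (0 <= rho `^ 2^-1 < 1)%R by rewrite powR_ge0 lt1.
have lt12' : (0 < 1 - rho `^ 2^-1)%R by rewrite subr_gt0 lt1.
exists (c * (N `^ r * (N + 1)) * (1 - rho `^ 2^-1)^-1)%R => [|a a0].
  apply: mulr_gt0; last by rewrite invr_gt0.
  apply: mulr_gt0 => //; apply: mulr_gt0; last exact: ltr_wpDl.
  apply: powR_gt0; rewrite ltr0n; apply/card_gt0P.
  by exists (m0 n oddL, m0 n oddL).
set X := \esum_(v in _) a v `^ r.
have X0 : 0 <= X by apply: esum_ge0 => v _; exact: poweR_ge0.
pose cs s v := \sum_(tau : M * M) a (shift tau (anc s v)).
have cs0 s v : 0 <= cs s v by exact: sume_ge0.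
have step v : ancestral_sum q a v `^ r <=
    c%:E * \sum_(s <oo) ((th * (q / th) `^ r) ^+ s)%:E * cs s v `^ r.
  have -> : ancestral_sum q a v = \sum_(s <oo) (th ^+ s)%:E * (((q / th) ^+ s)%:E * cs s v).
    apply: eq_eseriesr => s _; rewrite muleA -EFinM -exprMn (_ : th * (q / th) = q)%R//.
    by field; rewrite gt_eqF.
  have qth s : (0 <= (q / th) ^+ s)%R by rewrite exprn_ge0// divr_ge0// ltW.
  rewrite (le_trans (geometric_convexity (ltW r1) th01 _))// => [s|].
    by rewrite mule_ge0// lee_fin.
  rewrite cE lee_wpmul2l ?lee_fin ?(ltW c0)//.
  apply: lee_nneseries => [s _ _|s _]; first by rewrite mule_ge0 ?poweR_ge0// lee_fin exprn_ge0// ltW.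
  rewrite poweRM ?lee_fin// muleA poweR_EFin -EFinM.
  rewrite (_ : th ^+ s * ((q / th) ^+ s) `^ r = (th * (q / th) `^ r) ^+ s)%R//.
  rewrite [RHS]exprMn; congr (_ * _)%R.
  have qt0 : (0 <= q / th)%R by rewrite divr_ge0// ltW.
  by rewrite -(powR_mulrn s qt0) -(powR_mulrn s (powR_ge0 (q / th) r)) powRAC.
have kap0 s : (0 <= (th * (q / th) `^ r) ^+ s)%R by rewrite exprn_ge0// mulr_ge0 ?powR_ge0// ltW.
have card s : \esum_(v in [set: V]) cs s v `^ r <= ((2 ^+ n) ^+ s)%:E * ((N `^ r * (N + 1))%:E * X).
  apply: (@le_trans _ _ (\esum_(v in [set: V]) ((N `^ r)%:E * \sum_(tau : M * M) a (shift tau (anc s v)) `^ r))).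
    by apply: le_esum => v _; exact: sum_poweR_le.
  have F0 u : 0 <= \sum_(tau : M * M) a (shift tau u) `^ r by apply: sume_ge0 => tau _; exact: poweR_ge0.
  rewrite esumZl// (EFinM (N `^ r)) -(muleA (N `^ r)%:E) [leRHS]muleCA lee_wpmul2l ?lee_fin//.
  apply: (le_trans (esum_anc s F0)).
  rewrite lee_wpmul2l ?lee_fin ?exprn_ge0//; apply: esum_le_seq => l ul.
  rewrite exchange_big/= (@le_trans _ _ (\sum_(tau : M * M) X))//.
    apply: lee_sum => tau _; apply: (@esum_inj_le (shift tau) xpredT (fun v => a v `^ r)) => //.
      by move=> v; exact: poweR_ge0.
    by move=> u v _ _; exact: shift_inj.
  by rewrite sum_cst lee_wpmul2r// lee_fin lerDl.
apply: esum_le_seq => l ul.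
apply: (@le_trans _ _ (\sum_(v <- l) c%:E * \sum_(s <oo) ((th * (q / th) `^ r) ^+ s)%:E * cs s v `^ r)).
  by apply: lee_sum => v _.
rewrite -ge0_sume_distrr => [|v _]; last first.
  by apply: nneseries_ge0 => s _ _; rewrite mule_ge0 ?poweR_ge0// lee_fin.
rewrite -mulrA (EFinM c) -(muleA c%:E) lee_wpmul2l ?lee_fin ?(ltW c0)//.
rewrite -nneseries_sum; last by move=> v s _; rewrite mule_ge0 ?poweR_ge0// lee_fin.
rewrite [X in _ <= X%:E * _]mulrC (EFinM (1 - rho `^ 2^-1)^-1) -muleA.
have Y0 : 0 <= (N `^ r * (N + 1))%:E * X by rewrite mule_ge0// lee_fin mulr_ge0 ?addr_ge0.
apply: (le_trans _ (geometric_sum_le lt12 Y0)).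
apply: lee_nneseries => [s _ _|s _].
  by apply: sume_ge0 => v _; rewrite mule_ge0 ?poweR_ge0// lee_fin.
rewrite -ge0_sume_distrr => [|v _]; last exact: poweR_ge0.
have kE : (((rho `^ 2^-1) ^+ s)%:E = ((th * (q / th) `^ r) ^+ s)%:E * ((2 ^+ n) ^+ s)%:E).
  by rewrite -EFinM -exprMn thE.
rewrite kE -[leRHS]muleA lee_wpmul2l ?lee_fin//.
by apply: (le_trans _ (card s)); apply: seq_le_esum => // v; exact: poweR_ge0.
Qed.

(** With q = 2^(-n/t) one has q^r 2^n = 2^(-n (r/t - 1)), which is below 1 exactly when t < r; for
    the supremum norm q < 1 is enough. *)
Lemma ancestral_sum_norm (oddL : odd L) (q t C0 : R) (r : \bar R) : (0 < n)%N -> (0 < t)%R -> q = (2 `^ (- (n%:R / t)))%R ->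
  (0 <= C0)%R -> r = +oo \/ (exists2 r' : R, r = r'%:E & (1 < r')%R /\ (t < r')%R) ->
  exists2 C : R, (0 < C)%R & forall a b, (forall v, 0 <= a v) -> (forall v, 0 <= b v) ->
    (forall v, b v <= C0%:E * ancestral_sum q a v) -> seq_norm r b <= C%:E * seq_norm r a.
Proof.
move=> n0 t0 qE C00 hr.
have nt0 : (0 < n%:R / t)%R by rewrite divr_gt0// ltr0n.
have p21 (e : R) : (0 < e)%R -> (2 `^ (- e) < 1 :> R)%R.
  move=> e0; rewrite powRN invf_lt1 ?powR_gt0//.
  have := @gt0_ltr_powR _ _ e0 1%R 2%R; rewrite !nnegrE powR1; apply => //.
  by rewrite ltr1n.
have q0 : (0 < q)%R by rewrite qE powR_gt0.
have q1 : (q < 1)%R by rewrite qE p21.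
have C10 : (0 < C0 + 1)%R by exact: ltr_wpDl.
case: hr => [->|[r' -> [r1 tr]]].
  have [|C Cp CP] := @ancestral_sum_sup q; first by rewrite (ltW q0).
  exists ((C0 + 1) * C)%R; first exact: mulr_gt0.
  move=> a b a0 b0 ab; apply: ge_ereal_sup => _ [v _ <-].
  rewrite (le_trans (ab v))// (EFinM (C0 + 1)) -muleA lee_pmul ?lee_fin//.
  - by apply: ancestral_sum_ge0 => //; exact: ltW.
  - by rewrite lerDl.
  - exact: CP.
have r0 : (0 < r')%R by exact: lt_trans r1.
have [||C Cp CP] := @ancestral_sum_power q r' oddL _ r1; first by rewrite q0.
  rewrite qE -powRrM -powR_mulrn// -powRD; last by rewrite pnatr_eq0 implybT.
  rewrite (_ : (- (n%:R / t) * r' + n%:R = - (n%:R * (r' / t - 1)))%R); last by ring.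
  by rewrite p21// mulr_gt0 ?ltr0n// subr_gt0 ltr_pdivlMr// mul1r.
exists (((C0 + 1) `^ r' * C) `^ r'^-1)%R; first by rewrite powR_gt0// mulr_gt0// powR_gt0.
move=> a b a0 b0 ab /=.
have S0 : 0 <= \esum_(v in [set: V]) a v `^ r' by apply: esum_ge0 => v _; exact: poweR_ge0.
have CC0 : (0 <= (C0 + 1) `^ r' * C)%R by rewrite mulr_ge0 ?powR_ge0// ltW.
rewrite -poweR_EFin -poweRM ?lee_fin//.
apply: ge0_ler_poweR; first by rewrite invr_ge0 ltW.
  by apply: esum_ge0 => v _; exact: poweR_ge0.
apply: (@le_trans _ _ (\esum_(v in [set: V]) (((C0 + 1) `^ r')%:E * ancestral_sum q a v `^ r'))).
  apply: le_esum => v _.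
  have A0 : 0 <= ancestral_sum q a v by apply: ancestral_sum_ge0 => //; exact: ltW.
  rewrite -poweR_EFin -poweRM ?lee_fin ?(ltW C10)//; apply: ge0_ler_poweR => //; first exact: ltW.
  by rewrite (le_trans (ab v))// lee_wpmul2r// lee_fin lerDl.
rewrite esumZl ?powR_ge0//; last by move=> v; exact: poweR_ge0.
by rewrite EFinM -muleA lee_wpmul2l ?lee_fin ?powR_ge0//; exact: CP.
Qed.

End sequence_norms.

(** * Local estimates *)

Section local_norms.
Context {R : realType} (n : nat).
Local Notation V := (int * 'rV[int]_n)%type.
Local Notation cube := (@lcell R 1 n).
Local Notation mu := (lebesgue_rV R n).
Local Notation J f := (\int[mu]_x f x)%R.
Local Notation ii f := (mu.-integrable [set: 'rV[R]_n] (EFin \o f)).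
Implicit Types (p : 'I_n -> R) (F G : 'rV[R]_n -> \bar R).
Local Open Scope ereal_scope.

Definition scale (v : V) : R := (2 ^ (- v.1))%R.
Definition conj_exp p : 'I_n -> R := fun i => (p i / (p i - 1))%R.
(** The degree of homogeneity of the mixed norm: the indicator of a cube has the norm given by this
    power of the side. *)
Definition dim p : R := (\sum_i (p i)^-1)%R.

Lemma scale_gt0 v : (0 < scale v)%R. Proof. exact: exp2z_gt0. Qed.

Lemma measurable_lcell L v : measurable (@lcell R L n v).
Proof. exact: measurable_box. Qed.

Lemma conj_exp_gt1 p i : (1 < p i)%R -> (1 < conj_exp p i)%R.
Proof. by move=> h; rewrite /conj_exp ltr_pdivlMr ?subr_gt0// mul1r gtrBl. Qed.

Lemma conj_expP p i : (1 < p i)%R -> ((p i)^-1 + (conj_exp p i)^-1 = 1)%R.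
Proof.
move=> h; rewrite /conj_exp; field.
by rewrite !gt_eqF// ?subr_gt0// (lt_trans _ h).
Qed.

Lemma dim_conj p : (forall i, 1 < p i)%R -> dim (conj_exp p) = (n%:R - dim p)%R.
Proof.
move=> p1; have nE : (n%:R = \sum_(i < n) 1 :> R)%R by rewrite sumr_const card_ord.
rewrite /dim nE -sumrB.
by apply: eq_bigr => i _; have := conj_expP (p1 i); lra.
Qed.

Lemma scale_dim p v : (\prod_(i < n) scale v `^ (p i)^-1 = scale v `^ dim p)%R.
Proof.
rewrite /dim; apply: (big_ind2 (fun (x y : R) => x = scale v `^ y)%R).
- by rewrite powRr0.
- by move=> x y z w -> ->; rewrite powRD// (gt_eqF (scale_gt0 v)) implybT.
- by [].
Qed.

Lemma mixed_norm_cube p v : (forall i, 0 < p i)%R ->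
  mixed_norm p (fun x => (\1_(cube v) x)%:E) = (scale v `^ dim p)%:E.
Proof.
move=> p0; rewrite mixed_norm_box//; last first.
  by move=> i; rewrite ler_pM2l ?exp2z_gt0// ler_int lerDl.
rewrite -scale_dim; congr EFin; apply: eq_bigr => i _.
by rewrite lcell_side mulr1.
Qed.

Lemma measurable_on F (A : set 'rV[R]_n) : measurable A -> measurable_fun setT F ->
  measurable_fun setT (fun x => F x * (\1_A x)%:E).
Proof.
by move=> mA mF; apply: emeasurable_funM => //; apply/measurable_EFinP; exact: measurable_indic.
Qed.

Lemma on_ge0 F (A : set 'rV[R]_n) x : (forall x, 0 <= F x) -> 0 <= F x * (\1_A x)%:E.
Proof. by move=> F0; rewrite mule_ge0// lee_fin. Qed.

Lemma mixed_norm_on_ge0 p A F : 0 <= mixed_norm_on p A F.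
Proof. exact: mixed_norm_ge0. Qed.

Lemma mixed_norm_on_le p (A B : set 'rV[R]_n) F G : (forall i, 0 < p i)%R ->
  measurable A -> measurable B -> measurable_fun setT F -> measurable_fun setT G ->
  (forall x, 0 <= F x) -> (forall x, 0 <= G x) -> (forall x, A x -> B x /\ F x <= G x) ->
  mixed_norm_on p A F <= mixed_norm_on p B G.
Proof.
move=> p0 mA mB mF mG F0 G0 FG; apply: mixed_norm_le => //.
- exact: measurable_on.
- exact: measurable_on.
- by move=> x; exact: on_ge0.
- move=> x; have [Ax|Ax] := pselect (A x); last by rewrite indicE memNset// mule0 on_ge0.
  by have [Bx h] := FG x Ax; rewrite !indicE !mem_set// !mule1.
Qed.

Lemma hoelder_cube p F v : (forall i, 1 < p i)%R -> measurable_fun setT F ->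
  (forall x, 0 <= F x) ->
  \int[mu]_x (F x * (\1_(cube v) x)%:E) <=
  mixed_norm_on p (cube v) F * (scale v `^ (n%:R - dim p))%:E.
Proof.
move=> p1 mF F0; have p0 i : (0 < p i)%R by exact: lt_trans (p1 i).
have q0 i : (0 < conj_exp p i)%R by exact: lt_trans (conj_exp_gt1 (p1 i)).
have mc := measurable_lcell 1 v.
have m1 : measurable_fun setT (fun x => (\1_(cube v) x)%:E : \bar R).
  by apply/measurable_EFinP; exact: measurable_indic.
rewrite -dim_conj// -(mixed_norm_cube _ q0).
rewrite (_ : (fun x => F x * _) = (fun x => (F x * (\1_(cube v) x)%:E) * (\1_(cube v) x)%:E)).
  apply: mixed_hoelder => //.
  - by move=> i; exact: conj_expP.
  - exact: measurable_on.
  - by move=> x; exact: on_ge0.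
apply/funext => x; rewrite -muleA -EFinM; congr (_ * _%:E).
by rewrite indicE; case: (x \in _); rewrite ?mulr1 ?mulr0.
Qed.

Section cover.
Variables (L : nat) (oddL : odd L).
Local Notation big := (@lcell R L n).
Local Notation M := {ffun 'I_n -> 'I_L}.

Lemma big_cover v x : (\1_(big v) x <= \sum_(m : M) \1_(cube (shift (m0 n oddL, m) v)) x :> R)%R.
Proof.
have [vx|vx] := pselect (big v x); last by rewrite indicE memNset// sumr_ge0.
have [m mx] := shift_of oddL vx; rewrite (bigD1 m)//= [leLHS]indicE mem_set//.
by rewrite indicE mem_set// lerDl sumr_ge0.
Qed.

Lemma on_big_le F v x : (forall x, 0 <= F x) -> F x * (\1_(big v) x)%:E <=
  \sum_(m : M) F x * (\1_(cube (shift (m0 n oddL, m) v)) x)%:E.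
Proof.
move=> F0; rewrite -ge0_sume_distrr => [|m _]; last by rewrite lee_fin.
by rewrite lee_wpmul2l// sumEFin lee_fin big_cover.
Qed.

Lemma mixed_norm_on_big p : (forall i, 1 < p i)%R ->
  exists2 c : R, (0 < c)%R & forall F v, measurable_fun setT F -> (forall x, 0 <= F x) ->
  mixed_norm_on p (big v) F <=
  c%:E * \sum_(m : M) mixed_norm_on p (cube (shift (m0 n oddL, m) v)) F.
Proof.
move=> p1; have [c c0 cP] := @mixed_norm_sum R n p M (fun i => ltW (p1 i)).
exists c => // F v mF F0.
have mon m : measurable_fun setT (fun x => F x * (\1_(cube (shift (m0 n oddL, m) v)) x)%:E).
  by apply: measurable_on => //; exact: measurable_lcell.
apply: (le_trans _ (cP _ mon (fun m x => on_ge0 _ _ F0))).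
apply: mixed_norm_le.
- by move=> i; exact: lt_trans (p1 i).
- by apply: measurable_on => //; exact: measurable_lcell.
- exact: emeasurable_sum.
- by move=> x; exact: on_ge0.
- by move=> x; exact: on_big_le.
Qed.

Lemma integral_big_le p F v : (forall i, 1 < p i)%R -> measurable_fun setT F -> (forall x, 0 <= F x) ->
  \int[mu]_x (F x * (\1_(big v) x)%:E) <=
  (\sum_(m : M) mixed_norm_on p (cube (shift (m0 n oddL, m) v)) F) *
  (scale v `^ (n%:R - dim p))%:E.
Proof.
move=> p1 mF F0.
have mon m : measurable_fun setT (fun x => F x * (\1_(cube (shift (m0 n oddL, m) v)) x)%:E).
  by apply: measurable_on => //; exact: measurable_lcell.
apply: (@le_trans _ _ (\int[mu]_x \sum_(m : M) F x * (\1_(cube (shift (m0 n oddL, m) v)) x)%:E)).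
  apply: le_int => //.
  - by apply: measurable_on => //; exact: measurable_lcell.
  - exact: emeasurable_sum.
  - by move=> x; exact: on_ge0.
  - by move=> x _; exact: on_big_le.
rewrite ge0_integral_sum//; last by move=> m x _; exact: on_ge0.
rewrite ge0_sume_distrl => [|m _]; last exact: mixed_norm_on_ge0.
by apply: lee_sum => m _; exact: hoelder_cube.
Qed.

End cover.

Definition locally_mixed p (f : 'rV[R]_n -> R) : Prop :=
  measurable_fun setT f /\ forall v, mixed_norm_on p (cube v) (fun x => `|f x|%:E) < +oo.

Lemma locally_mixed_big p f L v : odd L -> (forall i, 1 < p i)%R -> locally_mixed p f ->
  ii (fun x => f x * \1_(@lcell R L n v) x)%R.
Proof.
move=> oddL p1 [mf fv]; have ma : measurable_fun setT (fun x => `|f x|%:E).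
  by apply/measurable_EFinP; exact: measurableT_comp.
apply/integrableP; split.
  apply/measurable_EFinP; apply: measurable_funM => //; apply: measurable_indic.
  exact: measurable_lcell.
rewrite (_ : (fun x => _) = (fun x => `|f x|%:E * (\1_(@lcell R L n v) x)%:E)); last first.
  by apply/funext => x /=; rewrite normrM -EFinM [X in (_ * X)%R]ger0_norm.
apply: (le_lt_trans (integral_big_le oddL v p1 ma _)) => //.
rewrite lte_mul_pinfty//.
- by apply: sume_ge0 => m _; exact: mixed_norm_on_ge0.
- rewrite ge0_fin_numE; last by apply: sume_ge0 => m _; exact: mixed_norm_on_ge0.
  by apply/lte_sum_pinfty => m _; exact: fv.
- by rewrite ltry.
Qed.

End local_norms.

Section cauchy_schwarz.
Context {R : realType}.

Lemma sum_cauchy_schwarz (I : Type) (s : seq I) (a b : I -> R) :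
  \sum_(i <- s) `|a i| * `|b i| <=
  Num.sqrt (\sum_(i <- s) a i ^+ 2) * Num.sqrt (\sum_(i <- s) b i ^+ 2).
Proof.
elim: s => [|i s ih]; first by rewrite !big_nil sqrtr0 mul0r.
rewrite !big_cons; move: ih.
set A := \sum_(i <- s) a i ^+ 2; set B := \sum_(i <- s) b i ^+ 2.
have A0 : 0 <= A by apply: sumr_ge0 => j _; exact: sqr_ge0.
have B0 : 0 <= B by apply: sumr_ge0 => j _; exact: sqr_ge0.
move=> ih; rewrite (le_trans (lerD (lexx _) ih))// -[leRHS]sqrtrM ?addr_ge0 ?sqr_ge0//.
have -> : `|a i| * `|b i| + Num.sqrt A * Num.sqrt B =
    Num.sqrt ((`|a i| * `|b i| + Num.sqrt A * Num.sqrt B) ^+ 2).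
  by rewrite [RHS]sqrtr_sqr [RHS]ger0_norm.
rewrite ler_wsqrtr// -subr_ge0.
rewrite -[a i ^+ 2]real_normK ?num_real// -[b i ^+ 2]real_normK ?num_real//.
move: (sqr_sqrtr A0) (sqr_sqrtr B0); move: (Num.sqrt A) (Num.sqrt B) `|a i| `|b i| => u v x y <- <-.
have -> : (x ^+ 2 + u ^+ 2) * (y ^+ 2 + v ^+ 2) - (x * y + u * v) ^+ 2 = (x * v - u * y) ^+ 2 by ring.
exact: sqr_ge0.
Qed.
End cauchy_schwarz.

(** * Size of wavelet coefficients *)

Section local_wavelets.
Context {R : realType} (n : nat) (n_gt0 : (0 < n)%N)
  (psi : 'I_(2 ^ n - 1) -> 'rV[R]_n -> R).
Local Notation V := (int * 'rV[int]_n)%type.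
Local Notation cube := (@lcell R 1 n).
Local Notation mu := (lebesgue_rV R n).
Local Notation J f := (\int[mu]_x f x)%R.
Local Notation ii f := (mu.-integrable [set: 'rV[R]_n] (EFin \o f)).
Implicit Types (p : 'I_n -> R) (f g : 'rV[R]_n -> R).
Variables (L : nat) (K0 : R) (oddL : odd L).
Local Notation big := (@lcell R L n).
Local Notation M := {ffun 'I_n -> 'I_L}.
Hypothesis H : wavelet_frame mu big (@lchild L n) fst (wavelet psi) K0 (2 ^+ n).
Local Notation wc := (wcoef mu (wavelet psi)).
Local Notation csq := (wsq mu cube (wavelet psi)).
Local Notation sf f := (fun x => (rsquare psi f x `^ 2^-1)%E).
Local Notation sc v := (@scale R n v).
Let F := @forest_rV R L oddL n.

Let K0_ge0 : 0 <= K0. Proof. exact: wf_K0 H. Qed.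
Let L_gt0 : (0 < L)%N. Proof. by case: (L) oddL. Qed.
Let sc0 (v : V) : 0 < sc v. Proof. exact: scale_gt0. Qed.

Definition wpair f g w : R := \sum_l `|wc f l w| * `|wc g l w|.

Lemma wpair_ge0 f g w : 0 <= wpair f g w.
Proof. by apply: sumr_ge0 => l _; rewrite mulr_ge0. Qed.

Lemma sqrt_scale w : Num.sqrt (sc w ^+ n) = sc w `^ (n%:R / 2).
Proof. by rewrite -powR12_sqrt ?exprn_ge0 ?(ltW (sc0 w))// -powR_mulrn ?(ltW (sc0 w))// -powRrM. Qed.

Lemma inv_sqrt_vol w : (Num.sqrt (vol mu big w))^-1 <= sc w `^ (- (n%:R / 2)).
Proof.
rewrite powRN -sqrt_scale lef_pV2 ?posrE ?sqrtr_gt0 ?exprn_gt0 ?(vol_gt0 F)//.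
rewrite ler_wsqrtr// vol_lcell lerXn2r ?nnegrE ?(ltW (sc0 w)) ?mulr_ge0 ?(ltW (exp2z_gt0 _))//.
by rewrite /scale ler_peMr ?(ltW (exp2z_gt0 _))// ler1n.
Qed.

Lemma cube_sub_big w : cube w `<=` big w.
Proof.
move=> x wx; apply: lcellP => i; have /andP[-> h2] := lcell_le i wx.
by rewrite (lt_le_trans h2)// ler_int lerD2l lez_nat.
Qed.

Lemma normr_wcoef_int g l w : ii g -> `|wc g l w| <= K0 * sc w `^ (- (n%:R / 2)) * J (fun x => `|g x|).
Proof.
move=> ig; have gloc v : ii (fun x => g x * \1_(big v) x).
  apply: (@integrable_mulR _ _ _ _ _ _ 1) => //.
    by apply: measurable_indic; exact: measurable_lcell.
  by move=> x; rewrite ger0_norm// indicE; case: (_ \in _).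
rewrite (le_trans (normr_wcoef H gloc l w))// ler_pM ?iabs_ge0 ?mulr_ge0 ?invr_ge0//.
  by rewrite ler_wpM2l// inv_sqrt_vol.
apply: Rintegral_leR; [exact: integrable_iabs gloc _|exact: integrable_normR|].
by move=> x; rewrite ler_piMr// indicE; case: (_ \in _).
Qed.

(** The local norms of [f] on the L^n cubes that cover the support cell of [w]; by Hoelder it
    controls the integral of |f| there. *)
Definition kf p f w : \bar R :=
  (\sum_(m : M) mixed_norm_on p (cube (shift (m0 n oddL, m) w)) (fun x => `|f x|%:E))%E.

Lemma kf_fin p f w : locally_mixed p f -> (kf p f w < +oo)%E.
Proof. by move=> [_ fv]; apply/lte_sum_pinfty => m _; exact: fv. Qed.

Lemma kf_ge0 p f w : (0 <= kf p f w)%E.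
Proof. by apply: sume_ge0 => m _; exact: mixed_norm_on_ge0. Qed.

Lemma normr_wcoef_local p f l w : (forall i, 1 < p i) -> locally_mixed p f ->
  `|wc f l w| <= K0 * sc w `^ (n%:R / 2 - dim p) * fine (kf p f w).
Proof.
move=> p1 fp; have gloc v := locally_mixed_big v oddL p1 fp.
have [mf _] := fp; have ma : measurable_fun setT (fun x => `|f x|%:E).
  by apply/measurable_EFinP; exact: measurableT_comp.
have ik : iabs mu big f w <= fine (kf p f w) * sc w `^ (n%:R - dim p).
  rewrite -lee_fin EFin_Rintegral; last exact: integrable_iabs gloc _.
  rewrite EFinM fineK ?ge0_fin_numE ?kf_ge0 ?kf_fin//.
  under eq_integral do rewrite EFinM.
  by apply: integral_big_le => // x; rewrite lee_fin.
rewrite (le_trans (normr_wcoef H gloc l w))//.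
have -> : n%:R / 2 - dim p = - (n%:R / 2) + (n%:R - dim p) :> R by field.
rewrite powRD; last by rewrite (gt_eqF (sc0 w)) implybT.
set S1 := _ `^ (- _); set S2 := _ `^ (_ - _) => /=.
have -> : K0 * (S1 * S2) * fine (kf p f w) = (K0 * S1) * (fine (kf p f w) * S2) by ring.
rewrite ler_pM ?iabs_ge0 ?mulr_ge0 ?invr_ge0//.
by rewrite ler_wpM2l// inv_sqrt_vol.
Qed.

Lemma csqE f w : csq f w = (\sum_l wc f l w ^+ 2) / sc w ^+ n.
Proof. by rewrite /wsq vol_lcell mulr1. Qed.

Lemma csq_ge0 f w : 0 <= csq f w.
Proof. exact: (wsq_ge0 _ (@forest_rV R 1 isT n)). Qed.

Lemma sum_wcoef f w : Num.sqrt (\sum_l wc f l w ^+ 2) = sc w `^ (n%:R / 2) * Num.sqrt (csq f w).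
Proof.
rewrite -sqrt_scale -sqrtrM ?exprn_ge0 ?(ltW (sc0 w))// csqE mulrC divfK//.
by rewrite gt_eqF// exprn_gt0.
Qed.

Lemma normr_wcoef_csq f l w : `|wc f l w| <= sc w `^ (n%:R / 2) * Num.sqrt (csq f w).
Proof.
rewrite -sum_wcoef -sqrtr_sqr ler_wsqrtr// (bigD1 l)//= lerDl.
by apply: sumr_ge0 => j _; exact: sqr_ge0.
Qed.

Let nl : R := (2 ^ n - 1)%:R.

Lemma sqrt_csq_local p f w : (forall i, 1 < p i) -> locally_mixed p f ->
  Num.sqrt (csq f w) <= (nl + 1) * K0 * sc w `^ (- dim p) * fine (kf p f w).
Proof.
move=> p1 fp; have k0 : 0 <= fine (kf p f w) by rewrite fine_ge0// kf_ge0.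
have nl0 : 0 <= nl by [].
have S0 : 0 < sc w `^ (n%:R / 2) by rewrite powR_gt0.
have R0 : 0 <= (nl + 1) * K0 * sc w `^ (- dim p) * fine (kf p f w).
  by rewrite mulr_ge0// mulr_ge0 ?powR_ge0// mulr_ge0// addr_ge0.
rewrite -(ler_pM2l S0) -sum_wcoef.
set B := K0 * sc w `^ (n%:R / 2 - dim p) * fine (kf p f w).
have B0 : 0 <= B by rewrite mulr_ge0// mulr_ge0// powR_ge0.
rewrite (_ : _ * (_ * _) = (nl + 1) * B); last first.
  rewrite /B powRD; last by rewrite (gt_eqF (sc0 w)) implybT.
  by ring.
have nB0 : 0 <= (nl + 1) * B by rewrite mulr_ge0// addr_ge0.
rewrite -[leRHS](ger0_norm nB0) -sqrtr_sqr ler_wsqrtr//.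
rewrite (@le_trans _ _ (\sum_(l < 2 ^ n - 1) B ^+ 2))//.
  apply: ler_sum => l _; rewrite -real_normK ?num_real// lerXn2r ?nnegrE//.
  exact: normr_wcoef_local.
rewrite sumr_const card_ord -[leLHS]mulr_natl [leRHS]exprMn ler_wpM2r ?sqr_ge0//.
by rewrite -/nl; nra.
Qed.

(** The coefficient of [f] is bounded by local norms, that of [g] by the full L^1 norm; the powers
    n/2 and -n/2 of the side cancel. This is how wavelets much coarser than the support of [g] are
    treated. *)
Lemma wpair_far p f g w : (forall i, 1 < p i) -> locally_mixed p f -> ii g ->
  wpair f g w <= nl * K0 ^+ 2 * J (fun x => `|g x|) * (sc w `^ (- dim p) * fine (kf p f w)).
Proof.
move=> p1 fp ig; set G := J _.
have G0 : 0 <= G by apply: Rintegral_ge0.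
have k0 : 0 <= fine (kf p f w) by rewrite fine_ge0// kf_ge0.
apply: (@le_trans _ _ (\sum_(l < 2 ^ n - 1) K0 ^+ 2 * G * (sc w `^ (- dim p) * fine (kf p f w)))).
  apply: ler_sum => l _.
  rewrite (le_trans (ler_pM _ _ (normr_wcoef_local l w p1 fp) (normr_wcoef_int l w ig)))//.
  have -> : sc w `^ (- dim p) = sc w `^ (n%:R / 2 - dim p) * sc w `^ (- (n%:R / 2)).
    rewrite -powRD; last by rewrite (gt_eqF (sc0 w)) implybT.
    by congr (_ `^ _); ring.
  by rewrite le_eqVlt; apply/orP; left; apply/eqP; rewrite -[Rintegral _ _ _]/G; ring.
rewrite sumr_const card_ord -[leLHS]mulr_natl -/nl.
by rewrite le_eqVlt; apply/orP; left; apply/eqP; ring.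
Qed.

Lemma wpair_far_csq f g w : ii g ->
  wpair f g w <= nl * K0 * J (fun x => `|g x|) * Num.sqrt (csq f w).
Proof.
move=> ig; set G := J _.
have G0 : 0 <= G by apply: Rintegral_ge0.
apply: (@le_trans _ _ (\sum_(l < 2 ^ n - 1) K0 * G * Num.sqrt (csq f w))).
  apply: ler_sum => l _.
  rewrite (le_trans (ler_pM _ _ (normr_wcoef_csq f l w) (normr_wcoef_int l w ig)))//.
  rewrite powRN; have S0 : sc w `^ (n%:R / 2) != 0 by rewrite gt_eqF// powR_gt0.
  by rewrite le_eqVlt; apply/orP; left; apply/eqP; rewrite -[Rintegral _ _ _]/G; field.
rewrite sumr_const card_ord -[leLHS]mulr_natl -/nl.
by rewrite le_eqVlt; apply/orP; left; apply/eqP; ring.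
Qed.

Lemma rsquare_seq f (s : seq V) x : uniq s ->
  ((Num.sqrt (\sum_(w <- s) (Num.sqrt (csq f w) * \1_(cube w) x) ^+ 2))%:E <= rsquare psi f x `^ 2^-1)%E.
Proof.
move=> us; rewrite -powR12_sqrt; last by apply: sumr_ge0 => w _; exact: sqr_ge0.
rewrite -poweR_EFin; apply: ge0_ler_poweR => //.
  by rewrite lee_fin; apply: sumr_ge0 => w _; exact: sqr_ge0.
rewrite -sumEFin /rsquare (eq_bigr (fun w => (csq f w * \1_(cube w) x)%:E)).
  by apply: seq_le_esum => // w; rewrite lee_fin mulr_ge0 ?csq_ge0.
move=> w _; rewrite exprMn sqr_sqrtr ?csq_ge0//.
by rewrite indicE; case: (_ \in _); rewrite ?expr1n ?expr0n.
Qed.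

Lemma measurable_sf f : measurable_fun setT (sf f).
Proof. by apply: emeasurable_poweR; exact: measurable_rsquare. Qed.

Lemma sf_ge0 f x : (0 <= sf f x)%E. Proof. exact: poweR_ge0. Qed.

(** Cauchy-Schwarz over the wavelets of one index, after which the product of the coefficients is an
    integral over the cube; a pointwise Cauchy-Schwarz over the indices then produces the two square
    functions. *)
Lemma wpair_near f g (A : set 'rV[R]_n) (s : seq V) : uniq s -> measurable A ->
  (forall w, w \in s -> cube w `<=` A) ->
  (\sum_(w <- s) (wpair f g w)%:E <= \int[mu]_x (sf f x * (\1_A x)%:E * sf g x))%E.
Proof.
move=> us mA sA.
have m1 w : measurable_fun setT (fun x => (Num.sqrt (csq f w) * Num.sqrt (csq g w) * \1_(cube w) x)%:E : \bar R).
  apply/measurable_EFinP; apply: measurable_funM => //; apply: measurable_indic.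
  exact: measurable_lcell.
apply: (@le_trans _ _ (\int[mu]_x \sum_(w <- s) (Num.sqrt (csq f w) * Num.sqrt (csq g w) * \1_(cube w) x)%:E)%E).
  rewrite ge0_integral_sum//.
  apply: lee_sum => w _.
  have c0 : 0 <= Num.sqrt (csq f w) * Num.sqrt (csq g w) by rewrite mulr_ge0.
  under eq_integral do rewrite EFinM.
  rewrite intZl//; last first.
    by apply/measurable_EFinP; apply: measurable_indic; exact: measurable_lcell.
  rewrite integral_indic//; last exact: measurable_lcell.
  have muE : (mu (cube w) = (sc w ^+ n)%:E)%E by rewrite [LHS](lebesgue_lcell 1 w) mulr1.
  rewrite setIT [X in (_ <= _ * X)%E]muE -EFinM lee_fin.
  rewrite (le_trans (sum_cauchy_schwarz _ _ _))// !sum_wcoef.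
  have -> : sc w ^+ n = sc w `^ (n%:R / 2) * sc w `^ (n%:R / 2).
    rewrite -powRD; last by rewrite (gt_eqF (sc0 w)) implybT.
    rewrite (_ : n%:R / 2 + n%:R / 2 = n%:R :> R); last by field.
    by rewrite powR_mulrn// ltW.
  by rewrite le_eqVlt; apply/orP; left; apply/eqP; ring.
apply: le_int => //.
- exact: emeasurable_sum.
- apply: emeasurable_funM; last exact: measurable_sf.
  by apply: measurable_on => //; exact: measurable_sf.
- by move=> x; apply: sume_ge0 => w _; rewrite lee_fin !mulr_ge0.
move=> x _.
have [Ax|Ax] := pselect (A x); last first.
  rewrite big1_seq => [|w /= ws].
    by rewrite mule_ge0 ?poweR_ge0// mule_ge0 ?poweR_ge0// lee_fin.
  by rewrite [\1_(cube w) x]indicE memNset ?mulr0// => /(sA w ws).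
rewrite [\1_A x]indicE mem_set// mule1.
apply: (@le_trans _ _ ((Num.sqrt (\sum_(w <- s) (Num.sqrt (csq f w) * \1_(cube w) x) ^+ 2))%:E *
   (Num.sqrt (\sum_(w <- s) (Num.sqrt (csq g w) * \1_(cube w) x) ^+ 2))%:E)%E).
  rewrite sumEFin -EFinM lee_fin; apply: (le_trans _ (sum_cauchy_schwarz _ _ _)).
  apply: ler_sum => w _; rewrite !ger0_norm ?mulr_ge0//.
  by rewrite indicE; case: (_ \in _); rewrite ?mulr1 ?mulr0.
by rewrite lee_pmul ?lee_fin ?rsquare_seq.
Qed.

End local_wavelets.

(** * Parseval's inequality *)

Section lebesgue_measurability.
Context {R : realType} (n : nat).
Local Notation mu := (lebesgue_rV R n).

Lemma borel_lebesgue_measurable (h : 'rV[R]_n -> R) : measurable_fun setT h ->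
  lebesgue_measurable h.
Proof.
move=> mh B mB; exists (h @^-1` B); first by rewrite -[X in measurable X]setTI; exact: mh.
by exists set0; [exact: negligible_set0|rewrite setU0].
Qed.

Lemma complex_ReM (c : R[i]) (a : R) : complex.Re (c * a%:C%C) = complex.Re c * a.
Proof. by case: c => x y; rewrite /= mulr0 subr0. Qed.

Lemma complex_ImM (c : R[i]) (a : R) : complex.Im (c * a%:C%C) = complex.Im c * a.
Proof. by case: c => x y; rewrite /= mulr0 add0r. Qed.

Lemma normc_sqr (c : R[i]) : Normc.normc c ^+ 2 = complex.Re c ^+ 2 + complex.Im c ^+ 2.
Proof. by case: c => x y /=; rewrite sqr_sqrtr// addr_ge0 ?sqr_ge0. Qed.

Lemma modulus_L2 (f : 'rV[R]_n -> R[i]) :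
  ('N[mu]_(2%:E)[modulus f] `^ 2 =
   \int[mu]_x (complex.Re (f x) ^+ 2 + complex.Im (f x) ^+ 2)%:E)%E.
Proof.
rewrite poweR_Lnorm ?pnatr_eq0//; apply: eq_integral => x _.
rewrite /modulus -normc_sqr abse_EFin poweR_EFin powR_mulrn//.
by rewrite real_normK// num_real.
Qed.

End lebesgue_measurability.

Section parseval_L2.
Context {R : realType} (n : nat) (n_gt0 : (0 < n)%N)
  (psi : 'I_(2 ^ n - 1) -> 'rV[R]_n -> R).
Hypothesis psiP : compact_wavelets n.+1 n psi.
Local Notation V := (int * 'rV[int]_n)%type.
Local Notation mu := (lebesgue_rV R n).
Local Notation J f := (\int[mu]_x f x)%R.
Local Notation ii f := (mu.-integrable [set: 'rV[R]_n] (EFin \o f)).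
Variables (L : nat) (K0 : R) (oddL : odd L).
Local Notation big := (@lcell R L n).
Hypothesis H : wavelet_frame mu big (@lchild L n) fst (wavelet psi) K0 (2 ^+ n).
Local Notation wc := (wcoef mu (wavelet psi)).
Local Notation e i := (wavelet psi i.1 i.2).
Let F := @forest_rV R L oddL n.

Lemma integrable_wavelet_mul (u : 'rV[R]_n -> R) B (i : 'I_(2 ^ n - 1) * V) :
  measurable_fun setT u -> (forall x, `|u x| <= B) -> ii (fun x => u x * e i x).
Proof.
move=> mu uB; apply: (@integrable_compact _ _ _ (big i.2) (B * (K0 / Num.sqrt (vol (lebesgue_rV R n) big i.2)))).
- exact: measurable_lcell.
- exact: forest_lty F _.
- by apply: measurable_funM => //; exact: wf_measurable H _ _.
- by move=> x ix; rewrite (wf_supp H)// mulr0.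
- by move=> x; rewrite normrM ler_pM// (wf_bound H).
Qed.

(** Density of the span gives complex coefficients and a list with possible repetitions. Dropping
    imaginary parts does not worsen the approximation of a real function, repetitions are merged,
    and the orthogonal projection is at least as good. *)
Lemma wavelet_orthogonal_projection (u : 'rV[R]_n -> R) (eps : R) : measurable_fun setT u ->
  ii (fun x => u x ^+ 2) -> (forall i, ii (fun x => u x * e i x)) -> 0 < eps ->
  exists2 s : seq ('I_(2 ^ n - 1) * V), uniq s &
    J (fun x => (u x - \sum_(i <- s) J (fun x => u x * e i x) * e i x) ^+ 2) <= eps ^+ 2.
Proof.
move=> mu0 iu2 iue eps0; have [_ _ [_ _ dense] _] := psiP.
have iee i j : ii (fun x => e i x * e j x).
  by apply: integrable_wavelet_mul; [exact: wf_measurable H _ _|move=> x; exact: (wf_bound H)].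
have uL2 : in_L2 (fun x => (u x)%:C%C).
  split.
    split; apply: borel_lebesgue_measurable => //=.
  apply: (@lty_poweRy _ _ 2); first by rewrite pnatr_eq0.
  rewrite modulus_L2 /=; under eq_integral do rewrite expr0n/= addr0.
  have /integrableP[_] := iu2; apply: le_lt_trans; rewrite le_eqVlt; apply/orP; left.
  by apply/eqP; apply: eq_integral => x _ /=; rewrite ger0_norm// sqr_ge0.
have [s [c cP]] := dense _ uL2 eps eps0.
pose b i := complex.Re (c i) *+ count_mem i s.
have sumE x : \sum_(i <- s) complex.Re (c i) * e i x = \sum_(i <- undup s) b i * e i x.
  rewrite -[LHS](@big_undup_iterop_count _ 0 +%R _ s xpredT (fun i => complex.Re (c i) * e i x)).
  by apply: eq_bigr => i _; rewrite /b mulrnAl.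
set t := undup s in sumE *; have ut : uniq t by exact: undup_uniq.
exists t => //.
pose phi x := u x - \sum_(i <- t) b i * e i x.
have mphi : measurable_fun setT phi.
  apply: measurable_funB => //; apply: measurable_sum => i.
  by apply: measurable_funM => //; exact: wf_measurable H _ _.
pose im x := \sum_(i <- s) complex.Im (c i) * e i x.
have mim : measurable_fun setT im.
  by apply: measurable_sum => i; apply: measurable_funM => //; exact: wf_measurable H _ _.
have phi2 : (\int[mu]_x (phi x ^+ 2)%:E <= (eps ^+ 2)%:E)%E.
  apply: (@le_trans _ _ (\int[mu]_x (phi x ^+ 2 + im x ^+ 2)%:E)%E).
    apply: le_int => //.
    - by apply/measurable_EFinP; exact: measurable_funX.
    - by apply/measurable_EFinP; apply: measurable_funD; exact: measurable_funX.
    - by move=> x; rewrite lee_fin sqr_ge0.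
    - by move=> x _; rewrite lee_fin lerDl sqr_ge0.
  have <- : ('N[mu]_(2%:E)[modulus (fun x => ((u x)%:C%C - \sum_(i <- s) c i * (e i x)%:C%C)%R)] `^ 2 =
      \int[mu]_x (phi x ^+ 2 + im x ^+ 2)%:E)%E.
    rewrite modulus_L2; apply: eq_integral => x _.
    have -> : complex.Re ((u x)%:C%C - \sum_(i <- s) c i * (e i x)%:C%C) = phi x.
      rewrite /phi -sumE raddfB/= raddf_sum; congr (_ - _).
      by apply: eq_bigr => i _; exact: complex_ReM.
    have -> : complex.Im ((u x)%:C%C - \sum_(i <- s) c i * (e i x)%:C%C) = - im x.
      rewrite /im raddfB/= raddf_sum sub0r; congr (- _).
      by apply: eq_bigr => i _; exact: complex_ImM.
    by rewrite sqrrN.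
  have -> : ((eps ^+ 2)%:E = eps%:E `^ 2)%E by rewrite poweR_EFin powR_mulrn// ltW.
  by apply: ge0_ler_poweR => //; [exact: Lnorm_ge0|exact: ltW].
have iphi2 : ii (fun x => phi x ^+ 2).
  apply/integrableP; split; first by apply/measurable_EFinP; exact: measurable_funX.
  apply: le_lt_trans (ltry (eps ^+ 2)); apply: le_trans phi2.
  by rewrite le_eqVlt; apply/orP; left; apply/eqP; apply: eq_integral => x _ /=; rewrite ger0_norm// sqr_ge0.
have ex a := @orthonormal_expansion _ _ _ mu _ (fun i => e i) iee (wavelet_orthonormal psiP) u t a ut iu2 iue.
rewrite (ex (fun i => J (fun x => u x * e i x))) (_ : \sum_(i <- t) (_ - _) ^+ 2 = 0); last first.
  by rewrite big1// => i _; rewrite subrr expr0n.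
rewrite addr0; apply: (@le_trans _ _ (J (fun x => phi x ^+ 2))).
  by rewrite /phi (ex b) lerDl; apply: sumr_ge0 => i _; exact: sqr_ge0.
by rewrite -lee_fin EFin_Rintegral.
Qed.

(** The integral of [u g] is the sum of the products of coefficients over a finite set plus the
    pairing of [g] with a remainder of small L^2 norm. *)
Lemma parseval_bounded (u g : 'rV[R]_n -> R) (A : set 'rV[R]_n) (B : R) :
  measurable A -> (mu A < +oo)%E -> measurable_fun setT u -> measurable_fun setT g ->
  (forall x, `|u x| <= B) -> (forall x, `|g x| <= B) ->
  (forall x, ~ A x -> u x = 0) -> (forall x, ~ A x -> g x = 0) ->
  (`|J (fun x => u x * g x)|%:E <= \esum_(w in [set: V]) (wpair psi u g w)%:E)%E.
Proof.
move=> mA Ay mu0 mg uB gB uA gA.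
have imul (a b : 'rV[R]_n -> R) : measurable_fun setT a -> measurable_fun setT b ->
    (forall x, `|a x| <= B) -> (forall x, `|b x| <= B) -> (forall x, ~ A x -> a x = 0) ->
    ii (fun x => a x * b x).
  move=> ma mb aB bB aA; apply: (@integrable_compact _ _ _ A (B * B)) => //.
  - exact: measurable_funM.
  - by move=> x Ax; rewrite aA// mul0r.
  - by move=> x; rewrite normrM ler_pM.
have iu2 : ii (fun x => u x ^+ 2) by exact: imul.
have ig2 : ii (fun x => g x ^+ 2) by exact: imul.
have iug : ii (fun x => u x * g x) by exact: imul.
have iue i : ii (fun x => u x * e i x) by exact: integrable_wavelet_mul mu0 uB.
have ige i : ii (fun x => g x * e i x) by exact: integrable_wavelet_mul mg gB.
have iee i j : ii (fun x => e i x * e j x).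
  by apply: integrable_wavelet_mul; [exact: wf_measurable H _ _|move=> x; exact: (wf_bound H)].
set G := J (fun x => g x ^+ 2); have G0 : 0 <= G by apply: Rintegral_ge0 => x _; exact: sqr_ge0.
apply/lee_addgt0Pr => d d0.
(* Chosen so that eps^-1 times eps^2 plus eps G equals [d], the bound on the pairing with the
   remainder. *)
pose eps := d / (1 + G); have eps0 : 0 < eps by rewrite divr_gt0// ltr_wpDr.
have [t ut tP] := wavelet_orthogonal_projection mu0 iu2 iue eps0.
pose a i := J (fun x => u x * e i x); pose b i := J (fun x => g x * e i x).
pose phi x := u x - \sum_(i <- t) a i * e i x.
have iphig : ii (fun x => phi x * g x).
  rewrite (_ : (fun x => _) = (fun x => u x * g x - \sum_(i <- t) a i * (g x * e i x))).
    by apply: integrableBR => //; apply: integrable_sumR => i; exact: integrableZR.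
  apply/funext => x; rewrite /phi mulrBl mulr_suml; congr (_ - _).
  by apply: eq_bigr => i _; ring.
have iphi2 : ii (fun x => phi x ^+ 2).
  rewrite (_ : (fun x => _) = (fun x => u x * phi x - \sum_(i <- t) a i * (phi x * e i x))).
    apply: integrableBR; last first.
      apply: integrable_sumR => i; apply: integrableZR.
      rewrite (_ : (fun x => _) = (fun x => u x * e i x - \sum_(j <- t) a j * (e j x * e i x))).
        by apply: integrableBR => //; apply: integrable_sumR => j; exact: integrableZR.
      apply/funext => x; rewrite /phi mulrBl mulr_suml; congr (_ - _).
      by apply: eq_bigr => j _; ring.
    rewrite (_ : (fun x => _) = (fun x => u x ^+ 2 - \sum_(j <- t) a j * (u x * e j x))).
      by apply: integrableBR => //; apply: integrable_sumR => j; exact: integrableZR.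
    apply/funext => x; rewrite /phi mulrBr mulr_sumr; congr (_ - _).
    by apply: eq_bigr => j _; ring.
  apply/funext => x; rewrite expr2 {1}/phi mulrBl mulr_suml; congr (_ - _).
  by apply: eq_bigr => i _; ring.
have JE : J (fun x => u x * g x) = J (fun x => phi x * g x) + \sum_(i <- t) a i * b i.
  have iae i : ii (fun x => a i * (g x * e i x)) by exact: integrableZR.
  rewrite (_ : \sum_(i <- t) a i * b i = J (fun x => \sum_(i <- t) a i * (g x * e i x))).
    rewrite -RintegralD//; last exact: integrable_sumR.
    congr Rintegral; apply/funext => x; rewrite /phi mulrBl mulr_suml -addrA -[LHS]addr0; congr (_ + _).
    by rewrite addrC; apply/esym/eqP; rewrite subr_eq0; apply/eqP; apply: eq_bigr => i _; ring.
  by rewrite Rintegral_sumR//; apply: eq_bigr => i _; rewrite RintegralZl.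
have hphi : `|J (fun x => phi x * g x)| <= d.
  rewrite (le_trans (le_normr_Rintegral _ iphig))//.
  apply: (@le_trans _ _ (J (fun x => eps^-1 * phi x ^+ 2 + eps * g x ^+ 2))).
    apply: Rintegral_leR; [exact: integrable_normR|by apply: integrableDR; exact: integrableZR|].
    move=> x; rewrite -subr_ge0 normrM -[phi x ^+ 2]real_normK ?num_real// -[g x ^+ 2]real_normK ?num_real//.
    set y := `|phi x|; set z := `|g x|.
    have -> : eps^-1 * y ^+ 2 + eps * z ^+ 2 - y * z = ((y - eps * z / 2) ^+ 2 + 3 / 4 * (eps * z) ^+ 2) / eps.
      by field; rewrite gt_eqF.
    by rewrite divr_ge0 ?(ltW eps0)// addr_ge0 ?sqr_ge0// mulr_ge0 ?sqr_ge0.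
  rewrite RintegralD//; [|exact: integrableZR|exact: integrableZR].
  rewrite !RintegralZl// -/G.
  rewrite (@le_trans _ _ (eps^-1 * eps ^+ 2 + eps * G))//.
    by rewrite lerD2r ler_wpM2l ?invr_ge0 ?(ltW eps0).
  rewrite expr2 mulKf ?gt_eqF// -{1}[eps]mulr1 -mulrDr /eps divfK//.
  by rewrite gt_eqF// ltr_wpDr.
have tX : (\sum_(i <- t) (`|a i| * `|b i|)%:E <= \esum_(w in [set: V]) (wpair psi u g w)%:E)%E.
  pose t2 := undup [seq i.2 | i <- t].
  pose t3 := [seq (l, w) | w <- t2, l <- enum 'I_(2 ^ n - 1)].
  apply: (@le_trans _ _ (\sum_(i <- t3) (`|a i| * `|b i|)%:E)%E).
    apply: sum_subset_le => // i it.
    apply/allpairsP; exists (i.2, i.1); rewrite /= mem_enum mem_undup map_f//.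
    by rewrite -surjective_pairing.
  rewrite /t3 big_allpairs_dep/=.
  rewrite (eq_bigr (fun w => (wpair psi u g w)%:E)); last first.
    by move=> w _; rewrite big_enum/= sumEFin.
  by apply: seq_le_esum; [move=> w; rewrite lee_fin; exact: wpair_ge0|exact: undup_uniq].
rewrite JE; apply: (@le_trans _ _ ((\sum_(i <- t) `|a i| * `|b i|) + d)%:E).
  rewrite lee_fin (le_trans (ler_normD _ _))// addrC lerD//.
  by rewrite (le_trans (ler_norm_sum _ _ _))//; apply: ler_sum => i _; rewrite normrM.
by rewrite EFinD leeD2r// -sumEFin.
Qed.

End parseval_L2.

Section ancestors_scale.
Context {R : realType} (n L : nat).
Local Notation V := (int * 'rV[int]_n)%type.
Local Notation M := {ffun 'I_n -> 'I_L}.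

Lemma scale_anc (v : V) k (tau : M * M) : scale (shift tau (anc k v)) = scale v * 2 ^+ k :> R.
Proof.
rewrite /scale; have -> : (shift tau (anc k v)).1 = v.1 - k%:Z by exact: anc_level.
by rewrite opprB addrC expfzDr.
Qed.

Lemma scale_anc_powR (v : V) k (tau : M * M) (a : R) :
  scale (shift tau (anc k v)) `^ a = scale v `^ a * (2 `^ a) ^+ k.
Proof.
rewrite scale_anc powRM ?(ltW (scale_gt0 _)) ?exprn_ge0//; congr (_ * _).
by rewrite -(powR_mulrn k (powR_ge0 2 a)) -(powR_mulrn k (ler0n R 2)) powRAC.
Qed.

Lemma powR2N_lt1 (a : R) : 0 < a -> 2 `^ (- a) < 1 :> R.
Proof.
move=> a0; rewrite powRN invf_lt1 ?powR_gt0//.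
have := @gt0_ltr_powR _ _ a0 1%R 2%R; rewrite !nnegrE powR1; apply => //.
by rewrite ltr1n.
Qed.

End ancestors_scale.

(** * Parseval's inequality beyond L^2 *)

Section parseval.
Context {R : realType} (n : nat) (n_gt0 : (0 < n)%N)
  (psi : 'I_(2 ^ n - 1) -> 'rV[R]_n -> R).
Hypothesis psiP : compact_wavelets n.+1 n psi.
Local Notation V := (int * 'rV[int]_n)%type.
Local Notation cube := (@lcell R 1 n).
Local Notation mu := (lebesgue_rV R n).
Local Notation J f := (\int[mu]_x f x)%R.
Local Notation ii f := (mu.-integrable [set: 'rV[R]_n] (EFin \o f)).
Variables (L : nat) (K0 : R) (oddL : odd L).
Local Notation big := (@lcell R L n).
Local Notation M := {ffun 'I_n -> 'I_L}.
Local Notation sc v := (@scale R n v).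
Hypothesis H : wavelet_frame mu big (@lchild L n) fst (wavelet psi) K0 (2 ^+ n).
Local Notation wc := (wcoef mu (wavelet psi)).
Local Notation sf f := (fun x => (rsquare psi f x `^ 2^-1)%E).
Let F := @forest_rV R L oddL n.
Variables (p : 'I_n -> R) (p1 : forall i, 1 < p i).

Let p0 i : 0 < p i. Proof. exact: lt_trans (p1 i). Qed.

Let L_gt0 : (0 < L)%N. Proof. by case: (L) oddL. Qed.

Lemma measurable_normE (f : 'rV[R]_n -> R) : measurable_fun setT f ->
  measurable_fun setT (fun x => `|f x|%:E : \bar R).
Proof. by move=> mf; apply/measurable_EFinP; exact: measurableT_comp. Qed.

Lemma integrable_local_wavelet (f : 'rV[R]_n -> R) l w : locally_mixed p f ->
  ii (fun x => f x * wavelet psi l w x).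
Proof.
move=> fp; have := integrable_mulR (locally_mixed_big w oddL p1 fp) (wf_measurable H l w) (wf_bound H l w).
congr (mu.-integrable setT _); apply/funext => x /=; congr EFin.
have [wx|wx] := pselect (big w x); first by rewrite indicE mem_set// mulr1.
by rewrite (wf_supp H)// !mulr0.
Qed.

Lemma locally_mixed_le (f g : 'rV[R]_n -> R) : measurable_fun setT g ->
  (forall x, `|g x| <= `|f x|) -> locally_mixed p f -> locally_mixed p g.
Proof.
move=> mg gf [mf fv]; split=> // v; apply: le_lt_trans (fv v).
apply: mixed_norm_on_le => //; [exact: measurable_lcell|exact: measurable_lcell|
  exact: measurable_normE|exact: measurable_normE|].
by move=> x vx; rewrite lee_fin.
Qed.

Lemma wpair_sub (f u g : 'rV[R]_n -> R) w : locally_mixed p f -> locally_mixed p (fun x => f x - u x) ->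
  wpair psi u g w <= wpair psi f g w + wpair psi (fun x => f x - u x) g w.
Proof.
move=> fp fu; rewrite /wpair -big_split/=; apply: ler_sum => l _.
rewrite -mulrDl ler_wpM2r//.
have -> : wc u l w = wc f l w - wc (fun x => f x - u x) l w.
  rewrite /wcoef -RintegralB//; [|exact: integrable_local_wavelet|exact: integrable_local_wavelet].
  by congr Rintegral; apply/funext => x; ring.
exact: ler_normB.
Qed.

(** Cutting in height and in space makes the function bounded with bounded support; multiplying by
    indicators keeps it and the remainder below |f|. *)
Definition truncation (f : 'rV[R]_n -> R) m x : R :=
  f x * (\1_[set y | `|f y| <= m%:R] x * \1_(box (fun=> - m%:R) (fun=> m%:R)) x).

Section truncation.
Variables (f : 'rV[R]_n -> R) (mf : measurable_fun setT f).

Let tr m x : R := \1_[set y | `|f y| <= m%:R] x * \1_(box (fun=> - m%:R) (fun=> m%:R)) x.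

Let tr01 m x : 0 <= tr m x <= 1.
Proof. by rewrite /tr !indicE; do 2 case: (_ \in _) => /=; lra. Qed.

Lemma measurable_truncation m : measurable_fun setT (truncation f m).
Proof.
apply: measurable_funM => //; apply: measurable_funM; apply: measurable_indic.
  rewrite (_ : [set y | _] = (fun y => `|f y|) @^-1` `]-oo, m%:R]); last first.
    by apply/seteqP; split => y /=; rewrite in_itv.
  by rewrite -[X in measurable X]setTI; apply: (measurableT_comp (@normr_measurable R setT) mf).
exact: measurable_box.
Qed.

Lemma truncation_le m x : `|truncation f m x| <= `|f x|.
Proof.
rewrite /truncation normrM; have /andP[a b] := tr01 m x.
by rewrite ler_piMr// ger0_norm.
Qed.

Lemma truncation_bound m x : `|truncation f m x| <= m%:R.
Proof.
have [h|h] := leP `|f x| m%:R; first exact: le_trans (truncation_le m x) h.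
rewrite /truncation [\1_[set y | _] x]indicE memNset ?mul0r ?mulr0 ?normr0//=.
by apply/negP; rewrite -ltNge.
Qed.

Lemma truncation_supp m x : ~ box (fun=> - m%:R) (fun=> m%:R) x -> truncation f m x = 0.
Proof. by move=> h; rewrite /truncation [\1_(box _ _) x]indicE memNset// !mulr0. Qed.

Lemma rest_le m x : `|f x - truncation f m x| <= `|f x|.
Proof.
have -> : f x - truncation f m x = f x * (1 - tr m x) by rewrite /truncation -/(tr m x); ring.
by rewrite normrM; have /andP[a b] := tr01 m x; rewrite ler_piMr// ger0_norm; lra.
Qed.

Lemma truncation_eventually x : exists N : nat, forall m, (N <= m)%N -> truncation f m x = f x.
Proof.
exists (Num.truncn (`|f x| + \sum_i `|x ord0 i|)).+1 => m Nm.
have mB : `|f x| + \sum_i `|x ord0 i| < m%:R.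
  by rewrite (lt_le_trans (truncnS_gt _))// ler_nat.
have S0 : 0 <= \sum_i `|x ord0 i| by apply: sumr_ge0.
rewrite /truncation !indicE !mem_set ?mulr1//=.
- move=> i; have h : `|x ord0 i| < m%:R.
    apply: le_lt_trans mB; rewrite (bigD1 i)//= addrCA lerDl addr_ge0//.
    by apply: sumr_ge0.
  by have := h; rewrite ltr_norml => /andP[/ltW -> ->].
- by apply/ltW/(le_lt_trans _ mB); rewrite lerDl.
Qed.

Lemma rest_vanishing (K : set 'rV[R]_n) : measurable K ->
  (mixed_norm_on p K (fun x => `|f x|%:E) < +oo)%E ->
  vanishing (fun m => mixed_norm_on p K (fun x => `|f x - truncation f m x|%:E)).
Proof.
move=> mK Ky; apply: (mixed_dominated p0 _ _ _ _ _ _ Ky).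
- move=> m; apply: measurable_on => //; apply: measurable_normE.
  by apply: measurable_funB => //; exact: measurable_truncation.
- by apply: measurable_on => //; exact: measurable_normE.
- by move=> m x; rewrite mule_ge0// lee_fin.
- by move=> x; rewrite mule_ge0// lee_fin.
- by move=> m x; rewrite lee_wpmul2r// lee_fin ?rest_le.
- move=> x _ e e0; have [N NP] := truncation_eventually x; exists N => m Nm.
  by rewrite NP// subrr normr0 mul0e lee_fin ltW.
Qed.

End truncation.

Lemma geometric_small (q a e : R) : 0 < q < 1 -> 0 <= a -> 0 < e -> exists S, a * q ^+ S <= e.
Proof.
move=> /andP[q0 q1] a0 e0; have a1 : 0 < a + 1 by exact: ltr_wpDl.
have q1' : `|q| < 1 by rewrite gtr0_norm.
have /cvgrPdist_le/(_ (e / (a + 1))) := cvg_expr q1'.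
move=> /(_ (divr_gt0 e0 a1))[S _ /(_ S (leqnn S))] /=.
rewrite sub0r normrN ger0_norm ?exprn_ge0 ?(ltW q0)// ler_pdivlMr// => h.
exists S; apply: le_trans h; rewrite mulrC ler_wpM2l ?exprn_ge0 ?(ltW q0)//.
by rewrite lerDl.
Qed.

Lemma wpair_meet (f g : 'rV[R]_n -> R) (v w : V) : (forall x, ~ cube v x -> g x = 0) ->
  wpair psi f g w != 0 -> exists x, big w x /\ cube v x.
Proof.
move=> gv; apply: contra_neqP => h; rewrite /wpair big1// => l _.
rewrite (wcoef_eq H (f := g) (f' := fun=> 0)).
  rewrite [X in _ * `|X|](_ : _ = 0) ?normr0 ?mulr0// /wcoef.
  by under eq_Rintegral do rewrite mul0r; rewrite Rintegral_cst//= mul0r.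
by move=> x wx; apply: gv => vx; apply: h; exists x.
Qed.

(** The bounded case applies to the truncation [u], whose coefficients differ from those of [f] by
    those of the remainder [rho]. Against [g], the coefficients of [rho] are summably small at
    coarse scales by the growth hypothesis, and at the other scales they are bounded by a local norm
    of [rho], which tends to 0. *)
Theorem parseval_local (f g : 'rV[R]_n -> R) (v : V) (A B kap : R) : locally_mixed p f ->
  0 <= A -> 0 < kap ->
  (forall w, sc w `^ (- dim p) * fine (kf oddL p f w) <= A * sc w `^ (- kap)) ->
  measurable_fun setT g -> (forall x, `|g x| <= B) -> (forall x, ~ cube v x -> g x = 0) ->
  (`|J (fun x => f x * g x)|%:E <= \esum_(w in [set: V]) (wpair psi f g w)%:E)%E.
Proof.
move=> fp A0 kap0 fA mg gB gv.
have [mf fv] := fp.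
have mc : measurable (cube v) by exact: measurable_lcell.
have cy : (mu (cube v) < +oo)%E by exact: (forest_lty (@forest_rV R 1 isT n) v).
have B0 : 0 <= B by exact: le_trans (normr_ge0 _) (gB 0).
have ig : ii g by exact: (integrable_compact mc cy mg gv gB).
pose u := truncation f; pose rho m x := f x - u m x.
have mu0 m : measurable_fun setT (u m) by exact: measurable_truncation.
have mrho m : measurable_fun setT (rho m) by exact: measurable_funB.
have rhop m : locally_mixed p (rho m).
  by apply: (@locally_mixed_le f) => // x; exact: rest_le.
set G := J (fun x => `|g x|); have G0 : 0 <= G by apply: Rintegral_ge0.
set X := \esum_(w in _) _.
have [q [q0 q1 qE]] : exists q : R, [/\ 0 < q, q < 1 & 2 `^ (- kap) = q].
  by exists (2 `^ (- kap)); rewrite powR_gt0// powR2N_lt1.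
pose nl : R := (2 ^ n - 1)%:R.
have K00 : 0 <= K0 := wf_K0 H.
have [D D0 DE] : exists2 D : R, 0 <= D & nl * K0 ^+ 2 * G * (A * sc v `^ (- kap)) = D.
  eexists; last exact: erefl.
  apply: mulr_ge0; last by rewrite mulr_ge0// powR_ge0.
  by apply: mulr_ge0 => //; apply: mulr_ge0; [exact: ler0n|exact: sqr_ge0].
have kfle m w : fine (kf oddL p (rho m) w) <= fine (kf oddL p f w).
  apply: fine_le; rewrite ?ge0_fin_numE ?kf_ge0 ?kf_fin//.
  apply: lee_sum => m' _; apply: mixed_norm_on_le => //.
  - exact: measurable_lcell.
  - exact: measurable_lcell.
  - exact: measurable_normE.
  - exact: measurable_normE.
  - by move=> x cx; split => //; rewrite lee_fin rest_le.
have far_term m m' k : wpair psi (rho m) g (shift (m', m0 n oddL) (anc k v)) <= D * q ^+ k.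
  set w := shift _ _.
  rewrite (le_trans (wpair_far oddL H w p1 (rhop m) ig))//.
  have wE : sc w `^ (- kap) = sc v `^ (- kap) * q ^+ k by rewrite /w scale_anc_powR qE.
  have -> : D * q ^+ k = nl * K0 ^+ 2 * G * (A * sc w `^ (- kap)) by rewrite wE -DE; ring.
  apply: ler_wpM2l.
    by apply: mulr_ge0 => //; apply: mulr_ge0; [exact: ler0n|exact: sqr_ge0].
  apply: le_trans (fA w); rewrite ler_wpM2l ?powR_ge0//; exact: kfle.
have far m S : (\sum_(s <oo) \sum_(m' : M) (wpair psi (rho m) g (shift (m', m0 n oddL) (anc (S + s.+1) v)))%:E <=
    ((1 - q)^-1 * (#|{: M}|%:R * D * q ^+ S.+1))%:E)%E.
  apply: (@le_trans _ _ (\sum_(s <oo) (q ^+ s)%:E * (#|{: M}|%:R * D * q ^+ S.+1)%:E)%E).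
    apply: lee_nneseries => [s _ _|s _].
      by apply: sume_ge0 => m' _; rewrite lee_fin wpair_ge0.
    apply: (@le_trans _ _ (\sum_(m' : M) (D * q ^+ (S + s.+1))%:E)%E).
      by apply: lee_sum => m' _; rewrite lee_fin far_term.
    rewrite sum_cst -!EFinM lee_fin le_eqVlt; apply/orP; left; apply/eqP.
    by rewrite -addSnnS exprD; ring.
  rewrite EFinM; apply: geometric_sum_le; first by rewrite (ltW q0).
  by rewrite lee_fin; apply: mulr_ge0; [exact: mulr_ge0|rewrite exprn_ge0// ltW].
have q2 i : 1 < conj_exp p i by exact: conj_exp_gt1.
have q20 i : 0 < conj_exp p i by exact: lt_trans (q2 i).
have [C1 C10 C1P] := mixed_square_bound n_gt0 psiP p1.
have [C2 C20 C2P] := mixed_square_bound n_gt0 psiP q2.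
have [gq gq0 gqP] : exists2 gq : R, 0 <= gq & (mixed_norm (conj_exp p) (fun x => `|g x|%:E) <= gq%:E)%E.
  exists (B * sc v `^ dim (conj_exp p)); first by rewrite mulr_ge0// powR_ge0.
  rewrite EFinM -(mixed_norm_cube _ q20).
  have m1 : measurable_fun setT (fun x => (\1_(cube v) x)%:E : \bar R).
    by apply/measurable_EFinP; exact: measurable_indic.
  rewrite -mixed_norm_scale//.
  apply: mixed_norm_le => //.
  - exact: measurable_normE.
  - by apply: emeasurable_funM.
  - move=> z; rewrite -EFinM lee_fin; have [vz|vz] := pselect (cube v z).
      by rewrite indicE mem_set// mulr1.
    by rewrite gv// normr0 mulr_ge0.
apply/lee_addgt0Pr => e e0.
have e3 : 0 < e / 3 by rewrite divr_gt0.
(* [S] is fixed before the level of truncation: the far bound is uniform in that level, whereas the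
   set [K] of the near bound depends on [S]. *)
have [S SP] : exists S, (1 - q)^-1 * (#|{: M}|%:R * D * q ^+ S.+1) <= e / 3.
  have a0 : 0 <= (1 - q)^-1 * (#|{: M}|%:R * D * q).
    by rewrite mulr_ge0 ?invr_ge0 ?subr_ge0 ?(ltW q1)// mulr_ge0 ?(ltW q0)// mulr_ge0.
  have [|S SP] := geometric_small _ a0 e3 (q := q); first by rewrite q0.
  by exists S; rewrite exprS !mulrA in SP *.
pose z := anc S v.
pose K := \bigcup_(m' in [set: M]) big (shift (m', m0 n oddL) z).
have mK : measurable K by apply: fin_bigcup_measurable => // m' _; exact: measurable_lcell.
have Ky : (mixed_norm_on p K (fun x => `|f x|%:E) < +oo)%E.
  have mfE := measurable_normE mf.
  have [c c0 cP] := @mixed_norm_sum R n p M (fun i => ltW (p1 i)).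
  have [c' c'0 c'P] := mixed_norm_on_big oddL p1.
  pose Fm m' x := (`|f x|%:E * (\1_(big (shift (m', m0 n oddL) z)) x)%:E)%E.
  have mFm m' : measurable_fun setT (Fm m') by apply: measurable_on => //; exact: measurable_lcell.
  have Fm0 m' x : (0 <= Fm m' x)%E by rewrite mule_ge0// lee_fin.
  apply: (@le_lt_trans _ _ (mixed_norm p (fun x => \sum_(m' : M) Fm m' x)%E)).
    apply: mixed_norm_le => //.
    - exact: measurable_on.
    - exact: emeasurable_sum.
    move=> x; rewrite -ge0_sume_distrr => [|m' _]; last by rewrite lee_fin.
    rewrite lee_wpmul2l// sumEFin lee_fin.
    have [[m' _ Kx]|Kx] := pselect (K x); last by rewrite indicE memNset// sumr_ge0.
    rewrite (bigD1 m')//= [leLHS]indicE mem_set; last by exists m'.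
    by rewrite indicE mem_set// lerDl sumr_ge0.
  apply: (le_lt_trans (cP _ mFm Fm0)); rewrite lte_mul_pinfty ?ltry ?lee_fin ?(ltW c0)//.
  apply: lte_sum_pinfty => m' _; apply: (le_lt_trans (c'P _ _ mfE _)) => //.
  rewrite lte_mul_pinfty ?ltry ?lee_fin ?(ltW c'0)//.
  by apply: lte_sum_pinfty => m2 _; exact: fv.
have near m : (\esum_(w in [set: V]) (if ((anc S v).1 <= w.1)%R then (wpair psi (rho m) g w)%:E else 0) <=
    (C1 * (C2 * gq))%:E * mixed_norm_on p K (fun x => `|rho m x|%:E))%E.
  apply: esum_le_seq => s us.
  pose P w := ((anc S v).1 <= w.1) && (wpair psi (rho m) g w != 0).
  pose rK x := rho m x * \1_K x.
  have mrK : measurable_fun setT rK by apply: measurable_funM => //; exact: measurable_indic.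
  (* The wavelets that count here live in [K], so cutting [rho m] to [K] leaves their coefficients
     unchanged and the square function bound applies to a function of small norm. *)
  have PE w : P w -> wpair psi (rho m) g w = wpair psi rK g w.
    move=> /andP[zw /(wpair_meet gv)[x [wx vx]]].
    have [m' [_ wK]] := near_shift oddL wx (cube_anc S vx) zw.
    apply: eq_bigr => l _; congr (`|_| * _); apply: (wcoef_eq H) => y wy.
    by rewrite /rK indicE mem_set ?mulr1//; exists m' => //; exact: wK.
  apply: (@le_trans _ _ (\sum_(w <- [seq w <- s | P w]) (wpair psi rK g w)%:E)%E).
    rewrite big_filter [leRHS]big_mkcond/=; apply: lee_sum => w _.
    case: ifPn => zw; last by case: ifP => //; rewrite lee_fin wpair_ge0.
    have [w0|w0] := eqVneq (wpair psi (rho m) g w) 0.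
      by rewrite w0; case: ifP => //; rewrite lee_fin wpair_ge0.
    by rewrite ifT ?PE// /P zw.
  apply: (@le_trans _ _ (\int[mu]_x (sf rK x * (\1_[set: 'rV[R]_n] x)%:E * sf g x))%E).
    by apply: wpair_near => //; exact: filter_uniq.
  under eq_integral do rewrite indicT mule1.
  have mh := @mixed_hoelder R n p (conj_exp p) (sf rK) (sf g) p0 q20 (fun i => conj_expP (p1 i))
    (measurable_sf _ _) (measurable_sf _ _) (sf_ge0 _ _) (sf_ge0 _ _).
  have h1 := C1P _ mrK; have h2 := C2P _ mg.
  have rKE : mixed_norm p (fun x => `|rK x|%:E) = mixed_norm_on p K (fun x => `|rho m x|%:E).
    by congr mixed_norm; apply/funext => x; rewrite normrM -EFinM [X in (_ * X)%R]ger0_norm.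
  rewrite (EFinM C1) muleAC; apply: (le_trans mh); apply: lee_pmul; try exact: mixed_norm_ge0.
    by apply: (le_trans h1); rewrite rKE.
  by apply: (le_trans h2); rewrite EFinM lee_wpmul2l// lee_fin ltW.
have iug m : ii (fun x => u m x * g x).
  have := @integrable_mulR _ _ _ _ _ _ m%:R ig (mu0 m) (truncation_bound f m).
  by congr (mu.-integrable setT _); apply/funext => x /=; rewrite mulrC.
have irg m : ii (fun x => rho m x * g x).
  have := integrable_mulR (locally_mixed_big v (isT : odd 1) p1 (rhop m)) mg gB.
  congr (mu.-integrable setT _); apply/funext => x /=; congr EFin.
  have [vx|vx] := pselect (cube v x); first by rewrite indicE mem_set// mulr1.
  by rewrite gv// !mulr0.
have diff m : (`|J (fun x => rho m x * g x)|%:E <=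
    (B * sc v `^ (n%:R - dim p))%:E * mixed_norm_on p (cube v) (fun x => `|rho m x|%:E))%E.
  have mrE := measurable_normE (mrho m).
  apply: (@le_trans _ _ (\int[mu]_x (B%:E * (`|rho m x|%:E * (\1_(cube v) x)%:E)))%E).
    apply: (@le_trans _ _ (\int[mu]_x `|rho m x * g x|%:E)%E).
      rewrite -EFin_Rintegral; last exact: integrable_normR.
      by rewrite lee_fin le_normr_Rintegral.
    apply: le_int => //.
    - by apply: measurable_normE; exact: measurable_funM.
    - by apply: emeasurable_funM => //; exact: measurable_on.
    - move=> x _; rewrite -!EFinM lee_fin normrM.
      have [vx|vx] := pselect (cube v x); last by rewrite gv// normr0 mulr0 !mulr_ge0.
      by rewrite indicE mem_set// mulr1 mulrC ler_wpM2r.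
  rewrite intZl//; last exact: measurable_on.
  rewrite (EFinM B) -muleA lee_wpmul2l ?lee_fin//.
  by rewrite muleC; exact: hoelder_cube.
have small (c : R) (K' : set 'rV[R]_n) : 0 <= c -> measurable K' ->
    (mixed_norm_on p K' (fun x => `|f x|%:E) < +oo)%E ->
    exists N, forall m, (N <= m)%N -> (c%:E * mixed_norm_on p K' (fun x => `|rho m x|%:E) <= (e / 3)%:E)%E.
  move=> c0 mK' Ky'; have c10 : 0 < c + 1 by exact: ltr_wpDl.
  have [|N NP] := rest_vanishing mf mK' Ky' (e := e / 3 / (c + 1)); first by rewrite divr_gt0.
  exists N => m Nm; apply: (@le_trans _ _ (c%:E * (e / 3 / (c + 1))%:E)%E).
    by rewrite lee_wpmul2l// NP.
  by rewrite -EFinM lee_fin mulrCA ler_piMr ?(ltW e3)// ler_pdivrMr// mul1r lerDl.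
have cn : 0 <= C1 * (C2 * gq) by rewrite mulr_ge0 ?(ltW C10)// mulr_ge0// ltW.
have [N1 N1P] := small _ K cn mK Ky.
have cd : 0 <= B * sc v `^ (n%:R - dim p) by rewrite mulr_ge0// powR_ge0.
have [N2 N2P] := small _ (cube v) cd mc (fv v).
pose m := maxn N1 N2.
have JE : J (fun x => f x * g x) = J (fun x => u m x * g x) + J (fun x => rho m x * g x).
  rewrite -RintegralD//; congr Rintegral; apply/funext => x; rewrite /rho; ring.
rewrite JE; apply: (@le_trans _ _ (`|J (fun x => u m x * g x)|%:E + `|J (fun x => rho m x * g x)|%:E)%E).
  by rewrite -EFinD lee_fin ler_normD.
have uX : (`|J (fun x => u m x * g x)|%:E <= X + (e / 3 + e / 3)%:E)%E.
  pose bx : set 'rV[R]_n := box (fun=> - m%:R) (fun=> m%:R).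
  have mb : measurable bx by exact: measurable_box.
  have by_ : (mu bx < +oo)%E by rewrite lebesgue_rV_box ?ltry// => i; rewrite ge0_cp// ler0n.
  have bB : m%:R <= Num.max m%:R B by rewrite le_max lexx.
  have bB' : B <= Num.max m%:R B by rewrite le_max lexx orbT.
  have := @parseval_bounded R n psi psiP L K0 oddL H (u m) g (bx `|` cube v) (Num.max m%:R B)
    (measurableU _ _ mb mc) _ (mu0 m) mg
    (fun x => le_trans (truncation_bound f m x) bB) (fun x => le_trans (gB x) bB').
  move=> h; apply: (le_trans (h _ _ _)) => {h}.
  - by rewrite (le_lt_trans (measureU2 _ mb mc))// lte_add_pinfty.
  - by move=> x h; apply: truncation_supp => bx'; apply: h; left.
  - by move=> x h; apply: gv => vx; apply: h; right.
  apply: (@le_trans _ _ (X + \esum_(w in [set: V]) (wpair psi (rho m) g w)%:E)%E).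
    rewrite /X -esumD; last 2 first.
    - by move=> w _; rewrite lee_fin wpair_ge0.
    - by move=> w _; rewrite lee_fin wpair_ge0.
    by apply: le_esum => w _; rewrite -EFinD lee_fin; exact: (@wpair_sub f (u m) g w fp (rhop m)).
  apply: leeD => //.
  have W0 w : (0 <= (wpair psi (rho m) g w)%:E)%E by rewrite lee_fin wpair_ge0.
  apply: (le_trans (@esum_split _ n L oddL S v _ W0 _)).
    by move=> w; rewrite eqe => /(wpair_meet gv).
  rewrite EFinD; apply: leeD.
    by apply: (le_trans (near m)); rewrite N1P// leq_maxl.
  by apply: (le_trans (far m S)); rewrite lee_fin.
have -> : e = (e / 3 + e / 3) + e / 3 by field.
rewrite (EFinD _ (e / 3)) addeA leeD//.
by rewrite (le_trans (diff m))// N2P// leq_maxr.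
Qed.

End parseval.

(** * Square roots and sums over ancestors *)

(** * Comparison of local norms *)

Section square_roots.
Context {R : realType}.
Local Open Scope ereal_scope.

Lemma sqrt_add_le (a Y : \bar R) : 0 <= a -> 0 <= Y ->
  (a + Y `^ 2) `^ 2^-1 <= a `^ 2^-1 + Y.
Proof.
have h2 : (2^-1 != 0 :> R)%R by rewrite invr_eq0 pnatr_eq0.
move: a Y => [a| |] [y| |]//; rewrite ?lee_fin => a0 y0; last 3 first.
- by rewrite [leRHS](_ : _ = +oo) ?leey// poweR_EFin.
- by rewrite (poweRyr h2) addye ?leey.
- by rewrite [leRHS](_ : _ = +oo) ?leey// (poweRyr h2).
have s0 : (0 <= Num.sqrt a)%R by exact: sqrtr_ge0.
rewrite powR_mulrn// !powR12_sqrt ?addr_ge0 ?sqr_ge0//.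
rewrite -[leRHS]ger0_norm ?addr_ge0// -sqrtr_sqr ler_wsqrtr//.
rewrite -{1}(sqr_sqrtr a0) -subr_ge0.
have -> : ((Num.sqrt a + y) ^+ 2 - (Num.sqrt a ^+ 2 + y ^+ 2) = 2 * (Num.sqrt a * y))%R by ring.
by rewrite mulr_ge0// mulr_ge0.
Qed.

Lemma nneseries_sqr_le (y : nat -> R) : (forall s, (0 <= y s)%R) ->
  \sum_(s <oo) ((y s) ^+ 2)%:E <= (\sum_(s <oo) (y s)%:E) `^ 2.
Proof.
move=> y0; set Y := \sum_(s <oo) (y s)%:E.
have Y0 : 0 <= Y by apply: nneseries_ge0 => s _ _; rewrite lee_fin.
have yY s : (y s)%:E <= Y.
  rewrite /Y (@nneseriesD1 R (fun k => (y k)%:E) s xpredT)//; last by move=> k _; rewrite lee_fin.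
  by rewrite leeDl// nneseries_ge0// => k _ _; rewrite lee_fin.
have [Yy|] := ltP Y +oo; last by rewrite leye_eq => /eqP ->; rewrite poweRyr ?leey// pnatr_eq0.
have [r rY] : exists r : R, Y = r%:E by exists (fine Y); rewrite fineK// ge0_fin_numE.
rewrite rY poweR_EFin powR_mulrn; last by rewrite -lee_fin -rY.
apply: (@le_trans _ _ (\sum_(s <oo) r%:E * (y s)%:E)).
  apply: lee_nneseries => [s _ _|s _]; first by rewrite lee_fin sqr_ge0.
  by rewrite -EFinM lee_fin expr2 ler_wpM2r// -lee_fin -rY.
rewrite nneseriesZl => [|s _]; last by rewrite lee_fin.
by rewrite -/Y rY -EFinM expr2.
Qed.

End square_roots.

Section ancestral_terms.
Context {R : realType} (n L : nat) (oddL : odd L).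
Local Notation V := (int * 'rV[int]_n)%type.
Local Notation M := {ffun 'I_n -> 'I_L}.
Local Open Scope ereal_scope.
Variables (q : R) (q0 : (0 <= q)%R) (a : V -> \bar R) (a0 : forall v, 0 <= a v).

Let term0 s v : 0 <= (q ^+ s)%:E * \sum_(tau : M * M) a (shift tau (anc s v)).
Proof. by rewrite mule_ge0// ?lee_fin ?exprn_ge0//; exact: sume_ge0. Qed.

Lemma sum_shift_le v :
  \sum_(m : M) a (shift (m0 n oddL, m) v) <= \sum_(tau : M * M) a (shift tau v) /\
  \sum_(m : M) a (shift (m, m0 n oddL) v) <= \sum_(tau : M * M) a (shift tau v).
Proof.
have E : \sum_(tau : M * M) a (shift tau v) = \sum_(m : M) \sum_(m' : M) a (shift (m, m') v).
  by rewrite pair_bigA; apply: eq_bigr => -[].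
split.
  rewrite E [leRHS](bigD1 (m0 n oddL))//= leeDl// sume_ge0// => m _.
  exact: sume_ge0.
rewrite E; apply: lee_sum => m _; rewrite [leRHS](bigD1 (m0 n oddL))//= leeDl//.
exact: sume_ge0.
Qed.

Lemma ancestral_near v :
  \sum_(m : M) a (shift (m0 n oddL, m) v) <= ancestral_sum L q a v /\
  \sum_(m : M) a (shift (m, m0 n oddL) v) <= ancestral_sum L q a v.
Proof.
have [h1 h2] := sum_shift_le v.
have h : \sum_(tau : M * M) a (shift tau v) <= ancestral_sum L q a v.
  rewrite /ancestral_sum (@nneseriesD1 R (fun s => (q ^+ s)%:E * \sum_(tau : M * M) a (shift tau (anc s v))) 0%N xpredT)//= expr0 mul1e leeDl//.
  exact: nneseries_ge0.
by split; [exact: le_trans h1 h|exact: le_trans h2 h].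
Qed.

Lemma ancestral_far v :
  \sum_(s <oo) (q ^+ s.+1)%:E * \sum_(tau : M * M) a (shift tau (anc s.+1 v)) <= ancestral_sum L q a v.
Proof.
apply: lime_le; first by apply: is_cvg_nneseries => s _ _; exact: term0.
apply: nearW => N; apply: (le_trans _ (nneseries_lim_ge N.+1 _)) => [|s _ _]; last exact: term0.
by rewrite big_nat_recl//= leeDr//; exact: (term0 0).
Qed.

End ancestral_terms.

(** * The two local estimates *)

Section local_estimates.
Context {R : realType} (n : nat) (n_gt0 : (0 < n)%N)
  (psi : 'I_(2 ^ n - 1) -> 'rV[R]_n -> R).
Hypothesis psiP : compact_wavelets n.+1 n psi.
Local Notation V := (int * 'rV[int]_n)%type.
Local Notation cube := (@lcell R 1 n).
Local Notation mu := (lebesgue_rV R n).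
Local Notation J f := (\int[mu]_x f x)%R.
Local Notation ii f := (mu.-integrable [set: 'rV[R]_n] (EFin \o f)).
Variables (L : nat) (K0 : R) (oddL : odd L).
Local Notation big := (@lcell R L n).
Local Notation M := {ffun 'I_n -> 'I_L}.
Local Notation sc v := (@scale R n v).
Hypothesis H : wavelet_frame mu big (@lchild L n) fst (wavelet psi) K0 (2 ^+ n).
Local Notation wc := (wcoef mu (wavelet psi)).
Local Notation csq := (wsq mu cube (wavelet psi)).
Local Notation sf f := (fun x => (rsquare psi f x `^ 2^-1)%E).
Let F := @forest_rV R L oddL n.
Variables (p : 'I_n -> R) (p1 : forall i, 1 < p i) (t : R) (t0 : 0 < t).

Let p0 i : 0 < p i. Proof. exact: lt_trans (p1 i). Qed.
Let q2 i : 1 < conj_exp p i. Proof. exact: conj_exp_gt1. Qed.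
Let q20 i : 0 < conj_exp p i. Proof. exact: lt_trans (q2 i). Qed.
Let K00 : 0 <= K0. Proof. exact: wf_K0 H. Qed.

(** The term of the Morrey norm at a cube, before the l^r norm: the exponent of the volume in that
    norm times n is n/t - [dim p]. *)
Definition acoef (G : 'rV[R]_n -> \bar R) (v : V) : \bar R :=
  ((sc v `^ (n%:R / t - dim p))%:E * mixed_norm_on p (cube v) G)%E.

Lemma acoef_ge0 G v : (0 <= acoef G v)%E.
Proof. by rewrite mule_ge0 ?mixed_norm_on_ge0// lee_fin powR_ge0. Qed.

Let q : R := 2 `^ (- (n%:R / t)).

Let q_gt0 : 0 < q. Proof. exact: powR_gt0. Qed.

Let scd v (a b : R) : sc v `^ (a + b) = sc v `^ a * sc v `^ b.
Proof. by rewrite powRD// (gt_eqF (scale_gt0 v)) implybT. Qed.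

(** Passing to the k-th ancestor multiplies the side by 2^k, so the Morrey factor of the cube is q^k
    times that of the ancestor. This is the origin of the geometric weights. *)
Let sc_anc v k (tau : M * M) : sc v `^ (n%:R / t) = q ^+ k * sc (shift tau (anc k v)) `^ (n%:R / t).
Proof.
rewrite scale_anc_powR mulrCA -exprMn /q -powRD; last by rewrite pnatr_eq0 implybT.
by rewrite addNr powRr0 expr1n mulr1.
Qed.

Let mfE (f : 'rV[R]_n -> R) (mf : measurable_fun setT f) := measurable_normE mf.

(** A cube not coarser than [v] and containing [x] has its enlargement in that of [v], so only [f]
    on [big v] matters there. The coarser cubes are bounded by all translated ancestors, which gives
    a constant on [v]. *)
Lemma rsquare_local (f : 'rV[R]_n -> R) v x : cube v x ->
  (rsquare psi f x <= rsquare psi (fun y => f y * \1_(big v) y)%R x +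
    \sum_(s <oo) \sum_(m : M) (csq f (shift (m, m0 n oddL) (anc s.+1 v)))%:E)%E.
Proof.
move=> vx; have L_gt0 : (0 < L)%N by case: (L) oddL.
pose A w : \bar R := (csq f w * \1_(cube w) x)%:E.
have A0 w : (0 <= A w)%E by rewrite lee_fin mulr_ge0 ?csq_ge0.
apply: (le_trans (@esum_split R n L oddL 0 v A A0 _)).
  move=> w; rewrite eqe mulf_eq0 negb_or => /andP[_ h]; exists x; split => //.
  apply: (cube_sub_big oddL); apply: contrapT => wx.
  by move: h; rewrite indicE memNset// eqxx.
apply: leeD.
  apply: le_esum => w _; case: ifP => vw; last by rewrite lee_fin mulr_ge0 ?csq_ge0.
  rewrite lee_fin /A; have [wx|wx] := pselect (cube w x); last by rewrite [\1_(cube w) x]indicE memNset// !mulr0.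
  rewrite ler_wpM2r// /wsq ler_wpM2r ?invr_ge0 ?(ltW (vol_gt0 (@forest_rV R 1 isT n) _))//.
  apply: ler_sum => l _; rewrite (wcoef_eq H (f' := fun y => f y * \1_(big v) y))// => y wy.
  have vy : big v y by exact: (@cube_nest R n L oddL L v w x L_gt0 vw wx vx y wy).
  by rewrite indicE mem_set// mulr1.
apply: lee_nneseries => [s _ _|s _]; first exact: sume_ge0.
by apply: lee_sum => m _; rewrite lee_fin ler_piMr ?csq_ge0.
Qed.

Let kf_acoef (f : 'rV[R]_n -> R) w : locally_mixed p f ->
  (\sum_(m' : M) acoef (fun x => `|f x|%:E) (shift (m0 n oddL, m') w) =
    (sc w `^ (n%:R / t - dim p) * fine (kf oddL p f w))%:E)%E.
Proof.
move=> fp; rewrite EFinM fineK ?ge0_fin_numE ?kf_ge0 ?kf_fin// /kf ge0_sume_distrr => [|m' _].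
  by apply: eq_bigr => m' _.
exact: mixed_norm_on_ge0.
Qed.

Let far_coef (f : 'rV[R]_n -> R) v s (m : M) : locally_mixed p f ->
  ((sc v `^ (n%:R / t) * Num.sqrt (csq f (shift (m, m0 n oddL) (anc s.+1 v))))%:E <=
  (((2 ^ n - 1)%:R + 1) * K0 * q ^+ s.+1)%:E *
    \sum_(m' : M) acoef (fun x => `|f x|%:E) (shift (m, m') (anc s.+1 v)))%E.
Proof.
move=> fp; set w := shift _ _.
have k0 : 0 <= fine (kf oddL p f w) by rewrite fine_ge0// kf_ge0.
have -> : (\sum_(m' : M) acoef (fun x => `|f x|%:E) (shift (m, m') (anc s.+1 v)) =
    (sc w `^ (n%:R / t - dim p) * fine (kf oddL p f w))%:E)%E.
  rewrite -kf_acoef//; apply: eq_bigr => m' _; congr acoef.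
  by rewrite /w /shift/=; congr (_, _); apply/rowP => i; rewrite !mxE !ffunE/=; ring.
rewrite -EFinM lee_fin (sc_anc v s.+1 (m, m0 n oddL)) -/w.
have h := sqrt_csq_local oddL H w p1 fp.
have S0 : 0 <= q ^+ s.+1 * sc w `^ (n%:R / t) by rewrite mulr_ge0 ?powR_ge0// exprn_ge0// ltW.
apply: (le_trans (ler_wpM2l S0 h)); rewrite scd.
by rewrite le_eqVlt; apply/orP; left; apply/eqP; ring.
Qed.

(** On [v] the square function is at most that of [f] cut to [big v], controlled by the mixed norm
    bound, plus a constant [Y] made of the coarse coefficients. Each of these decays geometrically
    against the Morrey weights. *)
Theorem direct_estimate : exists2 C : R, 0 < C & forall f, locally_mixed p f ->
  forall v, (acoef (sf f) v <= C%:E * ancestral_sum L q (acoef (fun x => `|f x|%:E)) v)%E.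
Proof.
have [C1 C10 C1P] := mixed_square_bound n_gt0 psiP p1.
have [c2 c21 c2P] := @mixed_norm_add R n p (fun i => ltW (p1 i)).
have c20 : 0 <= c2 by exact: le_trans c21.
have [c3 c30 c3P] := mixed_norm_on_big oddL p1.
have [K1 K10 K1E] : exists2 K1 : R, 0 <= K1 & ((2 ^ n - 1)%:R + 1) * K0 = K1.
  by eexists; last exact: erefl; rewrite mulr_ge0// addr_ge0.
have Cp : 0 < c2 * (C1 * c3 + K1 + 1).
  apply: mulr_gt0; first exact: lt_le_trans ltr01 c21.
  by apply: ltr_wpDl => //; apply: addr_ge0 => //; apply: mulr_ge0; exact: ltW.
exists (c2 * (C1 * c3 + K1 + 1)) => //.
move=> f fp v; have [mf fv] := fp.
pose a := acoef (fun x => `|f x|%:E); have a0 w : (0 <= a w)%E by exact: acoef_ge0.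
rewrite -/a; set X := ancestral_sum L q a v.
have X0 : (0 <= X)%E by apply: ancestral_sum_ge0 => //; exact: ltW.
pose y s : R := \sum_(m : M) Num.sqrt (csq f (shift (m, m0 n oddL) (anc s.+1 v))).
have y0 s : 0 <= y s by apply: sumr_ge0.
pose Y : \bar R := (\sum_(s <oo) (y s)%:E)%E.
have Y0 : (0 <= Y)%E by apply: nneseries_ge0 => s _ _; rewrite lee_fin.
pose fb x := f x * \1_(big v) x.
have mc : measurable (cube v) by exact: measurable_lcell.
have mb : measurable (big v) by exact: measurable_lcell.
have mfb : measurable_fun setT fb by apply: measurable_funM => //; exact: measurable_indic.
have point x : cube v x -> (rsquare psi f x `^ 2^-1 <= rsquare psi fb x `^ 2^-1 + Y)%E.
  move=> vx; apply: (le_trans _ (sqrt_add_le (rsquare_ge0 psi fb x) Y0)).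
  apply: ge0_ler_poweR => //; first exact: rsquare_ge0.
  apply: (le_trans (rsquare_local f vx)); rewrite leeD2l//.
  apply: (le_trans _ (nneseries_sqr_le y0)); apply: lee_nneseries => [s _ _|s _].
    by apply: sume_ge0 => m _; rewrite lee_fin csq_ge0.
  rewrite sumEFin lee_fin /y; apply: le_trans (sum_sqr_le _ _) => //.
  by apply: ler_sum => m _; rewrite sqr_sqrtr ?csq_ge0.
have YX : ((sc v `^ (n%:R / t))%:E * Y <= K1%:E * X)%E.
  rewrite /Y -nneseriesZl; last by move=> s _; rewrite lee_fin.
  apply: (@le_trans _ _ (K1%:E * \sum_(s <oo) (q ^+ s.+1)%:E * \sum_(tau : M * M) a (shift tau (anc s.+1 v)))%E).
    rewrite -nneseriesZl; last first.
      by move=> s _; rewrite mule_ge0// ?lee_fin ?exprn_ge0 ?(ltW q_gt0)//; exact: sume_ge0.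
    apply: lee_nneseries => [s _ _|s _]; first by rewrite mule_ge0 ?lee_fin// powR_ge0.
    rewrite -EFinM mulr_sumr -sumEFin.
    have -> : (\sum_(tau : M * M) a (shift tau (anc s.+1 v)) = \sum_(m : M) \sum_(m' : M) a (shift (m, m') (anc s.+1 v)))%E.
      by rewrite pair_bigA; apply: eq_bigr => -[].
    rewrite muleA -EFinM ge0_sume_distrr => [|m _]; last exact: sume_ge0.
    by apply: lee_sum => m _; rewrite -K1E; exact: far_coef.
  by rewrite lee_wpmul2l ?lee_fin//; apply: ancestral_far => //; exact: ltW.
(* An infinite [Y] forces the ancestral sum to be infinite, by [YX]. *)
have [Yy|] := ltP Y +oo%E; last first.
  rewrite leye_eq => /eqP Yy; move: YX; rewrite Yy gt0_muley ?lte_fin ?powR_gt0 ?scale_gt0//.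
  rewrite leye_eq => /eqP KX; rewrite (_ : X = +oo%E) ?gt0_muley ?leey//.
  by move: KX X0; case: X => [x| |]//.
have [r rY] : exists r : R, Y = r%:E by exists (fine Y); rewrite fineK// ge0_fin_numE.
have r0 : 0 <= r by rewrite -lee_fin -rY.
have m1 : measurable_fun setT (fun x => (\1_(cube v) x)%:E : \bar R).
  by apply/measurable_EFinP; exact: measurable_indic.
have norm_le : (mixed_norm_on p (cube v) (sf f) <=
    c2%:E * (mixed_norm p (sf fb) + r%:E * (sc v `^ dim p)%:E))%E.
  rewrite -(mixed_norm_cube v p0) -mixed_norm_scale//.
  apply: (le_trans _ (c2P _ _ _ _ _ _)); first last.
  - by move=> z; rewrite -EFinM lee_fin mulr_ge0.
  - by move=> z; exact: sf_ge0.
  - exact: emeasurable_funM.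
  - exact: measurable_sf.
  apply: mixed_norm_le => //.
  - by apply: measurable_on => //; exact: measurable_sf.
  - by apply: emeasurable_funD; [exact: measurable_sf|exact: emeasurable_funM].
  - by move=> z; rewrite mule_ge0 ?poweR_ge0// lee_fin.
  move=> z; have [vz|vz] := pselect (cube v z).
    by rewrite indicE mem_set// !mule1 -rY point.
  by rewrite indicE memNset// !mule0 adde0 poweR_ge0.
have near : ((sc v `^ (n%:R / t - dim p))%:E * mixed_norm p (sf fb) <= (C1 * c3)%:E * X)%E.
  have h : (mixed_norm p (sf fb) <= C1%:E * mixed_norm_on p (big v) (fun x => `|f x|%:E))%E.
    apply: (le_trans (C1P _ mfb)); rewrite le_eqVlt; apply/orP; left; apply/eqP; congr (_ * mixed_norm p _)%E.
    by apply/funext => x; rewrite /fb normrM -EFinM [X in (_ * X)%R]ger0_norm.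
  have s0 : (0 <= (sc v `^ (n%:R / t - dim p))%:E :> \bar R)%E by rewrite lee_fin powR_ge0.
  apply: (le_trans (lee_wpmul2l s0 h)); rewrite muleCA (EFinM C1) -[leRHS]muleA lee_wpmul2l ?lee_fin ?(ltW C10)//.
  apply: (le_trans (lee_wpmul2l s0 (c3P _ v (mfE mf) _))) => //.
  rewrite muleCA lee_wpmul2l ?lee_fin ?(ltW c30)//.
  rewrite ge0_sume_distrr => [|m _]; last exact: mixed_norm_on_ge0.
  by have [+ _] := @ancestral_near R n L oddL q (ltW q_gt0) a a0 v.
rewrite /acoef; set S := (sc v `^ _)%:E; have S0 : (0 <= S)%E by rewrite lee_fin powR_ge0.
apply: (le_trans (lee_wpmul2l S0 norm_le)); rewrite muleCA (EFinM c2) -[leRHS]muleA lee_wpmul2l ?lee_fin//.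
rewrite ge0_muleDr ?mixed_norm_ge0//; last by rewrite -EFinM lee_fin mulr_ge0 ?powR_ge0.
have XE : (((C1 * c3 + K1 + 1)%:E) * X = (C1 * c3)%:E * X + K1%:E * X + X)%E.
  rewrite !EFinD !ge0_muleDl ?mul1e ?adde_ge0 ?lee_fin ?mulr_ge0 ?(ltW C10) ?(ltW c30)//.
rewrite XE; apply: (@le_trans _ _ ((C1 * c3)%:E * X + K1%:E * X)%E); last by rewrite leeDl.
apply: leeD => //; apply: le_trans YX.
rewrite rY /S -!EFinM lee_fin.
have -> : n%:R / t = (n%:R / t - dim p) + dim p by rewrite subrK.
by rewrite addrK [X in _ <= X * _]scd le_eqVlt; apply/orP; left; apply/eqP; ring.
Qed.


(** The square function is at least the contribution of [w] on the whole cube [w], so its local norm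
    there bounds the coefficients of [f]; the L^1 norm of [g] is bounded by Hoelder on [v]. *)
Let far_csq (f g : 'rV[R]_n -> R) v w : measurable_fun setT g -> ii g ->
  (forall x, ~ cube v x -> g x = 0) -> (mixed_norm (conj_exp p) (fun x => `|g x|%:E) <= 1)%E ->
  ((wpair psi f g w)%:E <=
   ((2 ^ n - 1)%:R * K0 * sc v `^ dim p * sc w `^ (- dim p))%:E * mixed_norm_on p (cube w) (sf f))%E.
Proof.
move=> mg ig gv g1; set nl : R := (2 ^ n - 1)%:R.
have mw : measurable (cube w) by exact: measurable_lcell.
have G1 : J (fun x => `|g x|) <= sc v `^ dim p.
  rewrite -lee_fin EFin_Rintegral; last exact: integrable_normR.
  have -> : (\int[mu]_x `|g x|%:E = \int[mu]_x (`|g x|%:E * (\1_(cube v) x)%:E))%E.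
    apply: eq_integral => x _; have [vx|vx] := pselect (cube v x).
      by rewrite indicE mem_set// mule1.
    by rewrite gv// normr0 mul0e.
  apply: (le_trans (hoelder_cube v q2 (mfE mg) _)) => //.
  have -> : mixed_norm_on (conj_exp p) (cube v) (fun x => `|g x|%:E) = mixed_norm (conj_exp p) (fun x => `|g x|%:E).
    congr mixed_norm; apply/funext => x; have [vx|vx] := pselect (cube v x).
      by rewrite indicE mem_set// mule1.
    by rewrite gv// normr0 mul0e.
  rewrite dim_conj// (_ : n%:R - (n%:R - dim p) = dim p); last by ring.
  by rewrite -[leRHS]mul1e lee_wpmul2r// lee_fin powR_ge0.
have csf : ((Num.sqrt (csq f w) * sc w `^ dim p)%:E <= mixed_norm_on p (cube w) (sf f))%E.
  have m1 : measurable_fun setT (fun x => (\1_(cube w) x)%:E : \bar R).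
    by apply/measurable_EFinP; exact: measurable_indic.
  rewrite EFinM -(mixed_norm_cube w p0) -mixed_norm_scale//.
  apply: mixed_norm_le => //.
  - exact: emeasurable_funM.
  - by apply: measurable_on => //; exact: measurable_sf.
  - move=> x; have [wx|wx] := pselect (cube w x); last by rewrite indicE memNset// !mule0.
    have := @rsquare_seq R n psi f [:: w] x isT.
    by rewrite big_seq1 sqrtr_sqr ger0_norm// indicE mem_set// mulr1 !mule1.
have k0 : 0 <= nl * K0 * sc v `^ dim p * sc w `^ (- dim p).
  by rewrite mulr_ge0 ?powR_ge0// mulr_ge0 ?powR_ge0// mulr_ge0.
apply: (le_trans _ (lee_wpmul2l _ csf)); last by rewrite lee_fin.
rewrite -EFinM lee_fin; apply: (le_trans (wpair_far_csq oddL H f w ig)); rewrite -/nl.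
have -> : nl * K0 * sc v `^ dim p * sc w `^ (- dim p) * (Num.sqrt (csq f w) * sc w `^ dim p) =
    nl * K0 * sc v `^ dim p * Num.sqrt (csq f w).
  have S0 : sc w `^ dim p != 0 by rewrite gt_eqF// powR_gt0// scale_gt0.
  by rewrite powRN; field.
by rewrite ler_wpM2r// ler_wpM2l// mulr_ge0.
Qed.

(** The local norm of [f] is computed by duality with test functions on [v], and Parseval's
    inequality brings in the coefficients. The number [A] only guarantees convergence and does not
    enter the constant. *)
Theorem converse_estimate : exists2 C : R, 0 < C & forall f A, locally_mixed p f -> 0 <= A ->
  (forall v, (acoef (fun x => `|f x|%:E) v <= A%:E)%E) ->
  forall v, (acoef (fun x => `|f x|%:E) v <= C%:E * ancestral_sum L q (acoef (sf f)) v)%E.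
Proof.
have [C2 C20 C2P] := mixed_square_bound n_gt0 psiP q2.
have [c2 c21 c2P] := @mixed_norm_add R n p (fun i => ltW (p1 i)).
have c20 : 0 < c2 by exact: lt_le_trans c21.
pose nl : R := (2 ^ n - 1)%:R.
have [K1 K10 K1E] : exists2 K1 : R, 0 <= K1 & nl * K0 = K1.
  by eexists; last exact: erefl; rewrite mulr_ge0.
exists (c2 * (C2 + K1)); first by rewrite mulr_gt0// ltr_wpDr.
move=> f A fp A0 fA v; have [mf fv] := fp.
pose a := acoef (sf f); have a0 w : (0 <= a w)%E by exact: acoef_ge0.
rewrite -/a; set X := ancestral_sum L q a v.
have X0 : (0 <= X)%E by apply: ancestral_sum_ge0 => //; exact: ltW.
have mc : measurable (cube v) by exact: measurable_lcell.
have cy : (mu (cube v) < +oo)%E by exact: (forest_lty (@forest_rV R 1 isT n) v).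
have nt0 : 0 < n%:R / t by rewrite divr_gt0// ltr0n.
pose S := sc v `^ (n%:R / t - dim p); have S0 : 0 < S by rewrite powR_gt0// scale_gt0.
(* The bound [A] on the Morrey coefficients is exactly decay with exponent n/t at coarse scales, as
   Parseval's inequality requires. *)
have grow w : sc w `^ (- dim p) * fine (kf oddL p f w) <= #|{: M}|%:R * A * sc w `^ (- (n%:R / t)).
  have h : sc w `^ (n%:R / t - dim p) * fine (kf oddL p f w) <= #|{: M}|%:R * A.
    rewrite -lee_fin -kf_acoef// EFinM -sum_cst; apply: lee_sum => m _; exact: fA.
  have -> : sc w `^ (- dim p) = sc w `^ (- (n%:R / t)) * sc w `^ (n%:R / t - dim p).
    by rewrite -scd; congr (_ `^ _); ring.
  by rewrite -mulrA [leRHS]mulrC ler_wpM2l// powR_ge0.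
(* A test function of dual norm at most 1. The wavelets not coarser than [v] give [C2], from the
   square function bound at the dual exponents, and the coarser ones give [K1]. *)
have test (g : 'rV[R]_n -> R) B : measurable_fun setT g -> (forall x, `|g x| <= B) ->
    (forall x, ~ cube v x -> g x = 0) -> (mixed_norm (conj_exp p) (fun x => `|g x|%:E) <= 1)%E ->
    (S%:E * `|J (fun x => f x * g x)|%:E <= (C2 + K1)%:E * X)%E.
  move=> mg gB gv g1.
  have ig : ii g by exact: (integrable_compact mc cy mg gv gB).
  have kA : 0 <= #|{: M}|%:R * A by rewrite mulr_ge0.
  have S0e : (0 <= S%:E)%E by rewrite lee_fin ltW.
  have par := parseval_local n_gt0 psiP H p1 fp kA nt0 grow mg gB gv.
  apply: (le_trans (lee_wpmul2l S0e par)).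
  have W0 w : (0 <= (wpair psi f g w)%:E)%E by rewrite lee_fin wpair_ge0.
  apply: (@le_trans _ _ (S%:E * (C2%:E * \sum_(m : M) mixed_norm_on p (cube (shift (m, m0 n oddL) v)) (sf f) +
     \sum_(s <oo) \sum_(m : M) (wpair psi f g (shift (m, m0 n oddL) (anc s.+1 v)))%:E))%E).
    rewrite lee_wpmul2l//; apply: (le_trans (@esum_split _ n L oddL 0 v _ W0 _)).
      by move=> w; rewrite eqe => /(wpair_meet H gv).
    rewrite leeD2r//; apply: esum_le_seq => s us.
    pose P w := ((anc 0 v).1 <= w.1) && (wpair psi f g w != 0).
    pose D := \bigcup_(m in [set: M]) cube (shift (m, m0 n oddL) v).
    have mD : measurable D by apply: fin_bigcup_measurable => // m _; exact: measurable_lcell.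
    apply: (@le_trans _ _ (\sum_(w <- [seq w <- s | P w]) (wpair psi f g w)%:E)%E).
      rewrite big_filter [leRHS]big_mkcond/=; apply: lee_sum => w _.
      case: ifPn => zw; last by case: ifP.
      have [w0|w0] := eqVneq (wpair psi f g w) 0.
        by rewrite w0; case: ifP => //; rewrite lee_fin wpair_ge0.
      by rewrite ifT// /P zw.
    have mon (m : M) : measurable_fun setT (fun x => (sf f x * (\1_(cube (shift (m, m0 n oddL) v)) x)%:E)%E).
      by apply: measurable_on; [exact: measurable_lcell|exact: measurable_sf].
    have on0 (m : M) x : (0 <= sf f x * (\1_(cube (shift (m, m0 n oddL) v)) x)%:E)%E.
      by rewrite mule_ge0 ?poweR_ge0// lee_fin.
    have mon2 (m : M) : measurable_fun setT (fun x => (sf f x * (\1_(cube (shift (m, m0 n oddL) v)) x)%:E * sf g x)%E).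
      by apply: emeasurable_funM => //; exact: measurable_sf.
    apply: (@le_trans _ _ (\int[mu]_x (sf f x * (\1_D x)%:E * sf g x))%E).
      apply: wpair_near => //; first exact: filter_uniq.
      move=> w; rewrite mem_filter => /andP[/andP[zw /(wpair_meet H gv)[x [wx vx]]] _].
      have [m [mw _]] := near_shift oddL wx vx zw.
      by move=> y /mw my; exists m.
    apply: (@le_trans _ _ (\int[mu]_x \sum_(m : M) (sf f x * (\1_(cube (shift (m, m0 n oddL) v)) x)%:E * sf g x))%E).
      apply: le_int => //.
      - apply: emeasurable_funM; last exact: measurable_sf.
        by apply: measurable_on => //; exact: measurable_sf.
      - exact: emeasurable_sum.
      - by move=> x; rewrite mule_ge0 ?poweR_ge0// mule_ge0 ?poweR_ge0// lee_fin.
      move=> x _; have [[m _ Dx]|Dx] := pselect (D x); last first.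
        by rewrite [\1_D x]indicE memNset// mule0 mul0e sume_ge0// => m _; rewrite mule_ge0 ?poweR_ge0.
      rewrite [\1_D x]indicE mem_set; last by exists m.
      rewrite (bigD1 m)//= [\1_(cube _) x in leRHS]indicE mem_set// leeDl// sume_ge0// => m' _.
      by rewrite mule_ge0 ?poweR_ge0.
    rewrite ge0_integral_sum//; last by move=> m x _; rewrite mule_ge0 ?poweR_ge0.
    rewrite ge0_sume_distrr => [|m _]; last exact: mixed_norm_on_ge0.
    apply: lee_sum => m _.
    have mh := @mixed_hoelder R n p (conj_exp p) _ (sf g) p0 q20 (fun i => conj_expP (p1 i))
      (mon m) (measurable_sf psi g) (on0 m) (sf_ge0 psi g).
    apply: (le_trans mh); rewrite muleC lee_wpmul2r ?mixed_norm_ge0//.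
    apply: (le_trans (C2P _ mg)); rewrite -[leRHS]mule1 lee_wpmul2l// lee_fin ltW//.
  have F0 : (0 <= C2%:E * \sum_(m : M) mixed_norm_on p (cube (shift (m, m0 n oddL) v)) (sf f))%E.
    by rewrite mule_ge0// ?lee_fin ?(ltW C20)//; apply: sume_ge0 => m _; exact: mixed_norm_on_ge0.
  have G0 : (0 <= \sum_(s <oo) \sum_(m : M) (wpair psi f g (shift (m, m0 n oddL) (anc s.+1 v)))%:E)%E.
    by apply: nneseries_ge0 => s _ _; exact: sume_ge0.
  rewrite ge0_muleDr// EFinD ge0_muleDl ?lee_fin ?(ltW C20)//; apply: leeD.
    rewrite muleCA lee_wpmul2l ?lee_fin ?(ltW C20)//.
    rewrite ge0_sume_distrr => [|m _]; last exact: mixed_norm_on_ge0.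
    by have [_] := @ancestral_near R n L oddL q (ltW q_gt0) a a0 v.
  apply: (le_trans _ (lee_wpmul2l _ (@ancestral_far R n L q (ltW q_gt0) a a0 v))); last by rewrite lee_fin.
  rewrite -!nneseriesZl; last 2 first.
  - by move=> s _; rewrite mule_ge0// ?lee_fin ?exprn_ge0 ?(ltW q_gt0)//; exact: sume_ge0.
  - by move=> s _; exact: sume_ge0.
  apply: lee_nneseries => [s _ _|s _]; first by rewrite mule_ge0//; exact: sume_ge0.
  have q0s : (0 <= (q ^+ s.+1)%:E :> \bar R)%E by rewrite lee_fin exprn_ge0// ltW.
  have K10e : (0 <= K1%:E :> \bar R)%E by rewrite lee_fin.
  have [_ hs] := @sum_shift_le R n L oddL a a0 (anc s.+1 v).
  apply: (le_trans _ (lee_wpmul2l K10e (lee_wpmul2l q0s hs))).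
  rewrite muleA -EFinM !ge0_sume_distrr//.
  apply: lee_sum => m _; set w := shift _ _.
  apply: (le_trans (lee_wpmul2l S0e (far_csq f w mg ig gv g1))).
  rewrite -/nl K1E muleA -EFinM /a /acoef muleA -EFinM lee_wpmul2r ?mixed_norm_on_ge0//.
  rewrite lee_fin le_eqVlt; apply/orP; left; apply/eqP.
  have wE : sc v `^ (n%:R / t) = q ^+ s.+1 * sc w `^ (n%:R / t) := sc_anc v s.+1 (m, m0 n oddL).
  have -> : S * (K1 * sc v `^ dim p * sc w `^ (- dim p)) = K1 * (S * sc v `^ dim p) * sc w `^ (- dim p) by ring.
  have -> : S * sc v `^ dim p = sc v `^ (n%:R / t) by rewrite /S -scd subrK.
  by rewrite wE scd; ring.
have trunc (m : nat) : (S%:E * mixed_norm_on p (cube v) (fun x => `|truncation f m x|%:E) <= (C2 + K1)%:E * X)%E.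
  pose fM x := `|truncation f m x| * \1_(cube v) x.
  have mtr := measurable_truncation mf m.
  have mfM : measurable_fun setT fM.
    by apply: measurable_funM; [exact: measurableT_comp|exact: measurable_indic].
  have fMB x : 0 <= fM x <= m%:R.
    have i1 : \1_(cube v) x <= 1 :> R by rewrite indicE; case: (x \in _).
    by rewrite mulr_ge0//= (le_trans _ (truncation_bound f m x))// ler_piMr.
  have fMv x : ~ cube v x -> fM x = 0 by move=> vx; rewrite /fM indicE memNset// mulr0.
  have [h [mh h0 hE h1]] := mixed_norm_dual p1 q20 (fun i => conj_expP (p1 i)) mfM fMB fMv.
  have -> : mixed_norm_on p (cube v) (fun x => `|truncation f m x|%:E) = mixed_norm p (fun x => (fM x)%:E).
    by congr mixed_norm; apply/funext => x; rewrite /fM EFinM.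
  rewrite -hE.
  have -> : ((C2 + K1)%:E * X = S%:E * (S^-1%:E * ((C2 + K1)%:E * X)))%E.
    by rewrite muleA -EFinM divff ?mul1e// gt_eqF.
  rewrite lee_wpmul2l ?lee_fin ?(ltW S0)//.
  (* The extremal function need not be bounded, but test functions must be; its truncations increase
     to it. The sign of [f], inserted below, turns the pairing with |f| into one with [f]. *)
  pose hk (k : nat) x := Num.min (h x) k%:R.
  have mhk k : measurable_fun setT (hk k) by exact: measurable_minr.
  have hk0 k x : 0 <= hk k x by rewrite /hk le_min h0 ler0n.
  apply: (@mct_sup _ _ _ mu (fun k x => (fM x * hk k x)%:E)).
  - by move=> k; apply/measurable_EFinP; exact: measurable_funM.
  - by move=> k x; rewrite lee_fin mulr_ge0//; have /andP[] := fMB x.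
  - move=> x i j ij; rewrite lee_fin ler_wpM2l//; first by have /andP[] := fMB x.
    by rewrite /hk le_min !ge_min lexx/= ler_nat ij orbT.
  - by apply/measurable_EFinP; exact: measurable_funM.
  - by move=> x; rewrite lee_fin mulr_ge0//; have /andP[] := fMB x.
  - move=> x; apply: ereal_sup_ubound; exists (Num.truncn (h x)).+1 => //.
    by rewrite /hk min_l// ltW// truncnS_gt.
  move=> k; pose sg x : R := 2 * \1_[set y | 0 <= f y] x - 1.
  have sgP x : f x * sg x = `|f x| /\ `|sg x| = 1.
    rewrite /sg indicE; have [fx|fx] := leP 0 (f x).
      by rewrite mem_set// ger0_norm// (_ : 2 * 1 - 1 = 1 :> R) ?mulr1 ?normr1//; ring.
    rewrite memNset; last by apply/negP; rewrite -ltNge.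
    by rewrite mulr0 sub0r mulrN1 normrN normr1 ltr0_norm.
  have msg : measurable_fun setT sg.
    apply: measurable_funB => //; apply: measurable_funM => //; apply: measurable_indic.
    rewrite (_ : [set y | _] = f @^-1` `[0, +oo[); last by apply/seteqP; split => y /=; rewrite in_itv/= andbT.
    by rewrite -[X in measurable X]setTI; exact: mf.
  pose g x := sg x * (hk k x * \1_(cube v) x).
  have mg : measurable_fun setT g.
    by apply: measurable_funM => //; apply: measurable_funM => //; exact: measurable_indic.
  have ghk x : `|g x| <= hk k x.
    have i1 : \1_(cube v) x <= 1 :> R by rewrite indicE; case: (x \in _).
    by rewrite /g normrM (proj2 (sgP x)) mul1r ger0_norm ?mulr_ge0// ler_piMr.
  have gB x : `|g x| <= k%:R by rewrite (le_trans (ghk x))// /hk ge_min lexx orbT.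
  have gv x : ~ cube v x -> g x = 0 by move=> vx; rewrite /g indicE memNset// !mulr0.
  have g1 : (mixed_norm (conj_exp p) (fun x => `|g x|%:E) <= 1)%E.
    apply: le_trans h1; apply: mixed_norm_le => //.
    - exact: mfE.
    - exact/measurable_EFinP.
    - by move=> x; rewrite lee_fin (le_trans (ghk x))// /hk ge_min lexx.
  have ifg : ii (fun x => f x * g x).
    have := integrable_mulR (locally_mixed_big v (isT : odd 1) p1 fp) mg gB.
    congr (mu.-integrable setT _); apply/funext => x /=; congr EFin.
    have [vx|vx] := pselect (cube v x); first by rewrite indicE mem_set// mulr1.
    by rewrite gv// !mulr0.
  have fgE x : f x * g x = `|f x| * (hk k x * \1_(cube v) x) by rewrite /g mulrA (proj1 (sgP x)).
  apply: (@le_trans _ _ (`|J (fun x => f x * g x)|%:E)%E).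
    apply: (@le_trans _ _ ((J (fun x => f x * g x))%:E)%E); last by rewrite lee_fin ler_norm.
    rewrite EFin_Rintegral//; apply: le_int => //.
    - by apply/measurable_EFinP; exact: measurable_funM.
    - by apply/measurable_EFinP; exact: measurable_funM.
    - by move=> x; rewrite lee_fin mulr_ge0//; have /andP[] := fMB x.
    - move=> x _; rewrite lee_fin fgE /fM -mulrA [X in _ * X]mulrC ler_wpM2r ?mulr_ge0//.
      exact: truncation_le.
  have Se : (0 <= S^-1%:E)%E by rewrite lee_fin invr_ge0 ltW.
  apply: (le_trans _ (lee_wpmul2l Se (test g _ mg gB gv g1))).
  have SS : S^-1 * S = 1 by rewrite mulVf// gt_eqF.
  by rewrite [leRHS]muleA -(EFinM S^-1 S) SS mul1e.
apply/lee_addgt0Pr => e e0.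
have cS0 : 0 < c2 * S by exact: mulr_gt0.
(* The remainder will be multiplied by the quasi-triangle constant [c2] and the Morrey weight [S],
   which leaves [e]. *)
have [|N /(_ N (leqnn N)) NP] := rest_vanishing p1 mf mc (fv v) (e := e / (c2 * S)).
  by rewrite divr_gt0.
have mtr := measurable_truncation mf N.
have mre : measurable_fun setT (fun x => f x - truncation f N x) by exact: measurable_funB.
have split : (mixed_norm_on p (cube v) (fun x => `|f x|%:E) <=
    c2%:E * (mixed_norm_on p (cube v) (fun x => `|truncation f N x|%:E) +
             mixed_norm_on p (cube v) (fun x => `|f x - truncation f N x|%:E)))%E.
  have mon (g : 'rV[R]_n -> R) : measurable_fun setT g ->
    measurable_fun setT (fun x => (`|g x|%:E * (\1_(cube v) x)%:E)%E).
    by move=> mg; apply: measurable_on => //; exact: mfE.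
  have on0 (g : 'rV[R]_n -> R) x : (0 <= `|g x|%:E * (\1_(cube v) x)%:E)%E.
    by rewrite mule_ge0// lee_fin.
  apply: (le_trans _ (c2P _ _ (mon _ mtr) (mon _ mre) (on0 _) (on0 _))).
  apply: mixed_norm_le => //; [exact: mon|by apply: emeasurable_funD; exact: mon|].
  move=> x; rewrite -!EFinM -EFinD lee_fin -mulrDl ler_wpM2r//.
  by rewrite (le_trans _ (ler_normD _ _))// addrC subrK.
have S0e : (0 <= S%:E)%E by rewrite lee_fin ltW.
rewrite /acoef -/S; apply: (le_trans (lee_wpmul2l S0e split)).
rewrite muleCA ge0_muleDr ?mixed_norm_on_ge0// ge0_muleDr; last 2 first.
- by rewrite mule_ge0 ?mixed_norm_on_ge0.
- by rewrite mule_ge0 ?mixed_norm_on_ge0.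
apply: leeD.
  by rewrite (EFinM c2) -muleA lee_wpmul2l ?lee_fin ?(ltW c20).
apply: (@le_trans _ _ (c2%:E * (S%:E * (e / (c2 * S))%:E))%E).
  by rewrite lee_wpmul2l ?lee_fin ?(ltW c20)// lee_wpmul2l.
rewrite -!EFinM lee_fin le_eqVlt; apply/orP; left; apply/eqP; field.
by rewrite !gt_eqF.
Qed.

End local_estimates.

(** * Lebesgue measurable functions *)

Import HBNNSimple.

Section null_sets.
Context d (T : measurableType d) (R : realType) (mu : {measure set T -> \bar R}).
Local Open Scope ereal_scope.

Lemma nonneg_integral_null_le (f g : T -> \bar R) (N : set T) : measurable N -> mu N = 0 ->
  (forall x, 0 <= f x) -> (forall x, 0 <= g x) -> (forall x, ~ N x -> f x <= g x) ->
  \int[mu]_x f x <= \int[mu]_x g x.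
Proof.
move=> mN N0 f0 g0 fg; rewrite !ge0_integralTE//; apply: ge_ereal_sup => _ [h hf <-].
have mNc : measurable (~` N) by exact: measurableC.
apply: ereal_sup_ubound; exists (proj_nnsfun h mNc) => /=.
  move=> x; rewrite mindicE; have [Nx|Nx] := pselect (N x).
    by rewrite memNset ?mulr0//; exact: contrapT.
  by rewrite mem_set// mulr1 (le_trans (hf x))// fg.
rewrite -!integralT_nnsfun; pose hN := proj_nnsfun h mN.
have mh (k : {nnsfun T >-> R}) : measurable_fun setT (fun x => (k x)%:E).
  by apply/measurable_EFinP; exact: measurable_funP.
have hN0 : \int[mu]_x (hN x)%:E = 0.
  apply: (@ae_zero_integral _ _ _ mu (fun x => (hN x)%:E) N) => //.
  - by move=> x; rewrite lee_fin.
  - by move=> x Nx; rewrite /hN /= mindicE memNset// mulr0.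
rewrite -[LHS]adde0 -[X in _ + X]hN0 -ge0_integralD//; try by move=> x _; rewrite lee_fin.
apply: eq_integral => x _; rewrite /hN /= !mindicE -EFinD -mulrDr; congr EFin.
have [Nx|Nx] := pselect (N x).
  have -> : (x \in ~` N) = false by apply: memNset => h'; exact: h'.
  by have -> : (x \in N) = true by [exact: mem_set]; rewrite add0r mulr1.
have -> : (x \in ~` N) = true by exact: mem_set.
by have -> : (x \in N) = false by [exact: memNset]; rewrite addr0 mulr1.
Qed.

Lemma integral_null_eq (f g : T -> \bar R) (N : set T) : measurable N -> mu N = 0 ->
  (forall x, ~ N x -> f x = g x) -> \int[mu]_x f x = \int[mu]_x g x.
Proof.
move=> mN N0 fg.
have eqp (u v : T -> \bar R) : (forall x, 0 <= u x) -> (forall x, 0 <= v x) ->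
    (forall x, ~ N x -> u x = v x) -> \int[mu]_x u x = \int[mu]_x v x.
  move=> u0 v0 uv; apply/eqP; rewrite eq_le; apply/andP; split.
    by apply: (nonneg_integral_null_le mN N0) => // x Nx; rewrite uv.
  by apply: (nonneg_integral_null_le mN N0) => // x Nx; rewrite uv.
rewrite integralE [RHS]integralE; congr (_ - _); apply: eqp => // x Nx.
  by rewrite !funeposE fg.
by rewrite !funenegE fg.
Qed.

End null_sets.

Section mixed_null_sets.
Context {R : realType}.
Local Open Scope ereal_scope.

(** By Tonelli almost every slice of [N] is null, so the inner norms agree off a null set of the
    remaining variables. The points with a nonnull slice form the exceptional set of the
    induction. *)
Lemma mixed_norm_null n (p : 'I_n -> R) (F G : 'rV[R]_n -> \bar R) (N : set 'rV[R]_n) :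
  measurable N -> lebesgue_rV R n N = 0 -> (forall x, ~ N x -> F x = G x) ->
  mixed_norm p F = mixed_norm p G.
Proof.
elim: n p F G N => [|n ih] p F G N mN N0 FG.
  rewrite /= FG// => Nx; move: N0; rewrite /= diracE mem_set// => /eqP.
  by rewrite onee_eq0.
pose I x : \bar R := (\1_N x)%:E.
have mI : measurable_fun setT I by apply/measurable_EFinP; exact: measurable_indic.
have I0 x : 0 <= I x by rewrite lee_fin.
have mIy := measurable_tonelli mI I0.
have Iy0 y : 0 <= \int[@lebesgue_measure R]_x I (rV_cons (x, y)) by exact: integral_ge0.
have /(zero_ae (p := 1))[//|//||mN' N'0] : \int[lebesgue_rV R n]_y (\int[@lebesgue_measure R]_x I (rV_cons (x, y))) `^ 1 = 0.
  under eq_integral do rewrite poweRe1//.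
  rewrite -lebesgue_rV_tonelli// /I integral_indic ?setIT//.
  exact: Iy0.
apply: (ih _ _ _ _ mN' N'0) => y /negP/negPn/eqP Ny0.
rewrite unlock; congr (_ `^ _).
pose Ny := [set x : measurableTypeR R | N (rV_cons (x, y))].
have mNy : measurable Ny.
  have := measurable_cons y mI measurableT (emeasurable_set1 1%:E); rewrite setTI; congr measurable.
  apply/seteqP; split => x /=; rewrite /I /Ny /= indicE.
    have [//|h] := pselect (N (rV_cons (x, y))); rewrite memNset//= => /eqP.
    by rewrite eqe eq_sym oner_eq0.
  by move=> h; rewrite mem_set.
apply: (integral_null_eq mNy); last by move=> x Nx; rewrite FG.
move: Ny0; rewrite /I (_ : (fun x => _) = (fun x => (\1_Ny x)%:E)) ?integral_indic ?setIT//.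
Qed.

End mixed_null_sets.

Section lebesgue_borel.
Context {R : realType} (n : nat).
Local Notation mu := (lebesgue_rV R n).

(** Each superlevel set at a rational height is Borel up to a null set. Off the union of these
    countably many null sets the function is kept, on it the function is set to 0. *)
Lemma lebesgue_measurable_borel (h : 'rV[R]_n -> R) : lebesgue_measurable h ->
  exists2 h' : 'rV[R]_n -> R, measurable_fun setT h' &
  exists2 N : set 'rV[R]_n, measurable N /\ mu N = 0%E & forall x, ~ N x -> h x = h' x.
Proof.
move=> lh.
have hq (q : rat) : exists AM : set 'rV[R]_n * set 'rV[R]_n,
    [/\ measurable AM.1, measurable AM.2, mu AM.2 = 0%E &
        forall x, ~ AM.2 x -> (ratr q < h x <-> AM.1 x)].
  have [|A mA [N0 [M [mM M0 NM]] hE]] := lh `]ratr q, +oo[%classic; first exact: measurable_itv.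
  exists (A, M); split => //= x Mx; have : (h @^-1` `]ratr q, +oo[) x <-> (A `|` N0) x by rewrite hE.
  rewrite /= in_itv/= andbT => -[h1 h2]; split=> [/h1[//|/NM//]|Ax].
  by apply: h2; left.
have [AM AMP] := choice hq.
pose N := \bigcup_q (AM q).2.
have mN : measurable N by apply: bigcupT_measurable_rat => q; have [] := AMP q.
exists (fun x => h x * \1_(~` N) x).
  apply: (measurability _ (@RGenOInfty.measurableE R)) => _ [_ [a ->] <-].
  (* On [N] the new function is 0, so [N] is counted for the negative rationals only. *)
  rewrite setTI (_ : _ @^-1` _ = \bigcup_q (if a < ratr q then ((AM q).1 `&` ~` N) `|` (if ratr q < 0 :> R then N else set0) else set0)).
    apply: bigcupT_measurable_rat => q; case: ifP => // _.
    have [mA _ _ _] := AMP q; apply: measurableU; last by case: ifP.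
    by apply: measurableI => //; exact: measurableC.
  apply/seteqP; split => x /=.
    rewrite in_itv/= andbT => ax.
    have [q] := rat_in_itvoo ax; rewrite in_itv/= => /andP[aq qx].
    exists q => //; rewrite aq.
    have [Nx|Nx] := pselect (N x).
      by right; move: qx; rewrite indicE memNset ?mulr0 => [->|h2]//; exact: h2.
    left; split => //; have [_ _ _ /(_ x)] := AMP q; move=> /(_ _)[].
      by move=> Mx; apply: Nx; exists q.
    by move=> + _; apply; move: qx; rewrite indicE mem_set// mulr1.
  move=> [q _]; case: ifP => // aq; rewrite in_itv/= andbT => -[[Ax Nx]|].
    have [_ _ _ /(_ x)] := AMP q; move=> /(_ _)[].
      by move=> Mx; apply: Nx; exists q.
    move=> _ /(_ Ax) qx; rewrite indicE mem_set// mulr1.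
    exact: lt_trans qx.
  case: ifP => // q0 Nx; rewrite indicE memNset; last by apply.
  by rewrite mulr0; exact: lt_trans q0.
exists N; last by move=> x Nx; rewrite indicE mem_set// mulr1.
split=> //; apply/eqP; rewrite eq_le measure_ge0 andbT.
suff -> : mu N = 0%E by [].
apply/negligibleP => //.
pose Fk (k : nat) := if unpickle k is Some q then (AM q).2 else set0.
apply: (@negligibleS _ _ _ mu (\bigcup_k Fk k)).
  move=> x [q _ Mx]; exists (pickle q); first exact: Logic.I.
  rewrite /Fk pickleK; exact: Mx.
apply: negligible_bigcup => k; rewrite /Fk; case: unpickle => [q|]; last exact: negligible_set0.
by have [_ mM M0 _] := AMP q; apply/negligibleP.
Qed.

End lebesgue_borel.

(** * Morrey norms and square functions in terms of dyadic indices *)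

Section index_form.
Context {R : realType} (n : nat) (n_gt0 : (0 < n)%N).
Local Notation V := (int * 'rV[int]_n)%type.
Local Notation cube := (@lcell R 1 n).
Local Notation mu := (lebesgue_rV R n).
Local Open Scope ereal_scope.

Lemma dyadic_cubeE (v : V) : dyadic_cube v.1 v.2 = cube v.
Proof. by []. Qed.

Lemma volume_cube (v : V) : volume (cube v) = (scale v ^+ n)%R.
Proof. by have := @vol_lcell R n 1 v; rewrite mulr1. Qed.

(** The volume determines the level, and two cubes of one level with a common point coincide. The
    sum over the set of cubes thus becomes a sum over indices without repetition. *)
Lemma lcell_inj : injective cube.
Proof.
move=> v w vw; have := volume_cube v; rewrite vw volume_cube => /esym/eqP.
rewrite eqrXn2 ?(ltW (scale_gt0 _))// => /eqP sE.
have e : v.1 = w.1.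
  have [h|h|//] := ltgtP v.1 w.1; move/eqP: sE; rewrite /scale.
    by rewrite gt_eqF// ltr_eXz2l ?ltr1n// ltrN2.
  by rewrite lt_eqF// ltr_eXz2l ?ltr1n// ltrN2.
pose x : 'rV[R]_n := (\row_i (2 ^ (- v.1) * (v.2 ord0 i)%:~R))%R.
have vx : cube v x.
  apply: lcellP => i; rewrite mxE mulrA -expfzDr// subrr mul1r lexx /=.
  by rewrite intrD ltrDl.
have wx : cube w x by rewrite -vw.
exact: cube_uniq vx wx e.
Qed.

Lemma bourgain_morrey_normE (p : 'I_n -> R) (t : R) (r : \bar R) (G : 'rV[R]_n -> \bar R) :
  r = +oo \/ (exists2 r' : R, r = r'%:E & (0 < r')%R) ->
  bourgain_morrey_norm p t r G = seq_norm r (acoef p t G).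
Proof.
have n0 : (n%:R != 0 :> R)%R by rewrite pnatr_eq0 -lt0n.
have sE (v : V) (a b : R) : (volume (cube v) `^ (a - b * \sum_i (p i)^-1) =
    scale v `^ (n%:R * (a - b * dim p)))%R.
  by rewrite volume_cube powRrM powR_mulrn// ltW// scale_gt0.
have D : @dyadic_cubes R n = cube @` [set: V].
  apply/seteqP; split => Q.
    by move=> [j [k ->]]; exists (j, k).
  by move=> [[j k] _ <-]; exists j, k.
have nE : (n%:R / t - dim p = n%:R * (t^-1 - n%:R^-1 * dim p))%R.
  by rewrite mulrBr mulrA divff// mul1r.
case=> [->|[r' -> r0]].
  rewrite /= D; congr ereal_sup; apply/seteqP; split => y.
    by move=> [_ [v _ <-] <-]; exists v => //; rewrite sE -nE.
  by move=> [v _ <-]; exists (cube v); [exists v|rewrite sE -nE].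
rewrite /= (@reindex_esum R _ _ [set: V] (@dyadic_cubes R n) cube); last first.
  split.
  - by move=> v _; rewrite D; exists v.
  - by move=> v w _ _; exact: lcell_inj.
  - by rewrite D.
congr (_ `^ _); apply: eq_esum => v _.
rewrite sE /acoef poweRM ?mixed_norm_on_ge0 ?lee_fin ?powR_ge0// poweR_EFin -powRrM.
by congr ((_ `^ _)%:E * _); move: (t^-1)%R => u; field.
Qed.

Lemma le_seq_norm (r : \bar R) (a : V -> \bar R) v :
  r = +oo \/ (exists2 r' : R, r = r'%:E & (0 < r')%R) -> (forall v, 0 <= a v) ->
  a v <= seq_norm r a.
Proof.
move=> hr a0; case: hr => [->|[r' -> r0]]; first by apply: ereal_sup_ubound; exists v.
rewrite /= -[leLHS](ge0_poweRK r0 (a0 v)); apply: ge0_ler_poweR; first by rewrite invr_ge0 ltW.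
  exact: poweR_ge0.
have := @seq_le_esum R V [:: v] (fun v => a v `^ r'); rewrite big_seq1; apply => //.
by move=> w; exact: poweR_ge0.
Qed.

End index_form.

Section square_function_form.
Context {R : realType} (n : nat) (psi : 'I_(2 ^ n - 1) -> 'rV[R]_n -> R).
Local Notation mu := (lebesgue_rV R n).

(** The wavelets are real, so the squared modulus of a coefficient is the sum of the squares for the
    real and imaginary parts, and the square of [chi] is the indicator divided by the volume.
    Integrals ignore the null set, so the equality holds at every point. *)
Lemma square_functionE (f : 'rV[R]_n -> R[i]) (f1 f2 : 'rV[R]_n -> R) (N : set 'rV[R]_n) :
  measurable N -> mu N = 0%E ->
  (forall x, ~ N x -> complex.Re (f x) = f1 x) -> (forall x, ~ N x -> complex.Im (f x) = f2 x) ->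
  square_function psi f = (fun x => (rsquare psi f1 x + rsquare psi f2 x) `^ 2^-1)%E.
Proof.
move=> mN N0 fr fi; apply/funext => x; rewrite /square_function; congr (_ `^ _)%E.
have wE (u u1 : 'rV[R]_n -> R) l v : (forall x, ~ N x -> u x = u1 x) ->
    \int[mu]_x (u x * dilate (psi l) v.1 v.2 x) = wcoef mu (wavelet psi) u1 l v.
  move=> uu; rewrite /wcoef /Rintegral; congr fine; apply: (integral_null_eq mN N0) => y Ny.
  by rewrite uu.
rewrite -esum_sum => [|v l _ _]; last by rewrite lee_fin sqr_ge0.
rewrite /rsquare -esumD; last 2 first.
- by move=> v _; rewrite lee_fin mulr_ge0 ?csq_ge0.
- by move=> v _; rewrite lee_fin mulr_ge0 ?csq_ge0.
pose wc u l v := wcoef mu (wavelet psi) u l v.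
have cE l (v : int * 'rV[int]_n) : Normc.normc (pairing f (dilate (psi l) v.1 v.2) * (chi v.1 v.2 x)%:C%C) ^+ 2 =
    (wc f1 l v ^+ 2 + wc f2 l v ^+ 2) * chi v.1 v.2 x ^+ 2.
  rewrite normc_sqr complex_ReM complex_ImM /pairing /= (wE _ _ _ _ fr) (wE _ _ _ _ fi).
  by rewrite [X in X + _]exprMn [X in _ + X]exprMn -mulrDl.
apply: eq_esum => v _.
rewrite (eq_bigr (fun l => ((wc f1 l v ^+ 2 + wc f2 l v ^+ 2) * chi v.1 v.2 x ^+ 2)%:E)) => [|l _]; last by rewrite cE.
rewrite -EFinD sumEFin; congr EFin.
rewrite !csqE -!mulrDl -big_split/= -mulr_suml -mulrA; congr (_ * _).
rewrite /chi exprMn; have -> : (2 `^ (v.1%:~R * n%:R / 2)) ^+ 2 = (scale v ^+ n)^-1 :> R.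
  rewrite -powR_mulrn ?powR_ge0// -powRrM divfK ?pnatr_eq0// powRrM powR_mulrn ?powR_ge0//.
  by rewrite powR_intmul// /scale -exprVn -invr_expz invrK.
by congr (_ * _); rewrite dyadic_cubeE indicE; case: (_ \in _); rewrite ?expr1n ?expr0n.
Qed.

End square_function_form.

(** * Equivalence of norms *)

Section norm_equivalence.
Context {R : realType} (n : nat) (n_gt0 : (0 < n)%N) (p : 'I_n -> R) (p1 : forall i, 1 < p i)
  (t : R) (t1 : 1 < t) (r : \bar R)
  (hr : r = +oo%E \/ (exists2 r' : R, r = r'%:E & (1 < r')%R /\ (t < r')%R))
  (psi : 'I_(2 ^ n - 1) -> 'rV[R]_n -> R) (psiP : compact_wavelets n.+1 n psi).
Local Notation V := (int * 'rV[int]_n)%type.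
Local Notation cube := (@lcell R 1 n).
Local Notation a := (acoef p t).
Local Notation sf f := (fun x => rsquare psi f x `^ 2^-1)%E.
Local Open Scope ereal_scope.

Let p0 i : (0 < p i)%R. Proof. exact: lt_trans (p1 i). Qed.
Let t0 : (0 < t)%R. Proof. exact: lt_trans t1. Qed.
Let hr0 : r = +oo \/ (exists2 r' : R, r = r'%:E & (0 < r')%R).
Proof. by case: hr => [|[r' rE [r1 _]]]; [left|right; exists r' => //; exact: lt_trans r1]. Qed.

Lemma seq_norm_ge0 (b : V -> \bar R) : (forall v, 0 <= b v) -> 0 <= seq_norm r b.
Proof. by move=> b0; apply: (le_trans (b0 (0, 0)%R)); exact: le_seq_norm. Qed.

Lemma acoef_le F G v : measurable_fun setT F -> measurable_fun setT G ->
  (forall x, 0 <= F x) -> (forall x, F x <= G x) -> a F v <= a G v.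
Proof.
move=> mF mG F0 FG; rewrite lee_wpmul2l ?lee_fin ?powR_ge0//.
apply: mixed_norm_on_le => //; try exact: measurable_lcell.
by move=> x; exact: le_trans (F0 x) (FG x).
Qed.

Lemma acoef_add : exists2 c : R, (0 < c)%R & forall F G K v,
  measurable_fun setT F -> measurable_fun setT G -> measurable_fun setT K ->
  (forall x, 0 <= F x) -> (forall x, 0 <= G x) -> (forall x, 0 <= K x) ->
  (forall x, K x <= F x + G x) -> a K v <= c%:E * (a F v + a G v).
Proof.
have [c c1 cP] := @mixed_norm_add R n p (fun i => ltW (p1 i)).
exists c => [|F G K v mF mG mK F0 G0 K0 KFG]; first exact: lt_le_trans c1.
have mon (E : 'rV[R]_n -> \bar R) : measurable_fun setT E -> measurable_fun setT (fun x => E x * (\1_(cube v) x)%:E).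
  by move=> mE; apply: measurable_on => //; exact: measurable_lcell.
rewrite /acoef -ge0_muleDr ?mixed_norm_on_ge0// muleCA lee_wpmul2l ?lee_fin ?powR_ge0//.
apply: (le_trans _ (cP _ _ (mon _ mF) (mon _ mG) _ _)); try by move=> x; exact: on_ge0.
apply: mixed_norm_le => //.
- exact: mon.
- by apply: emeasurable_funD; exact: mon.
- by move=> x; exact: on_ge0.
- by move=> x; rewrite -ge0_muleDl// lee_wpmul2r// lee_fin.
Qed.

Lemma ancestral_sum_le L (q : R) (b b' : V -> \bar R) v : (0 <= q)%R -> (forall v, 0 <= b v) ->
  (forall v, b v <= b' v) -> ancestral_sum L q b v <= ancestral_sum L q b' v.
Proof.
move=> q0 b0 bb; apply: lee_nneseries => [s _ _|s _].
  by rewrite mule_ge0 ?lee_fin ?exprn_ge0//; exact: sume_ge0.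
by rewrite lee_wpmul2l ?lee_fin ?exprn_ge0//; apply: lee_sum.
Qed.

(** The local estimates for the two real components are combined at each cube and then summed over
    ancestors. Finiteness of the norm of the modulus makes both components locally of finite mixed
    norm and supplies the bound [A] of the converse estimate. *)
Theorem norm_equivalence : exists2 C : R, (0 < C)%R & forall f1 f2 : 'rV[R]_n -> R,
  measurable_fun setT f1 -> measurable_fun setT f2 ->
  let m x := (Num.sqrt (f1 x ^+ 2 + f2 x ^+ 2))%:E in
  let s x := (rsquare psi f1 x + rsquare psi f2 x) `^ 2^-1 in
  seq_norm r (a m) < +oo ->
  seq_norm r (a m) <= C%:E * seq_norm r (a s) /\
  seq_norm r (a s) <= C%:E * seq_norm r (a m).
Proof.
have [L [K0 [oddL H]]] := wavelet_frame_rV n_gt0 psiP.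
have [C1 C10 C1P] := direct_estimate n_gt0 psiP oddL H p1 t.
have [C2 C20 C2P] := converse_estimate n_gt0 psiP oddL H p1 t0.
have [c c0 cP] := acoef_add.
pose q : R := (2 `^ (- (n%:R / t)))%R; have q0 : (0 <= q)%R by exact: powR_ge0.
(* The real and the imaginary part contribute equally, and [c] is the price of adding their local
   norms. *)
have CA0 : (0 <= c * (C1 + C1))%R by rewrite mulr_ge0 ?addr_ge0 ?(ltW c0) ?(ltW C10).
have CB0 : (0 <= c * (C2 + C2))%R by rewrite mulr_ge0 ?addr_ge0 ?(ltW c0) ?(ltW C20).
have [CU CU0 CUP] := ancestral_sum_norm oddL n_gt0 t0 (erefl q) CA0 hr.
have [CL CL0 CLP] := ancestral_sum_norm oddL n_gt0 t0 (erefl q) CB0 hr.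
exists (CU + CL)%R => [|f1 f2 mf1 mf2 m s my]; first exact: addr_gt0.
have mm : measurable_fun setT m.
  apply/measurable_EFinP; rewrite (_ : (fun x => _) = (fun x => (f1 x ^+ 2 + f2 x ^+ 2) `^ 2^-1)%R); last first.
    by apply/funext => x; rewrite powR12_sqrt// addr_ge0 ?sqr_ge0.
  by apply: emeasurable_powR; apply: measurable_funD; exact: measurable_funX.
have ms : measurable_fun setT s.
  by apply: emeasurable_poweR; apply: emeasurable_funD; exact: measurable_rsquare.
have m_ge0 x : 0 <= m x by rewrite lee_fin sqrtr_ge0.
have s_ge0 x : 0 <= s x by exact: poweR_ge0.
have n1 : measurable_fun setT (fun x => `|f1 x|%:E : \bar R) by exact: measurable_normE.
have n2 : measurable_fun setT (fun x => `|f2 x|%:E : \bar R) by exact: measurable_normE.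
have f1m x : `|f1 x|%:E <= m x by rewrite lee_fin -sqrtr_sqr ler_wsqrtr// lerDl sqr_ge0.
have f2m x : `|f2 x|%:E <= m x by rewrite lee_fin -sqrtr_sqr ler_wsqrtr// lerDr sqr_ge0.
have mf x : m x <= `|f1 x|%:E + `|f2 x|%:E.
  rewrite -EFinD lee_fin -[leRHS]ger0_norm ?addr_ge0// -sqrtr_sqr ler_wsqrtr//.
  rewrite -[(f1 x ^+ 2)%R]real_normK ?num_real// -[(f2 x ^+ 2)%R]real_normK ?num_real//.
  by rewrite sqrrD addrAC lerDl mulrn_wge0// mulr_ge0.
have r0 f x : 0 <= rsquare psi f x by exact: rsquare_ge0.
have sf1 x : sf f1 x <= s x by apply: ge0_ler_poweR; rewrite ?invr_ge0// leeDl.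
have sf2 x : sf f2 x <= s x by apply: ge0_ler_poweR; rewrite ?invr_ge0// leeDr.
have ssf x : s x <= sf f1 x + sf f2 x.
  have := @sqrt_add_le R (rsquare psi f1 x) (sf f2 x) (r0 _ _) (sf_ge0 psi f2 x).
  by rewrite ge0_poweRVK.
have am v : a m v <= seq_norm r (a m) by apply: le_seq_norm => // w; exact: acoef_ge0.
have loc (f : 'rV[R]_n -> R) : measurable_fun setT f -> (forall x, `|f x|%:E <= m x) -> locally_mixed p f.
  move=> mf' fm; split=> // v.
  have : a (fun x => `|f x|%:E) v < +oo.
    apply: (@le_lt_trans _ _ (a m v)); last exact: le_lt_trans (am v) my.
    by apply: acoef_le => //; exact: measurable_normE.
  rewrite /acoef; have := mixed_norm_on_ge0 p (cube v) (fun x => `|f x|%:E).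
  case: mixed_norm_on => [y| |]//; rewrite ?ltry// => _.
  by rewrite gt0_muley ?lte_fin ?powR_gt0 ?scale_gt0.
have l1 := loc f1 mf1 f1m; have l2 := loc f2 mf2 f2m.
have N0 : 0 <= seq_norm r (a m) by apply: seq_norm_ge0 => v; exact: acoef_ge0.
have [A AE] : exists A : R, seq_norm r (a m) = A%:E.
  by exists (fine (seq_norm r (a m))); rewrite fineK// ge0_fin_numE.
have A0 : (0 <= A)%R by rewrite -lee_fin -AE.
have bound (f : 'rV[R]_n -> R) : measurable_fun setT f -> (forall x, `|f x|%:E <= m x) ->
    forall v, a (fun x => `|f x|%:E) v <= A%:E.
  move=> mf' fm v; rewrite -AE; apply: (le_trans _ (am v)).
  by apply: acoef_le => //; exact: measurable_normE.
have upper v : a s v <= (c * (C1 + C1))%:E * ancestral_sum L q (a m) v.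
  have X0 : 0 <= ancestral_sum L q (a m) v by apply: ancestral_sum_ge0 => // w; exact: acoef_ge0.
  apply: (le_trans (cP _ _ _ v (measurable_sf psi f1) (measurable_sf psi f2) ms (sf_ge0 _ _) (sf_ge0 _ _) s_ge0 ssf)).
  rewrite (EFinM c) -muleA lee_wpmul2l ?lee_fin ?(ltW c0)// EFinD ge0_muleDl ?lee_fin ?(ltW C10)//.
  apply: leeD.
    apply: (le_trans (C1P f1 l1 v)); rewrite lee_wpmul2l ?lee_fin ?(ltW C10)//.
    by apply: ancestral_sum_le => // w; [exact: acoef_ge0|exact: acoef_le].
  apply: (le_trans (C1P f2 l2 v)); rewrite lee_wpmul2l ?lee_fin ?(ltW C10)//.
  by apply: ancestral_sum_le => // w; [exact: acoef_ge0|exact: acoef_le].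
have lower v : a m v <= (c * (C2 + C2))%:E * ancestral_sum L q (a s) v.
  have X0 : 0 <= ancestral_sum L q (a s) v by apply: ancestral_sum_ge0 => // w; exact: acoef_ge0.
  apply: (le_trans (cP _ _ _ v n1 n2 mm _ _ m_ge0 mf)) => //.
  rewrite (EFinM c) -muleA lee_wpmul2l ?lee_fin ?(ltW c0)// EFinD ge0_muleDl ?lee_fin ?(ltW C20)//.
  have h (f : 'rV[R]_n -> R) : (forall x, sf f x <= s x) -> ancestral_sum L q (a (sf f)) v <= ancestral_sum L q (a s) v.
    move=> fs; apply: ancestral_sum_le => // w; first exact: acoef_ge0.
    by apply: acoef_le => //; [exact: measurable_sf|move=> x; exact: poweR_ge0].
  apply: leeD.
    apply: (le_trans (C2P f1 A l1 A0 (bound f1 mf1 f1m) v)); rewrite lee_wpmul2l ?lee_fin ?(ltW C20)//.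
    exact: h.
  apply: (le_trans (C2P f2 A l2 A0 (bound f2 mf2 f2m) v)); rewrite lee_wpmul2l ?lee_fin ?(ltW C20)//.
  exact: h.
have as0 v : 0 <= a s v by exact: acoef_ge0.
have am0 v : 0 <= a m v by exact: acoef_ge0.
split.
  apply: (le_trans (CLP _ _ as0 am0 lower)); rewrite lee_wpmul2r ?seq_norm_ge0//.
  by rewrite lee_fin lerDr ltW.
apply: (le_trans (CUP _ _ am0 as0 upper)); rewrite lee_wpmul2r ?seq_norm_ge0//.
by rewrite lee_fin lerDl ltW.
Qed.

End norm_equivalence.

Theorem theorem9p1 (R : realType) (n : nat) (n_gt0 : (0 < n)%N)
    (p : 'I_n -> R) (p_gt1 : forall i, 1 < p i) (t : R) (r : \bar R)
    (t_r : [/\ 1 < hmean p, hmean p < t,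
               (t%:E < r)%E & (r < +oo)%E] \/
           [/\ 1 < hmean p, hmean p <= t & r = +oo%E])
    (psi : 'I_(2 ^ n - 1) -> 'rV[R]_n -> R)
    (psi_wavelets : compact_wavelets n.+1 n psi) :
  exists C : R, 0 < C /\
    forall f : 'rV[R]_n -> R[i], bourgain_morrey p t r f ->
      (bourgain_morrey_norm p t r (modulus f) <=
         C%:E * bourgain_morrey_norm p t r (square_function psi f))%E /\
      (bourgain_morrey_norm p t r (square_function psi f) <=
         C%:E * bourgain_morrey_norm p t r (modulus f))%E.
Proof.
have t1 : 1 < t by case: t_r => -[h1 h2 _ *]; [exact: lt_trans h2|exact: lt_le_trans h2].
have hr : r = +oo%E \/ (exists2 r' : R, r = r'%:E & (1 < r')%R /\ (t < r')%R).
  case: t_r => [[_ _]|[_ _ ->]]; last by left.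
  case: r => [r'| |]// tr _; right; exists r' => //.
  by move: tr; rewrite lte_fin => tr; split => //; exact: lt_trans tr.
have hr0 : r = +oo%E \/ (exists2 r' : R, r = r'%:E & (0 < r')%R).
  by case: hr => [|[r' rE [r1 _]]]; [left|right; exists r' => //; exact: lt_trans r1].
have [C C0 CP] := norm_equivalence n_gt0 p_gt1 t1 hr psi_wavelets.
exists C; split => // f [[lre lim] fy].
(* The real and imaginary parts are only Lebesgue measurable. They are replaced by Borel functions
   off a null set, which neither the mixed norms nor the wavelet coefficients see. *)
have [f1 mf1 [N1 [mN1 N10] f1E]] := lebesgue_measurable_borel lre.
have [f2 mf2 [N2 [mN2 N20] f2E]] := lebesgue_measurable_borel lim.
pose N := N1 `|` N2; have mN : measurable N by exact: measurableU.
have N0 : lebesgue_rV R n N = 0%E.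
  by apply/negligibleP => //; apply: negligibleU; exact/negligibleP.
have Nf1 x : ~ N x -> complex.Re (f x) = f1 x by move=> Nx; apply: f1E => N1x; apply: Nx; left.
have Nf2 x : ~ N x -> complex.Im (f x) = f2 x by move=> Nx; apply: f2E => N2x; apply: Nx; right.
have mE v : acoef p t (modulus f) v = acoef p t (fun x => (Num.sqrt (f1 x ^+ 2 + f2 x ^+ 2))%:E) v.
  congr (_ * _)%E; apply: (mixed_norm_null _ mN N0) => x Nx; congr (_ * _)%E.
  by rewrite /modulus -(Nf1 x Nx) -(Nf2 x Nx); case: (f x).
rewrite !(bourgain_morrey_normE n_gt0 _ _ _ hr0) in fy *.
rewrite (funext mE) in fy *.
rewrite (square_functionE psi mN N0 Nf1 Nf2).
exact: CP.
Qed.
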